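(* Assume that the mesh family satisfies the mesh regularity assumption stated in the context, and that the semi-discrete kernel problem stated in the context admits a unique solution $(\boldsymbol u_h,\varphi_h)$ whose phase component satisfies $\|\varphi_h(\cdot,t)\|_{W^{1,\infty}(\Omega)}\le\widetilde C_T$ for a.e. $t\in(0,T]$, with $\widetilde C_T$ independent of $h$ (but depending on $T$). Let the polynomial degrees $k\ge1$, $\ell\ge2$ satisfy $k\ge\ell-1$. Suppose that the initial values $(\boldsymbol u_{h,0},\varphi_{h,0})$ are uniformly bounded in $L^2$ (with respect to $h$). Then the solution $(\boldsymbol u_h,\varphi_h)$ of the semi-discrete kernel problem satisfies $$(\varphi_h(\cdot,t),1)_\Omega=(\varphi_{h,0},1)_\Omega\qquad\text{for a.e. }t\in(0,T),$$ $$\|\boldsymbol u_h\|_{L^\infty(0,T;\boldsymbol L^2(\Omega))}+\|\varphi_h\|_{L^\infty(0,T;L^2(\Omega))}+\|\boldsymbol u_h\|_{L^2(0,T;\boldsymbol V)}+\|\varphi_h\|_{L^2(0,T;H)}\le\widetilde C_{\rm stab},$$ where $\widetilde C_{\rm stab}$ is a positive constant depending on the data, on the physical parameters and on $\widetilde C_T$, and independent of $h$.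
   Context: Setting. $\Omega\subset\mathbb R^2$ is a polygonal domain with boundary $\Gamma$ and outward unit normal $\boldsymbol n$; $T>0$; $\nu,\lambda,\gamma,\varepsilon>0$ are constants (physical parameters); $f(s)=s^3-s$; $\boldsymbol g\in L^2(0,T;\boldsymbol L^2(\Omega))$. $(\cdot,\cdot)_D$ is the $L^2(D)$ inner product, $|\cdot|_{s,D}$ and $\|\cdot\|_{s,D}$ the seminorm and norm of $H^s(D)$; boldface spaces are vector-valued; $\boldsymbol D^2$ is the Hessian. $\boldsymbol V=\boldsymbol H^1_0(\Omega)$ with $\|\boldsymbol v\|_{\boldsymbol V}=|\boldsymbol v|_{1,\Omega}$; $Q=L^2_0(\Omega)$ (zero-mean functions); $H=\{\phi\in H^2(\Omega):\partial_{\boldsymbol n}\phi=0\text{ on }\Gamma\}$ with $\|\phi\|_H:=|\phi|_{2,\Omega}$; $b(\boldsymbol v,q)=(q,\operatorname{div}\boldsymbol v)_\Omega$. Meshes and polynomials. $\{\Omega_h\}_h$ is a family of decompositions of $\Omega$ into non-overlapping polygons $E$ with diameter $h_E$, area $|E|$, barycenter $\boldsymbol x_E$, outward normal $\boldsymbol n_E$, and edges $e$ of length $h_e$ with unit normal $\boldsymbol n_e$ and unit tangent $\boldsymbol t_e$; $h=\max_Eh_E$. Mesh regularity assumption: there is $\rho>0$ (independent of $h$) such that every $E$ is star-shaped with respect to every point of a ball of radius $\ge\rho h_E$ and every edge $e\subset\partial E$ has $h_e\ge\rho h_E$. $\mathbb P_n(D)$ denotes polynomials of degree $\le n$ on $D$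 ($\{0\}$ if $n<0$); for $m<n$, $\widehat{\mathbb P}_{n\setminus m}(E)$ is the span of the monomials $((\boldsymbol x-\boldsymbol x_E)/h_E)^{\boldsymbol\alpha}$ with $m+1\le|\boldsymbol\alpha|\le n$. Projections on $E$: $\Pi^{0,n}_E$ is the $L^2(E)$-orthogonal projection onto polynomials of degree $\le n$ (bold $\boldsymbol\Pi^{0,n}_E$ for vector and tensor functions, componentwise); $\boldsymbol\Pi^{\nabla,n}_E:\boldsymbol H^1(E)\to[\mathbb P_n(E)]^2$ is defined by $(\boldsymbol\nabla(\boldsymbol v-\boldsymbol\Pi^{\nabla,n}_E\boldsymbol v),\boldsymbol\nabla\boldsymbol q)_E=0$ for all $\boldsymbol q\in[\mathbb P_n(E)]^2$ and $\int_{\partial E}(\boldsymbol v-\boldsymbol\Pi^{\nabla,n}_E\boldsymbol v)=\boldsymbol0$; $\Pi^{\boldsymbol D,n}_E:H^2(E)\to\mathbb P_n(E)$ is defined by $(\boldsymbol D^2(v-\Pi^{\boldsymbol D,n}_Ev),\boldsymbol D^2q)_E=0$ for all $q\in\mathbb P_n(E)$, $\int_{\partial E}(v-\Pi^{\boldsymbol D,n}_Ev)=0$, $\int_{\partial E}\nabla(v-\Pi^{\boldsymbol D,n}_Ev)=\boldsymbol0$. Virtual spaces. For $k\ge1$, $\widehat k=\max\{k,2\}$, $\boldsymbol x^\perp=(x_2,-x_1)$, let $\boldsymbol V_h(E)$ be the set of $\boldsymbol v_h\in\boldsymbol C^0(\overline E)$ with: (i) $\boldsymbol\Delta\boldsymbol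 v_h+\nabla s\in\boldsymbol x^\perp\mathbb P_{k-1}(E)$ for some $s\in L^2_0(E)$; (ii) $\operatorname{div}\boldsymbol v_h\in\mathbb P_{k-1}(E)$; (iii) $\boldsymbol v_h|_e\cdot\boldsymbol t_e\in\mathbb P_k(e)$, $\boldsymbol v_h|_e\cdot\boldsymbol n_e\in\mathbb P_{\widehat k}(e)$ for every edge $e$; (iv) $(\boldsymbol v_h-\boldsymbol\Pi^{\nabla,k}_E\boldsymbol v_h,\boldsymbol x^\perp\widehat p)_E=0$ for all $\widehat p\in\widehat{\mathbb P}_{k-1\setminus k-3}(E)$. Set $\boldsymbol V_h=\{\boldsymbol v_h\in\boldsymbol V:\boldsymbol v_h|_E\in\boldsymbol V_h(E)\ \forall E\}$, $Q_h=\{q_h\in Q:q_h|_E\in\mathbb P_{k-1}(E)\ \forall E\}$, $\boldsymbol Z_h=\{\boldsymbol v_h\in\boldsymbol V_h:b(\boldsymbol v_h,q_h)=0\ \forall q_h\in Q_h\}$ (all its elements are divergence-free). For $\ell\ge2$, $\widehat\ell=\max\{\ell,3\}$, let $H_h(E)$ be the set of $\phi_h\in C^1(\overline E)$ with: (i) $\Delta^2\phi_h\in\mathbb P_\ell(E)$; (ii) $\phi_h|_e\in\mathbb P_{\widehat\ell}(e)$, $\partial_{\boldsymbol n_e}\phi_h\in\mathbb P_{\ell-1}(e)$ for every edge; (iii) $(\phi_h-\Pi^{\boldsymbol D,\ell}_E\phi_h,\widehat q)_E=0$ for all $\widehat q\in\widehat{\mathbb P}_{\ell\setminus\ell-4}(E)$.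 Set $H_h=\{\phi_h\in H:\phi_h|_E\in H_h(E)\ \forall E\}$. Discrete forms (global forms are sums over $E\in\Omega_h$ of the local ones). $s^E_{0,F},s^E_{\nabla}$ on $\boldsymbol V_h(E)$ and $s^E_0,s^E_{\boldsymbol D}$ on $H_h(E)$ are symmetric positive definite bilinear forms with, uniformly in $E$ and $h$, $s^E_{0,F}(\boldsymbol v,\boldsymbol v)\approx\|\boldsymbol v\|^2_{0,E}$ on $\ker\boldsymbol\Pi^{0,k}_E$, $s^E_\nabla(\boldsymbol v,\boldsymbol v)\approx|\boldsymbol v|^2_{1,E}$ on $\ker\boldsymbol\Pi^{\nabla,k}_E$, $s^E_0(\phi,\phi)\approx\|\phi\|^2_{0,E}$ on $\ker\Pi^{0,\ell}_E$, $s^E_{\boldsymbol D}(\phi,\phi)\approx|\phi|^2_{2,E}$ on $\ker\Pi^{\boldsymbol D,\ell}_E$. Then $m^E_{F,h}(\boldsymbol u,\boldsymbol v)=(\boldsymbol\Pi^{0,k}_E\boldsymbol u,\boldsymbol\Pi^{0,k}_E\boldsymbol v)_E+s^E_{0,F}((I-\boldsymbol\Pi^{0,k}_E)\boldsymbol u,(I-\boldsymbol\Pi^{0,k}_E)\boldsymbol v)$; $m^E_h(\varphi,\phi)=(\Pi^{0,\ell}_E\varphi,\Pi^{0,\ell}_E\phi)_E+s^E_0((I-\Pi^{0,\ell}_E)\varphi,(I-\Pi^{0,\ell}_E)\phi)$; $a^E_{\nabla,h}(\boldsymbol u,\boldsymbol v)=(\boldsymbol\Pi^{0,k-1}_E\boldsymbol\nabla\boldsymbol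 u,\boldsymbol\Pi^{0,k-1}_E\boldsymbol\nabla\boldsymbol v)_E+s^E_\nabla((I-\boldsymbol\Pi^{\nabla,k}_E)\boldsymbol u,(I-\boldsymbol\Pi^{\nabla,k}_E)\boldsymbol v)$; $a^E_{\boldsymbol D,h}(\varphi,\phi)=(\boldsymbol\Pi^{0,\ell-2}_E\boldsymbol D^2\varphi,\boldsymbol\Pi^{0,\ell-2}_E\boldsymbol D^2\phi)_E+s^E_{\boldsymbol D}((I-\Pi^{\boldsymbol D,\ell}_E)\varphi,(I-\Pi^{\boldsymbol D,\ell}_E)\phi)$; $c^E_{F,h}(\boldsymbol w;\boldsymbol u,\boldsymbol v)=\frac12[\widetilde c^E_{F,h}(\boldsymbol w;\boldsymbol u,\boldsymbol v)-\widetilde c^E_{F,h}(\boldsymbol w;\boldsymbol v,\boldsymbol u)]$ with $\widetilde c^E_{F,h}(\boldsymbol w;\boldsymbol u,\boldsymbol v)=((\boldsymbol\Pi^{0,k-1}_E\boldsymbol\nabla\boldsymbol u)\boldsymbol\Pi^{0,k}_E\boldsymbol w,\boldsymbol\Pi^{0,k}_E\boldsymbol v)_E$; $c^E_h(\boldsymbol u;\varphi,\phi)=\frac12[\widetilde c^E_h(\boldsymbol u;\varphi,\phi)-\widetilde c^E_h(\boldsymbol u;\phi,\varphi)]$ with $\widetilde c^E_h(\boldsymbol u;\varphi,\phi)=(\boldsymbol\Pi^{0,k}_E\boldsymbol u\cdot\nabla\Pi^{0,\ell}_E\varphi,\Pi^{0,\ell}_E\phi)_E+((\boldsymbol u\cdot\boldsymbol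 n_E)(I-\Pi^{0,\ell}_E)\varphi,\Pi^{0,\ell}_E\phi)_{\partial E}$; $d^E_h(\varphi;\phi,\boldsymbol v)=(\Pi^{0,\ell-2}_E\Delta\varphi\;\boldsymbol\Pi^{0,\ell-1}_E\nabla\phi,\boldsymbol\Pi^{0,k}_E\boldsymbol v)_E$; $r^E_h(\eta;\varphi,\phi)=(f'(\Pi^{0,\ell}_E\eta)\boldsymbol\Pi^{0,\ell-1}_E\nabla\varphi,\boldsymbol\Pi^{0,\ell-1}_E\nabla\phi)_E$; and $(\boldsymbol g_h,\boldsymbol v)_\Omega=\sum_E(\boldsymbol\Pi^{0,k}_E\boldsymbol g,\boldsymbol v)_E$. Semi-discrete kernel problem: given $(\boldsymbol u_{h,0},\varphi_{h,0})\in\boldsymbol V_h\times H_h$ (discrete initial data), find $\boldsymbol u_h\in L^\infty(0,T;\boldsymbol L^2(\Omega))\cap L^2(0,T;\boldsymbol Z_h)$ and $\varphi_h\in L^\infty(0,T;L^2(\Omega))\cap L^2(0,T;H_h)$ with $\boldsymbol u_h(\cdot,0)=\boldsymbol u_{h,0}$, $\varphi_h(\cdot,0)=\varphi_{h,0}$ and, for a.e. $t\in(0,T]$ and all $(\boldsymbol v_h,\phi_h)\in\boldsymbol Z_h\times H_h$, $m_{F,h}(\partial_t\boldsymbol u_h,\boldsymbol v_h)+\nu a_{\nabla,h}(\boldsymbol u_h,\boldsymbol v_h)+c_{F,h}(\boldsymbol u_h;\boldsymbol u_h,\boldsymbol v_h)+\lambda d_h(\varphi_h;\varphi_h,\boldsymbol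 v_h)=(\boldsymbol g_h,\boldsymbol v_h)_\Omega$, $m_h(\partial_t\varphi_h,\phi_h)+\gamma a_{\boldsymbol D,h}(\varphi_h,\phi_h)+c_h(\boldsymbol u_h;\varphi_h,\phi_h)+\gamma\varepsilon^{-2}r_h(\varphi_h;\varphi_h,\phi_h)=0$. Constants may also depend on $\Omega,T,k,\ell,\rho$. *)

(* Defs.v *)
From HB Require Import structures.
From mathcomp Require Import all_boot all_order all_algebra.
From mathcomp Require Import all_classical all_reals all_analysis.
Set Implicit Arguments.
Unset Strict Implicit.
Unset Printing Implicit Defensive.
Import Order.TTheory GRing.Theory Num.Theory.
Import numFieldNormedType.Exports.
Local Open Scope classical_set_scope.
Local Open Scope ring_scope.

(* Conventions.  Points of the plane are pairs [R * R], which carry both the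
   topology/differential structure and the product Lebesgue measure; values of
   vector (resp. tensor) fields are matrices 'cV[R]_2 (resp. 'M[R]_2).
   Functions "on D" are total functions whose values outside the closure of D
   are irrelevant.  Index 0 : 'I_2 is the x_1 direction and 1 is x_2. *)

Section Plane.
Context {R : realType}.
Local Notation pt := (R * R)%type.
Local Notation leb1 := (@lebesgue_measure R).

Definition leb2 := (@lebesgue_measure R \x @lebesgue_measure R)%E.

Definition ebase (i : 'I_2) : pt := if i == 0 then (1, 0) else (0, 1).

Definition coords (x : pt) : 'cV[R]_2 := \col_i (if i == 0 then x.1 else x.2).

Definition frob {m n : nat} (A B : 'M[R]_(m, n)) : R :=
  \sum_i \sum_j A i j * B i j.

Definition enorm {m n : nat} (A : 'M[R]_(m, n)) : R := Num.sqrt (frob A A).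

Definition euclid_dist (x y : pt) : R := enorm (coords (x - y)).

Definition vcomp (v : pt -> 'cV[R]_2) (i : 'I_2) : pt -> R := fun x => v x i 0.

Definition inner (D : set pt) (f g : pt -> R) : R :=
  \int[leb2]_(x in D) (f x * g x).

Definition innerM {m n : nat} (D : set pt) (F G : pt -> 'M[R]_(m, n)) : R :=
  \int[leb2]_(x in D) frob (F x) (G x).

Definition L2norm (D : set pt) (f : pt -> R) : \bar R :=
  Lnorm leb2 2%:E (EFin \o (f \_ D)).

Definition L2normM {m n : nat} (D : set pt) (F : pt -> 'M[R]_(m, n)) : \bar R :=
  L2norm D (fun x => enorm (F x)).

Definition Linfnorm (D : set pt) (f : pt -> R) : \bar R :=
  Lnorm leb2 +oo%E (EFin \o (f \_ D)).

Definition L2 (D : set pt) (f : pt -> R) : Prop :=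
  measurable_fun D f /\ (L2norm D f < +oo)%E.

Definition pd (i : 'I_2) (f : pt -> R) : pt -> R := fun x => 'D_(ebase i) f x.

Definition pds (s : seq 'I_2) (f : pt -> R) : pt -> R := foldr pd f s.

Definition clap (f : pt -> R) : pt -> R := fun x => \sum_i pd i (pd i f) x.

Definition smooth (f : pt -> R) : Prop := forall s : seq 'I_2,
  continuous (pds s f) /\ forall i x, derivable (pds s f) x (ebase i).

Definition test_fun (D : set pt) (psi : pt -> R) : Prop :=
  smooth psi /\
  exists K : set pt, [/\ compact K, K `<=` D & forall x, ~ K x -> psi x = 0].

Definition C0bar (D : set pt) (f : pt -> R) : Prop :=
  {within closure D, continuous f}.

Definition C1bar (D : set pt) (f : pt -> R) : Prop :=
  C0bar D f /\ forall i,
    (forall x, D x -> derivable f x (ebase i)) /\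
    exists2 g, C0bar D g & forall x, D x -> pd i f x = g x.

(* value on the closure of D of the continuous extension of f|_D *)
Definition bdval (D : set pt) (f : pt -> R) : pt -> R :=
  fun x => lim (f y @[y --> within D (nbhs x)]).

Definition loc_integrable (D : set pt) (f : pt -> R) : Prop :=
  forall K : set pt, compact K -> K `<=` D -> leb2.-integrable K (EFin \o f).

Definition is_wd (D : set pt) (i : 'I_2) (f g : pt -> R) : Prop :=
  [/\ loc_integrable D f, loc_integrable D g &
      forall psi, test_fun D psi -> inner D f (pd i psi) = - inner D g psi].

(* A chosen representative of the weak derivative (unique a.e. on D), and 0 when
   there is none. *)
Definition wd (D : set pt) (i : 'I_2) (f : pt -> R) : pt -> R :=
  xget (fun=> 0) [set g | is_wd D i f g].

Definition H1 (D : set pt) (f : pt -> R) : Prop :=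
  L2 D f /\ forall i, exists2 g, is_wd D i f g & L2 D g.

Definition H2 (D : set pt) (f : pt -> R) : Prop :=
  H1 D f /\ forall i, H1 D (wd D i f).

Definition grad (D : set pt) (f : pt -> R) : pt -> 'cV[R]_2 :=
  fun x => \col_i wd D i f x.

Definition gradv (D : set pt) (v : pt -> 'cV[R]_2) : pt -> 'M[R]_2 :=
  fun x => \matrix_(i, j) wd D j (vcomp v i) x.

Definition divv (D : set pt) (v : pt -> 'cV[R]_2) : pt -> R :=
  fun x => \sum_i wd D i (vcomp v i) x.

Definition hess (D : set pt) (f : pt -> R) : pt -> 'M[R]_2 :=
  fun x => \matrix_(i, j) wd D j (wd D i f) x.

Definition lap (D : set pt) (f : pt -> R) : pt -> R :=
  fun x => \sum_i wd D i (wd D i f) x.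

Definition W1inf_norm (D : set pt) (f : pt -> R) : \bar R :=
  maxe (Linfnorm D f) (Linfnorm D (fun x => enorm (grad D f x))).

Definition H1_cvg (D : set pt) (w : nat -> pt -> R) (f : pt -> R) : Prop :=
  (fun n => L2norm D (w n \- f)) @ \oo --> 0%E /\
  forall i, (fun n => L2norm D (pd i (w n) \- wd D i f)) @ \oo --> 0%E.

Definition H10 (D : set pt) (f : pt -> R) : Prop :=
  H1 D f /\
  exists2 w : nat -> pt -> R, (forall n, test_fun D (w n)) & H1_cvg D w f.

(* An edge (a, b) is oriented from a to b, with the polygon on its
   left. *)

Definition edge_pt (e : pt * pt) (s : R) : pt := e.1 + s *: (e.2 - e.1).

Definition segment (e : pt * pt) : set pt := edge_pt e @` `[0, 1].

Definition open_segment (e : pt * pt) : set pt := edge_pt e @` `]0, 1[.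

Definition elen (e : pt * pt) : R := euclid_dist e.2 e.1.

Definition etan (e : pt * pt) : 'cV[R]_2 := (elen e)^-1 *: coords (e.2 - e.1).

Definition enor (e : pt * pt) : 'cV[R]_2 :=
  \col_i (if i == 0 then etan e 1 0 else - etan e 0 0).

Definition shift_pt (x : pt) (s : R) (v : 'cV[R]_2) : pt :=
  (x.1 + s * v 0 0, x.2 + s * v 1 0).

Record polygon := Polygon { cell : set pt ; edges : seq (pt * pt) }.

(* A bounded domain whose boundary consists of finitely many disjoint simple
   closed polygonal lines: edges meet at most at vertices, each vertex starts
   exactly one edge and ends exactly one, and along each edge the domain lies
   locally on one side only, [enor] pointing outwards.  Consecutive edges may be
   aligned (hanging nodes). *)
Definition polygonal_domain (P : polygon) : Prop :=
  [/\ [/\ open (cell P), cell P !=set0, connected (cell P) &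
          bounded_set (cell P)],
      closure (cell P) `\` cell P = \bigcup_(e in [set` edges P]) segment e,
      [/\ forall e, e \in edges P -> e.1 != e.2,
          uniq (map fst (edges P)) &
          perm_eq (map fst (edges P)) (map snd (edges P))],
      forall e e', e \in edges P -> e' \in edges P -> e != e' ->
        open_segment e `&` segment e' = set0 &
      forall e x, e \in edges P -> open_segment e x ->
        \forall s \near 0^'+, cell P (shift_pt x (- s) (enor e)) /\
                              ~ closure (cell P) (shift_pt x s (enor e))].

Definition bdint (P : polygon) (F : pt * pt -> pt -> R) : R :=
  \sum_(e <- edges P)
    elen e * \int[leb1]_(s in `[0, 1]) F e (edge_pt e s).

Definition diam (D : set pt) : R :=
  sup [set d | exists x y, [/\ D x, D y & d = euclid_dist x y]].

Definition area (D : set pt) : R := fine (leb2 D).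

Definition barycenter (D : set pt) : pt :=
  ((area D)^-1 * \int[leb2]_(x in D) x.1, (area D)^-1 * \int[leb2]_(x in D) x.2).

Definition decomposition (Om : polygon) (N : nat) (M : 'I_N -> polygon) : Prop :=
  [/\ forall i, polygonal_domain (M i),
      forall i j, i != j -> cell (M i) `&` cell (M j) = set0 &
      closure (cell Om) = \bigcup_i closure (cell (M i))].

(* The first clause: star-shapedness with respect to every point of a ball of
   radius r >= rho * h_E (which then lies in the element). *)
Definition mesh_regular (rho : R) (N : nat) (M : 'I_N -> polygon) : Prop :=
  forall i,
    (exists c r, rho * diam (cell (M i)) <= r /\
       forall y, euclid_dist y c < r -> forall x, cell (M i) x ->
         forall s, 0 <= s <= 1 -> cell (M i) (edge_pt (y, x) s)) /\
    forall e, e \in edges (M i) -> rho * diam (cell (M i)) <= elen e.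

(* g is the trace of f in H^1(P) if (f, g) is a limit in
   H^1(P) x L^2(boundary) of pairs (w, w|_boundary) with w smooth. *)
Definition is_trace (P : polygon) (f g : pt -> R) : Prop :=
  (forall e, e \in edges P ->
     measurable_fun (`[0, 1] : set R) (fun s => g (edge_pt e s))) /\
  exists w : nat -> pt -> R,
    [/\ forall n, smooth (w n), H1_cvg (cell P) w f &
        forall e, e \in edges P ->
          (fun n => Lnorm leb1 2%:E (EFin \o
             ((fun s => w n (edge_pt e s) - g (edge_pt e s)) \_ `[0, 1])))
          @ \oo --> 0%E].

Definition Vspace (Om : polygon) (v : pt -> 'cV[R]_2) : Prop :=
  forall i, H10 (cell Om) (vcomp v i).

Definition Hspace (Om : polygon) (phi : pt -> R) : Prop :=
  H2 (cell Om) phi /\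
  exists2 g : pt -> 'cV[R]_2,
    forall i, is_trace Om (wd (cell Om) i phi) (vcomp g i) &
    forall e, e \in edges Om ->
      {ae leb1, forall s, 0 <= s <= 1 -> frob (g (edge_pt e s)) (enor e) = 0}.

Definition normV (Om : polygon) (v : pt -> 'cV[R]_2) : \bar R :=
  L2normM (cell Om) (gradv (cell Om) v).

Definition normH (Om : polygon) (phi : pt -> R) : \bar R :=
  L2normM (cell Om) (hess (cell Om) phi).

Definition poly2 (n : nat) (p : pt -> R) : Prop :=
  exists c : nat -> nat -> R, forall x,
    p x = \sum_(i < n.+1) \sum_(j < n.+1 | (i + j <= n)%N)
            c i j * x.1 ^+ i * x.2 ^+ j.

Definition polyv (n : nat) (p : pt -> 'cV[R]_2) : Prop :=
  forall i, poly2 n (vcomp p i).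

(* span of the scaled monomials of degree > m and <= n; m may be negative *)
Definition poly_hat (D : set pt) (n : nat) (m : int) (p : pt -> R) : Prop :=
  exists c : nat -> nat -> R, forall x,
    p x = \sum_(i < n.+1) \sum_(j < n.+1 | (i + j <= n)%N && (m < (i + j)%N%:Z))
            c i j * ((x.1 - (barycenter D).1) / diam D) ^+ i
                  * ((x.2 - (barycenter D).2) / diam D) ^+ j.

Definition poly_edge (e : pt * pt) (n : nat) (f : pt -> R) : Prop :=
  exists2 p : {poly R}, (size p <= n.+1)%N &
    forall s, 0 <= s <= 1 -> f (edge_pt e s) = p.[s].

(* Each set below is a singleton for the functions the projection
   is applied to, so the default value of xget is never used.  Boundary values
   are those of the continuous extension to the closed element: the H^1 and H^2
   projections are only applied to functions of class C^0, resp. C^1, up to the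
   boundary, whose traces are their continuous extensions. *)

Definition proj0 (E : polygon) (n : nat) (f : pt -> R) : pt -> R :=
  xget (fun=> 0) [set p | poly2 n p /\
    forall q, poly2 n q -> inner (cell E) (f \- p) q = 0].

Definition proj0M {m1 m2 : nat} (E : polygon) (n : nat)
    (F : pt -> 'M[R]_(m1, m2)) : pt -> 'M[R]_(m1, m2) :=
  fun x => \matrix_(i, j) proj0 E n (fun y => F y i j) x.

Definition projG (E : polygon) (n : nat) (v : pt -> 'cV[R]_2) :
    pt -> 'cV[R]_2 :=
  xget (fun=> 0) [set p | [/\ polyv n p,
    forall q, polyv n q ->
      innerM (cell E) (gradv (cell E) (v \- p)) (gradv (cell E) q) = 0 &
    forall i, bdint E (fun _ => vcomp (v \- p) i) = 0]].

Definition projD (E : polygon) (n : nat) (v : pt -> R) : pt -> R :=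
  xget (fun=> 0) [set p | [/\ poly2 n p,
    forall q, poly2 n q ->
      innerM (cell E) (hess (cell E) (v \- p)) (hess (cell E) q) = 0,
    bdint E (fun _ => v \- p) = 0 &
    forall i, bdint E (fun _ => bdval (cell E) (pd i (v \- p))) = 0]].

Definition perp (x : pt) : 'cV[R]_2 :=
  \col_i (if i == 0 then x.2 else - x.1).

(* The Stokes condition is understood in the sense of distributions.
   Membership in H^1 is what makes its projection meaningful. *)
Definition Vh_loc (k : nat) (E : polygon) (v : pt -> 'cV[R]_2) : Prop :=
  [/\ forall i, C0bar (cell E) (vcomp v i) /\ H1 (cell E) (vcomp v i),
      exists s p, [/\ L2 (cell E) s, inner (cell E) s (cst 1) = 0,
        poly2 k.-1 p &
        forall i psi, test_fun (cell E) psi ->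
          inner (cell E) (vcomp v i) (clap psi) - inner (cell E) s (pd i psi)
          = inner (cell E) (fun x => perp x i 0 * p x) psi],
      exists2 p, poly2 k.-1 p &
        {ae leb2, forall x, cell E x -> divv (cell E) v x = p x},
      forall e, e \in edges E ->
        poly_edge e k (fun x => frob (v x) (etan e)) /\
        poly_edge e (maxn k 2) (fun x => frob (v x) (enor e)) &
      forall p, poly_hat (cell E) k.-1 (k%:Z - 3) p ->
        innerM (cell E) (v \- projG E k v) (fun x => p x *: perp x) = 0].

Definition Vh (k : nat) (Om : polygon) (N : nat) (M : 'I_N -> polygon)
    (v : pt -> 'cV[R]_2) : Prop :=
  Vspace Om v /\ forall i, Vh_loc k (M i) v.

Definition Qh (k : nat) (Om : polygon) (N : nat) (M : 'I_N -> polygon)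
    (q : pt -> R) : Prop :=
  [/\ L2 (cell Om) q, inner (cell Om) q (cst 1) = 0 &
      forall i, exists2 p, poly2 k.-1 p & forall x, cell (M i) x -> q x = p x].

Definition Zh (k : nat) (Om : polygon) (N : nat) (M : 'I_N -> polygon)
    (v : pt -> 'cV[R]_2) : Prop :=
  Vh k Om M v /\
  forall q, Qh k Om M q -> inner (cell Om) q (divv (cell Om) v) = 0.

Definition Hh_loc (l : nat) (E : polygon) (phi : pt -> R) : Prop :=
  [/\ C1bar (cell E) phi /\ H2 (cell E) phi,
      exists2 p, poly2 l p & forall psi, test_fun (cell E) psi ->
        inner (cell E) phi (clap (clap psi)) = inner (cell E) p psi,
      forall e, e \in edges E ->
        poly_edge e (maxn l 3) phi /\
        poly_edge e l.-1
          (fun x => \sum_i enor e i 0 * bdval (cell E) (pd i phi) x) &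
      forall q, poly_hat (cell E) l (l%:Z - 4) q ->
        inner (cell E) (phi \- projD E l phi) q = 0].

Definition Hh (l : nat) (Om : polygon) (N : nat) (M : 'I_N -> polygon)
    (phi : pt -> R) : Prop :=
  Hspace Om phi /\ forall i, Hh_loc l (M i) phi.

(* The forms s_{0,F}, s_grad, s_0 and s_D of one element. *)
Record stab := Stab {
  s0F : (pt -> 'cV[R]_2) -> (pt -> 'cV[R]_2) -> R ;
  sG : (pt -> 'cV[R]_2) -> (pt -> 'cV[R]_2) -> R ;
  s0 : (pt -> R) -> (pt -> R) -> R ;
  sD : (pt -> R) -> (pt -> R) -> R }.

Definition spd_form {W : lmodType R} (D : set pt) (S : set (pt -> W))
    (s : (pt -> W) -> (pt -> W) -> R) : Prop :=
  [/\ forall a u v w, S u -> S v -> S w ->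
        s (fun x => a *: u x + v x) w = a * s u w + s v w,
      forall u v, S u -> S v -> s u v = s v u &
      forall u, S u -> (exists2 x, D x & u x != 0) -> 0 < s u u].

(* a and b are the constants of the norm equivalences on the kernels of the
   projections. *)
Definition stab_admissible (k l : nat) (a b : R) (E : polygon) (st : stab) :
    Prop :=
  [/\ spd_form (cell E) [set v | Vh_loc k E v] (s0F st) /\
        (forall v, Vh_loc k E v -> (forall x, proj0M E k v x = 0) ->
           a * innerM (cell E) v v <= s0F st v v <= b * innerM (cell E) v v),
      spd_form (cell E) [set v | Vh_loc k E v] (sG st) /\
        (forall v, Vh_loc k E v -> (forall x, projG E k v x = 0) ->
           let n2 := innerM (cell E) (gradv (cell E) v) (gradv (cell E) v) in
           a * n2 <= sG st v v <= b * n2),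
      spd_form (cell E) [set phi | Hh_loc l E phi] (s0 st) /\
        (forall phi, Hh_loc l E phi -> (forall x, proj0 E l phi x = 0) ->
           a * inner (cell E) phi phi <= s0 st phi phi
             <= b * inner (cell E) phi phi) &
      spd_form (cell E) [set phi | Hh_loc l E phi] (sD st) /\
        (forall phi, Hh_loc l E phi -> (forall x, projD E l phi x = 0) ->
           let n2 := innerM (cell E) (hess (cell E) phi) (hess (cell E) phi) in
           a * n2 <= sD st phi phi <= b * n2)].

Definition mF_loc (k : nat) (E : polygon) (st : stab)
    (u v : pt -> 'cV[R]_2) : R :=
  innerM (cell E) (proj0M E k u) (proj0M E k v) +
  s0F st (u \- proj0M E k u) (v \- proj0M E k v).

Definition m_loc (l : nat) (E : polygon) (st : stab) (phi psi : pt -> R) : R :=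
  inner (cell E) (proj0 E l phi) (proj0 E l psi) +
  s0 st (phi \- proj0 E l phi) (psi \- proj0 E l psi).

Definition aG_loc (k : nat) (E : polygon) (st : stab)
    (u v : pt -> 'cV[R]_2) : R :=
  innerM (cell E) (proj0M E k.-1 (gradv (cell E) u))
                  (proj0M E k.-1 (gradv (cell E) v)) +
  sG st (u \- projG E k u) (v \- projG E k v).

Definition aD_loc (l : nat) (E : polygon) (st : stab) (phi psi : pt -> R) : R :=
  innerM (cell E) (proj0M E (l - 2) (hess (cell E) phi))
                  (proj0M E (l - 2) (hess (cell E) psi)) +
  sD st (phi \- projD E l phi) (psi \- projD E l psi).

Definition cF_tilde (k : nat) (E : polygon) (w u v : pt -> 'cV[R]_2) : R :=
  innerM (cell E)
    (fun x => proj0M E k.-1 (gradv (cell E) u) x *m proj0M E k w x)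
    (proj0M E k v).

Definition cF_loc (k : nat) (E : polygon) (w u v : pt -> 'cV[R]_2) : R :=
  2^-1 * (cF_tilde k E w u v - cF_tilde k E w v u).

Definition c_tilde (k l : nat) (E : polygon) (u : pt -> 'cV[R]_2)
    (phi psi : pt -> R) : R :=
  inner (cell E)
    (fun x => frob (proj0M E k u x) (grad (cell E) (proj0 E l phi) x))
    (proj0 E l psi) +
  bdint E (fun e x => frob (u x) (enor e) * (phi x - proj0 E l phi x)
                      * proj0 E l psi x).

Definition c_loc (k l : nat) (E : polygon) (u : pt -> 'cV[R]_2)
    (phi psi : pt -> R) : R :=
  2^-1 * (c_tilde k l E u phi psi - c_tilde k l E u psi phi).

Definition d_loc (k l : nat) (E : polygon) (phi psi : pt -> R)
    (v : pt -> 'cV[R]_2) : R :=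
  innerM (cell E)
    (fun x => proj0 E (l - 2) (lap (cell E) phi) x
              *: proj0M E l.-1 (grad (cell E) psi) x)
    (proj0M E k v).

Definition fpot (s : R) : R := s ^+ 3 - s.

Definition r_loc (l : nat) (E : polygon) (eta phi psi : pt -> R) : R :=
  innerM (cell E)
    (fun x => derive1 fpot (proj0 E l eta x)
              *: proj0M E l.-1 (grad (cell E) phi) x)
    (proj0M E l.-1 (grad (cell E) psi)).

Definition time_measurable (T : R) (D : set pt) (w : R -> pt -> R) : Prop :=
  measurable_fun (`]0, T[ `*` D) (fun z : R * pt => w z.1 z.2).

Definition time_norm (T : R) (p : \bar R) (N : R -> \bar R) : \bar R :=
  Lnorm leb1 p (N \_ `]0, T[).

(* w lies in W^{1,1}(0,T;L^2(D)), is represented by its continuous version on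
   [0,T], and w' is its time derivative. *)
Definition is_time_deriv (T : R) (D : set pt) (w w' : R -> pt -> R) : Prop :=
  [/\ time_measurable T D w',
      (time_norm T 1%:E (fun t => L2norm D (w' t)) < +oo)%E &
      forall t, 0 <= t <= T -> {ae leb2, forall x, D x ->
        w t x = w 0 x + \int[leb1]_(s in `[0, t]) w' s x}].

Definition kernel_solution (Om : polygon) (T nu lam gam eps : R) (k l : nat)
    (g : R -> pt -> 'cV[R]_2) (N : nat) (M : 'I_N -> polygon)
    (st : 'I_N -> stab) (u0 : pt -> 'cV[R]_2) (phi0 : pt -> R)
    (u : R -> pt -> 'cV[R]_2) (phi : R -> pt -> R) : Prop :=
  [/\
   [/\ forall i, time_measurable T (cell Om) (fun t => vcomp (u t) i),
       (time_norm T +oo (fun t => L2normM (cell Om) (u t)) < +oo)%E,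
       (time_norm T 2%:E (fun t => normV Om (u t)) < +oo)%E &
       {ae leb1, forall t, 0 < t < T -> Zh k Om M (u t)}],
   [/\ time_measurable T (cell Om) phi,
       (time_norm T +oo (fun t => L2norm (cell Om) (phi t)) < +oo)%E,
       (time_norm T 2%:E (fun t => normH Om (phi t)) < +oo)%E &
       {ae leb1, forall t, 0 < t < T -> Hh l Om M (phi t)}],
   {ae leb2, forall x, cell Om x -> u 0 x = u0 x /\ phi 0 x = phi0 x} &
   exists (ut : R -> pt -> 'cV[R]_2) (phit : R -> pt -> R),
   [/\ forall i, is_time_deriv T (cell Om) (fun t => vcomp (u t) i)
                                           (fun t => vcomp (ut t) i),
       is_time_deriv T (cell Om) phi phit,
       {ae leb1, forall t, 0 < t < T -> Zh k Om M (ut t) /\ Hh l Om M (phit t)} &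
       {ae leb1, forall t, 0 < t <= T ->
          forall v psi, Zh k Om M v -> Hh l Om M psi ->
          \sum_i mF_loc k (M i) (st i) (ut t) v
            + nu * \sum_i aG_loc k (M i) (st i) (u t) v
            + \sum_i cF_loc k (M i) (u t) (u t) v
            + lam * \sum_i d_loc k l (M i) (phi t) (phi t) v
            = \sum_i innerM (cell (M i)) (proj0M (M i) k (g t)) v
          /\
          \sum_i m_loc l (M i) (st i) (phit t) psi
            + gam * \sum_i aD_loc l (M i) (st i) (phi t) psi
            + \sum_i c_loc k l (M i) (u t) (phi t) psi
            + gam * eps ^- 2 * \sum_i r_loc l (M i) (phi t) (phi t) psi
            = 0}]].

End Plane.
Arguments polygon R : clear implicits.
Arguments stab R : clear implicits.

(* Main.v *)
From HB Require Import structures.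
Require Import Defs.
From mathcomp Require Import all_boot all_order all_algebra.
From mathcomp Require Import all_classical all_reals all_analysis.
From mathcomp Require Import measurable_realfun.
From mathcomp Require Import ring lra.
Set Implicit Arguments.
Unset Strict Implicit.
Unset Printing Implicit Defensive.
Import Order.TTheory GRing.Theory Num.Theory.
Import numFieldNormedType.Exports.
Local Open Scope classical_set_scope.
Local Open Scope ring_scope.

(** The a priori bounds come from testing the two equations with the constant 1, with
  the phase and with the velocity.

  Conservation of mass.  Against the constant 1 the fourth-order form and the
  potential vanish, and the mass form reduces to the mean of the time derivative.  The
  convective form also vanishes: since k >= l - 1, the projection of the velocity is
  exact against gradients of polynomials of degree l, and with its boundary term the
  form on an element becomes, by Green's formula, half the integral of u.grad phi.
  The discrete divergence constraint makes u divergence free, so the sum over the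
  elements is zero (green_L1, element_convection, convection_mass, mass_conserved).
  Green's formula is obtained by slicing: almost every line parallel to an axis
  crosses the boundary of a polygon transversally at finitely many interior points of
  edges (slice_polygon).

  Phase.  The bound in the maximum norm gives the bound in mean square.  With the
  phase as test function the convective form is zero by antisymmetry, the potential
  is bounded below because its derivative is at least -1 and the gradient is bounded,
  and coercivity of the fourth-order form (hessian_coercive, aD_loc_ge) leaves the
  integral in time of the Hessian (phase_estimate).

  Velocity.  The convective form is again antisymmetric.  The coupling term is
  estimated by Young's inequality: the projected Laplacian of the phase is controlled
  by the previous step, and the projected gradient in the maximum norm by an inverse
  estimate that is uniform on regular meshes (proj0_bounded).  The resulting multiple
  of the kinetic energy is absorbed into its supremum, which is finite by hypothesis
  (velocity_estimate).

  Two facts support these computations.  First, the stabilised forms are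
  semidefinite, and equivalent to the mean square, on the local virtual spaces
  (m_loc_psd, mF_loc_psd): the spaces are linear and contain the polynomials, because
  all their constraints are linear and the projections entering them are well
  defined.  Secondly, m(w', w) is half the derivative of m(w, w).  The curves are only
  differentiable in the sense of an integral representation in mean square, and m is
  not an integral, but it is dominated by the mean square; approximating m(., z) by
  inner products (riesz_approx) and summing second-order errors over short intervals
  yields the identity (energy_identity, phase_energy, velocity_energy). *)

(** * Semidefinite forms on a subspace *)

Section Forms.
Context {R : realType} {V : lmodType R}.
Implicit Types (S : set V) (B : V -> V -> R) (u v w e : V) (a : R).

Definition subsp S := S 0 /\ forall a u v, S u -> S v -> S (a *: u + v).

Definition psd S B := [/\ subsp S,
  forall a u v w, S u -> S v -> S w -> B (a *: u + v) w = a * B u w + B v w,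
  forall u v, S u -> S v -> B u v = B v u &
  forall u, S u -> 0 <= B u u].

Lemma subspZ S a u : subsp S -> S u -> S (a *: u).
Proof. by move=> [S0 SD] Su; have := SD a u 0 Su S0; rewrite addr0. Qed.

Lemma subspD S u v : subsp S -> S u -> S v -> S (u + v).
Proof. by move=> [S0 SD] Su Sv; have := SD 1 u v Su Sv; rewrite scale1r. Qed.

Lemma subspB S u v : subsp S -> S u -> S v -> S (u - v).
Proof.
by move=> sS Su Sv; apply: subspD => //; rewrite -scaleN1r; apply: subspZ.
Qed.

Section PsdTheory.
Context (S : set V) (B : V -> V -> R) (pB : psd S B).

Let sS : subsp S. Proof. by case: pB. Qed.

Lemma psdC u v : S u -> S v -> B u v = B v u.
Proof. by case: pB => _ _ + _; exact. Qed.

Lemma psd_ge0 u : S u -> 0 <= B u u.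
Proof. by case: pB => _ _ _; exact. Qed.

Lemma psdDl u v w : S u -> S v -> S w -> B (u + v) w = B u w + B v w.
Proof.
by case: pB => _ L _ _ Su Sv Sw; rewrite -[u in LHS]scale1r L// mul1r.
Qed.

Lemma psd0l w : S w -> B 0 w = 0.
Proof.
move=> Sw; have S0 : S 0 by case: sS.
by have := psdDl S0 S0 Sw; rewrite addr0 -{1}[B 0 w]addr0 => /addrI/esym.
Qed.

Lemma psdZl a u w : S u -> S w -> B (a *: u) w = a * B u w.
Proof.
move=> Su Sw; have S0 : S 0 by case: sS.
case: pB => _ L _ _; rewrite -[a *: u]addr0 L// psd0l// addr0 //.
Qed.

Lemma psdBl u v w : S u -> S v -> S w -> B (u - v) w = B u w - B v w.
Proof.
move=> Su Sv Sw; rewrite -scaleN1r psdDl//; last exact: subspZ.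
by rewrite psdZl// mulN1r.
Qed.

Lemma psdDr u v w : S u -> S v -> S w -> B w (u + v) = B w u + B w v.
Proof.
move=> Su Sv Sw; rewrite psdC//; last exact: subspD.
by rewrite psdDl// (psdC Su)// (psdC Sv).
Qed.

Lemma psdZr a u w : S u -> S w -> B w (a *: u) = a * B w u.
Proof.
move=> Su Sw; rewrite psdC//; last exact: subspZ.
by rewrite psdZl// (psdC Su).
Qed.

Lemma psdBr u v w : S u -> S v -> S w -> B w (u - v) = B w u - B w v.
Proof.
move=> Su Sv Sw; rewrite psdC//; last exact: subspB.
by rewrite psdBl// (psdC Su)// (psdC Sv).
Qed.

Lemma psd0r w : S w -> B w 0 = 0.
Proof. by move=> Sw; rewrite psdC ?psd0l//; case: sS. Qed.

Lemma psd_sqrD a u v : S u -> S v ->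
  B (u + a *: v) (u + a *: v) = B u u + 2 * a * B u v + a ^+ 2 * B v v.
Proof.
move=> Su Sv; have Sav : S (a *: v) by exact: subspZ.
rewrite psdDl ?psdDr ?psdZl ?psdZr//; last exact: subspD.
by rewrite (psdC Sv Su); ring.
Qed.

Lemma psd_cauchy_schwarz u v : S u -> S v -> B u v ^+ 2 <= B u u * B v v.
Proof.
move=> Su Sv.
have H t : 0 <= B u u + 2 * t * B u v + t ^+ 2 * B v v.
  by rewrite -psd_sqrD//; apply: psd_ge0; apply: subspD => //; exact: subspZ.
have := psd_ge0 Sv; rewrite le_eqVlt => /predU1P[/esym a0|a0].
  rewrite a0 mulr0 in H *.
  have [->|b0] := eqVneq (B u v) 0; first by rewrite expr0n.
  have := H (- (B u u + 1) / (2 * B u v)); rewrite mulr0 addr0.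
  have -> : 2 * (- (B u u + 1) / (2 * B u v)) * B u v = - (B u u + 1).
    by field.
  by lra.
have := H (- (B u v) / B v v).
have -> : B u u + 2 * (- B u v / B v v) * B u v + (- B u v / B v v) ^+ 2 * B v v
   = B u u - B u v ^+ 2 / B v v by field; rewrite gt_eqF.
by rewrite subr_ge0 ler_pdivrMr.
Qed.

Lemma psd_cs u v : S u -> S v -> `|B u v| <= Num.sqrt (B u u) * Num.sqrt (B v v).
Proof.
move=> Su Sv; rewrite -sqrtrM ?psd_ge0// -sqrtr_sqr ler_sqrt.
  exact: psd_cauchy_schwarz.
by rewrite mulr_ge0// psd_ge0.
Qed.

Lemma psd_null u v : S u -> S v -> B v v = 0 -> B u v = 0.
Proof.
move=> Su Sv v0; apply/eqP; rewrite -normr_le0.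
by apply: le_trans (psd_cs Su Sv) _; rewrite v0 sqrtr0 mulr0.
Qed.

End PsdTheory.

Fixpoint span (s : seq V) (p : V) : Prop :=
  if s is e :: s' then exists a q, span s' q /\ p = a *: e + q else p = 0.

Lemma span_subsp s : subsp (span s).
Proof.
elim: s => [|e s [s0 sD]]; first by split=> // a _ _ /= -> ->; rewrite scaler0 addr0.
split=> [|a _ _ [b [p [sp ->]]] [c [q [sq ->]]]].
  by exists 0, 0; split => //; rewrite scale0r addr0.
exists (a * b + c), (a *: p + q); split; first exact: sD.
by rewrite scalerDr scalerDl scalerA addrACA.
Qed.

Lemma span_sub S s p : subsp S -> (forall e, e \in s -> S e) -> span s p -> S p.
Proof.
move=> [S0 SD]; elim: s p => [|e s IH] p sS /=; first by move=> ->.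
case=> a [q [sq ->]]; apply: SD; first by apply: sS; rewrite mem_head.
by apply: IH => // x xs; apply: sS; rewrite inE xs orbT.
Qed.

Lemma mem_span s e : e \in s -> span s e.
Proof.
elim: s => [//|f s IH]; rewrite inE => /predU1P[->|es].
  by exists 1, 0; split; [case: (span_subsp s)|rewrite scale1r addr0].
by exists 0, e; split; [exact: IH|rewrite scale0r add0r].
Qed.

(** Gram-Schmidt for a form that need not be definite: a new vector whose
  component orthogonal to the previous ones is degenerate is orthogonal to
  everything, by Cauchy-Schwarz, and needs no coefficient. *)
Lemma psd_projection S B (s : seq V) v : psd S B ->
  (forall e, e \in s -> S e) -> S v ->
  exists2 p, span s p & forall q, span s q -> B (v - p) q = 0.
Proof.
move=> pB; have sS : subsp S by case: pB.
elim: s v => [|e s IH] v sub Sv.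
  by exists 0 => // q ->; rewrite (psd0r pB)// subr0.
have sub' x : x \in s -> S x by move=> xs; apply: sub; rewrite inE xs orbT.
have Se : S e by apply: sub; rewrite mem_head.
have [e0 se0 oe] := IH e sub' Se; have [v0 sv0 ov] := IH v sub' Sv.
have Ss p : span s p -> S p by exact: span_sub.
set e' := e - e0; set v' := v - v0.
have Se' : S e' by apply: subspB => //; exact: Ss.
have Sv' : S v' by apply: subspB => //; exact: Ss.
pose c := B v' e' / B e' e'.
exists (c *: e + (v0 - c *: e0)).
  exists c, (v0 - c *: e0); split => //.
  by apply: subspB; [exact: span_subsp|by []|apply: subspZ => //; exact: span_subsp].
move=> _ [a [q [sq ->]]].
have -> : v - (c *: e + (v0 - c *: e0)) = v' - c *: e'.
  by rewrite /v' /e' scalerBr !opprD !opprK !addrA; congr (_ + _); rewrite addrAC.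
have -> : a *: e + q = a *: e' + (a *: e0 + q).
  by rewrite /e' scalerBr addrA subrK.
have sq' : span s (a *: e0 + q) by case: (span_subsp s) => _; apply.
have Sq' := Ss _ sq'.
have Sce : S (c *: e') by exact: subspZ.
have Sd : S (v' - c *: e') by exact: subspB.
have Be := oe _ sq'; have Bv := ov _ sq'; rewrite -/e' in Be; rewrite -/v' in Bv.
rewrite {}/c in Sce Sd *; clearbody e' v'.
rewrite (psdDr pB)//; last exact: subspZ.
rewrite (psdZr pB)// !(psdBl pB)// !(psdZl pB)// Be Bv mulr0 subr0 addr0.
have [z|nz] := eqVneq (B e' e') 0.
  by rewrite (psd_null pB Sv' Se' z) z mulr0 subr0 mulr0.
by rewrite divfK// subrr mulr0.
Qed.

(** The quadratic functional z |-> B(z,z)/2 - f(z) is bounded below, and the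
  functional B(z,.) attached to a near-minimiser z is close to f in the dual
  norm.  This replaces the Riesz representation on spaces of functions that may
  fail to be complete. *)
Lemma riesz_approx S B (f : V -> R) (M : R) : psd S B ->
  (forall a u v, S u -> S v -> f (a *: u + v) = a * f u + f v) ->
  (forall u, S u -> `|f u| <= M * Num.sqrt (B u u)) ->
  forall eps, 0 < eps -> exists2 z, S z &
    forall y, S y -> `|f y - B z y| <= eps * Num.sqrt (B y y).
Proof.
move=> pB fL fM eps eps0; have sS : subsp S by case: pB.
have S0 : S 0 by case: sS.
pose J z := B z z / 2 - f z.
have Jlb z : S z -> - (M ^+ 2) / 2 <= J z.
  move=> Sz; have := fM _ Sz; move/(le_trans (ler_norm _)) => h.
  rewrite /J; have e : B z z = Num.sqrt (B z z) ^+ 2.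
    by rewrite sqr_sqrtr// (psd_ge0 pB).
  have := sqr_ge0 (M - Num.sqrt (B z z)); rewrite sqrrB -e; lra.
have hinf : has_inf [set J z | z in S].
  split; first by exists (J 0), 0.
  by exists (- (M ^+ 2) / 2) => _ [z Sz <-]; exact: Jlb.
have d0 : 0 < eps ^+ 2 / 2 by rewrite divr_gt0// exprn_gt0.
have [_ [z Sz <-] Jz] := inf_adherent d0 hinf.
have Jmin y t : S y -> J z - eps ^+ 2 / 2 <= J (z + t *: y).
  move=> Sy; apply: (@le_trans _ _ (inf [set J z | z in S])).
    by rewrite lerBlDr ltW.
  apply: ge_inf; first by case: hinf.
  by exists (z + t *: y) => //; apply: subspD => //; exact: subspZ.
exists z => // y Sy; set r := f y - B z y.
have H t : 0 <= eps ^+ 2 / 2 - t * r + t ^+ 2 * B y y / 2.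
  have := Jmin y t Sy; rewrite /J (psd_sqrD pB)//.
  have -> : f (z + t *: y) = t * f y + f z by rewrite addrC fL.
  by rewrite /r; lra.
have := psd_ge0 pB Sy; rewrite le_eqVlt => /predU1P[/esym n0|n0].
  have -> : r = 0.
    rewrite /r (psd_null pB)// subr0; apply/eqP; rewrite -normr_le0.
    by apply: le_trans (fM _ Sy) _; rewrite n0 sqrtr0 mulr0.
  by rewrite normr0 mulr_ge0// ltW.
have {}H : r ^+ 2 <= eps ^+ 2 * B y y.
  have := H (r / B y y).
  have -> : eps ^+ 2 / 2 - r / B y y * r + (r / B y y) ^+ 2 * B y y / 2 =
     (eps ^+ 2 - r ^+ 2 / B y y) / 2 by field; rewrite gt_eqF.
  by rewrite pmulr_lge0// subr_ge0 ler_pdivrMr.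
rewrite -ler_sqr ?nnegrE ?mulr_ge0 ?(ltW eps0)//.
by rewrite real_normK ?num_real// exprMn sqr_sqrtr// ltW.
Qed.

End Forms.

(** * Integrable and square-integrable functions *)

Section Integrals.
Context {d} {T : measurableType d} {R : realType}.
Context (mu : {measure set T -> \bar R}) (D : set T) (mD : measurable D).
Implicit Types (f g h : T -> R) (a M : R).

Definition intg f := mu.-integrable D (EFin \o f).

Definition sqi f := measurable_fun D f /\ intg (fun x => f x ^+ 2).

Definition ipg f g := \int[mu]_(x in D) (f x * g x).

Lemma intg_meas f : intg f -> measurable_fun D f.
Proof. by move=> /measurable_int/measurable_EFinP. Qed.

Lemma intg_le f g : measurable_fun D f -> (forall x, D x -> `|f x| <= `|g x|) ->
  intg g -> intg f.
Proof.
move=> mf fg; apply: le_integrable => //.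
exact/measurable_EFinP.
Qed.

Lemma intgD f g : intg f -> intg g -> intg (fun x => f x + g x).
Proof. by move=> If Ig; exact: (integrableD mD If Ig). Qed.

Lemma intgB f g : intg f -> intg g -> intg (fun x => f x - g x).
Proof. by move=> If Ig; exact: (integrableB mD If Ig). Qed.

Lemma intgZ a f : intg f -> intg (fun x => a * f x).
Proof. by move=> If; exact: (integrableZl mD a If). Qed.

Lemma intg0 : intg (fun=> 0).
Proof. exact: (integrable0 mu D). Qed.

Lemma intg_norm f : intg f -> intg (fun x => `|f x|).
Proof. exact: integrable_norm. Qed.

Lemma eq_intg f g : (forall x, D x -> f x = g x) -> intg f -> intg g.
Proof.
move=> fg; apply: eq_integrable => // x /set_mem Dx /=.
by rewrite fg.
Qed.

Lemma eq_Rint f g : (forall x, D x -> f x = g x) ->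
  \int[mu]_(x in D) f x = \int[mu]_(x in D) g x.
Proof. by move=> fg; apply: eq_Rintegral => x /set_mem; exact: fg. Qed.

Lemma ae_eq_meas f g : measurable_fun D f -> measurable_fun D g ->
  {ae mu, forall x, D x -> f x = g x} ->
  \int[mu]_(x in D) f x = \int[mu]_(x in D) g x.
Proof.
move=> mf mg fg; congr fine; apply: ae_eq_integral => //.
- exact/measurable_EFinP.
- exact/measurable_EFinP.
- by apply: filterS fg => x /= h Dx; rewrite h.
Qed.

Lemma ae_intg f g : measurable_fun D g -> {ae mu, forall x, D x -> f x = g x} ->
  intg f -> intg g.
Proof.
move=> mg fg If; have mf := intg_meas If.
apply/integrableP; split; first exact/measurable_EFinP.
move/integrableP : If => [_]; rewrite (_ : (\int[mu]_(x in D) _ = \int[mu]_(x in D) `|(EFin \o g) x|)%E)//.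
apply: ae_eq_integral => //.
- by apply: measurableT_comp => //; exact/measurable_EFinP.
- by apply: measurableT_comp => //; exact/measurable_EFinP.
- by apply: filterS fg => x /= h Dx; rewrite h.
Qed.

Lemma Rint_EFin f : intg f ->
  (\int[mu]_(x in D) f x)%:E = (\int[mu]_(x in D) (f x)%:E)%E.
Proof. by move=> If; rewrite fineK//; exact: integrable_fin_num. Qed.

Lemma le_Rint f g : intg f -> intg g -> (forall x, D x -> f x <= g x) ->
  \int[mu]_(x in D) f x <= \int[mu]_(x in D) g x.
Proof. by move=> If Ig fg; exact: le_Rintegral. Qed.

Lemma le_Rint_ae f g : intg f -> intg g ->
  {ae mu, forall x, D x -> f x <= g x} ->
  \int[mu]_(x in D) f x <= \int[mu]_(x in D) g x.
Proof.
move=> If Ig fg.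
have Im : intg (fun x => Num.min (f x) (g x)).
  apply: (@intg_le _ (fun x => `|f x| + `|g x|)).
  - by apply: measurable_minr; exact: intg_meas.
  - move=> x _; rewrite [leRHS]ger0_norm ?addr_ge0//.
    by rewrite /Num.min; case: ifP => _; rewrite ?lerDl ?lerDr.
  - by apply: intgD; exact: intg_norm.
have -> : \int[mu]_(x in D) f x = \int[mu]_(x in D) (Num.min (f x) (g x)).
  apply: ae_eq_meas; [exact: intg_meas|exact: intg_meas|].
  by apply: filterS fg => x + Dx => /(_ Dx) /min_idPl ->.
by apply: le_Rint => // x _; rewrite ge_min lexx orbT.
Qed.

Lemma Rint0_ae f : intg f -> (forall x, D x -> 0 <= f x) ->
  \int[mu]_(x in D) f x = 0 -> {ae mu, forall x, D x -> f x = 0}.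
Proof.
move=> If f0 h0.
have : (\int[mu]_(x in D) `|(EFin \o f) x|)%E = 0.
  transitivity (\int[mu]_(x in D) f x)%:E; last by rewrite h0.
  rewrite Rint_EFin//; apply: eq_integral => x /set_mem Dx /=.
  by rewrite ger0_norm// f0.
have mf : measurable_fun D (EFin \o f) by apply/measurable_EFinP; exact: intg_meas.
move/(ae_eq_integral_abs mu mD mf) => h.
by apply: filterS h => x /= + Dx => /(_ Dx) [].
Qed.

Lemma intg_bound f M : (mu D < +oo)%E -> measurable_fun D f ->
  (forall x, D x -> `|f x| <= M) -> intg f.
Proof.
move=> fin mf fM; apply: measurable_bounded_integrable => //.
exists M; split; first by rewrite num_real.
by move=> y My x /= Dx; apply: le_trans (fM _ Dx) (ltW My).
Qed.

Lemma intg_sum (I : Type) (s : seq I) (F : I -> T -> R) : (forall i, intg (F i)) ->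
  intg (fun x => \sum_(i <- s) F i x).
Proof.
move=> IF; elim: s => [|i s IH]; first by apply: eq_intg intg0 => x _; rewrite big_nil.
by apply: eq_intg (intgD (IF i) IH) => x _; rewrite big_cons.
Qed.

Lemma Rint_sum (I : Type) (s : seq I) (F : I -> T -> R) : (forall i, intg (F i)) ->
  \int[mu]_(x in D) (\sum_(i <- s) F i x) = \sum_(i <- s) \int[mu]_(x in D) F i x.
Proof.
move=> IF; elim: s => [|i s IH].
  by rewrite big_nil (eq_Rint (g := fun=> 0)) ?Rintegral_cst ?mul0r// => x _; rewrite big_nil.
rewrite big_cons -IH -RintegralD//; [|exact: IF|exact: intg_sum].
by apply: eq_Rint => x _; rewrite big_cons.
Qed.

Lemma sqi_meas f : sqi f -> measurable_fun D f. Proof. by case. Qed.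

Lemma sqi_mul f g : sqi f -> sqi g -> intg (fun x => f x * g x).
Proof.
move=> [mf If] [mg Ig].
apply: (@intg_le _ (fun x => f x ^+ 2 + g x ^+ 2)); last exact: intgD.
  exact: measurable_funM.
move=> x _; rewrite [leRHS]ger0_norm ?addr_ge0 ?sqr_ge0// normrM.
rewrite -[f x ^+ 2]real_normK ?num_real// -[g x ^+ 2]real_normK ?num_real//.
have := sqr_ge0 (`|f x| - `|g x|); have := normr_ge0 (f x).
by have := normr_ge0 (g x); nra.
Qed.

Lemma sqi_subsp : subsp sqi.
Proof.
split; first by split; [exact: measurable_cst|apply: eq_intg intg0 => x _; rewrite /= expr0n].
move=> a f g sf sg; have mf := sqi_meas sf; have mg := sqi_meas sg.
split; first by apply: measurable_funD => //; exact: measurable_funM.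
apply: (@eq_intg (fun x => a ^+ 2 * f x ^+ 2 + (2 * a * (f x * g x) + g x ^+ 2))).
  by move=> x _; rewrite -[(a *: f + g) x]/(a * f x + g x); ring.
apply: intgD; first by apply: intgZ; case: sf.
by apply: intgD; [apply: intgZ; exact: sqi_mul|case: sg].
Qed.

Lemma psd_ipg : psd sqi ipg.
Proof.
split; first exact: sqi_subsp.
- move=> a f g h sf sg sh; rewrite /ipg -RintegralZl//; last exact: sqi_mul.
  rewrite -RintegralD//; [|by apply: intgZ; exact: sqi_mul|exact: sqi_mul].
  by apply: eq_Rint => x _; rewrite -[(a *: f + g) x]/(a * f x + g x) mulrDl mulrA.
- by move=> f g _ _; apply: eq_Rint => x _; rewrite mulrC.
- by move=> f _; apply: Rintegral_ge0 => x _; rewrite -expr2 sqr_ge0.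
Qed.

Lemma ipg0_ae f : sqi f -> ipg f f = 0 -> {ae mu, forall x, D x -> f x = 0}.
Proof.
move=> sf /Rint0_ae h.
have {}h := h (sqi_mul sf sf) (fun x _ => _).
have {h} : {ae mu, forall x, D x -> f x * f x = 0}.
  by apply: h => x; rewrite -expr2 sqr_ge0.
by apply: filterS => x + Dx => /(_ Dx) /eqP; rewrite mulf_eq0 orbb => /eqP.
Qed.

Lemma sqi_bound f M : (mu D < +oo)%E -> measurable_fun D f ->
  (forall x, D x -> `|f x| <= M) -> sqi f.
Proof.
move=> fin mf fM; split => //; apply: (@intg_bound _ (M ^+ 2)) => //.
  exact: measurable_funX.
move=> x Dx; rewrite normrX lerXn2r ?nnegrE//; last exact: fM.
by apply: le_trans (fM x Dx).
Qed.

Lemma sqi_cst a : (mu D < +oo)%E -> sqi (fun=> a).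
Proof. by move=> fin; apply: (@sqi_bound _ `|a|). Qed.

Lemma sqi_intg f : (mu D < +oo)%E -> sqi f -> intg f.
Proof.
move=> fin sf; apply: eq_intg (sqi_mul sf (sqi_cst 1 fin)) => x _.
by rewrite mulr1.
Qed.

Lemma ae_sqi f g : measurable_fun D g -> {ae mu, forall x, D x -> f x = g x} ->
  sqi f -> sqi g.
Proof.
move=> mg fg [mf If]; split => //; apply: ae_intg If.
  exact: measurable_funX.
by apply: filterS fg => x h Dx; rewrite h.
Qed.

Lemma ae_ipg f g f' g' : measurable_fun D f -> measurable_fun D g ->
  measurable_fun D f' -> measurable_fun D g' ->
  {ae mu, forall x, D x -> f x = f' x} -> {ae mu, forall x, D x -> g x = g' x} ->
  ipg f g = ipg f' g'.
Proof.
move=> mf mg mf' mg' ff gg; apply: ae_eq_meas; [exact: measurable_funM..|].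
by apply: filterS2 ff gg => x h1 h2 Dx; rewrite h1// h2.
Qed.

Lemma Lnorm2E f : measurable_fun D f ->
  Lnorm mu 2%:E (EFin \o (f \_ D)) = (sqrte (\int[mu]_(x in D) (f x ^+ 2)%:E))%E.
Proof.
move=> mf; rewrite unlock poweR12_sqrt; last first.
  by apply: integral_ge0 => x _; exact: poweR_ge0.
congr sqrte; rewrite [RHS]integral_mkcond; apply: eq_integral => x _ /=.
rewrite !patchE; case: ifP => _; last by rewrite normr0 powR0.
by rewrite (powR_mulrn 2)// real_normK ?num_real.
Qed.

Lemma Lnorm2_sqi f : measurable_fun D f ->
  (Lnorm mu 2%:E (EFin \o (f \_ D)) < +oo)%E <-> sqi f.
Proof.
move=> mf; rewrite Lnorm2E//.
have e : (\int[mu]_(x in D) (f x ^+ 2)%:E = \int[mu]_(x in D) `|(EFin \o (fun x => f x ^+ 2)%R) x|)%E.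
  by apply: eq_integral => x _ /=; rewrite ger0_norm ?sqr_ge0.
split => [h|[_ /integrableP[_]]].
  split => //; apply/integrableP; split.
    by apply/measurable_EFinP; exact: measurable_funX.
  by rewrite -e; move: h; case: (\int[mu]_(x in D) (f x ^+ 2)%:E)%E => //= r _; rewrite ltry.
by rewrite -e; case: (\int[mu]_(x in D) (f x ^+ 2)%:E)%E => //= r _; rewrite ltry.
Qed.

Lemma Lnorm2_ipg f : sqi f ->
  Lnorm mu 2%:E (EFin \o (f \_ D)) = (Num.sqrt (ipg f f))%:E.
Proof.
move=> [mf If]; rewrite Lnorm2E// -Rint_EFin//=; by congr (Num.sqrt _)%:E; apply: eq_Rint.
Qed.

End Integrals.

Lemma ae_imp {d} {T : measurableType d} {R : realType}
  (mu : {measure set T -> \bar R}) (P Q : T -> Prop) :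
  (forall x, P x -> Q x) -> {ae mu, forall x, P x} -> {ae mu, forall x, Q x}.
Proof. by move=> PQ; apply: filterS. Qed.

Lemma ae_imp2 {d} {T : measurableType d} {R : realType}
  (mu : {measure set T -> \bar R}) (P1 P2 Q : T -> Prop) :
  (forall x, P1 x -> P2 x -> Q x) ->
  {ae mu, forall x, P1 x} -> {ae mu, forall x, P2 x} -> {ae mu, forall x, Q x}.
Proof. by move=> PQ; apply: filterS2. Qed.

Lemma ae_all {d} {T : measurableType d} {R : realType}
  (mu : {measure set T -> \bar R}) (P : T -> Prop) :
  (forall x, P x) -> {ae mu, forall x, P x}.
Proof. by move=> h; apply: nearW. Qed.

Lemma ae_forall_fin {d} {T : measurableType d} {R : realType}
  (mu : {measure set T -> \bar R}) (I : finType) (P : I -> T -> Prop) :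
  (forall i, {ae mu, forall x, P i x}) -> {ae mu, forall x, forall i, P i x}.
Proof.
move=> h; pose P' n x := if [pick i | enum_rank i == n :> nat] is Some i then P i x else True.
apply: ae_imp (_ : {ae mu, forall x, forall n, P' n x}).
  move=> x hx i; have := hx (enum_rank i); rewrite /P'; case: pickP => [j|/(_ i)].
    by move=> /eqP/val_inj/enum_rank_inj ->.
  by rewrite eqxx.
apply: ae_foralln => n; rewrite /P'; case: pickP => [i _|_]; first exact: h.
exact: ae_all.
Qed.

Lemma intg_restrict {d} {T : measurableType d} {R : realType}
  (mu : {measure set T -> \bar R}) (D : set T) (f : T -> R) : measurable D ->
  intg mu setT (f \_ D) <-> intg mu D f.
Proof.
move=> mD; rewrite /intg; apply: iff_sym.
by rewrite (integrable_mkcond (EFin \o f) mD) restrict_EFin.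
Qed.

Lemma intgS {d} {T : measurableType d} {R : realType}
  (mu : {measure set T -> \bar R}) (D E : set T) (f : T -> R) :
  measurable D -> measurable E -> E `<=` D -> intg mu D f -> intg mu E f.
Proof. by move=> mD mE ED; exact: integrableS. Qed.

Lemma sqiS {d} {T : measurableType d} {R : realType}
  (mu : {measure set T -> \bar R}) (D E : set T) (f : T -> R) :
  measurable D -> measurable E -> E `<=` D -> sqi mu D f -> sqi mu E f.
Proof.
move=> mD mE ED [mf If]; split; last exact: intgS If.
exact: measurable_funS mf.
Qed.

(** The sets whose preimage has integral zero form a Dynkin class. *)
Lemma Rint_preimage0 {R : realType} d1 d2 (T1 : measurableType d1) (T2 : measurableType d2)
    (mu : {measure set T1 -> \bar R}) (p : T1 -> T2) (G : set (set T2)) (h : T1 -> R) :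
  measurable_fun setT p -> @measurable _ T2 = <<s G >> -> setI_closed G ->
  intg mu setT h -> \int[mu]_x h x = 0 ->
  (forall A, G A -> \int[mu]_(x in p @^-1` A) h x = 0) ->
  forall A, measurable A -> \int[mu]_(x in p @^-1` A) h x = 0.
Proof.
move=> mp mG GI Ih h0 hG.
have mpA A : measurable A -> measurable (p @^-1` A).
  by move=> mA; rewrite -[X in measurable X]setTI; exact: mp.
suff : <<s G >> `<=` [set A | \int[mu]_(x in p @^-1` A) h x = 0] by rewrite -mG.
apply: (dynkin_induction mG GI) => //=.
- move=> A mA h1; rewrite preimage_setC.
  have := @Rintegral_setU _ _ _ mu (p @^-1` A) (~` (p @^-1` A)) h.
  rewrite setUv => /(_ (mpA _ mA) (measurableC (mpA _ mA)) Ih).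
  by rewrite disj_set2E setICr eqxx => /(_ isT); rewrite h0 h1 add0r.
move=> F mF tF hF; rewrite /= preimage_bigcup /Rintegral.
rewrite integral_bigcup //; last 3 first.
- by move=> i j _ _ [x [/= ? ?]]; apply: tF => //; exists (p x).
- by move=> n; exact: mpA.
- by apply: integrableS Ih => //; apply: bigcup_measurable => n _; exact: mpA.
rewrite eseries0// => n _ _; rewrite -Rint_EFin ?hF//; first exact: mpA.
by apply: intgS Ih => //; exact: mpA.
Qed.

Lemma Rint_subsets0_ae {R : realType} d (T : measurableType d) (mu : {measure set T -> \bar R})
    (h : T -> R) : intg mu setT h ->
  (forall A, measurable A -> \int[mu]_(x in A) h x = 0) ->
  {ae mu, forall x, h x = 0}.
Proof.
move=> Ih h0.
have : ae_eq mu setT (EFin \o h) (cst 0%E).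
  apply: integral_ae_eq => // E _ mE; rewrite integral0 -Rint_EFin ?h0//.
  exact: intgS Ih.
by apply: filterS => x /= /(_ I) [].
Qed.

(** * Open sets of the plane and null functions *)

(** The product of the Borel structures, on which the plane measure is defined; the
  annotation selects it among the structures carried by a pair of reals. *)
Notation measurable2 D :=
  (measurable (D : set (measurableTypeR _ * measurableTypeR _)%type)).

Section PlaneSets.
Context {R : realType}.
Local Notation pt := (R * R)%type.
Local Notation leb := (@lebesgue_measure R).
Implicit Types (a b x y : pt) (D : set pt).

Definition obox a b : set pt := `]a.1, b.1[%classic `*` `]a.2, b.2[%classic.
Definition cbox a b : set pt := `[a.1, b.1]%classic `*` `[a.2, b.2]%classic.

Lemma oboxE a b x : obox a b x <-> [/\ a.1 < x.1, x.1 < b.1, a.2 < x.2 & x.2 < b.2].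
Proof.
rewrite /obox /= !in_itv /=; split; first by move=> [/andP[? ?] /andP[? ?]]; split.
by move=> [-> -> -> ->].
Qed.

Lemma cboxE a b x :
  cbox a b x <-> [/\ a.1 <= x.1, x.1 <= b.1, a.2 <= x.2 & x.2 <= b.2].
Proof.
rewrite /cbox /= !in_itv /=; split; first by move=> [/andP[? ?] /andP[? ?]]; split.
by move=> [-> -> -> ->].
Qed.

Lemma obox_cbox a b : obox a b `<=` cbox a b.
Proof. by move=> x /oboxE[? ? ? ?]; apply/cboxE; split; apply: ltW. Qed.

Lemma cbox_compact a b : compact (cbox a b).
Proof. by apply: compact_setX; exact: segment_compact. Qed.

Lemma obox_measurable a b : measurable2 (obox a b).
Proof. by apply: measurableX. Qed.

Lemma cbox_measurable a b : measurable2 (cbox a b).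
Proof. by apply: measurableX. Qed.

Lemma nbhs_boxP x (P : set pt) : nbhs x P <->
  exists2 e : R, 0 < e & forall y, `|y.1 - x.1| < e -> `|y.2 - x.2| < e -> P y.
Proof.
split=> [/nbhs_ballP[e /= e0 h]|[e e0 h]].
  exists e => // y h1 h2; apply: h; split; rewrite -ball_normE /ball_ /=.
    by rewrite distrC.
  by rewrite distrC.
apply/nbhs_ballP; exists e => // y [].
by rewrite -ball_normE /ball_ /= => h1 h2; apply: h; rewrite distrC.
Qed.

Lemma open_boxP D : open D <-> forall x, D x ->
  exists2 e : R, 0 < e & forall y, `|y.1 - x.1| < e -> `|y.2 - x.2| < e -> D y.
Proof.
rewrite openE; split=> h x Dx; first by apply/nbhs_boxP; exact: h.
by apply/nbhs_boxP; exact: h.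
Qed.

Lemma obox_open a b : open (obox a b).
Proof.
apply/open_boxP => x /oboxE[h1 h2 h3 h4].
exists (Num.min (Num.min (x.1 - a.1) (b.1 - x.1)) (Num.min (x.2 - a.2) (b.2 - x.2))).
  by rewrite !lt_min !subr_gt0 h1 h2 h3 h4.
move=> y; rewrite !lt_min !ltr_norml => /andP[/andP[/andP[? ?] /andP[? ?]] _].
move=> /andP[_ /andP[/andP[? ?] /andP[? ?]]]; apply/oboxE; split; lra.
Qed.

(** The sequence enumerates the boxes with rational corners whose closure lies in D. *)
Lemma open_bigcup_box D : open D -> exists a b : nat -> pt,
  D = \bigcup_n obox (a n) (b n) /\ forall n, cbox (a n) (b n) `<=` D.
Proof.
move=> /open_boxP oD.
pose Q : countType := ((rat * rat) * (rat * rat))%type.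
pose r (q : rat * rat) : pt := (ratr q.1, ratr q.2).
have ok n : {q : Q | unpickle n = Some q /\ cbox (r q.1) (r q.2) `<=` D} +
    {forall q : Q, unpickle n = Some q -> ~ (cbox (r q.1) (r q.2) `<=` D)}.
  case e : (unpickle n) => [q|]; last by right.
  case: (pselect (cbox (r q.1) (r q.2) `<=` D)) => h; first by left; exists q.
  by right => q' [<-].
pose c n : pt * pt := match ok n with inleft q => (r (sval q).1, r (sval q).2)
  | inright _ => ((1, 1), (0, 0)) end.
have cD n : cbox (c n).1 (c n).2 `<=` D.
  rewrite /c; case: (ok n) => [[q [_ h]]|_] //= x /cboxE[/= h1 h2 _ _].
  by exfalso; lra.
exists (fun n => (c n).1), (fun n => (c n).2); split => //; apply/seteqP; split; last first.
  by move=> x [n _] /obox_cbox; exact: cD.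
move=> x Dx; have [e e0 h] := oD _ Dx.
have [q1 /andP[]] : exists q : rat, (ratr q : R) \in `]x.1 - e, x.1[.
  by apply: rat_in_itvoo; rewrite ltrBlDr ltrDl.
have [q2 /andP[]] : exists q : rat, (ratr q : R) \in `]x.1, x.1 + e[.
  by apply: rat_in_itvoo; rewrite ltrDl.
have [q3 /andP[]] : exists q : rat, (ratr q : R) \in `]x.2 - e, x.2[.
  by apply: rat_in_itvoo; rewrite ltrBlDr ltrDl.
have [q4 /andP[]] : exists q : rat, (ratr q : R) \in `]x.2, x.2 + e[.
  by apply: rat_in_itvoo; rewrite ltrDl.
rewrite !bnd_simp => h1 h2 h3 h4 h5 h6 h7 h8.
pose q : Q := ((q1, q3), (q2, q4)).
exists (pickle q) => //; rewrite /c.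
have qD : cbox (r q.1) (r q.2) `<=` D.
  move=> y /cboxE[/= k1 k2 k3 k4]; apply: h; rewrite ltr_norml; lra.
case: (ok _) => [[q' [/= + _]]|/(_ q)]; rewrite pickleK.
  by move=> [<-] /=; apply/oboxE; split.
by move=> /(_ erefl).
Qed.

Lemma open2_measurable D : open D -> measurable2 D.
Proof.
move=> /open_bigcup_box[a [b [-> _]]].
by apply: bigcupT_measurable => n; exact: obox_measurable.
Qed.

Lemma closed2_measurable D : closed D -> measurable2 D.
Proof.
by move=> cD; rewrite -(setCK D); apply: measurableC; apply: open2_measurable; exact: closed_openC.
Qed.

Lemma compact2_measurable D : compact D -> measurable2 D.
Proof. by move=> /(compact_closed (@norm_hausdorff _ _)); exact: closed2_measurable. Qed.

Lemma continuous2_measurable D (f : pt -> R) : open D ->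
  (forall x, D x -> {for x, continuous f}) -> measurable_fun D f.
Proof.
move=> oD cf; apply: (measurability _ (RGenOpens.measurableE R)).
move=> _ [_ [a [b ->] <-]]; apply: open2_measurable.
rewrite openE => x [Dx fx]; apply: filterI; first exact: open_nbhs_nbhs.
by apply: (cf _ Dx); apply: open_nbhs_nbhs; split => //; exact: interval_open.
Qed.

Lemma leb2_cbox a b : (leb2 (cbox a b) < +oo)%E.
Proof.
rewrite /leb2 /cbox product_measure1E//=.
by rewrite !lebesgue_measure_itv /=; do 2 case: ifP => _; rewrite -?EFinB -?EFinM ?mule0 ?mul0e ltry.
Qed.

Lemma bounded_cbox D : bounded_set D -> exists2 M, 0 < M & D `<=` cbox (- M, - M) (M, M).
Proof.
move=> [M [_ hM]]; exists (`|M| + 1); first by rewrite ltr_wpDl.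
move=> x Dx; have := hM (`|M| + 1) _ x Dx.
rewrite (le_lt_trans (ler_norm M)) ?ltrDl// => /(_ isT) h.
have [h1 h2] : `|x.1| <= `|M| + 1 /\ `|x.2| <= `|M| + 1.
  by move: h; rewrite /= /Num.norm /= ge_max => /andP.
by apply/cboxE => /=; move: h1 h2; rewrite !ler_norml => /andP[? ?] /andP[? ?]; split.
Qed.

Lemma leb2_bounded D : measurable2 D -> bounded_set D -> (leb2 D < +oo)%E.
Proof.
move=> mD /bounded_cbox[M _ h]; apply: le_lt_trans (leb2_cbox (- M, - M) (M, M)).
by apply: le_measure => //; rewrite inE//; exact: cbox_measurable.
Qed.

Lemma ray_pi_system : setI_closed (@RGenOInfty.G R).
Proof.
move=> _ _ [x ->] [y ->]; exists (Num.max x y); apply/seteqP; split => z /=.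
  by rewrite !in_itv /= !andbT gt_max => -[-> ->].
by rewrite !in_itv /= !andbT gt_max => /andP[-> ->].
Qed.

(** Two applications of the previous lemma, one per coordinate, pass from boxes
  to products of Borel sets; a third one passes to all measurable sets. *)
Lemma boxes0_ae a b (g : pt -> R) : intg leb2 (obox a b) g ->
  (forall a' b', obox a' b' `<=` obox a b ->
     \int[leb2]_(x in obox a' b') g x = 0) ->
  {ae leb2, forall x, obox a b x -> g x = 0}.
Proof.
move=> Ig g0; set B := obox a b; set h := g \_ B.
have mB : measurable2 B := obox_measurable a b.
have Ih : intg leb2 setT h.
  exact/intg_restrict.
have hE A : \int[leb2]_(x in A) h x = \int[leb2]_(x in A `&` B) g x.
  by rewrite Rintegral_mkcondr.
have box0 u v : \int[leb2]_(x in obox u v) h x = 0.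
  rewrite hE; pose u' : pt := (Num.max u.1 a.1, Num.max u.2 a.2).
  pose v' : pt := (Num.min v.1 b.1, Num.min v.2 b.2).
  have -> : obox u v `&` B = obox u' v'.
    apply/seteqP; split => x; rewrite /B /setI /= !oboxE /= !gt_max !lt_min.
      by move=> [[-> -> -> ->] [-> -> -> ->]].
    by move=> [/andP[-> ->] /andP[-> ->] /andP[-> ->] /andP[-> ->]].
  apply: g0 => x /oboxE /=; rewrite !gt_max !lt_min.
  by move=> [/andP[_ ?] /andP[_ ?] /andP[_ ?] /andP[_ ?]]; apply/oboxE.
have hB A : A `&` B `<=` B by move=> x [].
have ray0 s t : \int[leb2]_(x in `]s, +oo[%classic `*` `]t, +oo[%classic) h x = 0.
  rewrite hE -(box0 (s, t) b) hE; congr Rintegral; apply/seteqP; split => x.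
    move=> [[]]; rewrite /= !in_itv /= !andbT => ? ? Bx; split => //.
    by apply/oboxE; split => //; move/oboxE : Bx => [].
  move=> [/oboxE[/= ? _ ? _] Bx]; split => //.
  by rewrite /= !in_itv /= !andbT.
have mR := RGenOInfty.measurableE R.
have allT : \int[leb2]_x h x = 0.
  rewrite -[RHS](box0 a b) !hE setTI; congr Rintegral.
  by rewrite /B setIid.
apply: ae_imp (_ : {ae leb2, forall x, h x = 0}).
  by move=> x; rewrite /h patchE => /[swap] Bx; rewrite mem_set.
apply: (Rint_subsets0_ae Ih).
have half s A2 : measurable A2 -> \int[leb2]_(x in `]s, +oo[%classic `*` A2) h x = 0.
  move=> mA2; set C : set pt := `]s, +oo[%classic `*` setT.
  have mC : measurable2 C by exact: measurableX.
  have CE A : `]s, +oo[%classic `*` A = snd @^-1` A `&` C.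
    by apply/seteqP; split => x; [move=> [] | move=> [? []]].
  rewrite CE Rintegral_mkcondr.
  apply: (Rint_preimage0 _ mR ray_pi_system) => //.
  - by apply/intg_restrict => //; apply: intgS Ih.
  - rewrite -Rintegral_mkcond -[RHS](ray0 s a.2) !hE; congr Rintegral.
    apply/seteqP; split => x [[H1 H2] Bx]; split => //; split => //.
    by rewrite /= in_itv /= andbT; move/oboxE : Bx => [].
  - by move=> _ [t ->]; rewrite -Rintegral_mkcondr -CE ray0.
have rect A1 A2 : measurable A1 -> measurable A2 -> \int[leb2]_(x in A1 `*` A2) h x = 0.
  move=> mA1 mA2; set C : set pt := setT `*` A2.
  have mC : measurable2 C by exact: measurableX.
  have CE A : A `*` A2 = fst @^-1` A `&` C.
    by apply/seteqP; split => x; [move=> [] | move=> [? []]].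
  rewrite CE Rintegral_mkcondr.
  apply: (Rint_preimage0 _ mR ray_pi_system) => //.
  - by apply/intg_restrict => //; apply: intgS Ih.
  - rewrite -Rintegral_mkcond -[RHS](half a.1 A2 mA2) !hE; congr Rintegral.
    apply/seteqP; split => x [[H1 H2] Bx]; split => //; split => //.
    by rewrite /= in_itv /= andbT; move/oboxE : Bx => [].
  - by move=> _ [t ->]; rewrite -Rintegral_mkcondr -CE half.
move=> A mA; rewrite -[A]preimage_id.
apply: (Rint_preimage0 _ (measurable_prod_measurableType _ _)) => //.
- move=> _ _ [A1 mA1 [A2 mA2 <-]] [B1 mB1 [B2 mB2 <-]]; rewrite -setXI.
  by exists (A1 `&` B1); [exact: measurableI|exists (A2 `&` B2) => //; exact: measurableI].
- by move=> _ [A1 mA1 [A2 mA2 <-]]; rewrite preimage_id rect.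
Qed.

(** Countably many boxes exhaust D, and on each of them the integrals over the
  smaller boxes determine the function up to a null set. *)
Lemma open_boxes0_ae D (g : pt -> R) : open D -> loc_integrable D g ->
  (forall a b, cbox a b `<=` D -> \int[leb2]_(x in obox a b) g x = 0) ->
  {ae leb2, forall x, D x -> g x = 0}.
Proof.
move=> /open_bigcup_box[a [b [-> cD]]] Lg g0.
apply: ae_imp (_ : {ae leb2, forall x, forall n, obox (a n) (b n) x -> g x = 0}).
  by move=> x h [n _]; exact: h.
apply/ae_foralln => n; apply: boxes0_ae.
  have := Lg _ (@cbox_compact (a n) (b n)) (cD n).
  apply: integrableS; [exact: cbox_measurable|exact: obox_measurable|exact: obox_cbox].
move=> a' b' sub; have [[x /oboxE[x1 x2 x3 x4]]|] := pselect (obox a' b' !=set0); last first.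
  by move=> /set0P/negP; rewrite negbK => /eqP ->; rewrite Rintegral_set0.
apply: g0 => y /cboxE[y1 y2 y3 y4]; apply: (cD n).
have c1 z : a'.1 < z < b'.1 -> (a n).1 < z < (b n).1.
  move=> /andP[z1 z2]; have /oboxE[/= -> -> _ _ //] : obox (a n) (b n) (z, x.2).
  by apply: sub; apply/oboxE.
have c2 z : a'.2 < z < b'.2 -> (a n).2 < z < (b n).2.
  move=> /andP[z1 z2]; have /oboxE[/= _ _ -> -> //] : obox (a n) (b n) (x.1, z).
  by apply: sub; apply/oboxE.
have lim (p q r s u : R) : p < u < q -> (forall z, p < z < q -> r < z < s) -> r <= p /\ q <= s.
  move=> /andP[u1 u2] h; split; apply/ler_addgt0Pr => e e0.
    pose z := Num.min ((p + u) / 2) (p + e / 2).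
    have : p < z < q by rewrite /z; case: (ltP ((p + u) / 2)) => ?; apply/andP; split; lra.
    move/h => /andP[+ _]; rewrite /z; case: (ltP ((p + u) / 2)) => ? ?; lra.
  pose z := Num.max ((q + u) / 2) (q - e / 2).
  have : p < z < q by rewrite /z; case: (ltP ((q + u) / 2)) => ?; apply/andP; split; lra.
  move/h => /andP[_]; rewrite /z; case: (ltP ((q + u) / 2)) => ? ?; lra.
have [k1 k2] := lim _ _ _ _ x.1 (introT andP (conj x1 x2)) c1.
have [k3 k4] := lim _ _ _ _ x.2 (introT andP (conj x3 x4)) c2.
apply/cboxE; split; lra.
Qed.

End PlaneSets.

(** * Smooth functions and bumps *)

Section Smooth.
Context {R : realType}.
Local Notation pt := (R * R)%type.
Implicit Types (f g : pt -> R) (i j : 'I_2) (x : pt).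

Lemma ord2_ind (P : 'I_2 -> Prop) : P 0 -> P 1 -> forall i, P i.
Proof.
move=> P0 P1 [[|[|//]] h]; [rewrite (_ : Ordinal h = 0)//|rewrite (_ : Ordinal h = 1)//];
  exact: val_inj.
Qed.

Lemma ebase0 : @ebase R 0 = (1, 0). Proof. by []. Qed.
Lemma ebase1 : @ebase R 1 = (0, 1). Proof. by []. Qed.

Lemma quot_slice0 f s y (h : R) :
  h^-1 *: ((f \o shift (s, y)) (h *: ebase 0) - f (s, y)) =
  h^-1 *: (((fun r => f (r, y)) \o shift s) (h *: 1) - f (s, y)).
Proof.
congr (_ *: (_ - _)); rewrite ebase0 /= /shift /=.
by rewrite -[(h *: _ + _)]/(h *: 1 + s, h *: 0 + y) scaler0 add0r.
Qed.

Lemma quot_slice1 f s y (h : R) :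
  h^-1 *: ((f \o shift (s, y)) (h *: ebase 1) - f (s, y)) =
  h^-1 *: (((fun r => f (s, r)) \o shift y) (h *: 1) - f (s, y)).
Proof.
congr (_ *: (_ - _)); rewrite ebase1 /= /shift /=.
by rewrite -[(h *: _ + _)]/(h *: 0 + s, h *: 1 + y) scaler0 add0r.
Qed.

Lemma derivable_slice0 f s y :
  derivable f (s, y) (ebase 0) = derivable (fun r => f (r, y)) s 1.
Proof.
by rewrite /derivable (funext (quot_slice0 f s y)).
Qed.

Lemma derivable_slice1 f s y :
  derivable f (s, y) (ebase 1) = derivable (fun r => f (s, r)) y 1.
Proof.
by rewrite /derivable (funext (quot_slice1 f s y)).
Qed.

Lemma pd_slice0 f s y : pd 0 f (s, y) = 'D_1 (fun r => f (r, y)) s.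
Proof.
by rewrite /pd /derive (funext (quot_slice0 f s y)).
Qed.

Lemma pd_slice1 f s y : pd 1 f (s, y) = 'D_1 (fun r => f (s, r)) y.
Proof.
by rewrite /pd /derive (funext (quot_slice1 f s y)).
Qed.

Lemma smooth_class (C : set (pt -> R)) :
  (forall f, C f -> [/\ continuous f, forall i x, derivable f x (ebase i) &
     forall i, C (pd i f)]) -> forall f, C f -> smooth f.
Proof.
move=> hC f Cf s; have {Cf} : C (pds s f).
  by elim: s => [//|i s IH] /=; have [_ _] := hC _ IH; exact.
by move=> /hC[].
Qed.

Lemma smooth_cont f : smooth f -> continuous f.
Proof. by move=> /(_ [::])[]. Qed.

Lemma smooth_derivable f i x : smooth f -> derivable f x (ebase i).
Proof. by move=> /(_ [::])[]. Qed.

Lemma smooth_pd f i : smooth f -> smooth (pd i f).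
Proof. by move=> sf s; have := sf (rcons s i); rewrite /pds foldr_rcons. Qed.

Inductive smooth_alg : (pt -> R) -> Prop :=
| SmoothBase f of smooth f : smooth_alg f
| SmoothAdd f g of smooth_alg f & smooth_alg g : smooth_alg (f + g)
| SmoothMul f g of smooth_alg f & smooth_alg g : smooth_alg (f * g).

Lemma smooth_algP f : smooth_alg f -> smooth f.
Proof.
apply: smooth_class => {}f; elim => {f} [f sf|f g _ [cf df pf] _ [cg dg pg]|
  f g sf [cf df pf] sg [cg dg pg]].
- split; [exact: smooth_cont|by move=> i x; exact: smooth_derivable|].
  by move=> i; apply: SmoothBase; exact: smooth_pd.
- split; first by move=> x; apply: continuousD; [exact: cf|exact: cg].
    by move=> i x; exact: derivableD.
  move=> i; rewrite (_ : pd i (f + g) = pd i f + pd i g); first exact: SmoothAdd.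
  by apply/funext => x; rewrite /pd deriveD.
- split; first by move=> x; apply: continuousM; [exact: cf|exact: cg].
    by move=> i x; exact: derivableM.
  move=> i; rewrite (_ : pd i (f * g) = f * pd i g + g * pd i f).
    by apply: SmoothAdd; apply: SmoothMul.
  by apply/funext => x; rewrite /pd deriveM.
Qed.

Lemma smoothD f g : smooth f -> smooth g -> smooth (f + g).
Proof. by move=> sf sg; apply: smooth_algP; apply: SmoothAdd; apply: SmoothBase. Qed.

Lemma smoothM f g : smooth f -> smooth g -> smooth (f * g).
Proof. by move=> sf sg; apply: smooth_algP; apply: SmoothMul; apply: SmoothBase. Qed.

Definition coord i x : R := if i == 0 then x.1 else x.2.

Lemma coord_cont i : continuous (coord i).
Proof.
by elim/ord2_ind: i => x; [exact: (@cvg_fst _ _ _ _ _)|exact: (@cvg_snd _ _ _ _ _)].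
Qed.

Lemma is_derive_mul (u v : R -> R) (s a b : R) : is_derive s (1 : R) u a ->
  is_derive s (1 : R) v b -> is_derive s (1 : R) (fun r => u r * v r) (u s * b + v s * a).
Proof.
move=> da db; have h : is_derive s (1 : R) (u * v) (u s *: b + v s *: a) by exact: is_deriveM.
exact: h.
Qed.

Lemma is_derive_scale (c : R) (u : R -> R) (s a : R) : is_derive s (1 : R) u a ->
  is_derive s (1 : R) (fun r => c * u r) (c * a).
Proof.
move=> da; have h : is_derive s (1 : R) (c *: u) (c *: a) by exact: is_deriveZ.
exact: h.
Qed.

(** G lists the successive derivatives of a function of one variable. *)
Lemma smooth_ridge (G : nat -> R -> R) i (a b : R) :
  (forall n (s : R), is_derive s (1 : R) (G n) (G n.+1 s)) ->
  smooth (fun x => G 0%N (a * coord i x + b)).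
Proof.
move=> dG.
pose C : set (pt -> R) := [set f | exists (c : R) n, f = fun x => c * G n (a * coord i x + b)].
have cG n : continuous (G n).
  by move=> s; apply: differentiable_continuous; apply/derivable1_diffP; have [] := dG n s.
have dl n (s : R) : is_derive s (1 : R) (fun r : R => G n (a * r + b)) (a * G n.+1 (a * s + b)).
  have := @is_derive1_comp _ (G n) (fun r : R => a * r + b) s _ a (dG n (a * s + b)).
  rewrite mulrC; apply.
  have dab : is_derive s (1 : R) (a *: (@id R) + cst b) (a *: (1 : R) + 0).
    exact: is_deriveD.
  by apply: (is_derive_eq dab); rewrite addr0 /GRing.scale /= mulr1.
apply: (@smooth_class C); last by exists 1, 0%N; apply/funext => x; rewrite mul1r.
move=> _ [c [n ->]].
have dc i' (s y : R) : i' = i -> is_derive s (1 : R)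
    (fun r : R => c * G n (a * coord i (if i == 0 then (r, y) else (y, r)) + b))
    (c * a * G n.+1 (a * s + b)).
  move=> _; rewrite (_ : (fun r => _) = fun r => c * G n (a * r + b)); last first.
    by apply/funext => r /=; rewrite /coord; case: ifP => ->.
  by rewrite -mulrA; apply: is_derive_scale.
split.
- move=> x; apply: cvgM; first exact: cvg_cst.
  apply: (continuous_comp (f := fun x => a * coord i x + b)); last exact: cG.
  by apply: cvgD; [apply: cvgM; [exact: cvg_cst|exact: coord_cont]|exact: cvg_cst].
- move=> j [s y]; elim/ord2_ind: j; elim/ord2_ind: i {C} dc => dc.
  + by rewrite derivable_slice0; have [] := dc 0 s y erefl.
  + by rewrite derivable_slice0; exact: (derivable_cst (c * G n (a * y + b))).
  + by rewrite derivable_slice1; exact: (derivable_cst (c * G n (a * s + b))).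
  + by rewrite derivable_slice1; have [] := dc 1 y s erefl.
- move=> j; case: (eqVneq j i) => [->|ji].
    exists (c * a), n.+1; apply/funext => -[s y]; elim/ord2_ind: i dc {C} => dc.
      by rewrite pd_slice0; have [_] := dc 0 s y erefl.
    by rewrite pd_slice1; have [_] := dc 1 y s erefl.
  exists 0, 0%N; apply/funext => -[s y]; rewrite mul0r; move: ji.
  elim/ord2_ind: j; elim/ord2_ind: i {C dc} => // _.
    by rewrite pd_slice0; exact: (derive_cst (c * G n (a * y + b))).
  by rewrite pd_slice1; exact: (derive_cst (c * G n (a * s + b))).
Qed.

Lemma smooth_cst (c : R) : smooth (fun=> c).
Proof.
apply: (@smooth_ridge (fun n _ => if n is 0%N then c else 0) 0 0 0) => -[|n] s; exact: is_derive_cst.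
Qed.

Lemma smooth_coord i : smooth (coord i).
Proof.
rewrite (_ : coord i = fun x => 1 * coord i x + 0); last first.
  by apply/funext => x; rewrite mul1r addr0.
apply: (@smooth_ridge (fun n s => if n is 0%N then s else if n is 1%N then 1 else 0)
  i 1 0) => -[|[|n]] s; [exact: is_derive_id|exact: is_derive_cst..].
Qed.

Definition bump (p : {poly R}) (s : R) : R :=
  if 0 < s then p.[s^-1] * expR (- s^-1) else 0.

Lemma poly_expR_bound (p : {poly R}) m :
  exists C, forall y, 0 < y -> y ^+ m * `|p.[y]| * expR (- y) <= C.
Proof.
elim/poly_ind: p m => [|p c IH] m.
  by exists 0 => y y0; rewrite horner0 normr0 mulr0 mul0r.
have base n : exists C, forall y : R, 0 < y -> y ^+ n * expR (- y) <= C.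
  case: n => [|n]; first by exists 1 => y y0; rewrite expr0 mul1r -expR0 ler_expR; lra.
  exists (n.+1%:R ^+ n.+1) => y y0.
  have n0 : 0 < n.+1%:R :> R by [].
  have h : (y / n.+1%:R) ^+ n.+1 <= expR y.
    have -> : expR y = expR (y / n.+1%:R) ^+ n.+1.
      by rewrite -expRM_natl mulrC divfK// gt_eqF.
    rewrite lerXn2r ?nnegrE ?expR_ge0 ?divr_ge0 ?(ltW y0)//.
    by apply: le_trans (expR_ge1Dx _); rewrite lerDr.
  rewrite expRN ler_pdivrMr ?expR_gt0//.
  by move: h; rewrite expr_div_n ler_pdivrMr ?exprn_gt0// mulrC.
have [C1 h1] := IH m.+1; have [C2 h2] := base m.
exists (C1 + `|c| * C2) => y y0; rewrite hornerMXaddC.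
apply: (@le_trans _ _ ((y ^+ m.+1 * `|p.[y]| + `|c| * y ^+ m) * expR (- y))).
  rewrite ler_wpM2r ?expR_ge0// exprSr -mulrA [`|c| * _]mulrC -mulrDr.
  rewrite ler_wpM2l ?exprn_ge0 ?(ltW y0)//.
  apply: le_trans (ler_normD _ _) _.
  by rewrite lerD2r normrM (gtr0_norm y0) mulrC.
by rewrite mulrDl lerD ?h1// -mulrA ler_wpM2l ?h2.
Qed.

Lemma bump_derive p (s : R) : is_derive s (1 : R) (bump p) (bump ('X^2 * (p - p^`())) s).
Proof.
have [s0|s0|<-] := ltgtP 0 s.
- have ds : is_derive s (1 : R) (fun r : R => r^-1) (- s ^- 2).
    apply: is_derive_eq; first by apply: is_deriveV; rewrite gt_eqF.
    by rewrite /GRing.scale /= mulr1.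
  have dp : is_derive s (1 : R) (fun r : R => p.[r^-1]) (p^`().[s^-1] * - s ^- 2).
    apply: (@is_derive1_comp _ (horner p) (fun r => r^-1)) => //; exact: is_derive_poly.
  have de : is_derive s (1 : R) (fun r : R => expR (- r^-1)) (expR (- s^-1) * s ^- 2).
    apply: (@is_derive1_comp _ expR (fun r => - r^-1)).
    by apply: is_derive_eq; rewrite opprK.
  have dm : is_derive s (1 : R) (fun r : R => p.[r^-1] * expR (- r^-1))
      (bump ('X^2 * (p - p^`())) s).
    apply: is_derive_eq (is_derive_mul dp de) _.
    rewrite /bump s0 /= hornerM hornerXn hornerD hornerN exprVn.
    by ring.
  apply: near_eq_is_derive dm; near=> r.
  by rewrite /bump; case: ifPn => // /negP[]; near: r; exact: lt_nbhsr.
- have -> : bump ('X^2 * (p - p^`())) s = 0 by rewrite /bump ltNge ltW.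
  apply: near_eq_is_derive (is_derive_cst (0 : R) s (1 : R)); near=> r.
  rewrite /bump ltNge; case: ifPn => //; rewrite -ltNge ltNge => /negP[].
  by apply: ltW; near: r; exact: lt_nbhsl.
- rewrite {2}/bump ltxx.
  have [C hC] := poly_expR_bound p 2.
  have C0 : 0 <= C by apply: le_trans (hC 1 ltr01); rewrite !mulr_ge0// expR_ge0.
  have C1 : 0 < C + 1 by lra.
  have bC h : `|bump p h| <= C * h ^+ 2.
    rewrite /bump; case: ifPn => [h0|_]; last by rewrite normr0 mulr_ge0// sqr_ge0.
    have := hC h^-1; rewrite invr_gt0 => /(_ h0).
    rewrite normrM (ger0_norm (expR_ge0 _)) exprVn -mulrA.
    by rewrite mulrC ler_pdivrMr ?exprn_gt0.
  have lim0 : h^-1 *: ((bump p \o shift 0) (h *: 1) - bump p 0) @[h --> 0^'] --> (0 : R).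
    apply/cvgr0Pnorm_le => e e0; near=> h.
    rewrite /= addr0 /GRing.scale /= mulr1 {2}/bump ltxx subr0 normrM normfV.
    have h0 : h != 0 by near: h; exact: nbhs_dnbhs_neq.
    rewrite mulrC ler_pdivrMr ?normr_gt0//.
    apply: le_trans (bC h) _; rewrite -real_normK ?num_real// expr2 mulrA.
    rewrite ler_wpM2r//.
    apply: (@le_trans _ _ (C * (e / (C + 1)))).
      by rewrite ler_wpM2l//; near: h; apply: dnbhs0_le; rewrite divr_gt0.
    by rewrite mulrA ler_pdivrMr// mulrC ler_pM2l// lerDl.
  by split; [apply/cvg_ex; exists 0|exact/cvg_lim].
Unshelve. all: by end_near. Qed.

Fixpoint bump_poly n : {poly R} :=
  if n is n'.+1 then 'X^2 * (bump_poly n' - (bump_poly n')^`()) else 1.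

Definition bump1 : R -> R := bump 1.

Lemma bump1_ge0 s : 0 <= bump1 s.
Proof. by rewrite /bump1 /bump; case: ifP => // _; rewrite hornerE mul1r expR_ge0. Qed.

Lemma bump1_le1 s : bump1 s <= 1.
Proof.
rewrite /bump1 /bump; case: ifPn => // s0; rewrite hornerE mul1r -expR0 ler_expR.
by rewrite oppr_le0 invr_ge0 ltW.
Qed.

Lemma bump1_0 s : s <= 0 -> bump1 s = 0.
Proof. by rewrite /bump1 /bump ltNge => ->. Qed.

Lemma bump1_cvg s : 0 < s -> (fun n : nat => bump1 (n%:R * s)) @ \oo --> (1 : R).
Proof.
move=> s0.
have : (fun n : nat => expR (- (harmonic n * s^-1))) @ \oo --> expR (- (0 * s^-1)).
  apply: continuous_cvg; first exact: continuous_expR.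
  by apply: cvgN; apply: cvgM; [exact: cvg_harmonic|exact: cvg_cst].
rewrite mul0r oppr0 expR0 => h; rewrite -cvg_shiftS; apply: cvg_trans h.
apply: near_eq_cvg; apply: nearW => n.
by rewrite /= /bump1 /bump mulr_gt0// hornerE mul1r invfM.
Qed.

Lemma smooth_bump1 i (a b : R) : smooth (fun x => bump1 (a * coord i x + b)).
Proof. by apply: (@smooth_ridge (fun n => bump (bump_poly n))) => n s; exact: bump_derive. Qed.

(** Smooth functions increasing to the indicator of an open box. *)
Definition box_bump (a b : pt) (n : nat) : pt -> R :=
  (fun x => bump1 (n%:R * coord 0 x - n%:R * a.1)) *
  (fun x => bump1 (- n%:R * coord 0 x + n%:R * b.1)) *
  ((fun x => bump1 (n%:R * coord 1 x - n%:R * a.2)) *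
   (fun x => bump1 (- n%:R * coord 1 x + n%:R * b.2))).

Lemma box_bumpE a b n x : box_bump a b n x =
  bump1 (n%:R * (x.1 - a.1)) * bump1 (n%:R * (b.1 - x.1)) *
  (bump1 (n%:R * (x.2 - a.2)) * bump1 (n%:R * (b.2 - x.2))).
Proof.
have e (u v : R) : n%:R * (u - v) = n%:R * u - n%:R * v by rewrite mulrBr.
have e' (u v : R) : n%:R * (u - v) = - n%:R * v + n%:R * u by rewrite mulrBr mulNr addrC.
rewrite (e x.1) (e x.2) (e' b.1) (e' b.2) //.
Qed.

Lemma box_bump_smooth a b n : smooth (box_bump a b n).
Proof. by apply: smoothM; apply: smoothM; exact: smooth_bump1. Qed.

Lemma box_bump_out a b n x : ~ obox a b x -> box_bump a b n x = 0.
Proof.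
move=> nx; rewrite box_bumpE.
have z (u : R) : u <= 0 -> bump1 (n%:R * u) = 0 by move=> ?; rewrite bump1_0// mulr_ge0_le0.
have [h|h1] := leP (x.1 - a.1) 0; first by rewrite z// !mul0r.
have [h|h2] := leP (b.1 - x.1) 0; first by rewrite (z _ h) mulr0 mul0r.
have [h|h3] := leP (x.2 - a.2) 0; first by rewrite (z _ h) mul0r mulr0.
have [h|h4] := leP (b.2 - x.2) 0; first by rewrite (z _ h) !mulr0.
by exfalso; apply: nx; apply/oboxE; rewrite -subr_gt0 h1 -subr_gt0 h2 -subr_gt0 h3 -subr_gt0 h4.
Qed.

Lemma box_bump_le1 a b n x : `|box_bump a b n x| <= 1.
Proof.
by rewrite box_bumpE ger0_norm ?mulr_ge0 ?bump1_ge0// !mulr_ile1 ?mulr_ge0 ?bump1_ge0 ?bump1_le1.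
Qed.

Lemma box_bump_cvg a b x : obox a b x -> (fun n => box_bump a b n x) @ \oo --> (1 : R).
Proof.
move=> /oboxE[h1 h2 h3 h4].
rewrite (_ : (fun n => _) = fun n => bump1 (n%:R * (x.1 - a.1)) * bump1 (n%:R * (b.1 - x.1)) *
  (bump1 (n%:R * (x.2 - a.2)) * bump1 (n%:R * (b.2 - x.2)))); last first.
  by apply/funext => n; rewrite box_bumpE.
rewrite -[X in _ --> X](_ : 1 * 1 * (1 * 1) = 1 :> R); last by rewrite !mulr1.
by apply: cvgM; apply: cvgM; apply: bump1_cvg; rewrite subr_gt0.
Qed.

Lemma box_bump_test D a b n : cbox a b `<=` D -> test_fun D (box_bump a b n).
Proof.
move=> abD; split; first exact: box_bump_smooth.
exists (cbox a b); split => //; first exact: cbox_compact.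
by move=> x nx; apply: box_bump_out => /obox_cbox.
Qed.

End Smooth.

(** * Iterated integrals and the fundamental theorem of calculus *)

Section RFubini.
Context {d1 d2} {T1 : measurableType d1} {T2 : measurableType d2} {R : realType}.
Context (m1 : {sigma_finite_measure set T1 -> \bar R})
  (m2 : {sigma_finite_measure set T2 -> \bar R}).
Variable f : T1 * T2 -> R.
Hypothesis If : intg (m1 \x m2)%E setT f.

Lemma fubini_section1 : {ae m1, forall x, intg m2 setT (fun y => f (x, y))}.
Proof. exact: (ae_integrable1 If). Qed.

Lemma fubini_section2 : {ae m2, forall y, intg m1 setT (fun x => f (x, y))}.
Proof. exact: (ae_integrable2 If). Qed.

Lemma fubini_intg1 : intg m1 setT (fun x => \int[m2]_y f (x, y)).
Proof.
have h := integrable_fubini_F If; rewrite /intg.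
apply/integrableP; split.
  apply/measurable_EFinP; apply: (measurableT_comp (f := fine)) => //.
  exact: (measurable_int m1 h).
move/integrableP : h => [_]; apply: le_lt_trans; apply: ge0_le_integral => //.
- apply: measurableT_comp => //; apply/measurable_EFinP.
  apply: (measurableT_comp (f := fine)) => //.
  by have /measurable_int := integrable_fubini_F If.
- by apply: measurableT_comp => //; have /measurable_int := integrable_fubini_F If.
- move=> x _ /=; rewrite /Rintegral /fubini_F /=.
  by case: (\int[m2]_y _)%E => [r||] //=; rewrite normr0 ?leey.
Qed.

Lemma fubini_Rint1 : \int[(m1 \x m2)%E]_z f z = \int[m1]_x \int[m2]_y f (x, y).
Proof.
rewrite /Rintegral -(fubini1 If); congr fine.
apply: ae_eq_integral => //.
- by have /measurable_int := integrable_fubini_F If.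
- by have /measurable_int := fubini_intg1.
- apply: filterS fubini_section1 => x Ix _; rewrite /fubini_F /=.
  by rewrite fineK//; apply: integrable_fin_num.
Qed.

Lemma fubini_intg2 : intg m2 setT (fun y => \int[m1]_x f (x, y)).
Proof.
have mf : measurable_fun setT (EFin \o f) := measurable_int _ If.
have mG : measurable_fun setT (fubini_G m1 (EFin \o f)) := measurable_fubini_G If.
have mG' : measurable_fun setT (EFin \o (fine \o fubini_G m1 (EFin \o f))).
  by apply/measurable_EFinP; apply: measurableT_comp.
apply/integrableP; split => //.
apply: le_lt_trans ((integrable21ltyP _ _ mf).1 If); apply: ge0_le_integral => //.
- exact: measurableT_comp.
- apply: (@measurable_fun_fubini_tonelli_G _ _ _ _ _ m1 (abse \o (EFin \o f))) => //.
    exact: measurableT_comp.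
  by move=> x; exact: abse_ge0.
- move=> y _; apply: (@le_trans _ _ `|fubini_G m1 (EFin \o f) y|%E).
    by rewrite /Rintegral /fubini_G /=; case: (\int[m1]_y _)%E => [r||] //=; rewrite normr0 ?leey.
  apply: le_abse_integral => //.
  exact: (measurableT_comp mf (measurable_pair2 y)).
Qed.

Lemma fubini_Rint2 : \int[(m1 \x m2)%E]_z f z = \int[m2]_y \int[m1]_x f (x, y).
Proof.
rewrite /Rintegral -(fubini2 If); congr fine.
apply: ae_eq_integral => //.
- exact: (measurable_fubini_G If).
- by have /measurable_int := fubini_intg2.
- apply: filterS fubini_section2 => x Ix _; rewrite /fubini_G /=.
  by rewrite fineK//; apply: integrable_fin_num.
Qed.

End RFubini.

Lemma Rint_dominated {d} {T : measurableType d} {R : realType}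
  (mu : {measure set T -> \bar R}) (D : set T) (F : nat -> T -> R) (f g : T -> R) :
  measurable D -> (forall n, measurable_fun D (F n)) -> measurable_fun D f ->
  {ae mu, forall x, D x -> F n x @[n --> \oo] --> f x} -> intg mu D g ->
  (forall n x, D x -> `|F n x| <= g x) ->
  intg mu D f /\ \int[mu]_(x in D) F n x @[n --> \oo] --> \int[mu]_(x in D) f x.
Proof.
move=> mD mF mf cF Ig leg.
have [] := @dominated_convergence _ _ _ mu D mD (fun n => EFin \o F n) (EFin \o f) (EFin \o g).
- by move=> n; apply/measurable_EFinP.
- exact/measurable_EFinP.
- by apply: filterS cF => x h Dx; apply/cvg_EFin; [exact: nearW|exact: h].
- exact: Ig.
- by apply: nearW => x n Dx; rewrite /= lee_fin leg.
move=> If _ h; split => //; apply: fine_cvg.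
by rewrite Rint_EFin//; exact: h.
Qed.

Section FTC.
Context {R : realType}.
Local Notation leb := (@lebesgue_measure R).

Lemma Rint_deriv (G g : R -> R) (a b : R) : a <= b ->
  (forall x, a <= x <= b -> is_derive x (1 : R) G (g x)) ->
  {within `[a, b], continuous g} ->
  \int[leb]_(x in `[a, b]) g x = G b - G a.
Proof.
rewrite le_eqVlt => /predU1P[<- _ _|ab dG cg].
  by rewrite set_itv1 Rintegral_set1 subrr.
rewrite /Rintegral (@continuous_FTC2 _ _ G)//.
- have cG x : a <= x <= b -> G y @[y --> x] --> G x.
    move=> /dG[d _]; apply: differentiable_continuous.
    exact/derivable1_diffP.
  split.
  + move=> x; rewrite in_itv /= => /andP[ax xb].
    by have [] := dG x (introT andP (conj (ltW ax) (ltW xb))).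
  + by apply: cvg_at_right_filter; apply: cG; rewrite lexx ltW.
  + by apply: cvg_at_left_filter; apply: cG; rewrite lexx ltW.
- move=> x; rewrite in_itv /= => /andP[ax xb]; rewrite derive1E.
  by have [_] := dG x (introT andP (conj (ltW ax) (ltW xb))).
Qed.

End FTC.

(** * Weak derivatives *)

Section WeakDerivatives.
Context {R : realType}.
Local Notation pt := (R * R)%type.
Implicit Types (D E K : set pt) (f g psi : pt -> R) (i j : 'I_2) (x : pt).

Lemma L2P D f : measurable2 D -> L2 D f <-> sqi leb2 D f.
Proof.
move=> mD; split=> [[mf h]|sf].
  have h2 := Lnorm2_sqi leb2 mf.
  exact (proj1 h2 h).
by have [mf _] := sf; split => //; exact: (proj2 (Lnorm2_sqi leb2 mf) sf).
Qed.

Lemma inner_mkcond D f g : inner D f g = \int[leb2]_x (((fun x => f x * g x) \_ D) x).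
Proof. by rewrite /inner Rintegral_mkcond. Qed.

Lemma loc_integrable_lin D (a : R) f g : loc_integrable D f -> loc_integrable D g ->
  loc_integrable D (a *: f + g).
Proof.
move=> lf lg K cK KD; have mK := compact2_measurable cK.
exact: (intgD mK (intgZ mK a (lf K cK KD)) (lg K cK KD)).
Qed.

Lemma loc_integrableS D E f : E `<=` D -> loc_integrable D f -> loc_integrable E f.
Proof. by move=> ED lf K cK KE; apply: lf => //; exact: subset_trans ED. Qed.

Lemma loc_integrable_meas D f : open D -> loc_integrable D f -> measurable_fun D f.
Proof.
move=> /open_bigcup_box[a [b [-> cD]]] lf.
apply/measurable_fun_bigcup => [n|n]; first exact: obox_measurable.
apply: (measurable_funS (@cbox_measurable _ (a n) (b n)) (@obox_cbox _ _ _)).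
by apply: intg_meas; apply: lf; [exact: cbox_compact|exact: cD].
Qed.

Lemma compact_leb2 K : compact K -> (leb2 K < +oo)%E.
Proof.
by move=> cK; apply: leb2_bounded; [exact: compact2_measurable|exact: compact_bounded].
Qed.

Lemma loc_integrable_sqi D f : measurable2 D -> sqi leb2 D f -> loc_integrable D f.
Proof.
move=> mD sf K cK KD; have mK := compact2_measurable cK.
exact: (sqi_intg mK (compact_leb2 cK) (sqiS mD mK KD sf)).
Qed.

Lemma compact_bound K f : compact K -> {within K, continuous f} ->
  exists M : R, forall x, K x -> `|f x| <= M.
Proof.
move=> cK /continuous_compact/(_ cK)/compact_bounded[M [_ hM]].
exists (M + 1) => x Kx; apply: hM; [by rewrite ltrDl|by exists x].
Qed.

Lemma continuous_on_within D K f : K `<=` D ->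
  (forall x, D x -> {for x, continuous f}) -> {within K, continuous f}.
Proof.
move=> KD cf; apply/subspace_continuousP => x Kx.
by apply: cvg_within_filter; exact: cf (KD _ Kx).
Qed.

Lemma loc_integrable_cont D f : open D ->
  (forall x, D x -> {for x, continuous f}) -> loc_integrable D f.
Proof.
move=> oD cf K cK KD; have mK := compact2_measurable cK.
have [M hM] := compact_bound cK (continuous_on_within KD cf).
apply: (intg_bound mK (compact_leb2 cK) _ hM).
by apply: measurable_funS (continuous2_measurable oD cf) => //; exact: open2_measurable.
Qed.

Lemma pd_near i f g x : (\near x, f x = g x) -> pd i f x = pd i g x.
Proof. exact: near_eq_derive. Qed.

Lemma pd0_outside i K psi : compact K -> (forall x, ~ K x -> psi x = 0) ->
  forall x, ~ K x -> pd i psi x = 0.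
Proof.
move=> cK h x nK; rewrite (@pd_near i psi (cst 0) x); first exact: derive_cst.
have : nbhs x (~` K).
  apply: open_nbhs_nbhs; split => //; apply: closed_openC.
  exact: compact_closed (@norm_hausdorff _ _) cK.
by apply: filterS => y /h.
Qed.

Lemma test_fun_pd D i psi : test_fun D psi -> test_fun D (pd i psi).
Proof.
move=> [sp [K [cK KD h]]]; split; first exact: smooth_pd.
by exists K; split => //; exact: pd0_outside h.
Qed.

Lemma test_funS D E psi : E `<=` D -> test_fun E psi -> test_fun D psi.
Proof.
move=> ED [sp [K [cK KE h]]]; split => //; exists K; split => //.
exact: subset_trans ED.
Qed.

Lemma test_fun_add D psi1 psi2 : test_fun D psi1 -> test_fun D psi2 ->
  test_fun D (psi1 + psi2).
Proof.
move=> [s1 [K1 [c1 D1 h1]]] [s2 [K2 [c2 D2 h2]]]; split; first exact: smoothD.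
exists (K1 `|` K2); split; first exact: compactU.
  by move=> x [/D1|/D2].
by move=> x /not_orP[/h1 e1 /h2 e2]; rewrite fctE e1 e2 addr0.
Qed.

Lemma test_bound D psi : test_fun D psi -> exists M : R, forall x, `|psi x| <= M.
Proof.
move=> [sp [K [cK KD h]]].
have [|M hM] := compact_bound cK (f := psi).
  apply: (@continuous_on_within setT) => // x _; exact: smooth_cont.
exists `|M| => x; have [Kx|nK] := pselect (K x); last by rewrite h// normr0.
by apply: le_trans (hM x Kx) (ler_norm _).
Qed.

Lemma test_meas D E psi : measurable2 E -> test_fun D psi -> measurable_fun E psi.
Proof.
move=> mE [sp _]; apply: (@measurable_funS _ _ _ _ setT) => //.
by apply: continuous2_measurable; [exact: openT|move=> x _; exact: smooth_cont].
Qed.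

(** Products with test functions only involve the values on a compact. *)
Lemma test_mul_intg D f psi : open D -> loc_integrable D f -> test_fun D psi ->
  intg leb2 D (fun x => f x * psi x).
Proof.
move=> oD lf tp; have mD := open2_measurable oD.
have [M hM] := test_bound tp; have mf := loc_integrable_meas oD lf.
have [_ [K [cK KD h]]] := tp; have mK := compact2_measurable cK.
have IK : intg leb2 D ((fun x => M * `|f x|) \_ K).
  apply: (intgS _ mD (@subsetT _ D)) => //; apply/intg_restrict => //.
  by apply: (intgZ mK); apply: intg_norm; exact: lf.
apply: intg_le IK => //; first by apply: measurable_funM => //; exact: test_meas tp.
move=> x Dx; rewrite patchE; case: ifPn => [_|]; last first.
  by rewrite notin_setE => nK; rewrite h// mulr0.
by rewrite normrM mulrC normrM normr_id ler_wpM2r// (le_trans (hM x))// ler_norm.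
Qed.

Lemma inner_test_lin D (a : R) f g psi : open D -> loc_integrable D f ->
  loc_integrable D g -> test_fun D psi ->
  inner D (a *: f + g) psi = a * inner D f psi + inner D g psi.
Proof.
move=> oD lf lg tp; have mD := open2_measurable oD.
rewrite /inner -RintegralZl//; last exact: test_mul_intg.
rewrite -RintegralD//; last 2 first.
- by apply: intgZ => //; exact: test_mul_intg.
- exact: test_mul_intg.
by apply: eq_Rint => x _; rewrite -[(a *: f + g) x]/(a * f x + g x) mulrDl mulrA.
Qed.

Lemma inner_testS D E f psi : E `<=` D -> test_fun E psi -> inner D f psi = inner E f psi.
Proof.
move=> ED [_ [K [cK KE h]]]; rewrite !inner_mkcond; congr Rintegral.
apply/funext => x; rewrite !patchE.
have [Ex|nE] := pselect (E x); first by rewrite !mem_set//; exact: ED.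
rewrite (memNset nE); case: ifP => // _; rewrite h ?mulr0//.
by move=> /KE.
Qed.

(** The fundamental lemma of the calculus of variations: bumps increasing to the
  indicator of a box reduce it to the vanishing of the integrals over boxes. *)
Lemma test_null_ae D g : open D -> loc_integrable D g ->
  (forall psi, test_fun D psi -> inner D g psi = 0) ->
  {ae leb2, forall x, D x -> g x = 0}.
Proof.
move=> oD lg g0; apply: open_boxes0_ae => // a b abD.
have mB := @obox_measurable _ a b.
have oB : obox a b `<=` D by move=> x /obox_cbox /abD.
have Ig : intg leb2 (obox a b) g.
  apply: (intgS (@cbox_measurable _ a b) mB (@obox_cbox _ a b)).
  by apply: lg => //; exact: cbox_compact.
have mg := intg_meas Ig.
have h n : \int[leb2]_(x in obox a b) (box_bump a b n x * g x) = 0.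
  have tp := box_bump_test n abD.
  have := g0 _ tp; rewrite inner_mkcond.
  rewrite (_ : (_ \_ D) = ((fun x => box_bump a b n x * g x) \_ (obox a b))); last first.
    apply/funext => x; rewrite !patchE mulrC.
    have [Bx|nB] := pselect (obox a b x); first by rewrite !mem_set//; exact: oB.
    by rewrite (memNset nB); case: ifP => // _; rewrite box_bump_out// mul0r.
  by rewrite -Rintegral_mkcond.
have mE n : measurable_fun (obox a b) (fun x => box_bump a b n x * g x).
  by apply: measurable_funM => //; exact: test_meas (box_bump_test n abD).
have cB : {ae leb2, forall x, obox a b x -> box_bump a b n x * g x @[n --> \oo] --> g x}.
  apply: ae_all => x Bx; rewrite -[X in _ --> X]mul1r; apply: cvgM; last exact: cvg_cst.
  exact: box_bump_cvg.
have leB n x : obox a b x -> `|box_bump a b n x * g x| <= `|g x|.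
  by move=> _; rewrite normrM ler_piMl// box_bump_le1.
have [_] := Rint_dominated mB mE mg cB (intg_norm Ig) leB.
have -> : (fun n => \int[leb2]_(x in obox a b) (box_bump a b n x * g x)) = cst 0.
  exact/funext.
by move=> cv; apply: (cvg_unique _ cv (cvg_cst _)).
Qed.

Lemma is_wd_ae_unique D i f g g' : open D -> is_wd D i f g -> is_wd D i f g' ->
  {ae leb2, forall x, D x -> g x = g' x}.
Proof.
move=> oD [lf lg hg] [_ lg' hg'].
apply: (@ae_imp _ _ _ leb2 (fun x => D x -> (-1 *: g' + g) x = 0)).
  move=> x h Dx; have := h Dx; rewrite fctE /= scaleN1r addrC => /eqP.
  by rewrite subr_eq0 => /eqP.
apply: test_null_ae => //; first exact: loc_integrable_lin.
move=> psi tp; rewrite inner_test_lin//.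
by rewrite mulN1r -[inner D g psi]opprK -hg// hg'// opprK addrC subrr.
Qed.

Lemma is_wd_wd D i f g : is_wd D i f g -> is_wd D i f (wd D i f).
Proof. by move=> h; rewrite /wd; case: xgetP => [_ _ //|/(_ g)]. Qed.

Lemma wdE D i f g : open D -> is_wd D i f g ->
  {ae leb2, forall x, D x -> wd D i f x = g x}.
Proof. by move=> oD h; apply: is_wd_ae_unique oD (is_wd_wd h) h. Qed.

Lemma is_wd_lin D i (a : R) f g f' g' : open D -> is_wd D i f g -> is_wd D i f' g' ->
  is_wd D i (a *: f + f') (a *: g + g').
Proof.
move=> oD [lf lg h] [lf' lg' h']; split; [exact: loc_integrable_lin..|].
move=> psi tp; have tq := test_fun_pd i tp.
by rewrite !inner_test_lin// h// h'// mulrN opprD.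
Qed.

Lemma is_wdS D E i f g : E `<=` D -> is_wd D i f g -> is_wd E i f g.
Proof.
move=> ED [lf lg h]; split; [exact: loc_integrableS lf|exact: loc_integrableS lg|].
move=> psi tp; rewrite -(inner_testS f ED (test_fun_pd i tp)) -(inner_testS g ED tp).
by apply: h; exact: test_funS tp.
Qed.

Lemma inner_test_ae D f f' psi : open D -> loc_integrable D f -> loc_integrable D f' ->
  {ae leb2, forall x, D x -> f x = f' x} -> test_fun D psi ->
  inner D f psi = inner D f' psi.
Proof.
move=> oD lf lf' ff tp; have mD := open2_measurable oD.
have mp := test_meas mD tp.
apply: (ae_eq_meas mD).
- by apply: measurable_funM => //; exact: loc_integrable_meas.
- by apply: measurable_funM => //; exact: loc_integrable_meas.
- by apply: ae_imp ff => x h Dx; rewrite h.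
Qed.

Lemma is_wd_ae D i f f' g g' : open D -> loc_integrable D f' -> loc_integrable D g' ->
  {ae leb2, forall x, D x -> f x = f' x} -> {ae leb2, forall x, D x -> g x = g' x} ->
  is_wd D i f g -> is_wd D i f' g'.
Proof.
move=> oD lf' lg' ff gg [lf lg h]; split => // psi tp.
rewrite -(inner_test_ae oD lf lf' ff (test_fun_pd i tp)).
by rewrite -(inner_test_ae oD lg lg' gg tp) h.
Qed.

Lemma pair_cont0 (y : R) : continuous (fun r : R => (r, y) : pt).
Proof.
move=> s P /nbhs_boxP[e e0 h]; apply/nbhs_ballP; exists e => // r.
by rewrite -ball_normE /ball_ /= distrC => hr; apply: h; rewrite //= subrr normr0.
Qed.

Lemma pair_cont1 (y : R) : continuous (fun r : R => (y, r) : pt).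
Proof.
move=> s P /nbhs_boxP[e e0 h]; apply/nbhs_ballP; exists e => // r.
by rewrite -ball_normE /ball_ /= distrC => hr; apply: h; rewrite //= subrr normr0.
Qed.

(** Along each line of direction i the derivative integrates to a difference of
  values of F outside its support. *)
Lemma Rint_pd0 (F : pt -> R) i : (forall x, derivable F x (ebase i)) ->
  continuous (pd i F) ->
  (exists2 M, 0 < M & forall x, ~ cbox (- M, - M) (M, M) x -> F x = 0) ->
  \int[leb2]_x pd i F x = 0.
Proof.
move=> dF cF [M M0 hM]; set K := cbox (- M, - M) (M, M).
have cK : compact K by exact: cbox_compact.
have mK := compact2_measurable cK.
have hpd := pd0_outside i cK hM.
have mF : measurable_fun setT (pd i F).
  by apply: continuous2_measurable; [exact: openT|move=> x _; exact: cF].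
have eF : pd i F \_ K = pd i F.
  apply/funext => x; rewrite patchE; case: ifPn => //.
  by rewrite notin_setE => /hpd ->.
have IF : intg leb2 setT (pd i F).
  rewrite -eF; apply/intg_restrict => //.
  by apply: (@loc_integrable_cont setT) => //; [exact: openT|move=> x _; exact: cF].
have slice (G : R -> R) : (forall s, is_derive s (1 : R) G ('D_1 G s)) ->
    continuous (fun s => 'D_1 G s) -> (forall s, M < `|s| -> G s = 0) ->
    \int[@lebesgue_measure R]_s 'D_1 G s = 0.
  move=> dG cG G0; set I : set R := `[- (M + 1), M + 1]%classic.
  have D0 s : ~ I s -> 'D_1 G s = 0.
    move=> nI; rewrite (@near_eq_derive _ _ _ G (cst 0)); first exact: derive_cst.
    have Ms : M < `|s|.
      rewrite ltNge; apply/negP => h; apply: nI; rewrite /I /= in_itv /=.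
      by move: h; rewrite ler_norml => /andP[? ?]; apply/andP; split; lra.
    near=> r; apply: G0; near: r.
    have : nbhs `|s| [set r : R | M < r] by exact: lt_nbhsr.
    by move/(@norm_continuous _ _ s).
  rewrite (_ : (fun s => 'D_1 G s) = (fun s => 'D_1 G s) \_ I); last first.
    apply/funext => s; rewrite patchE; case: ifPn => //.
    by rewrite notin_setE => /D0.
  rewrite -Rintegral_mkcond (@Rint_deriv _ G) ?G0 ?subrr//.
  - by rewrite normrN ger0_norm; lra.
  - by rewrite ger0_norm; lra.
  - lra.
  - exact: continuous_subspaceT.
elim/ord2_ind: i dF cF hpd mF eF IF => dF cF hpd mF eF IF.
- rewrite (fubini_Rint2 IF) (_ : (fun y => _) = cst 0); first by rewrite Rintegral_cst// mul0r.
  apply/funext => y; rewrite -[RHS](slice (fun s => F (s, y))); last 3 first.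
  + by move=> s; split => //; rewrite -derivable_slice0; exact: dF.
  + move=> s; have -> : 'D_1 (fun r : R => F (r, y)) = (fun r : R => pd 0 F (r, y)).
      by apply/funext => r; rewrite pd_slice0.
    apply: (continuous_comp (f := fun r => (r, y))); last exact: cF.
    exact: pair_cont0.
  + move=> s Ms; apply: hM => /cboxE[/= h1 h2 _ _].
    by move: Ms; rewrite ltNge ler_norml h1 h2.
  by apply: eq_Rint => s _; rewrite pd_slice0.
- rewrite (fubini_Rint1 IF) (_ : (fun y => _) = cst 0); first by rewrite Rintegral_cst// mul0r.
  apply/funext => y; rewrite -[RHS](slice (fun s => F (y, s))); last 3 first.
  + by move=> s; split => //; rewrite -derivable_slice1; exact: dF.
  + move=> s; have -> : 'D_1 (fun r : R => F (y, r)) = (fun r : R => pd 1 F (y, r)).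
      by apply/funext => r; rewrite pd_slice1.
    apply: (continuous_comp (f := fun r => (y, r))); last exact: cF.
    exact: pair_cont1.
  + move=> s Ms; apply: hM => /cboxE[/= _ _ h1 h2].
    by move: Ms; rewrite ltNge ler_norml h1 h2.
  by apply: eq_Rint => s _; rewrite pd_slice1.
Unshelve. all: by end_near. Qed.

(** Extended by zero, the product of f with a test function is of class C^1 on the
  whole plane with compact support, so that its derivative has integral zero. *)
Lemma is_wd_C1 D i f : open D -> (forall x, D x -> {for x, continuous f}) ->
  (forall x, D x -> derivable f x (ebase i)) ->
  (forall x, D x -> {for x, continuous (pd i f)}) -> is_wd D i f (pd i f).
Proof.
move=> oD cf df cdf; split; [exact: loc_integrable_cont..|].
move=> psi tp; have [sp [K [cK KD h]]] := tp; have mD := open2_measurable oD.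
have tq := test_fun_pd i tp.
pose F : pt -> R := (fun x => f x * psi x) \_ D.
pose G : pt -> R := (fun x => f x * pd i psi x + pd i f x * psi x) \_ D.
have nK x : ~ D x -> \near x, F x = 0.
  move=> nD; have : nbhs x (~` K).
    apply: open_nbhs_nbhs; split => //; last by move=> /KD.
    by apply: closed_openC; exact: compact_closed (@norm_hausdorff _ _) cK.
  by apply: filterS => y nKy; rewrite /F patchE; case: ifP => // _; rewrite h ?mulr0.
have nD x : D x -> \near x, F x = (f * psi) x.
  move=> Dx; have : nbhs x D by apply: open_nbhs_nbhs.
  by apply: filterS => y Dy; rewrite /F patchE mem_set.
have dF x : is_derive x (ebase i) F (G x).
  have [Dx|nDx] := pselect (D x); last first.
    apply: (@near_eq_is_derive _ _ _ (cst 0)).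
      by apply: filterS (nK x nDx) => y ->.
    by rewrite /G patchE memNset//; exact: is_derive_cst.
  apply: (@near_eq_is_derive _ _ _ (f * psi)).
    by apply: filterS (nD x Dx) => y ->.
  have d1 : is_derive x (ebase i) f (pd i f x) by split => //; exact: df.
  have d2 : is_derive x (ebase i) psi (pd i psi x).
    by split => //; exact: smooth_derivable.
  have := @is_deriveM _ _ f psi x (ebase i) _ _ d1 d2.
  by rewrite /G patchE mem_set// /GRing.scale /= [psi x * _]mulrC.
have pdF : pd i F = G by apply/funext => x; have [_] := dF x.
have cG : continuous G.
  move=> x; have [Dx|nDx] := pselect (D x); last first.
    have G0 : \near x, G x = 0.
      have : nbhs x (~` K).
        apply: open_nbhs_nbhs; split => //; last by move=> /KD.
        by apply: closed_openC; exact: compact_closed (@norm_hausdorff _ _) cK.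
      apply: filterS => y nKy; rewrite /G patchE; case: ifP => // _.
      by rewrite h ?mulr0// (pd0_outside i cK h)// mulr0 addr0.
    rewrite /continuous_at (nbhs_singleton G0).
    by apply: cvg_near_cst.
  have e : \near x, G x = f x * pd i psi x + pd i f x * psi x.
    have : nbhs x D by apply: open_nbhs_nbhs.
    by apply: filterS => y Dy; rewrite /G patchE mem_set.
  have c2 : (fun y => f y * pd i psi y + pd i f y * psi y) y @[y --> x] -->
      f x * pd i psi x + pd i f x * psi x.
    apply: cvgD; apply: cvgM; [exact: cf|exact: smooth_cont (smooth_pd i sp) x|exact: cdf|].
    exact: smooth_cont sp x.
  rewrite /continuous_at (nbhs_singleton e); apply: cvg_trans c2; apply: near_eq_cvg.
  by apply: filterS e => y ->.
have : \int[leb2]_x pd i F x = 0.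
  apply: Rint_pd0; [by move=> x; have [] := dF x|by rewrite pdF|].
  have [M M0 hM] := bounded_cbox (compact_bounded cK).
  exists M => // x nx; rewrite /F patchE; case: ifP => // _.
  by rewrite h ?mulr0// => /hM.
rewrite pdF /G -Rintegral_mkcond RintegralD//; last 2 first.
- by apply: test_mul_intg => //; exact: loc_integrable_cont.
- by apply: test_mul_intg => //; exact: loc_integrable_cont.
by move/eqP; rewrite addr_eq0 => /eqP.
Qed.

End WeakDerivatives.

(** * Polynomials in the plane *)

Section Polynomials.
Context {R : realType}.
Local Notation pt := (R * R)%type.
Implicit Types (D E : set pt) (f g p q : pt -> R) (n m : nat).

Definition mono (i j : nat) : pt -> R := fun x => x.1 ^+ i * x.2 ^+ j.

Lemma subsp_sum (V : lmodType R) (S : set V) (I : Type) (r : seq I) (P : pred I)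
    (F : I -> V) : subsp S -> (forall k, P k -> S (F k)) -> S (\sum_(k <- r | P k) F k).
Proof.
move=> sS h; apply: big_ind => //; first by case: sS.
by move=> u v Su Sv; exact: subspD.
Qed.

Lemma poly2_subsp n : subsp (@poly2 R n).
Proof.
split.
  exists (fun _ _ => 0) => x; rewrite big1// => i _; rewrite big1// => j _.
  by rewrite !mul0r.
move=> a p q [c hc] [d hd]; exists (fun i j => a * c i j + d i j) => x.
rewrite -[(a *: p + q) x]/(a * p x + q x) hc hd mulr_sumr -big_split.
apply: eq_bigr => i _; rewrite mulr_sumr -big_split; apply: eq_bigr => j _ /=.
by rewrite !mulrDl !mulrA.
Qed.

Lemma poly2_mono n i j : (i + j <= n)%N -> poly2 n (mono i j).
Proof.
move=> ijn; have hi : (i < n.+1)%N by rewrite ltnS (leq_trans _ ijn)// leq_addr.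
have hj : (j < n.+1)%N by rewrite ltnS (leq_trans _ ijn)// leq_addl.
exists (fun i' j' => ((i' == i) && (j' == j))%:R) => x.
rewrite (bigD1 (Ordinal hi))//= (bigD1 (Ordinal hj))//= !eqxx mul1r.
rewrite big1 ?addr0; last first.
  move=> k /andP[_ kj]; rewrite (_ : (k == j :> nat) = false) ?mul0r//.
  by apply: contraNF kj => /eqP kj; apply/eqP; exact: val_inj.
rewrite big1 ?addr0// => k ki; rewrite big1// => k' _.
rewrite (_ : (k == i :> nat) = false) ?mul0r//.
by apply: contraNF ki => /eqP kj; apply/eqP; exact: val_inj.
Qed.

Lemma poly2_ind n (S : set (pt -> R)) : subsp S ->
  (forall i j, (i + j <= n)%N -> S (mono i j)) -> forall p, poly2 n p -> S p.
Proof.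
move=> sS h p [c hc].
have -> : p = \sum_(i < n.+1) \sum_(j < n.+1 | (i + j <= n)%N) c i j *: mono i j.
  apply/funext => x; rewrite hc fct_sumE; apply: eq_bigr => i _.
  by rewrite fct_sumE; apply: eq_bigr => j _; rewrite -mulrA.
by do 2 apply: subsp_sum => // ? ?; apply: subspZ => //; exact: h.
Qed.

(** The finite spanning family feeds the abstract projection theorem. *)
Lemma poly2_span n : exists s : seq (pt -> R), forall p, poly2 n p <-> span s p.
Proof.
exists [seq mono ij.1 ij.2 | ij <- [seq (i, j) | i <- iota 0 n.+1, j <- iota 0 n.+1]
  & (ij.1 + ij.2 <= n)%N] => p; split.
  apply: poly2_ind; first exact: span_subsp.
  move=> i j ijn; apply: mem_span; apply/mapP; exists (i, j) => //.
  rewrite mem_filter [X in X && _]ijn andTb; apply/allpairsP; exists (i, j).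
  by rewrite !mem_iota !add0n !ltnS !(leq_trans _ ijn)// ?leq_addr ?leq_addl.
apply: span_sub; first exact: poly2_subsp.
by move=> _ /mapP[[i j] + ->]; rewrite mem_filter => /andP[ijn _]; exact: poly2_mono.
Qed.

Lemma poly2_le n m p : (n <= m)%N -> poly2 n p -> poly2 m p.
Proof.
move=> nm; apply: poly2_ind; first exact: poly2_subsp.
by move=> i j ijn; apply: poly2_mono; exact: leq_trans nm.
Qed.

Lemma poly2_cst n (c : R) : poly2 n (fun=> c).
Proof.
have -> : (fun=> c) = c *: mono 0 0.
  by apply/funext => x; rewrite fctE /mono !expr0 mulr1 /GRing.scale /= mulr1.
by apply: subspZ; [exact: poly2_subsp|exact: poly2_mono].
Qed.

Lemma smooth_subsp : subsp (@smooth R).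
Proof.
split; first exact: (smooth_cst 0).
move=> a f g sf sg; exact: (smoothD (smoothM (smooth_cst a) sf) sg).
Qed.

Lemma mono_smooth i j : smooth (mono i j).
Proof.
apply: smoothM.
  elim: i => [|i IH]; first by under eq_fun do rewrite expr0; exact: smooth_cst.
  under eq_fun do rewrite exprS; exact: (smoothM (smooth_coord 0) IH).
elim: j => [|j IH]; first by under eq_fun do rewrite expr0; exact: smooth_cst.
by under eq_fun do rewrite exprS; exact: (smoothM (smooth_coord 1) IH).
Qed.

Lemma poly2_smooth n p : poly2 n p -> smooth p.
Proof. by apply: poly2_ind; [exact: smooth_subsp|move=> i j _; exact: mono_smooth]. Qed.

Lemma pd_lin (i : 'I_2) (a : R) f g x : derivable f x (ebase i) -> derivable g x (ebase i) ->
  pd i (a *: f + g) x = a * pd i f x + pd i g x.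
Proof.
move=> df dg; have hf : is_derive x (ebase i) f (pd i f x) by split.
have hg : is_derive x (ebase i) g (pd i g x) by split.
by have [_] := is_deriveD (is_deriveZ a hf) hg.
Qed.

Lemma derivable_lin (i : 'I_2) (a : R) f g x : derivable f x (ebase i) ->
  derivable g x (ebase i) -> derivable (a *: f + g) x (ebase i).
Proof.
move=> df dg; have hf : is_derive x (ebase i) f (pd i f x) by split.
have hg : is_derive x (ebase i) g (pd i g x) by split.
by have [] := is_deriveD (is_deriveZ a hf) hg.
Qed.

Lemma pd_smooth_lin (i : 'I_2) (a : R) f g : smooth f -> smooth g ->
  pd i (a *: f + g) = a *: pd i f + pd i g.
Proof. by move=> sf sg; apply/funext => x; rewrite pd_lin//; exact: smooth_derivable. Qed.

Lemma pd_cst (i : 'I_2) (c : R) : pd i (fun=> c) = 0.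
Proof. by apply/funext => x; rewrite /pd; exact: derive_cst. Qed.

Lemma pd0_mono i j : pd 0 (mono i j) = i%:R *: mono i.-1 j.
Proof.
apply/funext => -[x y]; rewrite pd_slice0 /mono /=.
have dX : is_derive x (1 : R) (fun r : R => r ^+ i) (i%:R * x ^+ i.-1).
  have := is_derive_poly ('X^i) x; rewrite derivXn hornerMn hornerXn -mulr_natl.
  by rewrite (_ : horner _ = fun r => r ^+ i)//; apply/funext => r; rewrite hornerXn.
have [_ ->] := is_derive_mul dX (is_derive_cst (y ^+ j) x (1 : R)).
by rewrite -[RHS]/(i%:R * (x ^+ i.-1 * y ^+ j)) /=; ring.
Qed.

Lemma pd1_mono i j : pd 1 (mono i j) = j%:R *: mono i j.-1.
Proof.
apply/funext => -[x y]; rewrite pd_slice1 /mono /=.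
have dX : is_derive y (1 : R) (fun r : R => r ^+ j) (j%:R * y ^+ j.-1).
  have := is_derive_poly ('X^j) y; rewrite derivXn hornerMn hornerXn -mulr_natl.
  by rewrite (_ : horner _ = fun r => r ^+ j)//; apply/funext => r; rewrite hornerXn.
have [_ ->] := is_derive_mul (is_derive_cst (x ^+ i) y (1 : R)) dX.
by rewrite -[RHS]/(j%:R * (x ^+ i * y ^+ j.-1)) /=; ring.
Qed.

Lemma poly2_pd n (i : 'I_2) p : poly2 n p -> poly2 n.-1 (pd i p).
Proof.
move=> pp; suff [] : smooth p /\ poly2 n.-1 (pd i p) by [].
move: p pp; apply: (@poly2_ind n (fun p => smooth p /\ poly2 n.-1 (pd i p))).
  split; first by split; [exact: (smooth_cst 0)|rewrite (pd_cst i 0); exact: poly2_cst].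
  move=> a f g [sf pf] [sg pg]; split; first by case: smooth_subsp => _; apply.
  by rewrite pd_smooth_lin//; case: (poly2_subsp n.-1) => _; apply.
move=> k l kln; split; first exact: mono_smooth.
elim/ord2_ind: i; rewrite ?pd0_mono ?pd1_mono.
  case: k kln => [|k] kln; first by rewrite scale0r; exact: poly2_cst.
  apply: subspZ; first exact: poly2_subsp.
  by apply: poly2_mono; rewrite /= -ltnS; apply: leq_trans kln (leqSpred _).
case: l kln => [|l] kln; first by rewrite scale0r; exact: poly2_cst.
apply: subspZ; first exact: poly2_subsp.
by apply: poly2_mono; rewrite /= -ltnS -addnS; apply: leq_trans kln (leqSpred _).
Qed.

Lemma poly_itv0 (P : {poly R}) (a b : R) : a < b ->
  (forall x, a < x < b -> P.[x] = 0) -> P = 0.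
Proof.
move=> ab h; apply/eqP; apply/negPn/negP => P0.
pose t k : R := a + (b - a) * (k.+1%:R / (size P).+1%:R).
have tm : {mono t : k l / (k < l)%N >-> k < l}.
  move=> k l; rewrite /t ltrD2l ltr_pM2l ?subr_gt0// ltr_pM2r ?invr_gt0 ?ltr0Sn//.
  by rewrite ltr_nat.
have := @max_poly_roots _ P [seq t k | k <- iota 0 (size P)] P0.
rewrite size_map size_iota ltnn => hm.
have tu : uniq [seq t k | k <- iota 0 (size P)].
  rewrite map_inj_uniq ?iota_uniq// => k l kl.
  by have := tm k l; have := tm l k; rewrite kl ltxx; case: ltngtP.
suff tr : all (root P) [seq t k | k <- iota 0 (size P)] by have := hm tr tu.
apply/allP => _ /mapP[k + ->]; rewrite mem_iota add0n /= => ks.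
rewrite rootE h// /t; have S0 : (0 : R) < (size P).+1%:R by [].
rewrite ltrDl mulr_gt0 ?subr_gt0// ?divr_gt0//=.
rewrite -ltrBrDl gtr_pMr ?subr_gt0// ltr_pdivrMr// mul1r ltr_nat.
by rewrite ltnS.
Qed.

Lemma poly2_slices n p : poly2 n p ->
  (forall y, exists P : {poly R}, forall x, p (x, y) = P.[x]) /\
  (forall x, exists P : {poly R}, forall y, p (x, y) = P.[y]).
Proof.
move: p; apply: (@poly2_ind n (fun p => (forall y, exists P : {poly R}, forall x, p (x, y) = P.[x]) /\
  (forall x, exists P : {poly R}, forall y, p (x, y) = P.[y]))).
  split; first by split=> ?; exists 0 => ?; rewrite horner0.
  move=> a f g [f1 f2] [g1 g2]; split=> z.
    have [P hP] := f1 z; have [Q hQ] := g1 z; exists (a *: P + Q) => x.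
    by rewrite hornerD hornerZ -hP -hQ.
  have [P hP] := f2 z; have [Q hQ] := g2 z; exists (a *: P + Q) => x.
  by rewrite hornerD hornerZ -hP -hQ.
move=> i j _; split=> z.
  by exists (z ^+ j *: 'X^i) => x; rewrite hornerZ hornerXn mulrC.
by exists (z ^+ i *: 'X^j) => x; rewrite hornerZ hornerXn.
Qed.

Lemma poly2_box0 n p (a b : pt) : poly2 n p -> a.1 < b.1 -> a.2 < b.2 ->
  (forall x, obox a b x -> p x = 0) -> p = 0.
Proof.
move=> /poly2_slices[p1 p2] ab1 ab2 h; apply/funext => -[x y].
have hy z : a.2 < z < b.2 -> forall x, p (x, z) = 0.
  move=> /andP[z1 z2] x'; have [P hP] := p1 z; rewrite hP (@poly_itv0 P a.1 b.1) ?horner0//.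
  by move=> r /andP[r1 r2]; rewrite -hP h//; apply/oboxE.
have [P hP] := p2 x; rewrite hP (@poly_itv0 P a.2 b.2) ?horner0//.
by move=> r hr; rewrite -hP hy.
Qed.

Lemma leb2_obox_gt0 (a b : pt) : a.1 < b.1 -> a.2 < b.2 -> (0 < leb2 (obox a b))%E.
Proof.
move=> ab1 ab2; rewrite /leb2 /obox product_measure1E//=.
by rewrite !lebesgue_measure_itv /= !lte_fin ab1 ab2 -EFinM lte_fin mulr_gt0// subr_gt0.
Qed.

Lemma cont_ae0 D f : open D -> (forall x, D x -> {for x, continuous f}) ->
  {ae leb2, forall x, D x -> f x = 0} -> forall x, D x -> f x = 0.
Proof.
move=> oD cf [N [mN N0 hN]] x Dx; apply/eqP; apply/negPn/negP => fx0.
have : nbhs x (D `&` [set y | f y != 0]).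
  apply: filterI; first exact: open_nbhs_nbhs.
  have : nbhs (f x) [set r : R | r != 0] by exact: (@open_nbhs_nbhs _ _ _ (conj (@open_neq _ 0) fx0)).
  exact: (cf x Dx).
move=> /nbhs_boxP[e e0 h].
pose B := obox (x.1 - e, x.2 - e) (x.1 + e, x.2 + e).
have BN : B `<=` N.
  move=> y /oboxE[/= y1 y2 y3 y4]; apply: hN => /= k.
  have [|| Dy /negP[]] := h y; [by rewrite ltr_norml; lra|by rewrite ltr_norml; lra|].
  by rewrite k.
have : (0 < leb2 N)%E.
  apply: (@lt_le_trans _ _ (leb2 B)); last first.
    by apply: le_measure => //; rewrite inE//; exact: obox_measurable.
  by apply: leb2_obox_gt0; rewrite /=; lra.
by rewrite N0 ltxx.
Qed.

Lemma open_has_box D : open D -> D !=set0 ->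
  exists a b : pt, [/\ a.1 < b.1, a.2 < b.2 & obox a b `<=` D].
Proof.
move=> /open_boxP oD [x /oD[e e0 h]].
exists (x.1 - e, x.2 - e), (x.1 + e, x.2 + e); split => /=; [lra|lra|].
move=> y /oboxE[/= y1 y2 y3 y4]; apply: h; rewrite ltr_norml; apply/andP; split; lra.
Qed.

Lemma poly2_ae0 n p D : open D -> D !=set0 -> poly2 n p ->
  {ae leb2, forall x, D x -> p x = 0} -> p = 0.
Proof.
move=> oD D0 pp h; have [a [b [ab1 ab2 abD]]] := open_has_box oD D0.
apply: (poly2_box0 pp ab1 ab2) => x /abD; apply: cont_ae0 => //.
by move=> y _; exact: smooth_cont (poly2_smooth pp) y.
Qed.

Lemma pd0_constant f : (forall i x, derivable f x (ebase i)) ->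
  (forall i x, pd i f x = 0) -> forall x, f x = f (0, 0).
Proof.
move=> df h [x y]; transitivity (f (0, y)).
  apply: (@is_derive_0_is_cst _ (fun r => f (r, y))) => r.
  by split; [rewrite -derivable_slice0|rewrite -pd_slice0].
apply: (@is_derive_0_is_cst _ (fun r => f (0, r))) => r.
by split; [rewrite -derivable_slice1|rewrite -pd_slice1].
Qed.

Lemma poly2_is_wd D n (i : 'I_2) p : open D -> poly2 n p -> is_wd D i p (pd i p).
Proof.
move=> oD pp; have sp := poly2_smooth pp.
apply: is_wd_C1 => // x _; [exact: smooth_cont|exact: smooth_derivable|].
exact: smooth_cont (smooth_pd i sp) x.
Qed.

Lemma poly2_wd D n (i : 'I_2) p : open D -> poly2 n p ->
  {ae leb2, forall x, D x -> wd D i p x = pd i p x}.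
Proof. by move=> oD pp; apply: wdE => //; exact: poly2_is_wd pp. Qed.

Lemma bounded_bound D f : bounded_set D -> continuous f ->
  exists M : R, forall x, D x -> `|f x| <= M.
Proof.
move=> /bounded_cbox[M _ hM] cf.
have [|M' hM'] := compact_bound (@cbox_compact _ (- M, - M) (M, M)) (f := f).
  exact: continuous_subspaceT.
by exists M' => x Dx; apply: hM'; exact: hM.
Qed.

Lemma cont_meas D f : measurable2 D -> continuous f -> measurable_fun D f.
Proof.
move=> mD cf; apply: (@measurable_funS _ _ _ _ setT) => //.
by apply: continuous2_measurable; [exact: openT|move=> x _; exact: cf].
Qed.

Lemma poly2_sqi D n p : open D -> bounded_set D -> poly2 n p -> sqi leb2 D p.
Proof.
move=> oD bD pp; have mD := open2_measurable oD.
have cp := smooth_cont (poly2_smooth pp).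
have [M hM] := bounded_bound bD cp.
by apply: (sqi_bound mD (leb2_bounded mD bD) _ hM); exact: cont_meas.
Qed.

End Polynomials.

(** * Function spaces on an element *)

Section MatrixFields.
Context {R : realType} {m n : nat}.
Local Notation pt := (R * R)%type.
Implicit Types (D : set pt) (F G H : pt -> 'M[R]_(m, n)).

Definition ent F i j : pt -> R := fun x => F x i j.

Definition sqiM D F := forall i j, sqi leb2 D (ent F i j).

Lemma sqiM_subsp D : measurable2 D -> subsp (sqiM D).
Proof.
move=> mD; split=> [i j|a F G sF sG i j].
  by rewrite (_ : ent 0 i j = 0); [case: (sqi_subsp leb2 mD)|apply/funext => x; rewrite /ent mxE].
rewrite (_ : ent _ i j = a *: ent F i j + ent G i j); last first.
  by apply/funext => x; rewrite /ent !fctE !mxE.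
by case: (sqi_subsp leb2 mD) => _; apply.
Qed.

Lemma innerM_sum D F G : measurable2 D -> sqiM D F -> sqiM D G ->
  innerM D F G = \sum_i \sum_j inner D (ent F i j) (ent G i j).
Proof.
move=> mD sF sG; rewrite /innerM /frob.
have I i j : intg leb2 D (fun x => ent F i j x * ent G i j x) by exact: (sqi_mul mD).
rewrite (Rint_sum mD); last by move=> i; apply: (intg_sum mD) => j; exact: I.
by apply: eq_bigr => i _; rewrite (Rint_sum mD)// => j; exact: I.
Qed.

Lemma ent_lin (a : R) F G i j : ent (a *: F + G) i j = a *: ent F i j + ent G i j.
Proof. by apply/funext => x; rewrite /ent !fctE !mxE. Qed.

Lemma psd_innerM D : measurable2 D -> psd (sqiM D) (innerM D).
Proof.
move=> mD; have sS := sqiM_subsp mD; have pI := psd_ipg leb2 mD; split => //.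
- move=> a F G H sF sG sH; have sFG : sqiM D (a *: F + G) by case: sS => _; apply.
  rewrite !innerM_sum// mulr_sumr -big_split; apply: eq_bigr => i _.
  rewrite mulr_sumr -big_split; apply: eq_bigr => j _; rewrite ent_lin /=.
  by case: pI => _ + _ _; apply.
- move=> F G sF sG; rewrite !innerM_sum//; apply: eq_bigr => i _.
  by apply: eq_bigr => j _; exact: (psdC pI).
- move=> F sF; rewrite innerM_sum//; apply: sumr_ge0 => i _; apply: sumr_ge0 => j _.
  exact: (psd_ge0 pI).
Qed.

Lemma ae_innerM D F F' G G' : measurable2 D -> sqiM D F -> sqiM D F' -> sqiM D G ->
  sqiM D G' -> (forall i j, {ae leb2, forall x, D x -> F x i j = F' x i j}) ->
  (forall i j, {ae leb2, forall x, D x -> G x i j = G' x i j}) ->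
  innerM D F G = innerM D F' G'.
Proof.
move=> mD sF sF' sG sG' ff gg; rewrite !innerM_sum//.
apply: eq_bigr => i _; apply: eq_bigr => j _.
by apply: (ae_ipg mD); [exact: (sF i j).1|exact: (sG i j).1|exact: (sF' i j).1|exact: (sG' i j).1|exact: ff|exact: gg].
Qed.

Lemma innerM0_ae D F : measurable2 D -> sqiM D F -> innerM D F F = 0 ->
  forall i j, {ae leb2, forall x, D x -> F x i j = 0}.
Proof.
move=> mD sF; rewrite innerM_sum// => /eqP.
rewrite psumr_eq0; last first.
  by move=> i _; apply: sumr_ge0 => j _; exact: (psd_ge0 (psd_ipg leb2 mD)).
move=> /allP h i j; apply: (ipg0_ae mD (sF i j)).
have := h i (mem_index_enum _); rewrite /= psumr_eq0; last first.
  by move=> k _; exact: (psd_ge0 (psd_ipg leb2 mD)).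
by move=> /allP /(_ j (mem_index_enum _)) /eqP.
Qed.

End MatrixFields.

Section PullBack.
Context {R : realType} {V W : lmodType R}.

Lemma psd_pull (S : set V) (T : V -> W) (S' : set W) (B : W -> W -> R) :
  psd S' B -> subsp S -> (forall u, S u -> S' (T u)) ->
  (forall a u v w, S u -> S v -> S w ->
     B (T (a *: u + v)) (T w) = B (a *: T u + T v) (T w)) ->
  psd S (fun u v => B (T u) (T v)).
Proof.
move=> pB sS ST lT; split => //.
- move=> a u v w Su Sv Sw; rewrite lT//.
  by case: pB => _ + _ _; apply; exact: ST.
- by move=> u v Su Sv; apply: (psdC pB); exact: ST.
- by move=> u Su; apply: (psd_ge0 pB); exact: ST.
Qed.

End PullBack.

Lemma psd_sub {R : realType} {V : lmodType R} (S S' : set V) (B : V -> V -> R) :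
  psd S' B -> subsp S -> S `<=` S' -> psd S B.
Proof. by move=> pB sS SS; exact: (psd_pull (T := id) pB). Qed.

Section Spaces.
Context {R : realType}.
Local Notation pt := (R * R)%type.
Implicit Types (D : set pt) (f g : pt -> R).

Definition domain D := [/\ open D, D !=set0 & bounded_set D].

Lemma domain_meas D : domain D -> measurable2 D.
Proof. by move=> [oD _ _]; exact: open2_measurable. Qed.

Lemma domain_fin D : domain D -> (leb2 D < +oo)%E.
Proof. by move=> dD; apply: leb2_bounded; [exact: domain_meas|case: dD]. Qed.

Lemma C0barP D f : C0bar D f <->
  forall x, closure D x -> f y @[y --> within (closure D) (nbhs x)] --> f x.
Proof. exact: subspace_continuousP. Qed.

Lemma C0bar_subsp D : subsp (C0bar D).
Proof.
split; first by apply/C0barP => x _; exact: cvg_cst.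
move=> a f g /C0barP cf /C0barP cg; apply/C0barP => x Dx.
by apply: cvgD; [apply: cvgZr; exact: cf|exact: cg].
Qed.

Lemma C0bar_mul D f g : C0bar D f -> C0bar D g -> C0bar D (f * g).
Proof.
move=> /C0barP cf /C0barP cg; apply/C0barP => x Dx.
by apply: cvgM; [exact: cf|exact: cg].
Qed.

Lemma C0bar_cont D f : continuous f -> C0bar D f.
Proof. exact: continuous_subspaceT. Qed.

Lemma C0bar_in D f : open D -> C0bar D f -> forall x, D x -> {for x, continuous f}.
Proof.
move=> oD /C0barP cf x Dx P nP.
have hP : \forall y \near x, closure D y -> P (f y) := cf x (subset_closure Dx) P nP.
have nD : \forall y \near x, D y by exact: open_nbhs_nbhs.
by apply: filterS2 hP nD => y h Dy; exact: h (subset_closure Dy).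
Qed.

Lemma closure_bounded D : bounded_set D -> bounded_set (closure D).
Proof.
move=> /bounded_cbox[M M0 hM].
have : closure D `<=` cbox (- M, - M) (M, M).
  have cK : closed (cbox (- M, - M) (M, M)).
    exact: compact_closed (@norm_hausdorff _ _) (@cbox_compact _ _ _).
  by rewrite closureE => x; apply.
move=> h; have [M' [rM' hM']] := compact_bounded (@cbox_compact R (- M, - M) (M, M)).
by exists M'; split => // r Mr x /h Kx; exact: hM' Mr x Kx.
Qed.

Lemma closure_compact D : bounded_set D -> compact (closure D).
Proof.
move=> /closure_bounded/bounded_cbox[M _ h].
by apply: (subclosed_compact (@closed_closure _ D) (@cbox_compact _ _ _) h).
Qed.

Lemma C0bar_bound D f : bounded_set D -> C0bar D f ->
  exists M : R, forall x, closure D x -> `|f x| <= M.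
Proof. by move=> bD cf; apply: compact_bound => //; exact: closure_compact. Qed.

Lemma C0bar_sqi D f : domain D -> C0bar D f -> sqi leb2 D f.
Proof.
move=> dD cf; have mD := domain_meas dD; have [oD _ bD] := dD.
have [M hM] := C0bar_bound bD cf.
apply: (sqi_bound mD (domain_fin dD) (M := M)).
  by apply: continuous2_measurable => //; exact: C0bar_in.
by move=> x Dx; apply: hM; exact: subset_closure.
Qed.

Lemma bdvalE D f g x : C0bar D g -> (forall y, D y -> f y = g y) -> closure D x ->
  bdval D f x = g x.
Proof.
move=> /C0barP cg fg Dx; rewrite /bdval.
have PF : ProperFilter (within D (nbhs x)) by exact: within_nbhs_proper.
apply: cvg_lim => //.
have cg' : g y @[y --> within D (nbhs x)] --> g x.
  move=> P nP.
  have hP : \forall y \near x, closure D y -> P (g y) := cg x Dx P nP.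
  by apply: filterS hP => y h Dy; exact: h (subset_closure Dy).
apply: cvg_trans cg'; apply: near_eq_cvg.
have wD : \forall y \near within D (nbhs x), D y by exact: withinT.
by apply: filterS wD => y Dy; rewrite fg.
Qed.

Lemma H1P D f : domain D -> H1 D f <-> sqi leb2 D f /\
  forall i, is_wd D i f (wd D i f) /\ sqi leb2 D (wd D i f).
Proof.
move=> dD; have mD := domain_meas dD; have [oD _ _] := dD.
split=> [[/(L2P _ mD) sf h]|[sf h]].
  split => // i; have [g wg /(L2P _ mD) sg] := h i.
  have wf := is_wd_wd wg; split => //.
  apply: (ae_sqi mD) sg; first by case: wf => _ /(loc_integrable_meas oD).
  by apply: ae_imp (wdE oD wg) => x e Dx; rewrite e.
split; first exact/(L2P _ mD).
by move=> i; exists (wd D i f); case: (h i) => // _ /(L2P _ mD).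
Qed.

Lemma H1_wd_lin D (a : R) f g i : domain D -> H1 D f -> H1 D g ->
  {ae leb2, forall x, D x -> wd D i (a *: f + g) x = a * wd D i f x + wd D i g x}.
Proof.
move=> dD; have [oD _ _] := dD; move=> /(H1P _ dD)[_ /(_ i)[wf _]] /(H1P _ dD)[_ /(_ i)[wg _]].
exact: wdE (is_wd_lin a oD wf wg).
Qed.

Lemma H1_subsp D : domain D -> subsp (H1 D).
Proof.
move=> dD; have mD := domain_meas dD; have [oD _ _] := dD; split.
  apply/(H1P _ dD); split; first by case: (sqi_subsp leb2 mD).
  have w0 i : is_wd D i 0 0.
    by have := poly2_is_wd i oD (poly2_cst 0 0); rewrite pd_cst.
  move=> i; split; first exact: is_wd_wd (w0 i).
  apply: (ae_sqi mD) (_ : sqi leb2 D 0); last by case: (sqi_subsp leb2 mD).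
    by case: (is_wd_wd (w0 i)) => _ /(loc_integrable_meas oD).
  by apply: ae_imp (wdE oD (w0 i)) => x e Dx; rewrite e.
move=> a f g /(H1P _ dD)[sf hf] /(H1P _ dD)[sg hg].
split; first by apply/(L2P _ mD); case: (sqi_subsp leb2 mD) => _; apply.
move=> i; have [wf sf'] := hf i; have [wg sg'] := hg i.
exists (a *: wd D i f + wd D i g); first exact: is_wd_lin.
by apply/(L2P _ mD); case: (sqi_subsp leb2 mD) => _; apply.
Qed.

Lemma H1_ae D f g : domain D -> {ae leb2, forall x, D x -> f x = g x} ->
  sqi leb2 D g -> H1 D f -> H1 D g /\
  forall i, {ae leb2, forall x, D x -> wd D i f x = wd D i g x}.
Proof.
move=> dD fg sg /(H1P _ dD)[sf hf]; have mD := domain_meas dD; have [oD _ _] := dD.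
have wg i : is_wd D i g (wd D i f).
  have [wf sf'] := hf i; have [_ l' _] := wf.
  by apply: (is_wd_ae oD _ l' fg _ wf); [exact: loc_integrable_sqi|exact: ae_all].
split.
  split; first exact/(L2P _ mD).
  by move=> i; exists (wd D i f); [exact: wg|apply/(L2P _ mD); case: (hf i)].
by move=> i; apply: is_wd_ae_unique oD (wg i) (is_wd_wd (wg i)).
Qed.

Lemma H2_subsp D : domain D -> subsp (H2 D).
Proof.
move=> dD; have mD := domain_meas dD; have [oD _ _] := dD.
have [H10 H1D] := H1_subsp dD; split.
  split => // i.
  have w0 : is_wd D i 0 0 by have := poly2_is_wd i oD (poly2_cst 0 0); rewrite pd_cst.
  have e : {ae leb2, forall x, D x -> (0 : pt -> R) x = wd D i 0 x}.
    by apply: ae_imp (wdE oD w0) => x e Dx; rewrite e.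
  by have [] := H1_ae dD e _ H10; case/(H1P _ dD): H10 => _ /(_ i)[].
move=> a f g [hf hf'] [hg hg']; split; first exact: H1D.
move=> i; have e : {ae leb2, forall x, D x ->
    (a *: wd D i f + wd D i g) x = wd D i (a *: f + g) x}.
  by apply: ae_imp (H1_wd_lin a i dD hf hg) => x e Dx; rewrite e.
have [|//] := H1_ae dD e _ (H1D _ _ _ (hf' i) (hg' i)).
by have := H1D a f g hf hg; move=> /(H1P _ dD)[_ /(_ i)[]].
Qed.

Lemma H2_wd_lin D (a : R) f g i j : domain D -> H2 D f -> H2 D g ->
  {ae leb2, forall x, D x -> wd D j (wd D i (a *: f + g)) x =
     a * wd D j (wd D i f) x + wd D j (wd D i g) x}.
Proof.
move=> dD Hf Hg; have [H20 H2D] := H2_subsp dD.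
have [hf hf'] := Hf; have [hg hg'] := Hg.
have e : {ae leb2, forall x, D x ->
    (a *: wd D i f + wd D i g) x = wd D i (a *: f + g) x}.
  by apply: ae_imp (H1_wd_lin a i dD hf hg) => x e Dx; rewrite e.
have se : sqi leb2 D (wd D i (a *: f + g)).
  by case: (H2D a f g Hf Hg) => /(H1P _ dD)[_ /(_ i)[]].
have [_ /(_ j) e2] := H1_ae dD e se (proj2 (H1_subsp dD) a _ _ (hf' i) (hg' i)).
by apply: ae_imp2 (H1_wd_lin a j dD (hf' i) (hg' i)) e2 => x e3 e4 Dx; rewrite -e4// e3.
Qed.

Lemma poly2_H1 D n p : domain D -> poly2 n p -> H1 D p.
Proof.
move=> dD pp; have mD := domain_meas dD; have [oD _ bD] := dD.
split; first by apply/(L2P _ mD); exact: poly2_sqi pp.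
move=> i; exists (pd i p); first exact: poly2_is_wd pp.
by apply/(L2P _ mD); apply: (poly2_sqi oD bD (poly2_pd i pp)).
Qed.

Lemma poly2_wd_ae D n p i : domain D -> poly2 n p ->
  {ae leb2, forall x, D x -> pd i p x = wd D i p x}.
Proof.
move=> [oD _ _] pp; apply: ae_imp (poly2_wd i oD pp) => x e Dx; by rewrite e.
Qed.

Lemma poly2_H2 D n p : domain D -> poly2 n p -> H2 D p.
Proof.
move=> dD pp; split; first exact: poly2_H1 pp.
move=> i; have [] := H1_ae dD (poly2_wd_ae i dD pp) _ (poly2_H1 dD (poly2_pd i pp)) => //.
by have := poly2_H1 dD pp => /(H1P _ dD)[_ /(_ i)[]].
Qed.

Lemma poly2_wd2_ae D n p i j : domain D -> poly2 n p ->
  {ae leb2, forall x, D x -> wd D j (wd D i p) x = pd j (pd i p) x}.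
Proof.
move=> dD pp; have [oD _ _] := dD.
have sp : sqi leb2 D (wd D i p) by have := poly2_H1 dD pp => /(H1P _ dD)[_ /(_ i)[]].
have [_ /(_ j) h] := H1_ae dD (poly2_wd_ae i dD pp) sp (poly2_H1 dD (poly2_pd i pp)).
by apply: ae_imp2 h (poly2_wd_ae j dD (poly2_pd i pp)) => x e1 e2 Dx; rewrite -e1// -e2.
Qed.

Lemma C1barP D f : C1bar D f <-> C0bar D f /\ forall i, exists g, C0bar D g /\
  forall x, D x -> derivable f x (ebase i) /\ pd i f x = g x.
Proof.
split=> [[cf h]|[cf h]]; split => // i.
  have [df [g cg e]] := h i; exists g; split => // x Dx; split; [exact: df|exact: e].
have [g [cg e]] := h i; split; first by move=> x /e[].
by exists g => // x /e[].
Qed.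

Lemma C1bar_subsp D : subsp (C1bar D).
Proof.
have [C0 CD] := C0bar_subsp D; split.
  apply/C1barP; split => // i; exists 0; split => // x _; split; first exact: derivable_cst.
  exact: derive_cst.
move=> a f g /C1barP[cf df] /C1barP[cg dg]; apply/C1barP; split; first exact: CD.
move=> i; have [f' [cf' ef]] := df i; have [g' [cg' eg]] := dg i.
exists (a *: f' + g'); split; first exact: CD.
move=> x Dx; have [d1 e1] := ef x Dx; have [d2 e2] := eg x Dx; split.
  exact: derivable_lin.
by rewrite pd_lin// e1 e2.
Qed.

Lemma smooth_C1bar D f : smooth f -> C1bar D f.
Proof.
move=> sf; apply/C1barP; split; first exact: C0bar_cont (smooth_cont sf).
move=> i; exists (pd i f); split; first exact: C0bar_cont (smooth_cont (smooth_pd i sf)).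
by move=> x _; split => //; exact: smooth_derivable.
Qed.

Lemma C1bar_is_wd D f i : open D -> C1bar D f -> is_wd D i f (pd i f).
Proof.
move=> oD /C1barP[cf df]; have [g [cg e]] := df i.
have cgD := C0bar_in oD cg.
apply: is_wd_C1 => //; first exact: C0bar_in.
  by move=> x /e[].
move=> x Dx; have nD : \near x, D x by exact: open_nbhs_nbhs.
have epd : pd i f x = g x by case: (e x Dx).
suff : pd i f y @[y --> x] --> pd i f x by [].
rewrite epd; apply: cvg_trans (cgD x Dx).
by apply: near_eq_cvg; apply: filterS nD => y /e[_ ->].
Qed.

End Spaces.

(** * Boundary integrals and polynomial projections *)

Section Boundary.
Context {R : realType}.
Local Notation pt := (R * R)%type.
Implicit Types (P : polygon R) (f g : pt -> R) (e : pt * pt).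

Lemma frob_col2 (u v : 'cV[R]_2) : frob u v = u 0 0 * v 0 0 + u 1 0 * v 1 0.
Proof.
have e : lift ord0 ord0 = 1 :> 'I_2 by exact: val_inj.
by rewrite /frob !big_ord_recl !big_ord0 !addr0 e.
Qed.

Lemma euclid_distE (x y : pt) :
  euclid_dist x y = Num.sqrt ((x.1 - y.1) ^+ 2 + (x.2 - y.2) ^+ 2).
Proof. by rewrite /euclid_dist /enorm frob_col2 /coords !mxE /= !expr2. Qed.

Lemma elen_gt0 e : e.1 != e.2 -> 0 < elen e.
Proof.
move=> ne; rewrite /elen euclid_distE sqrtr_gt0 lt_neqAle addr_ge0 ?sqr_ge0// andbT.
rewrite eq_sym paddr_eq0 ?sqr_ge0// !sqrf_eq0 !subr_eq0.
apply: contraNN ne => /andP[/eqP h1 /eqP h2].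
by apply/eqP; case: e h1 h2 => [[? ?] [? ?]] /= -> ->.
Qed.

Lemma polygonal_domain_domain P : polygonal_domain P -> domain (cell P).
Proof. by move=> [[? ? _ ?] _ _ _ _]; split. Qed.

Lemma edge_in_closure P e : polygonal_domain P -> e \in edges P ->
  segment e `<=` closure (cell P).
Proof.
move=> [_ h _ _ _] eP x ex; have : (closure (cell P) `\` cell P) x.
  by rewrite h; exists e.
by case.
Qed.

Lemma edges_nonempty P : polygonal_domain P -> exists e, e \in edges P.
Proof.
move=> pP; have [oD [x0 Dx0] bD] := polygonal_domain_domain pP.
case eP : (edges P) => [|e s]; last by exists e; rewrite mem_head.
have cD : compact (cell P).
  have -> : cell P = closure (cell P).
    apply/seteqP; split; first exact: subset_closure.
    move=> x Dx; apply: contrapT => nDx.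
    case: pP => _ h _ _ _; have : (closure (cell P) `\` cell P) x by [].
    by rewrite h => -[e /=]; rewrite eP.
  exact: closure_compact.
have [|c /set_mem Dc hc] := compact_EVT_max (ex_intro _ x0 Dx0) cD (f := fst : pt -> R).
  by apply: continuous_subspaceT => x; exact: cvg_fst.
have /open_boxP/(_ c Dc)[d d0 hd] := oD.
have : cell P (c.1 + d / 2, c.2).
  by apply: hd => /=; rewrite ?subrr ?normr0// ltr_norml; lra.
by move=> /mem_set/hc /=; lra.
Qed.

Definition perimeter P := \sum_(e <- edges P) elen e.

Lemma perimeter_gt0 P : polygonal_domain P -> 0 < perimeter P.
Proof.
move=> pP; have [e eP] := edges_nonempty pP.
have h e' : e' \in edges P -> 0 < elen e'.
  by case: pP => _ _ [h _ _] _ _ /h; exact: elen_gt0.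
rewrite /perimeter big_seq; move: (h); rewrite (big_rem e)//= eP => h'.
apply: ltr_pwDl; first exact: h.
by rewrite big_seq_cond sumr_ge0// => e' /andP[_ /h/ltW].
Qed.

Lemma edge_pt_cont e : continuous (edge_pt e).
Proof.
by move=> s; apply: cvgD; [exact: cvg_cst|apply: cvgZl; exact: cvg_id].
Qed.

Lemma edge_pt_segment e s : 0 <= s <= 1 -> segment e (edge_pt e s).
Proof. by move=> s01; exists s => //=; rewrite in_itv. Qed.

Section Polygonal.
Context (P : polygon R) (pP : polygonal_domain P).

Lemma C0bar_edge e f : e \in edges P -> C0bar (cell P) f ->
  {within `[0, 1]%classic, continuous (fun s => f (edge_pt e s))}.
Proof.
move=> eP /C0barP cf; apply/subspace_continuousP => s s01 Q nQ.
have Ds : closure (cell P) (edge_pt e s).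
  by apply: (edge_in_closure pP eP); exists s.
have h : \forall y \near edge_pt e s, closure (cell P) y -> Q (f y) := cf _ Ds Q nQ.
have h2 : nbhs (s : R) (fun r : R => closure (cell P) (edge_pt e r) -> Q (f (edge_pt e r))) :=
  @edge_pt_cont e s _ h.
have h3 : nbhs (s : R) (fun r : R => `[0, 1]%classic r -> Q (f (edge_pt e r))).
  apply: filterS h2 => r /= hr r01; apply: hr; apply: (edge_in_closure pP eP).
  by exists r.
exact: h3.
Qed.

Lemma C0bar_edge_intg e f : e \in edges P -> C0bar (cell P) f ->
  intg (@lebesgue_measure R) `[0, 1]%classic (fun s => f (edge_pt e s)).
Proof.
move=> eP cf; apply: continuous_compact_integrable; first exact: segment_compact.
exact: C0bar_edge.
Qed.

Lemma eq_bdint (F G : pt * pt -> pt -> R) :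
  (forall e x, e \in edges P -> segment e x -> F e x = G e x) -> bdint P F = bdint P G.
Proof.
move=> FG; rewrite /bdint big_seq [in RHS]big_seq; apply: eq_bigr => e eP.
congr (_ * _); apply: eq_Rint => // s s01; apply: FG => //.
by exists s.
Qed.

Lemma bdint_lin (a : R) f g : C0bar (cell P) f -> C0bar (cell P) g ->
  bdint P (fun _ => a *: f + g) = a * bdint P (fun _ => f) + bdint P (fun _ => g).
Proof.
move=> cf cg; rewrite /bdint mulr_sumr -big_split big_seq [in RHS]big_seq.
apply: eq_bigr => e eP /=; rewrite mulrCA -mulrDr; congr (_ * _).
rewrite -RintegralZl//; last exact: C0bar_edge_intg.
rewrite -RintegralD//; last exact: C0bar_edge_intg.
by apply: intgZ => //; exact: C0bar_edge_intg.
Qed.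

Lemma bdint_cst (c : R) : bdint P (fun _ _ => c) = c * perimeter P.
Proof.
rewrite /bdint /perimeter mulr_sumr; apply: eq_bigr => e _.
rewrite Rintegral_cst// (_ : fine _ = 1) ?mulr1 1?mulrC//=.
by rewrite lebesgue_measure_itv /= lte_fin ltr01 -EFinB subr0.
Qed.

End Polygonal.
End Boundary.

Section L2Projection.
Context {R : realType} (E : polygon R) (dE : domain (cell E)).
Local Notation pt := (R * R)%type.
Local Notation C := (cell E).
Implicit Types (f g p q : pt -> R) (n : nat).

Let mC : measurable2 C. Proof. exact: domain_meas. Qed.
Let oC : open C. Proof. by case: dE. Qed.
Let bC : bounded_set C. Proof. by case: dE. Qed.
Let C0 : C !=set0. Proof. by case: dE. Qed.
Let pI : psd (sqi leb2 C) (inner C). Proof. exact: psd_ipg. Qed.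

Lemma poly2_in_sqi n p : poly2 n p -> sqi leb2 C p.
Proof. exact: poly2_sqi. Qed.

Lemma proj0_exists n f : sqi leb2 C f -> exists p, poly2 n p /\
  forall q, poly2 n q -> inner C (f \- p) q = 0.
Proof.
move=> sf; have [s hs] := @poly2_span R n.
have [|p /hs pp h] := psd_projection (s := s) pI _ sf.
  by move=> e /mem_span/hs; exact: poly2_in_sqi.
by exists p; split => // q /hs; exact: h.
Qed.

Lemma poly2_inner0 n p : poly2 n p -> inner C p p = 0 -> p = 0.
Proof.
move=> pp p0; apply: (poly2_ae0 oC C0 pp).
by apply: (ipg0_ae mC) p0; exact: poly2_in_sqi pp.
Qed.

Lemma proj0_unique n f p : sqi leb2 C f -> poly2 n p ->
  (forall q, poly2 n q -> inner C (f \- p) q = 0) -> proj0 E n f = p.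
Proof.
move=> sf pp hp; rewrite /proj0; case: xgetP => [p' _ [pp' hp']|/(_ p)[]//].
have sp := poly2_in_sqi pp; have sp' := poly2_in_sqi pp'.
have pd' : poly2 n (p' - p) by apply: subspB => //; exact: poly2_subsp.
apply/eqP; rewrite -subr_eq0; apply/eqP; apply: (poly2_inner0 pd').
have sd := poly2_in_sqi pd'.
have := hp _ pd'; have := hp' _ pd'.
rewrite [inner C (f \- p) _](psdBl pI)// [inner C (f \- p') _](psdBl pI)// => h1 h2.
by rewrite (psdBl pI)//; lra.
Qed.

Lemma proj0P n f : sqi leb2 C f -> poly2 n (proj0 E n f) /\
  forall q, poly2 n q -> inner C (f \- proj0 E n f) q = 0.
Proof. by move=> sf; have [p [pp hp]] := proj0_exists n sf; rewrite (proj0_unique sf pp hp). Qed.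

Lemma proj0_sqi n f : sqi leb2 C f -> sqi leb2 C (proj0 E n f).
Proof. by move=> sf; apply: (poly2_in_sqi (n := n)); case: (proj0P n sf). Qed.

Lemma proj0_inner n f q : sqi leb2 C f -> poly2 n q ->
  inner C (proj0 E n f) q = inner C f q.
Proof.
move=> sf pq; have [pp /(_ q pq)] := proj0P n sf.
rewrite [inner C (f \- _) _](psdBl pI)//; [lra|exact: poly2_in_sqi pp|exact: poly2_in_sqi pq].
Qed.

Lemma proj0_poly n p : poly2 n p -> proj0 E n p = p.
Proof.
move=> pp; apply: (proj0_unique _ pp); first exact: poly2_in_sqi pp.
move=> q pq; rewrite (_ : p \- p = 0); first by apply: (psd0l pI); exact: poly2_in_sqi pq.
by apply/funext => x; rewrite /= subrr.
Qed.

Lemma proj0_lin n (a : R) f g : sqi leb2 C f -> sqi leb2 C g ->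
  proj0 E n (a *: f + g) = a *: proj0 E n f + proj0 E n g.
Proof.
move=> sf sg; have [pf hf] := proj0P n sf; have [pg hg] := proj0P n sg.
have spf := poly2_in_sqi pf; have spg := poly2_in_sqi pg.
have sfg : sqi leb2 C (a *: f + g) by case: (sqi_subsp leb2 mC) => _; apply.
have pfg : poly2 n (a *: proj0 E n f + proj0 E n g) by exact: (proj2 (poly2_subsp n)).
apply: (proj0_unique sfg pfg) => q pq; have sq := poly2_in_sqi pq.
have sP := poly2_in_sqi pfg.
rewrite [LHS](psdBl pI)//; case: pI => _ L _ _; rewrite !L//.
have := hf _ pq; have := hg _ pq; rewrite [inner C (f \- _) _](psdBl pI)//.
by rewrite [inner C (g \- _) _](psdBl pI)// => /subr0_eq -> /subr0_eq ->; rewrite subrr.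
Qed.

Lemma proj0_norm n f : sqi leb2 C f ->
  inner C (proj0 E n f) (proj0 E n f) + inner C (f - proj0 E n f) (f - proj0 E n f)
  = inner C f f.
Proof.
move=> sf; have [pp hp] := proj0P n sf; have sp := poly2_in_sqi pp.
have := hp _ pp; rewrite [inner C (f \- _) _](psdBl pI)// => h.
rewrite (psdBl pI)//; last exact: (subspB (sqi_subsp leb2 mC)).
by rewrite !(psdBr pI)// (psdC pI sp sf); lra.
Qed.

Lemma proj0_contract n f : sqi leb2 C f ->
  inner C (proj0 E n f) (proj0 E n f) <= inner C f f.
Proof.
move=> sf; rewrite -(proj0_norm n sf) lerDl; apply: (psd_ge0 pI).
by apply: (subspB (sqi_subsp leb2 mC)) => //; exact: proj0_sqi.
Qed.

Section Matrix.
Context {m1 m2 : nat}.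
Implicit Types (F G : pt -> 'M[R]_(m1, m2)).

Let pM : psd (sqiM C) (@innerM R m1 m2 C). Proof. exact: psd_innerM. Qed.

Lemma ent_proj0M n F i j : ent (proj0M E n F) i j = proj0 E n (ent F i j).
Proof. by apply/funext => x; rewrite /ent /proj0M mxE. Qed.

Lemma proj0M_sqi n F : sqiM C F -> sqiM C (proj0M E n F).
Proof. by move=> sF i j; rewrite ent_proj0M; exact: proj0_sqi. Qed.

Lemma proj0M_lin n (a : R) F G : sqiM C F -> sqiM C G ->
  proj0M E n (a *: F + G) = a *: proj0M E n F + proj0M E n G.
Proof.
move=> sF sG; apply/funext => x; apply/matrixP => i j.
rewrite -[LHS]/(ent (proj0M E n (a *: F + G)) i j x) ent_proj0M ent_lin proj0_lin//.
by rewrite !fctE !mxE.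
Qed.

Lemma proj0M_contract n F : sqiM C F ->
  innerM C (proj0M E n F) (proj0M E n F) <= innerM C F F.
Proof.
move=> sF; rewrite !innerM_sum//; [|exact: proj0M_sqi..].
apply: ler_sum => i _; apply: ler_sum => j _.
by rewrite ent_proj0M; exact: proj0_contract.
Qed.

Lemma proj0M_inner n F G : sqiM C F -> (forall i j, poly2 n (ent G i j)) ->
  innerM C (proj0M E n F) G = innerM C F G.
Proof.
move=> sF pG; have sG : sqiM C G by move=> i j; exact: poly2_in_sqi (pG i j).
rewrite !innerM_sum//; last exact: proj0M_sqi.
by apply: eq_bigr => i _; apply: eq_bigr => j _; rewrite ent_proj0M proj0_inner.
Qed.

Lemma proj0M_poly n F : (forall i j, poly2 n (ent F i j)) -> proj0M E n F = F.
Proof.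
move=> pF; apply/funext => x; apply/matrixP => i j.
by rewrite -[LHS]/(ent (proj0M E n F) i j x) ent_proj0M proj0_poly.
Qed.

End Matrix.
End L2Projection.

(** * Energy projections *)

Section AveragedProjection.
Context {R : realType} {V W : lmodType R}.
Context (S P : set V) (B : V -> V -> R) (A : V -> W) (K : W -> V).
Hypothesis pB : psd S B.
Hypothesis Pspan : exists s : seq V, forall p, P p <-> span s p.
Hypothesis PS : P `<=` S.
Hypothesis Alin : forall a u v, S u -> S v -> A (a *: u + v) = a *: A u + A v.
Hypothesis KP : forall w, P (K w).
Hypothesis AK : forall w, A (K w) = w.
Hypothesis BK : forall w q, P q -> B (K w) q = 0.
Hypothesis Pdef : forall p, P p -> B p p = 0 -> A p = 0 -> p = 0.

(** The orthogonality relations determine the projection up to the kernel of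
  the energy; the averages A fix that kernel. *)
Definition avg_proj v p := [/\ P p, forall q, P q -> B (v - p) q = 0 & A (v - p) = 0].

Let sS : subsp S. Proof. by case: pB. Qed.

Let sP : subsp P.
Proof.
have [s hs] := Pspan; have [s0 sD] := span_subsp s.
by split=> [|a u v /hs su /hs sv]; apply/hs => //; exact: sD.
Qed.

Let AB u v : S u -> S v -> A (u - v) = A u - A v.
Proof. by move=> Su Sv; rewrite addrC -scaleN1r Alin// scaleN1r addrC. Qed.

(** Project for the energy along a finite spanning family, then correct the averages
  by an element of the kernel of the energy. *)
Lemma avg_proj_exists v : S v -> exists p, avg_proj v p.
Proof.
move=> Sv; have [s hs] := Pspan.
have [|p0 /hs Pp0 o] := psd_projection (s := s) pB _ Sv.
  by move=> e /mem_span/hs/PS.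
have Sp0 := PS Pp0; have Svp : S (v - p0) by exact: subspB.
pose p := p0 + K (A (v - p0)); have Pp : P p by exact: subspD.
have e : v - p = (v - p0) - K (A (v - p0)) by rewrite /p opprD addrA.
exists p; split => // [q Pq|]; rewrite e.
  rewrite (psdBl pB)//; [|exact: PS|exact: PS].
  by rewrite BK// subr0 o//; apply/hs.
by rewrite AB ?AK ?subrr//; exact: PS.
Qed.

Lemma avg_proj_unique v p q : S v -> avg_proj v p -> avg_proj v q -> p = q.
Proof.
move=> Sv [Pp op Ap] [Pq oq Aq]; apply/eqP; rewrite -subr_eq0; apply/eqP.
have Pd : P (p - q) by exact: subspB.
have Sp := PS Pp; have Sq := PS Pq; have Sd := PS Pd; apply: Pdef => //.
  have := op _ Pd; have := oq _ Pd; rewrite !(psdBl pB)// => h1 h2; lra.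
rewrite AB//; move: Ap Aq; rewrite !AB// => /eqP + /eqP.
by rewrite !subr_eq0 => /eqP <- /eqP <-; rewrite subrr.
Qed.

Lemma avg_proj_lin a u v p q : S u -> S v -> avg_proj u p -> avg_proj v q ->
  avg_proj (a *: u + v) (a *: p + q).
Proof.
move=> Su Sv [Pp op Ap] [Pq oq Aq].
have Sp := PS Pp; have Sq := PS Pq.
have e : a *: u + v - (a *: p + q) = a *: (u - p) + (v - q).
  by rewrite scalerBr opprD addrACA.
have Sup : S (u - p) by exact: subspB. have Svq : S (v - q) by exact: subspB.
split; first exact: (proj2 sP).
  by move=> r Pr; rewrite e; case: pB => _ L _ _; rewrite L ?op ?oq ?mulr0 ?addr0//; exact: PS.
by rewrite e Alin// Ap Aq scaler0 addr0.
Qed.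

Lemma avg_proj_self p : P p -> avg_proj p p.
Proof.
move=> Pp; have Sp := PS Pp; split => // [q Pq|]; first by rewrite subrr (psd0l pB)//; exact: PS.
by rewrite AB// subrr.
Qed.

Lemma avg_proj_energy v p : S v -> avg_proj v p -> B v p = B p p /\
  B v v = B p p + B (v - p) (v - p).
Proof.
move=> Sv [Pp op _]; have Sp := PS Pp.
have h : B v p - B p p = 0 by rewrite -(psdBl pB)// op.
have Svp : S (v - p) by exact: subspB.
split; first lra.
by rewrite (psdBl pB)// !(psdBr pB)// (psdC pB Sp Sv); lra.
Qed.

End AveragedProjection.

Lemma mx_lin (R : pzRingType) m n (a : R) (A B : 'M[R]_(m, n)) i j :
  (a *: A + B) i j = a * A i j + B i j.
Proof. by rewrite !mxE. Qed.

Section Elliptic.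
Context {R : realType} (E : polygon R) (pE : polygonal_domain E).
Local Notation pt := (R * R)%type.
Local Notation C := (cell E).
Implicit Types (f g q : pt -> R) (u v w p : pt -> 'cV[R]_2) (n : nat).

Let dE : domain C. Proof. exact: polygonal_domain_domain. Qed.
Let mC : measurable2 C. Proof. exact: domain_meas. Qed.
Let oC : open C. Proof. by case: dE. Qed.
Let bC : bounded_set C. Proof. by case: dE. Qed.
Let C0 : C !=set0. Proof. by case: dE. Qed.
Let per0 : 0 < perimeter E. Proof. exact: perimeter_gt0. Qed.

Definition SG v := forall i, C0bar C (vcomp v i) /\ H1 C (vcomp v i).

Definition BG u v : R := innerM C (gradv C u) (gradv C v).

Lemma vcomp_lin (a : R) u v i : vcomp (a *: u + v) i = a *: vcomp u i + vcomp v i.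
Proof. by apply/funext => x; rewrite /vcomp !fctE !mxE. Qed.

Lemma SG_subsp : subsp SG.
Proof.
split=> [i|a u v Su Sv i].
  have -> : vcomp (0 : pt -> 'cV[R]_2) i = 0 by apply/funext => x; rewrite /vcomp mxE.
  by split; [case: (C0bar_subsp C)|case: (H1_subsp dE)].
have [c1 h1] := Su i; have [c2 h2] := Sv i.
by rewrite vcomp_lin; split; [exact: (proj2 (C0bar_subsp C))|exact: (proj2 (H1_subsp dE))].
Qed.

Lemma gradv_sqi v : (forall i, H1 C (vcomp v i)) -> sqiM C (gradv C v).
Proof.
move=> Sv i j; have := Sv i; move=> /(H1P _ dE)[_ /(_ j)[_ h]].
by rewrite (_ : ent _ i j = wd C j (vcomp v i))//; apply/funext => x; rewrite /ent mxE.
Qed.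

Lemma psd_BG : psd SG BG.
Proof.
have pM := @psd_innerM R 2 2 C mC.
apply: (psd_pull (T := gradv C) pM SG_subsp).
  by move=> u Su; apply: gradv_sqi => i; case: (Su i).
move=> a u v w Su Sv Sw.
have gu : sqiM C (gradv C u) by apply: gradv_sqi => i; case: (Su i).
have gv : sqiM C (gradv C v) by apply: gradv_sqi => i; case: (Sv i).
have gw : sqiM C (gradv C w) by apply: gradv_sqi => i; case: (Sw i).
have Suv : SG (a *: u + v) by exact: (proj2 SG_subsp).
apply: ae_innerM; [exact: mC|by apply: gradv_sqi => i; case: (Suv i)|
  exact: (proj2 (sqiM_subsp mC))|exact: gw|exact: gw|idtac|by move=> i j; exact: ae_all].
move=> i j; apply: ae_imp (H1_wd_lin a j dE (Su i).2 (Sv i).2) => x h Dx.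
  by rewrite [LHS]mxE vcomp_lin h// !fctE !mxE.
Qed.

Definition embv (i : 'I_2) (q : pt -> R) : pt -> 'cV[R]_2 :=
  fun x => \col_k (if k == i then q x else 0).

Lemma polyv_subsp n : subsp (@polyv R n).
Proof.
split=> [i|a u v pu pv i].
  have -> : vcomp (0 : pt -> 'cV[R]_2) i = 0 by apply/funext => x; rewrite /vcomp mxE.
  by case: (@poly2_subsp R n).
by rewrite vcomp_lin; exact: (proj2 (poly2_subsp n)).
Qed.

Lemma vcomp_embv i j q : vcomp (embv i q) j = if j == i then q else 0.
Proof. by apply/funext => x; rewrite /vcomp mxE; case: ifP. Qed.

Lemma polyv_span n : exists s : seq (pt -> 'cV[R]_2), forall p, polyv n p <-> span s p.
Proof.
have [s hs] := @poly2_span R n.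
exists [seq embv i q | i <- [:: 0; 1], q <- s] => p; split; last first.
  apply: span_sub; first exact: polyv_subsp.
  move=> _ /allpairsP[[i q] [_ qs ->]] j; rewrite vcomp_embv.
  case: ifP => _; last by case: (@poly2_subsp R n).
  by apply/hs; exact: mem_span.
move=> pp; set S := span _; have sS : subsp S by exact: span_subsp.
have h i q : poly2 n q -> S (embv i q).
  move=> /hs; apply: (@span_sub _ _ [set q | S (embv i q)]).
    split; first rewrite /= (_ : embv i 0 = 0); first by case: sS.
      by apply/funext => x; apply/matrixP => k l; rewrite !mxE; case: ifP.
    move=> a f g Sf Sg /=; rewrite (_ : embv i _ = a *: embv i f + embv i g); first exact: (proj2 sS).
    apply/funext => x; apply/matrixP => k l; rewrite !fctE !mxE.
    by case: ifP => //; rewrite mulr0 addr0.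
  move=> e es /=; apply: mem_span; apply/allpairsP; exists (i, e); split => //=.
  by elim/ord2_ind: i {es}; rewrite !inE.
have -> : p = embv 0 (vcomp p 0) + embv 1 (vcomp p 1).
  apply/funext => x; apply/matrixP => i l; rewrite !fctE !mxE (ord1 l) /vcomp.
  by elim/ord2_ind: i; rewrite /= ?addr0 ?add0r.
by apply: subspD => //; exact: h.
Qed.

Lemma polyv_SG n p : polyv n p -> SG p.
Proof.
move=> pp i; split; last exact: poly2_H1 (pp i).
by apply: C0bar_cont; exact: smooth_cont (poly2_smooth (pp i)).
Qed.

Lemma gradv_polyv n p i j : polyv n p ->
  {ae leb2, forall x, C x -> gradv C p x i j = pd j (vcomp p i) x}.
Proof. by move=> pp; apply: ae_imp (poly2_wd j oC (pp i)) => x h Dx; rewrite mxE h. Qed.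

Definition avgG v : 'cV[R]_2 := \col_i bdint E (fun _ => vcomp v i).
Definition corG (w : 'cV[R]_2) : pt -> 'cV[R]_2 := fun=> (perimeter E)^-1 *: w.

Lemma projG_avg n v : projG E n v =
  xget (fun=> 0) [set p | avg_proj (polyv n) BG avgG v p].
Proof.
rewrite /projG; congr xget; apply/seteqP; split=> p /=.
  by move=> [h1 h2 h3]; split => //; apply/colP => i; rewrite !mxE; exact: h3.
by move=> [h1 h2 h3]; split => // i; move/colP : h3 => /(_ i); rewrite !mxE.
Qed.

Lemma avgG_lin (a : R) u v : SG u -> SG v -> avgG (a *: u + v) = a *: avgG u + avgG v.
Proof.
move=> Su Sv; apply/colP => i; rewrite !mxE vcomp_lin.
by rewrite (bdint_lin pE)//; [case: (Su i)|case: (Sv i)].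
Qed.

Lemma corG_poly n (w : 'cV[R]_2) : polyv n (corG w).
Proof.
move=> i; rewrite (_ : vcomp _ _ = fun=> (perimeter E)^-1 * w i 0); first exact: poly2_cst.
by apply/funext => x; rewrite /vcomp mxE.
Qed.

Lemma avg_corG (w : 'cV[R]_2) : avgG (corG w) = w.
Proof.
apply/colP => i; rewrite mxE.
rewrite (_ : (fun _ => _) = fun _ _ => (perimeter E)^-1 * w i 0); last first.
  by apply/funext => e; apply/funext => x; rewrite /vcomp mxE.
by rewrite bdint_cst// mulrAC mulVf ?mul1r// gt_eqF.
Qed.

Lemma BG_cor (w : 'cV[R]_2) u : SG u -> BG (corG w) u = 0.
Proof.
move=> Su; have Sc := polyv_SG (@corG_poly 0 w).
rewrite (psdC psd_BG)//; apply: (psd_null psd_BG) => //.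
rewrite -[RHS](psd0l (@psd_innerM R 2 2 C mC) (w := gradv C (corG w))); last first.
  by apply: gradv_sqi => i; case: (Sc i).
have gs : sqiM C (gradv C (corG w)) by apply: gradv_sqi => i; case: (Sc i).
have g0 : sqiM C (0 : pt -> 'M[R]_2) by case: (@sqiM_subsp R 2 2 C mC).
apply: ae_innerM; [exact: mC|exact: gs|exact: g0|exact: gs|exact: gs|idtac|by move=> i j; exact: ae_all].
move=> i j; apply: ae_imp (gradv_polyv i j (@corG_poly 0 w)) => x h Dx.
rewrite h// mxE (_ : vcomp _ _ = fun=> (perimeter E)^-1 * w i 0) ?pd_cst//.
by apply/funext => y; rewrite /vcomp mxE.
Qed.

Lemma polyv_def n p : polyv n p -> BG p p = 0 -> avgG p = 0 -> p = 0.
Proof.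
move=> pp B0 A0; have Sp := polyv_SG pp.
have gs : sqiM C (gradv C p) by apply: gradv_sqi => i; case: (Sp i).
have cst i x : vcomp p i x = vcomp p i (0, 0).
  have sp := poly2_smooth (pp i).
  apply: pd0_constant; first by move=> j y; exact: smooth_derivable.
  move=> j y; rewrite (_ : pd j (vcomp p i) = 0)//.
  apply: (poly2_ae0 oC C0 (poly2_pd j (pp i))).
  apply: ae_imp2 (innerM0_ae mC gs B0 i j) (gradv_polyv i j pp) => z h1 h2 Dz.
  by rewrite -h2// h1.
apply/funext => x; apply/colP => i; rewrite -[LHS]/(vcomp p i x) cst mxE.
move/colP : A0 => /(_ i); rewrite !mxE.
rewrite (_ : (fun _ => _) = fun _ _ => vcomp p i (0, 0)); last first.
  by apply/funext => e; apply/funext => y; exact: cst.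
by rewrite bdint_cst// => /eqP; rewrite mulf_eq0 (gt_eqF per0) orbF => /eqP.
Qed.

Lemma projG_exists n v : SG v -> exists p, avg_proj (polyv n) BG avgG v p.
Proof.
exact: (avg_proj_exists psd_BG (@polyv_span n) (@polyv_SG n) avgG_lin (@corG_poly n)
  avg_corG (fun (w : 'cV[R]_2) (z : pt -> 'cV[R]_2) Pz => BG_cor w (polyv_SG Pz))).
Qed.

Lemma projG_spec n v : SG v -> avg_proj (polyv n) BG avgG v (projG E n v).
Proof.
move=> Sv; rewrite projG_avg; have [p hp] := projG_exists n Sv.
by case: xgetP => [_ _ //|/(_ p)].
Qed.

Lemma projG_eq n v p : SG v -> avg_proj (polyv n) BG avgG v p -> projG E n v = p.
Proof. by move=> Sv hp; exact: (avg_proj_unique psd_BG (@polyv_span n) (@polyv_SG n)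
  avgG_lin (@polyv_def n) Sv (projG_spec n Sv) hp). Qed.

Lemma projG_polyv n v : SG v -> polyv n (projG E n v).
Proof. by move=> Sv; case: (projG_spec n Sv). Qed.

Lemma projG_self n p : polyv n p -> projG E n p = p.
Proof.
move=> pp; apply: projG_eq; first exact: polyv_SG pp.
exact: (avg_proj_self psd_BG (@polyv_SG n) avgG_lin pp).
Qed.

Lemma projG_lin n (a : R) u v : SG u -> SG v ->
  projG E n (a *: u + v) = a *: projG E n u + projG E n v.
Proof.
move=> Su Sv; apply: projG_eq; first exact: (proj2 SG_subsp).
exact: (avg_proj_lin psd_BG (@polyv_span n) (@polyv_SG n) avgG_lin a Su Sv
  (projG_spec n Su) (projG_spec n Sv)).
Qed.

(** The gradient of the energy projection is a projection of the gradient onto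
  gradients of polynomials, hence no larger than the full projection. *)
Lemma gradient_coercive n v : SG v ->
  BG v v <= innerM C (proj0M E n.-1 (gradv C v)) (proj0M E n.-1 (gradv C v)) +
    BG (v - projG E n v) (v - projG E n v).
Proof.
move=> Sv; have hp := projG_spec n Sv; set p := projG E n v in hp *.
have pp : polyv n p by case: hp.
have Sp := polyv_SG pp.
have [e1 ->] := avg_proj_energy psd_BG (@polyv_SG n) Sv hp.
rewrite lerD2r; have gv : sqiM C (gradv C v) by apply: gradv_sqi => i; case: (Sv i).
have gp : sqiM C (gradv C p) by apply: gradv_sqi => i; case: (Sp i).
pose G : pt -> 'M[R]_2 := fun x => \matrix_(i, j) pd j (vcomp p i) x.
have entG i j : ent G i j = pd j (vcomp p i) by apply/funext => x; rewrite /ent mxE.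
have pG i j : poly2 n.-1 (ent G i j) by rewrite entG; exact: poly2_pd.
have sG : sqiM C G by move=> i j; exact: poly2_sqi (pG i j).
have aeG i j : {ae leb2, forall x, C x -> gradv C p x i j = G x i j}.
  by apply: ae_imp (gradv_polyv i j pp) => x h Dx; rewrite /G [RHS]mxE; exact: h.
have eGG : BG p p = innerM C G G.
  by apply: ae_innerM; [exact: mC|exact: gp|exact: sG|exact: gp|exact: sG|exact: aeG|exact: aeG].
have evG : BG v p = innerM C (gradv C v) G.
  apply: ae_innerM; [exact: mC|exact: gv|exact: gv|exact: gp|exact: sG|idtac|exact: aeG].
  by move=> i j; exact: ae_all.
have pM := @psd_innerM R 2 2 C mC.
set Q := proj0M E n.-1 (gradv C v); have sQ : sqiM C Q by exact: proj0M_sqi.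
have eQ : BG p p = innerM C Q G by rewrite -e1 evG proj0M_inner.
have := psd_cauchy_schwarz pM sQ sG; rewrite -eQ -eGG expr2.
have := psd_ge0 psd_BG Sp; rewrite le_eqVlt => /predU1P[<- _|p0].
  exact: (psd_ge0 pM).
by rewrite ler_pM2r.
Qed.

(** ** The scalar projection *)

Definition SD f := C1bar C f /\ H2 C f.

Definition BD f g : R := innerM C (hess C f) (hess C g).

Lemma SD_subsp : subsp SD.
Proof.
have [c0 cD] := C1bar_subsp C; have [h0 hD] := H2_subsp dE.
by split=> [//|a f g [cf hf] [cg hg]]; split; [exact: cD|exact: hD].
Qed.

Lemma hess_sqi f : H2 C f -> sqiM C (hess C f).
Proof.
move=> [_ hf] i j; have := hf i; move=> /(H1P _ dE)[_ /(_ j)[_ h]].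
by rewrite (_ : ent _ i j = wd C j (wd C i f))//; apply/funext => x; rewrite /ent mxE.
Qed.

Lemma hessE f x i j : hess C f x i j = wd C j (wd C i f) x.
Proof. by rewrite mxE. Qed.

Lemma psd_BD : psd SD BD.
Proof.
have pM := @psd_innerM R 2 2 C mC.
apply: (psd_pull (T := hess C) pM SD_subsp); first by move=> f [_ /hess_sqi].
move=> a f g h [_ hf] [_ hg] [_ hh].
have sf := hess_sqi hf; have sg := hess_sqi hg; have sh := hess_sqi hh.
apply: ae_innerM; [exact: mC|by apply: hess_sqi; exact: (proj2 (H2_subsp dE))|
  exact: (proj2 (sqiM_subsp mC))|exact: sh|exact: sh|idtac|by move=> i j; exact: ae_all].
move=> i j; apply: ae_imp (H2_wd_lin a i j dE hf hg) => x e Dx.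
apply: (etrans (hessE (a *: f + g) x i j)).
apply: (etrans (e Dx)).
apply: (etrans _ (esym (mx_lin a (hess C f x) (hess C g x) i j))).
exact: (f_equal2 (fun s t => a * s + t) (esym (hessE f x i j)) (esym (hessE g x i j))).
Qed.

Lemma poly2_SD n q : poly2 n q -> SD q.
Proof. by move=> pq; split; [exact: smooth_C1bar (poly2_smooth pq)|exact: poly2_H2 pq]. Qed.

Lemma hess_poly n q i j : poly2 n q ->
  {ae leb2, forall x, C x -> hess C q x i j = pd j (pd i q) x}.
Proof. by move=> pq; apply: ae_imp (poly2_wd2_ae i j dE pq) => x h Dx; rewrite mxE h. Qed.

Definition avgD f : R * 'cV[R]_2 :=
  (bdint E (fun _ => f), \col_i bdint E (fun _ => bdval C (pd i f))).

Lemma avgD2E f i : (avgD f).2 i 0 = bdint E (fun _ => bdval C (pd i f)).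
Proof. by rewrite mxE. Qed.

(** The affine function with prescribed boundary averages. *)
Definition corD (w : R * 'cV[R]_2) : pt -> R :=
  let l : pt -> R := fun x => (perimeter E)^-1 * (w.2 0 0 * x.1 + w.2 1 0 * x.2) in
  l + (fun=> (perimeter E)^-1 * (w.1 - bdint E (fun _ => l))).

Lemma projD_avg n f : projD E n f =
  xget (fun=> 0) [set p : pt -> R | avg_proj (poly2 n) BD avgD f p].
Proof.
rewrite /projD; congr xget; apply/seteqP; split=> p /=.
  move=> [h1 h2 h3 h4]; split => //; apply: injective_projections => //=.
  by apply/colP => i; rewrite !mxE; exact: h4.
move=> [h1 h2 h3]; split => //; first by have := congr1 fst h3.
by move=> i; have := congr1 snd h3 => /= /colP /(_ i); rewrite !mxE.
Qed.

Lemma bdval_pd_lin (a : R) f g i e x : C1bar C f -> C1bar C g -> e \in edges E ->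
  segment e x -> bdval C (pd i (a *: f + g)) x =
    a * bdval C (pd i f) x + bdval C (pd i g) x.
Proof.
move=> /C1barP[_ /(_ i)[f' [cf hf]]] /C1barP[_ /(_ i)[g' [cg hg]]] eE xe.
have Dx := edge_in_closure pE eE xe.
have ef : bdval C (pd i f) x = f' x by apply: bdvalE => // y /hf[].
have eg : bdval C (pd i g) x = g' x by apply: bdvalE => // y /hg[].
rewrite ef eg.
rewrite (bdvalE (proj2 (C0bar_subsp C) a _ _ cf cg))// => y Dy.
have [df ef'] := hf y Dy; have [dg eg'] := hg y Dy.
by rewrite pd_lin// ef' eg'.
Qed.

Lemma bdval_pd_C0 f i : C1bar C f -> exists2 g, C0bar C g &
  forall x, closure C x -> bdval C (pd i f) x = g x.
Proof.
move=> /C1barP[_ /(_ i)[f' [cf hf]]]; exists f' => // x Dx.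
by apply: bdvalE => // y /hf[].
Qed.

Lemma avgD_lin (a : R) f g : SD f -> SD g -> avgD (a *: f + g) = a *: avgD f + avgD g.
Proof.
move=> [cf _] [cg _]; apply: injective_projections => /=.
  by rewrite (bdint_lin pE)//; [case/C1barP: cf|case/C1barP: cg].
apply/colP => i; apply: (etrans (avgD2E (a *: f + g) i)).
apply: (etrans _ (esym (mx_lin a (avgD f).2 (avgD g).2 i 0))).
apply: (etrans _ (f_equal2 (fun s t => a * s + t) (esym (avgD2E f i)) (esym (avgD2E g i)))).
have [f' cf' ef] := bdval_pd_C0 i cf; have [g' cg' eg] := bdval_pd_C0 i cg.
rewrite (eq_bdint (P := E) (G := fun _ => a *: f' + g')); last first.
  move=> e x eE xe; have Dx := edge_in_closure pE eE xe.
  by rewrite (bdval_pd_lin _ _ cf cg eE xe) ef// eg.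
rewrite (bdint_lin pE)//; congr (_ * _ + _); apply: eq_bdint => e x eE xe.
  by rewrite ef//; exact: edge_in_closure xe.
by rewrite eg//; exact: edge_in_closure xe.
Qed.

Lemma bdval_smooth f i x : smooth f -> closure C x -> bdval C (pd i f) x = pd i f x.
Proof. by move=> sf Dx; apply: bdvalE => //; apply: C0bar_cont; exact: smooth_cont (smooth_pd i sf). Qed.

Let lin_poly (a b : R) : poly2 1 (fun x : pt => a * x.1 + b * x.2).
Proof.
have -> : (fun x : pt => a * x.1 + b * x.2) = a *: mono 1 0 + b *: mono 0 1.
  by apply/funext => x; rewrite !fctE /mono !expr1 !expr0 mulr1 mul1r.
apply: (proj2 (@poly2_subsp R 1)); first exact: poly2_mono.
by apply: subspZ; [exact: poly2_subsp|exact: poly2_mono].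
Qed.

Let pd_linf (a b : R) i x : pd i (fun x : pt => a * x.1 + b * x.2) x = if i == 0 then a else b.
Proof.
have -> : (fun x : pt => a * x.1 + b * x.2) = a *: mono 1 0 + b *: mono 0 1.
  by apply/funext => y; rewrite !fctE /mono !expr1 !expr0 mulr1 mul1r.
rewrite pd_lin; [|exact: smooth_derivable (mono_smooth _ _)|]; last first.
  by apply: smooth_derivable; exact: (subspZ b (@smooth_subsp R) (mono_smooth 0 1)).
rewrite -[b *: mono 0 1]addr0 pd_lin; [|exact: smooth_derivable (mono_smooth _ _)|exact: derivable_cst].
rewrite (pd_cst i 0).
elim/ord2_ind: i; rewrite ?pd0_mono ?pd1_mono /mono !fctE /GRing.scale /= !expr0 !mulr1;
  by rewrite ?mulr1 ?mul0r ?mulr0 ?addr0 ?add0r.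
Qed.

Lemma corD_affine (w : R * 'cV[R]_2) : corD w = (fun x : pt => (perimeter E)^-1 * w.2 0 0 * x.1 +
    (perimeter E)^-1 * w.2 1 0 * x.2) +
  (fun=> (perimeter E)^-1 * (w.1 - bdint E (fun _ => fun x : pt =>
    (perimeter E)^-1 * (w.2 0 0 * x.1 + w.2 1 0 * x.2)))).
Proof. by apply/funext => x; rewrite /corD !fctE; congr (_ + _); rewrite mulrDr !mulrA. Qed.

Lemma corD_poly n (w : R * 'cV[R]_2) : (0 < n)%N -> poly2 n (corD w).
Proof.
move=> n0; rewrite corD_affine; apply: subspD; [exact: poly2_subsp| |exact: poly2_cst].
exact: poly2_le (lin_poly _ _).
Qed.

Lemma pd_corD (w : R * 'cV[R]_2) i x : pd i (corD w) x = (perimeter E)^-1 * w.2 i 0.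
Proof.
rewrite corD_affine -[X in pd i (X + _)]scale1r pd_lin; last 2 first.
- exact: smooth_derivable (poly2_smooth (lin_poly _ _)).
- exact: derivable_cst.
rewrite pd_linf pd_cst addr0 mul1r.
by elim/ord2_ind: i.
Qed.

Lemma avg_corD (w : R * 'cV[R]_2) : avgD (corD w) = w.
Proof.
have sc : smooth (corD w) by exact: (poly2_smooth (@corD_poly 1 w isT)).
case: w sc => w1 w2 sc; congr pair.
  rewrite /corD -[X in bdint E (fun _ => X + _)]scale1r (bdint_lin pE); last 2 first.
  - apply: C0bar_cont; apply: smooth_cont; apply: (@poly2_smooth _ 1).
    rewrite (_ : (fun x => _) = (fun x : pt => (perimeter E)^-1 * w2 0 0 * x.1 +
      (perimeter E)^-1 * w2 1 0 * x.2)); first exact: lin_poly.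
    by apply/funext => x /=; rewrite mulrDr !mulrA.
  - by apply: C0bar_cont => x; exact: cvg_cst.
  rewrite bdint_cst// mul1r mulrAC mulVf ?mul1r ?gt_eqF//= addrC subrK //.
apply/colP => i; rewrite mxE.
rewrite (eq_bdint (P := E) (G := fun _ _ => (perimeter E)^-1 * w2 i 0)); last first.
  move=> e x eE xe; have Dx := edge_in_closure pE eE xe.
  by rewrite bdval_smooth// pd_corD.
by rewrite bdint_cst// mulrAC mulVf ?mul1r// gt_eqF.
Qed.

Lemma BD_cor (w : R * 'cV[R]_2) f : SD f -> BD (corD w) f = 0.
Proof.
move=> Sf; have pc := @corD_poly 1 w isT; have Sc := poly2_SD pc.
rewrite (psdC psd_BD)//; apply: (psd_null psd_BD) => //.
have gs : sqiM C (hess C (corD w)) by apply: hess_sqi; case: Sc.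
rewrite -[RHS](psd0l (@psd_innerM R 2 2 C mC) gs).
have g0 : sqiM C (0 : pt -> 'M[R]_2) by case: (@sqiM_subsp R 2 2 C mC).
apply: ae_innerM; [exact: mC|exact: gs|exact: g0|exact: gs|exact: gs|idtac|by move=> i j; exact: ae_all].
move=> i j; apply: ae_imp (hess_poly i j pc) => x h Dx.
rewrite h// mxE (_ : pd i _ = fun=> (perimeter E)^-1 * w.2 i 0) ?pd_cst//.
by apply/funext => y; exact: pd_corD.
Qed.

Lemma poly2_def n (p : pt -> R) : poly2 n p -> BD p p = 0 -> avgD p = 0 -> p = 0.
Proof.
move=> pp B0 A0; have Sp := poly2_SD pp; have sp := poly2_smooth pp.
have gs : sqiM C (hess C p) by apply: hess_sqi; case: Sp.
have cst i x : pd i p x = pd i p (0, 0).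
  have sq := smooth_pd i sp.
  apply: pd0_constant; first by move=> j y; exact: smooth_derivable.
  move=> j y; rewrite (_ : pd j (pd i p) = 0)//.
  apply: (poly2_ae0 oC C0 (poly2_pd j (poly2_pd i pp))).
  apply: ae_imp2 (innerM0_ae mC gs B0 i j) (hess_poly i j pp) => z h1 h2 Dz.
  by rewrite -h2// h1.
have d0 i x : pd i p x = 0.
  rewrite cst; have := congr1 snd A0 => /= /colP /(_ i); rewrite !mxE.
  rewrite (eq_bdint (P := E) (G := fun _ _ => pd i p (0, 0))); last first.
    move=> e y eE ye; have Dy := edge_in_closure pE eE ye.
    by rewrite bdval_smooth// cst.
  by rewrite bdint_cst// => /eqP; rewrite mulf_eq0 (gt_eqF per0) orbF => /eqP.
have pc x : p x = p (0, 0).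
  by apply: pd0_constant => // i y; exact: smooth_derivable.
apply/funext => x; rewrite pc; have := congr1 fst A0 => /=.
rewrite (_ : (fun _ => _) = fun _ _ => p (0, 0)); last first.
  by apply/funext => e; apply/funext => y; exact: pc.
by rewrite bdint_cst// => /eqP; rewrite mulf_eq0 (gt_eqF per0) orbF => /eqP.
Qed.

Section Degree.
Context (n : nat) (n0 : (0 < n)%N).

Lemma projD_exists f : SD f -> exists p : pt -> R, avg_proj (poly2 n) BD avgD f p.
Proof.
exact: (avg_proj_exists psd_BD (@poly2_span R n) (@poly2_SD n) avgD_lin
  (fun w : R * 'cV[R]_2 => corD_poly w n0) avg_corD
  (fun (w : R * 'cV[R]_2) q Pq => BD_cor w (poly2_SD Pq))).
Qed.

Lemma projD_spec f : SD f -> avg_proj (poly2 n) BD avgD f (projD E n f).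
Proof.
move=> Sf; rewrite projD_avg; have [p hp] := projD_exists Sf.
by case: xgetP => [_ _ //|/(_ p)].
Qed.

Lemma projD_eq f (p : pt -> R) : SD f -> avg_proj (poly2 n) BD avgD f p -> projD E n f = p.
Proof. by move=> Sf hp; exact: (avg_proj_unique psd_BD (@poly2_span R n) (@poly2_SD n)
  avgD_lin (@poly2_def n) Sf (projD_spec Sf) hp). Qed.

Lemma projD_poly2 f : SD f -> poly2 n (projD E n f).
Proof. by move=> Sf; case: (projD_spec Sf). Qed.

Lemma projD_self (p : pt -> R) : poly2 n p -> projD E n p = p.
Proof.
move=> pp; apply: projD_eq; first exact: poly2_SD pp.
exact: (avg_proj_self psd_BD (@poly2_SD n) avgD_lin pp).
Qed.

Lemma projD_lin (a : R) f g : SD f -> SD g ->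
  projD E n (a *: f + g) = a *: projD E n f + projD E n g.
Proof.
move=> Sf Sg; apply: projD_eq; first exact: (proj2 SD_subsp).
exact: (avg_proj_lin psd_BD (@poly2_span R n) (@poly2_SD n) avgD_lin a Sf Sg
  (projD_spec Sf) (projD_spec Sg)).
Qed.

(** As for the gradient: the Hessian of the energy projection of f is a projection
  of the Hessian of f onto polynomial tensors of degree n - 2. *)
Lemma hessian_coercive f : SD f ->
  BD f f <= innerM C (proj0M E (n - 2) (hess C f)) (proj0M E (n - 2) (hess C f)) +
    BD (f - projD E n f) (f - projD E n f).
Proof.
move=> Sf; have hp := projD_spec Sf; set p := projD E n f in hp *.
have pp : poly2 n p by case: hp.
have Sp := poly2_SD pp.
have [e1 ->] := avg_proj_energy psd_BD (@poly2_SD n) Sf hp.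
rewrite lerD2r; have gv : sqiM C (hess C f) by apply: hess_sqi; case: Sf.
have gp : sqiM C (hess C p) by apply: hess_sqi; case: Sp.
pose G : pt -> 'M[R]_2 := fun x => \matrix_(i, j) pd j (pd i p) x.
have entG i j : ent G i j = pd j (pd i p) by apply/funext => x; rewrite /ent mxE.
have pG i j : poly2 (n - 2) (ent G i j).
  by rewrite entG subn2; exact: poly2_pd (poly2_pd i pp).
have sG : sqiM C G by move=> i j; exact: poly2_sqi (pG i j).
have aeG i j : {ae leb2, forall x, C x -> hess C p x i j = G x i j}.
  by apply: ae_imp (hess_poly i j pp) => x h Dx; rewrite /G [RHS]mxE; exact: h.
have eGG : BD p p = innerM C G G.
  by apply: ae_innerM; [exact: mC|exact: gp|exact: sG|exact: gp|exact: sG|exact: aeG|exact: aeG].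
have evG : BD f p = innerM C (hess C f) G.
  apply: ae_innerM; [exact: mC|exact: gv|exact: gv|exact: gp|exact: sG|idtac|exact: aeG].
  by move=> i j; exact: ae_all.
have pM := @psd_innerM R 2 2 C mC.
set Q := proj0M E (n - 2) (hess C f); have sQ : sqiM C Q by exact: proj0M_sqi.
have eQ : BD p p = innerM C Q G by rewrite -e1 evG proj0M_inner.
have := psd_cauchy_schwarz pM sQ sG; rewrite -eQ -eGG expr2.
have := psd_ge0 psd_BD Sp; rewrite le_eqVlt => /predU1P[<- _|p0].
  exact: (psd_ge0 pM).
by rewrite ler_pM2r.
Qed.

End Degree.
End Elliptic.

(** * The local virtual spaces *)

Lemma sum_ord2 (V : nmodType) (F : 'I_2 -> V) : \sum_i F i = F 0 + F 1.
Proof. by rewrite big_ord_recl big_ord1; congr (_ + F _); exact: val_inj. Qed.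

Lemma lin_subE (R : pzRingType) (V : lmodType R) (a : R) (u v p q : V) :
  a *: u + v - (a *: p + q) = a *: (u - p) + (v - q).
Proof. by rewrite scalerBr opprD addrACA. Qed.

Section Edges.
Context {R : realType}.
Local Notation pt := (R * R)%type.

Lemma poly_edge_subsp (e : pt * pt) n : subsp (@poly_edge R e n).
Proof.
split; first by exists 0; [rewrite size_poly0|move=> s _; rewrite horner0].
move=> a f g [p sp hp] [q sq hq]; exists (a *: p + q).
  apply: leq_trans (size_polyD _ _) _; rewrite geq_max sq andbT.
  exact: leq_trans (size_scale_leq _ _) sp.
by move=> s hs; rewrite hornerD hornerZ -hp// -hq.
Qed.

Lemma poly_edge_le (e : pt * pt) n m (f : pt -> R) : (n <= m)%N ->
  poly_edge e n f -> poly_edge e m f.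
Proof. by move=> nm [p sp hp]; exists p => //; exact: leq_trans sp _. Qed.

Lemma poly2_edge (e : pt * pt) n (p : pt -> R) : poly2 n p -> poly_edge e n p.
Proof.
apply: poly2_ind; first exact: poly_edge_subsp.
move=> i j ijn; pose d := e.2 - e.1.
pose l (a b : R) : {poly R} := a%:P + b *: 'X.
have sl a b : (size (l a b) <= 2)%N.
  apply: leq_trans (size_polyD _ _) _; rewrite geq_max.
  rewrite (leq_trans (size_polyC_leq1 _))//.
  by rewrite (leq_trans (size_scale_leq _ _))// size_polyX.
have hl a b s : (l a b).[s] = a + s * b by rewrite hornerD hornerC hornerZ hornerX mulrC.
have se a b k : (size (l a b ^+ k) <= k.+1)%N.
  apply: leq_trans (size_poly_exp_leq _ _) _; rewrite ltnS -[leqRHS]mul1n leq_mul2r.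
  by have := sl a b; case: size => [|[|[]]]//; rewrite orbT.
exists (l e.1.1 d.1 ^+ i * l e.1.2 d.2 ^+ j).
  apply: leq_trans (size_polyMleq _ _) _.
  apply: (@leq_trans (i.+1 + j.+1).-1); last by rewrite addnS addSn /= ltnS.
  by rewrite -!subn1 leq_sub2r// leq_add.
by move=> s _; rewrite hornerM !horner_exp !hl.
Qed.

Lemma poly_edge_ext (e : pt * pt) n (f g : pt -> R) :
  (forall s, 0 <= s <= 1 -> f (edge_pt e s) = g (edge_pt e s)) ->
  poly_edge e n g -> poly_edge e n f.
Proof. by move=> fg [p sp hp]; exists p => // s hs; rewrite fg// hp. Qed.

End Edges.

Section Distributions.
Context {R : realType} (D : set (R * R)) (oD : open D).
Local Notation pt := (R * R)%type.
Implicit Types (f g psi : pt -> R).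

Lemma inner_testD f psi1 psi2 : loc_integrable D f -> test_fun D psi1 -> test_fun D psi2 ->
  inner D f (psi1 + psi2) = inner D f psi1 + inner D f psi2.
Proof.
move=> lf t1 t2; have mD := open2_measurable oD.
rewrite /inner -RintegralD//; [|exact: test_mul_intg|exact: test_mul_intg].
by apply: eq_Rint => x _; rewrite -mulrDr.
Qed.

Lemma clapE psi : clap psi = pd 0 (pd 0 psi) + pd 1 (pd 1 psi).
Proof. by apply/funext => x; rewrite /clap sum_ord2. Qed.

Lemma test_fun_clap psi : test_fun D psi -> test_fun D (clap psi).
Proof. by move=> t; rewrite clapE; apply: test_fun_add; do 2 apply: test_fun_pd. Qed.

Lemma poly2_clap n (p : pt -> R) : poly2 n p -> poly2 n.-2 (clap p).
Proof. by move=> pp; rewrite clapE; apply: subspD; [exact: poly2_subsp|..]; do 2 apply: poly2_pd. Qed.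

Lemma poly2_loc n (p : pt -> R) : poly2 n p -> loc_integrable D p.
Proof. by move=> pp; apply: loc_integrable_cont => // x _; exact: smooth_cont (poly2_smooth pp) x. Qed.

Lemma inner_pd_poly n (i : 'I_2) (p : pt -> R) psi : poly2 n p -> test_fun D psi ->
  inner D p (pd i psi) = - inner D (pd i p) psi.
Proof. by move=> pp t; have [_ _] := poly2_is_wd i oD pp; exact. Qed.

Lemma inner_clap_poly n (p : pt -> R) psi : poly2 n p -> test_fun D psi ->
  inner D p (clap psi) = inner D (clap p) psi.
Proof.
move=> pp t; have td i := test_fun_pd i t.
have lp := poly2_loc pp.
have h i : inner D p (pd i (pd i psi)) = inner D (pd i (pd i p)) psi.
  by rewrite (inner_pd_poly i pp (td i)) (inner_pd_poly i (poly2_pd i pp) t) opprK.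
have lpp i : loc_integrable D (pd i (pd i p)) := poly2_loc (poly2_pd i (poly2_pd i pp)).
have e1 := inner_testD lp (test_fun_pd 0 (td 0)) (test_fun_pd 1 (td 1)).
have e2 := inner_test_lin 1 oD (lpp 0) (lpp 1) t.
rewrite scale1r mul1r in e2.
rewrite (clapE psi) (clapE p).
apply: (etrans e1); apply: (etrans _ (esym e2)).
by congr (_ + _); exact: h.
Qed.

Lemma poly2_0 (p : pt -> R) : poly2 0 p -> exists c, p = fun=> c.
Proof.
apply: (poly2_ind (S := [set p | exists c, p = fun=> c])).
  split; first by exists 0.
  by move=> a _ _ [c ->] [c' ->]; exists (a * c + c').
move=> i j; rewrite leqn0 addn_eq0 => /andP[/eqP-> /eqP->]; exists 1.
by apply/funext => x; rewrite /mono !expr0 mulr1.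
Qed.

End Distributions.

Section Stokes.
Context {R : realType}.
Local Notation pt := (R * R)%type.

(** Every polynomial field splits in this way into a gradient, which the pressure
  absorbs, and a rotated multiple of the position vector, which the Stokes
  condition allows: this puts polynomials into the local velocity space. *)
Definition stokes_split n (q : pt -> 'cV[R]_2) := exists r p,
  [/\ poly2 n.+1 r, poly2 n p &
      forall i x, q x i 0 = pd i r x + perp x i 0 * p x].

Lemma stokes_split_subsp n : subsp (stokes_split n).
Proof.
split.
  exists 0, 0; split; [by case: (poly2_subsp (R:=R) n.+1)|by case: (poly2_subsp (R:=R) n)|].
  by move=> i x; rewrite (pd_cst i 0) mxE mulr0 addr0.
move=> a u v [r [p [pr pp h]]] [r' [p' [pr' pp' h']]].
exists (a *: r + r'), (a *: p + p'); split; [exact: (proj2 (poly2_subsp _))..|].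
move=> i x; rewrite pd_lin; [|exact: smooth_derivable (poly2_smooth pr)|exact: smooth_derivable (poly2_smooth pr')].
rewrite -[LHS]/((a *: u x + v x) i 0) mx_lin h h' -[(a *: p + p') x]/(a * p x + p' x).
by rewrite mulrDr mulrDr mulrCA addrACA.
Qed.

Lemma monoE (a b : nat) x : mono a b x = x.1 ^+ a * x.2 ^+ b :> R. Proof. by []. Qed.

Lemma perp0 (x : pt) : perp x 0 0 = x.2. Proof. by rewrite mxE. Qed.
Lemma perp1 (x : pt) : perp x 1 0 = - x.1. Proof. by rewrite mxE. Qed.

Lemma exprP (y : R) n : n%:R * y ^+ n = n%:R * (y * y ^+ n.-1).
Proof. by case: n => [|n]; [rewrite !mul0r|rewrite exprS]. Qed.

Let split_id (a b : nat) (X Y : R) : X ^+ a * Y ^+ b =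
  (a + b).+1%:R^-1 * (a.+1%:R * (X ^+ a * Y ^+ b)) +
  Y * ((a + b).+1%:R^-1 * b%:R * (X ^+ a * Y ^+ b.-1)).
Proof.
have m0 : (a + b).+1%:R != 0 :> R by rewrite pnatr_eq0.
have e : (a + b).+1%:R * (a + b).+1%:R^-1 = 1 :> R by rewrite divff.
move: e (exprP Y b); rewrite -addSn natrD.
set w := _^-1; set A := a.+1%:R; set B := b%:R; set P := X ^+ a; set Q := Y ^+ b.
set Q' := Y ^+ b.-1 => e h.
have -> : Y * (w * B * (P * Q')) = w * (P * (B * (Y * Q'))) by ring.
rewrite -h; have -> : w * (A * (P * Q)) + w * (P * (B * Q)) = (A + B) * w * (P * Q) by ring.
by rewrite e mul1r.
Qed.

Lemma embv_mono_split n i (a b : nat) : (a + b <= n)%N ->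
  stokes_split n (embv i (mono a b)).
Proof.
move=> abn; have ab0 : (a + b).+1%:R != 0 :> R by rewrite pnatr_eq0.
have Z m (q : pt -> R) c : poly2 m q -> poly2 m (c *: q).
  by apply: subspZ; exact: poly2_subsp.
have em (c : R) (a' b' : nat) x : (c *: mono a' b') x = c * (x.1 ^+ a' * x.2 ^+ b') by [].
elim/ord2_ind: i.
  exists ((a + b).+1%:R^-1 *: mono a.+1 b), (((a + b).+1%:R^-1 * b%:R) *: mono a b.-1).
  split; [by apply/Z/poly2_mono; rewrite addSn ltnS| |].
    by apply/Z/poly2_mono; rewrite (leq_trans _ abn)// leq_add2l leq_pred.
  move=> i x; rewrite -[_ *: mono a.+1 b]addr0 pd_lin; [|exact: smooth_derivable (mono_smooth _ _)|exact: derivable_cst].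
  rewrite (pd_cst _ 0) addr0 mxE; elim/ord2_ind: i => /=.
    rewrite pd0_mono perp0 !em; exact: split_id.
  rewrite pd1_mono perp1 !em /= exprS; ring.
exists ((a + b).+1%:R^-1 *: mono a b.+1), (- ((a + b).+1%:R^-1 * a%:R) *: mono a.-1 b).
split; [by apply/Z/poly2_mono; rewrite addnS ltnS| |].
  by apply/Z/poly2_mono; rewrite (leq_trans _ abn)// leq_add2r leq_pred.
move=> i x; rewrite -[_ *: mono a b.+1]addr0 pd_lin; [|exact: smooth_derivable (mono_smooth _ _)|exact: derivable_cst].
rewrite (pd_cst _ 0) addr0 mxE; elim/ord2_ind: i => /=.
  rewrite pd0_mono perp0 !em /= exprS; ring.
rewrite pd1_mono perp1 !em monoE [(a + b)%N]addnC.
rewrite [LHS]mulrC [LHS]split_id /=; ring.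
Qed.

Lemma polyv_split n q : polyv n q -> stokes_split n q.
Proof.
move=> pq; have sS := stokes_split_subsp n.
have h i r : poly2 n r -> stokes_split n (embv i r).
  apply: (poly2_ind (S := [set r | stokes_split n (embv i r)])).
    split; first rewrite /= (_ : embv i 0 = 0); first by case: sS.
      by apply/funext => x; apply/matrixP => k l; rewrite !mxE; case: ifP.
    move=> a f g Sf Sg /=; rewrite (_ : embv i _ = a *: embv i f + embv i g); first exact: (proj2 sS).
    apply/funext => x; apply/matrixP => k l; rewrite !fctE !mxE.
    by case: ifP => //; rewrite mulr0 addr0.
  by move=> a b abn /=; exact: embv_mono_split.
have -> : q = embv 0 (vcomp q 0) + embv 1 (vcomp q 1).
  apply/funext => x; apply/matrixP => i l; rewrite !fctE !mxE (ord1 l) /vcomp.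
  by elim/ord2_ind: i; rewrite /= ?addr0 ?add0r.
by apply: subspD => //; exact: h.
Qed.

End Stokes.

Section ZeroLeft.
Context {R : realType} (D : set (R * R)).

Lemma inner0l (f : R * R -> R) : inner D 0 f = 0.
Proof.
rewrite /inner (_ : (fun x => _) = fun=> 0); first by rewrite /Rintegral integral0.
by apply/funext => x; rewrite mul0r.
Qed.

Lemma innerM0l m n (F : R * R -> 'M[R]_(m, n)) : innerM D 0 F = 0.
Proof.
rewrite /innerM (_ : (fun x => _) = fun=> 0); first by rewrite /Rintegral integral0.
apply/funext => x; by rewrite /frob big1// => i _; rewrite big1// => j _; rewrite mxE mul0r.
Qed.

End ZeroLeft.

Lemma perp_smooth (R : realType) i : smooth (fun x : R * R => perp x i 0).
Proof.
elim/ord2_ind: i.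
  by rewrite (_ : (fun x => _) = mono 0 1); [exact: mono_smooth|apply/funext => x; rewrite mxE monoE expr0 mul1r].
rewrite (_ : (fun x => _) = -1 *: mono 1 0); first exact: (subspZ _ (@smooth_subsp R) (mono_smooth 1 0)).
by apply/funext => x; rewrite mxE scaleN1r fctE monoE expr0 mulr1.
Qed.

Lemma poly_hat_smooth (R : realType) (D : set (R * R)) n m (q : R * R -> R) :
  poly_hat D n m q -> smooth q.
Proof.
move=> [c hc]; set z := barycenter D; set d := diam D.
have aff (i : 'I_2) (b : R) : smooth (fun x : R * R => (coord i x - b) / d).
  rewrite (_ : (fun x => _) = d^-1 *: (coord i + (fun=> - b))); last first.
    by apply/funext => x; rewrite mulrC.
  apply: (subspZ _ (@smooth_subsp R)); apply: smoothD; [exact: smooth_coord|exact: smooth_cst].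
have ex f k : smooth f -> smooth (fun x : R * R => f x ^+ k).
  move=> sf; elim: k => [|k IH].
    by rewrite (_ : (fun x => _) = fun=> 1); [exact: smooth_cst|apply/funext => x; rewrite expr0].
  by rewrite (_ : (fun x => _) = f * (fun x => f x ^+ k));
    [exact: smoothM|apply/funext => x; rewrite exprS].
rewrite (_ : q = \sum_(i < n.+1) \sum_(j < n.+1 | (i + j <= n)%N && (m < (i + j)%N%:Z))
   c i j *: ((fun x => ((coord 0 x - z.1) / d) ^+ i) * (fun x => ((coord 1 x - z.2) / d) ^+ j))); last first.
  apply/funext => x; rewrite hc fct_sumE; apply: eq_bigr => i _.
  by rewrite fct_sumE; apply: eq_bigr => j _; rewrite -mulrA.
do 2 apply: subsp_sum (@smooth_subsp R) _ => ? _.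
by apply: (subspZ _ (@smooth_subsp R)); apply: smoothM; apply: (ex _ _ (aff _ _)).
Qed.

Lemma divvE (R : realType) (D : set (R * R)) (v : R * R -> 'cV[R]_2) x :
  divv D v x = wd D 0 (vcomp v 0) x + wd D 1 (vcomp v 1) x.
Proof. by rewrite /divv sum_ord2. Qed.

Section LocalSpaces.
Context {R : realType} (E : polygon R) (pE : polygonal_domain E).
Local Notation pt := (R * R)%type.
Local Notation C := (cell E).

Let dE : domain C. Proof. exact: polygonal_domain_domain. Qed.
Let mC : measurable2 C. Proof. exact: domain_meas. Qed.
Let oC : open C. Proof. by case: dE. Qed.
Let bC : bounded_set C. Proof. by case: dE. Qed.
Let C0 : C !=set0. Proof. by case: dE. Qed.

Lemma frob_vec (n : 'cV[R]_2) (v : pt -> 'cV[R]_2) :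
  (fun x => frob (v x) n) = n 0 0 *: vcomp v 0 + n 1 0 *: vcomp v 1.
Proof. by apply/funext => x; rewrite frob_col2 [v x 0 0 * _]mulrC [v x 1 0 * _]mulrC. Qed.

Lemma poly_edge_frob n e (w : 'cV[R]_2) (v : pt -> 'cV[R]_2) : polyv n v -> poly_edge e n (fun x => frob (v x) w).
Proof.
move=> pv; rewrite frob_vec; apply: subspD; first exact: poly_edge_subsp.
  by apply: subspZ; [exact: poly_edge_subsp|exact: poly2_edge].
by apply: subspZ; [exact: poly_edge_subsp|exact: poly2_edge].
Qed.

(** The Stokes condition holds with the pressure minus the gradient part of the
  polynomial Laplacian, normalised to mean zero; the enhancement condition holds
  because the projection fixes polynomials. *)
Lemma polyv_Vh_loc k p : (0 < k)%N -> polyv k p -> Vh_loc k E p.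
Proof.
move=> k0 pp; split.
- exact: polyv_SG pp.
- pose q : pt -> 'cV[R]_2 := fun x => \col_i clap (vcomp p i) x.
  have eq i : vcomp q i = clap (vcomp p i) by apply/funext => x; rewrite /vcomp mxE.
  have pq : polyv k.-2 q by move=> i; rewrite eq; exact: poly2_clap.
  have [r [w [pr pw h]]] := polyv_split pq.
  have sr : sqi leb2 C r by exact: poly2_sqi pr.
  have [p0 o] := proj0P dE 0 sr.
  have [c ec] := poly2_0 p0; rewrite ec in o.
  have hc : inner C (fun x => c - r x) (cst 1) = 0.
    rewrite (_ : (fun x => c - r x) = -1 *: (r \- fun=> c)); last first.
      by apply/funext => x; rewrite scaleN1r !fctE /= opprB.
    have sd : sqi leb2 C (r \- fun=> c).
      apply: (@poly2_sqi _ _ k.-2.+1) => //.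
      exact: (subspB (poly2_subsp _) pr (poly2_cst _ c)).
    have s1 : sqi leb2 C (fun=> 1) by apply: (@poly2_sqi _ _ 0) => //; exact: poly2_cst.
    rewrite -[LHS]/(ipg leb2 C _ _) (psdZl (psd_ipg leb2 mC))//.
    by rewrite -[X in _ * X]/(inner C _ _) o ?mulr0//; exact: poly2_cst.
  exists (fun x => c - r x), w; split => //; [|by apply: poly2_le pw; case: k k0 {pp pq pr h} => [|[|k]]|].
    apply/(L2P _ mC); apply: (@poly2_sqi _ _ k.-2.+1) => //.
    rewrite (_ : (fun x => _) = (fun=> c) - r)//; exact: (subspB (poly2_subsp _) (poly2_cst _ c) pr).
  move=> i psi tp.
  have ps : poly2 k.-2.+1 (fun x => c - r x).
    rewrite (_ : (fun x => _) = (fun=> c) - r)//; exact: (subspB (poly2_subsp _) (poly2_cst _ c) pr).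
  rewrite (inner_clap_poly oC (pp i) tp) (inner_pd_poly oC i ps tp) opprK -eq.
  rewrite -[inner C (vcomp q i) psi]mul1r -inner_test_lin//.
  + congr inner; apply/funext => x; rewrite scale1r !fctE /vcomp h.
    rewrite (_ : (fun y => c - r y) = -1 *: r + (fun=> c)); last by apply/funext => y; rewrite !fctE scaleN1r addrC.
    rewrite pd_lin; [|exact: smooth_derivable (poly2_smooth pr)|exact: derivable_cst].
    by rewrite pd_cst addr0 mulN1r addrAC subrr add0r.
  + exact: poly2_loc (pq i).
  + exact: poly2_loc (poly2_pd i ps).
- exists (pd 0 (vcomp p 0) + pd 1 (vcomp p 1)).
    by apply: subspD; [exact: poly2_subsp|exact: poly2_pd|exact: poly2_pd].
  apply: ae_imp2 (poly2_wd 0 oC (pp 0)) (poly2_wd 1 oC (pp 1)) => x h0 h1 Dx.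
  by rewrite /divv sum_ord2 h0// h1.
- move=> e eE; split; first exact: poly_edge_frob.
  by apply: (poly_edge_le (leq_maxl _ _)); exact: poly_edge_frob.
- move=> q _; rewrite projG_self//.
  rewrite (_ : p \- p = 0); last by apply/funext => x; rewrite /= subrr.
  exact: innerM0l.
Qed.

Lemma Vh_loc_SG k v : Vh_loc k E v -> SG E v.
Proof. by case. Qed.

Lemma Hh_loc_SD l f : Hh_loc l E f -> SD E f.
Proof. by case. Qed.

Lemma H1_sqi f : H1 C f -> sqi leb2 C f.
Proof. by move=> /(H1P _ dE)[]. Qed.

Lemma Vh_loc_sqi k v : Vh_loc k E v -> sqiM C v.
Proof.
move=> /Vh_loc_SG sv i j; rewrite (ord1 j) (_ : ent v i 0 = vcomp v i)//.
by apply: H1_sqi; case: (sv i).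
Qed.

Lemma Hh_loc_sqi l f : Hh_loc l E f -> sqi leb2 C f.
Proof. by move=> [[_ [/H1_sqi]]]. Qed.

Lemma Vh_loc_subsp k : (0 < k)%N -> subsp (Vh_loc k E).
Proof.
move=> k0; split.
  by apply: polyv_Vh_loc k0 _ => i; rewrite (_ : vcomp _ _ = fun=> 0);
    [exact: poly2_cst|apply/funext => x; rewrite /vcomp mxE].
move=> a u v Vu Vv; have Su := Vh_loc_SG Vu; have Sv := Vh_loc_SG Vv.
have Suv : SG E (a *: u + v) by exact: (proj2 (SG_subsp pE)).
case: Vu => _ [s1 [p1 [L1 o1 P1 H1']]] [d1 Pd1 D1] e1 q1.
case: Vv => _ [s2 [p2 [L2' o2 P2 H2']]] [d2 Pd2 D2] e2 q2.
have S1 : sqi leb2 C s1 by apply/(L2P _ mC).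
have S2 : sqi leb2 C s2 by apply/(L2P _ mC).
have L u' i : SG E u' -> loc_integrable C (vcomp u' i).
  by move=> h; apply: loc_integrable_sqi => //; apply: H1_sqi; case: (h i).
have lq i (p : pt -> R) : smooth p -> loc_integrable C (fun x => perp x i 0 * p x).
  move=> sp; apply: loc_integrable_cont => // x _.
  by have h := smooth_cont (smoothM (@perp_smooth R i) sp); exact: h.
split; [exact: Suv|..].
- exists (a *: s1 + s2), (a *: p1 + p2); split.
  + by apply/(L2P _ mC); exact: (proj2 (sqi_subsp leb2 mC)).
  + have s1' : sqi leb2 C (cst 1) by apply: (@poly2_sqi _ _ 0) => //; exact: poly2_cst.
    rewrite -[LHS]/(ipg leb2 C _ _); case: (psd_ipg leb2 mC) => _ -> //.
    by rewrite -![ipg _ _ _ _]/(inner C _ _) o1 o2 mulr0 addr0.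
  + exact: (proj2 (poly2_subsp _)).
  + move=> i psi tp; have tc := test_fun_clap tp; have td := test_fun_pd i tp.
    rewrite vcomp_lin (inner_test_lin a oC (L u i Su) (L v i Sv) tc).
    rewrite (inner_test_lin a oC (loc_integrable_sqi mC S1) (loc_integrable_sqi mC S2) td).
    rewrite (_ : (fun x => _) = a *: (fun x => perp x i 0 * p1 x) + (fun x => perp x i 0 * p2 x)).
      rewrite (inner_test_lin a oC (lq i _ (poly2_smooth P1)) (lq i _ (poly2_smooth P2)) tp).
      rewrite -(H1' i psi tp) -(H2' i psi tp).
      by rewrite opprD addrACA mulrBr.
    apply/funext => x; rewrite -[LHS]/(perp x i 0 * (a * p1 x + p2 x)).
    by rewrite -[RHS]/(a * (perp x i 0 * p1 x) + perp x i 0 * p2 x) mulrDr mulrCA.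
- exists (a *: d1 + d2); first exact: (proj2 (poly2_subsp _)).
  have h i := H1_wd_lin a i dE (Su i).2 (Sv i).2.
  have h12 : {ae leb2, forall x, C x -> divv C u x = d1 x /\ divv C v x = d2 x}.
    by apply: ae_imp2 D1 D2 => x h1 h2 Dx; split; [exact: h1|exact: h2].
  have h01 : {ae leb2, forall x, C x ->
      wd C 0 (a *: vcomp u 0 + vcomp v 0) x = a * wd C 0 (vcomp u 0) x + wd C 0 (vcomp v 0) x /\
      wd C 1 (a *: vcomp u 1 + vcomp v 1) x = a * wd C 1 (vcomp u 1) x + wd C 1 (vcomp v 1) x}.
    by apply: ae_imp2 (h 0) (h 1) => x h1 h2 Dx; split; [exact: h1|exact: h2].
  apply: ae_imp2 h12 h01 => x g1 g2 Dx; have [k1 k2] := g1 Dx; have [k3 k4] := g2 Dx.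
  apply: (etrans (divvE C (a *: u + v) x)).
  have e i : wd C i (vcomp (a *: u + v) i) x = wd C i (a *: vcomp u i + vcomp v i) x.
    by rewrite vcomp_lin.
  apply: (etrans (f_equal2 +%R (etrans (e 0) k3) (etrans (e 1) k4))).
  apply: (etrans _ (f_equal2 (fun s t => a * s + t) k1 k2)).
  apply: (etrans _ (esym (f_equal2 (fun s t => a * s + t) (divvE C u x) (divvE C v x)))).
  set A := wd C 0 _ x; set B := wd C 0 _ x; set A' := wd C 1 _ x; set B' := wd C 1 _ x.
  clear; move: A B A' B'; move=> A B A' B'; ring.
- move=> e eE; have [a1 b1] := e1 e eE; have [a2 b2] := e2 e eE.
  have fl w : (fun x => frob ((a *: u + v) x) w) =
      a *: (fun x => frob (u x) w) + (fun x => frob (v x) w).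
    apply/funext => x; rewrite !frob_col2 -![(a *: u + v) x]/(a *: u x + v x) !mx_lin.
    by rewrite -[RHS]/(a * frob (u x) w + frob (v x) w) !frob_col2; ring.
  by rewrite !fl; split; apply: (proj2 (poly_edge_subsp _ _)).
- move=> q hq; rewrite projG_lin//.
  have -> : (a *: u + v) \- (a *: projG E k u + projG E k v) =
     a *: (u \- projG E k u) + (v \- projG E k v).
    exact: lin_subE.
  have sP w : SG E w -> sqiM C (w \- projG E k w).
    move=> Sw; have sw : sqiM C w.
      move=> i j; rewrite (ord1 j); rewrite (_ : ent w i 0 = vcomp w i)//.
      by apply: H1_sqi; case: (Sw i).
    have sp : sqiM C (projG E k w).
      by move=> i j; rewrite (ord1 j); apply: poly2_sqi (projG_polyv pE _ Sw i).
    exact: (subspB (sqiM_subsp mC) sw sp).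
  have sq : sqiM C (fun x => q x *: perp x).
    move=> i j; rewrite (ord1 j) (_ : ent _ i 0 = fun x => q x * perp x i 0); last first.
      by apply/funext => x; rewrite /ent mxE.
    apply: C0bar_sqi => //; apply: C0bar_cont.
    exact: smooth_cont (smoothM (poly_hat_smooth hq) (@perp_smooth R i)).
  case: (psd_innerM (m := 2) (n := 1) mC) => _ Lin _ _.
  apply: (etrans (Lin a _ _ _ (sP _ Su) (sP _ Sv) sq)).
  apply: (etrans (f_equal2 (fun s t => a * s + t) (q1 q hq) (q2 q hq))).
  by rewrite mulr0 addr0.
Qed.

Lemma sum_bdval_poly (w : 'cV[R]_2) n p e x : poly2 n p -> e \in edges E -> segment e x ->
  \sum_i w i 0 * bdval C (pd i p) x = \sum_i w i 0 * pd i p x.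
Proof.
move=> pp eE xe; apply: eq_bigr => i _; rewrite bdval_smooth//; first exact: poly2_smooth pp.
exact: edge_in_closure xe.
Qed.

Lemma poly2_Hh_loc l p : (1 < l)%N -> poly2 l p -> Hh_loc l E p.
Proof.
move=> l1 pp; have l0 : (0 < l)%N by exact: ltnW.
split.
- by split; [exact: smooth_C1bar (poly2_smooth pp)|exact: poly2_H2 pp].
- exists (clap (clap p)).
    have pcc := poly2_clap (poly2_clap pp).
    by apply: poly2_le pcc; rewrite -!subn1 -!subnDA leq_subr.
  move=> psi tp; have tc := test_fun_clap tp.
  exact: (etrans (inner_clap_poly oC pp tc) (inner_clap_poly oC (poly2_clap pp) tp)).
- move=> e eE; split; first exact: poly_edge_le (leq_maxl _ _) (poly2_edge e pp).
  apply: (@poly_edge_ext _ _ _ _ (enor e 0 0 *: pd 0 p + enor e 1 0 *: pd 1 p)).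
    by move=> s hs; rewrite (sum_bdval_poly _ pp eE (edge_pt_segment e hs)) sum_ord2.
  apply: subspD; first exact: poly_edge_subsp.
    by apply: (subspZ _ (poly_edge_subsp e _)); apply: poly2_edge; exact: poly2_pd.
  by apply: (subspZ _ (poly_edge_subsp e _)); apply: poly2_edge; exact: poly2_pd.
- move=> q _; rewrite projD_self//.
  rewrite (_ : p \- p = 0); last by apply/funext => x; rewrite /= subrr.
  exact: inner0l.
Qed.

Lemma Hh_loc_subsp l : (1 < l)%N -> subsp (Hh_loc l E).
Proof.
move=> l1; have l0 : (0 < l)%N by exact: ltnW.
split; first by apply: (poly2_Hh_loc l1); exact: (poly2_cst l 0).
move=> a u v Vu Vv; have Su := Hh_loc_SD Vu; have Sv := Hh_loc_SD Vv.
have su := Hh_loc_sqi Vu; have sv := Hh_loc_sqi Vv.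
have lu := loc_integrable_sqi mC su; have lv := loc_integrable_sqi mC sv.
case: Vu => _ [p1 P1 h1] e1 q1; case: Vv => _ [p2 P2 h2] e2 q2.
split; first exact: (proj2 (SD_subsp pE)).
- exists (a *: p1 + p2); first exact: (proj2 (poly2_subsp _)).
  move=> psi tp; have tc := test_fun_clap (test_fun_clap tp).
  rewrite (inner_test_lin a oC lu lv tc).
  by rewrite (inner_test_lin a oC (poly2_loc oC P1) (poly2_loc oC P2) tp) h1// h2.
- move=> e eE; have [a1 b1] := e1 e eE; have [a2 b2] := e2 e eE.
  split; first exact: (proj2 (poly_edge_subsp _ _)).
  apply: poly_edge_ext (proj2 (poly_edge_subsp e l.-1) a _ _ b1 b2) => s hs.
  have eS := edge_pt_segment e hs.
  rewrite -[RHS]/(a * (\sum_i _) + \sum_i _) mulr_sumr -big_split; apply: eq_bigr => i _.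
  by rewrite (bdval_pd_lin pE a i Su.1 Sv.1 eE eS) mulrDr mulrCA.
- move=> q hq; rewrite projD_lin//.
  have -> : (a *: u + v) \- (a *: projD E l u + projD E l v) =
     a *: (u \- projD E l u) + (v \- projD E l v).
    exact: lin_subE.
  have sP w : SD E w -> sqi leb2 C w -> sqi leb2 C (w \- projD E l w).
    move=> Sw sw; apply: (subspB (sqi_subsp leb2 mC) sw).
    exact: poly2_sqi (projD_poly2 pE l0 Sw).
  have sq : sqi leb2 C q.
    by apply: C0bar_sqi => //; apply: C0bar_cont; exact: smooth_cont (poly_hat_smooth hq).
  have S1 := sP _ Su su; have S2 := sP _ Sv sv.
  case: (psd_ipg leb2 mC) => _ L _ _.
  apply: (etrans (L a _ _ _ S1 S2 sq)).
  apply: (etrans (f_equal2 (fun s t => a * s + t) (q1 q hq) (q2 q hq))).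
  by rewrite mulr0 addr0.
Qed.

End LocalSpaces.

(** * Stabilised mass forms *)

Section Stabilised.
Context {R : realType} {V : lmodType R}.
Context (S : set V) (I : V -> V -> R) (P : V -> V) (s : V -> V -> R) (a b : R).
Hypothesis pI : psd S I.
Hypothesis PS : forall v, S v -> S (P v).
Hypothesis Plin : forall c u v, S u -> S v -> P (c *: u + v) = c *: P u + P v.
Hypothesis PP : forall v, S v -> P (P v) = P v.
Hypothesis Porth : forall v, S v -> I (v - P v) (P v) = 0.
Hypothesis slin : forall c u v w, S u -> S v -> S w ->
  s (c *: u + v) w = c * s u w + s v w.
Hypothesis sC : forall u v, S u -> S v -> s u v = s v u.
Hypothesis a0 : 0 < a.
Hypothesis sab : forall v, S v -> P v = 0 -> a * I v v <= s v v <= b * I v v.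

Definition stab_form u v := I (P u) (P v) + s (u - P u) (v - P v).

Let sS : subsp S. Proof. by case: pI. Qed.
Let SB u : S u -> S (u - P u). Proof. by move=> Su; apply: subspB => //; exact: PS. Qed.

Let PB u : S u -> P (u - P u) = 0.
Proof.
by move=> Su; rewrite addrC -scaleN1r Plin ?PP// ?scaleN1r ?addNr//; exact: PS.
Qed.

Let pyth v : S v -> I v v = I (P v) (P v) + I (v - P v) (v - P v).
Proof.
move=> Sv; have SP := PS Sv; have Sd := SB Sv.
have h : I v (P v) - I (P v) (P v) = 0 by rewrite -(psdBl pI)// Porth.
rewrite (psdBl pI Sv SP Sd) (psdBr pI Sv SP Sv) (psdBr pI Sv SP SP) (psdC pI SP Sv).
lra.
Qed.

Let sge0 v : S v -> 0 <= s (v - P v) (v - P v).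
Proof.
move=> Sv; have [+ _] := andP (sab (SB Sv) (PB Sv)); apply: le_trans.
by rewrite mulr_ge0 ?(ltW a0)// (psd_ge0 pI)//; exact: SB.
Qed.

(** Both parts are semidefinite; since the projection is orthogonal, the bounds on
  the stabilisation over its kernel add up to bounds over the whole space. *)
Lemma stab_form_psd : psd S stab_form.
Proof.
split=> // [c u v w Su Sv Sw|u v Su Sv|u Su]; rewrite /stab_form.
- have SPu := PS Su; have SPv := PS Sv; have SPw := PS Sw.
  rewrite Plin//; case: (pI) => _ L _ _; rewrite L//.
  have -> : c *: u + v - (c *: P u + P v) = c *: (u - P u) + (v - P v).
    exact: lin_subE.
  by rewrite slin//; [ring|exact: SB..].
- exact: (f_equal2 +%R (psdC pI (PS Su) (PS Sv)) (sC (SB Su) (SB Sv))).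
- by rewrite addr_ge0 ?sge0// (psd_ge0 pI)//; exact: PS.
Qed.

Lemma stab_form_le v : S v -> stab_form v v <= Num.max 1 b * I v v.
Proof.
move=> Sv; rewrite (pyth Sv) mulrDr /stab_form; have [_ h] := andP (sab (SB Sv) (PB Sv)).
apply: lerD; first by rewrite ler_peMl ?le_max ?lexx// (psd_ge0 pI)//; exact: PS.
apply: le_trans h _; apply: ler_wpM2r; first by rewrite (psd_ge0 pI)//; exact: SB.
by rewrite le_max lexx orbT.
Qed.

Lemma stab_form_ge v : S v -> Num.min 1 a * I v v <= stab_form v v.
Proof.
move=> Sv; rewrite (pyth Sv) mulrDr /stab_form; have [h _] := andP (sab (SB Sv) (PB Sv)).
apply: lerD; first by rewrite ler_piMl ?ge_min ?lexx// (psd_ge0 pI)//; exact: PS.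
apply: le_trans h; apply: ler_wpM2r; first by rewrite (psd_ge0 pI)//; exact: SB.
by rewrite ge_min lexx orbT.
Qed.

End Stabilised.

Section ElementForms.
Context {R : realType} (E : polygon R) (pE : polygonal_domain E).
Context (k l : nat) (k0 : (0 < k)%N) (l1 : (1 < l)%N) (a b : R) (a0 : 0 < a).
Context (st : stab R) (adm : stab_admissible k l a b E st).
Local Notation pt := (R * R)%type.
Local Notation C := (cell E).

Let dE : domain C. Proof. exact: polygonal_domain_domain. Qed.
Let mC : measurable2 C. Proof. exact: domain_meas. Qed.
Let l0 : (0 < l)%N. Proof. exact: ltnW. Qed.

Let pI : psd (Hh_loc l E) (inner C).
Proof.
apply: (psd_sub (psd_ipg leb2 mC)) (Hh_loc_subsp pE l1) _ => f.
exact: Hh_loc_sqi.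
Qed.

Let pIF : psd (Vh_loc k E) (innerM C).
Proof.
apply: (psd_sub (psd_innerM mC)) (Vh_loc_subsp pE k0) _ => f.
exact: Vh_loc_sqi.
Qed.

Let proj0_Hh f : Hh_loc l E f -> Hh_loc l E (proj0 E l f).
Proof. by move=> hf; apply: (poly2_Hh_loc pE l1); case: (proj0P dE l (Hh_loc_sqi pE hf)). Qed.

Let proj0M_polyv v : sqiM C v -> polyv k (proj0M E k v).
Proof.
move=> sv i; rewrite (_ : vcomp _ i = proj0 E k (ent v i 0)); first by case: (proj0P dE k (sv i 0)).
by apply/funext => x; rewrite /vcomp mxE.
Qed.

Let proj0M_Vh v : Vh_loc k E v -> Vh_loc k E (proj0M E k v).
Proof. by move=> hv; apply: (polyv_Vh_loc pE k0); apply: proj0M_polyv; exact: Vh_loc_sqi hv. Qed.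

Lemma m_loc_form : m_loc l E st = stab_form (inner C) (proj0 E l) (s0 st).
Proof. by []. Qed.

Lemma mF_loc_form : mF_loc k E st = stab_form (innerM C) (proj0M E k) (s0F st).
Proof. by []. Qed.

Lemma m_loc_psd : [/\ psd (Hh_loc l E) (m_loc l E st),
  (forall f, Hh_loc l E f -> m_loc l E st f f <= Num.max 1 b * inner C f f) &
  (forall f, Hh_loc l E f -> Num.min 1 a * inner C f f <= m_loc l E st f f)].
Proof.
rewrite m_loc_form; have [_ _ [[slin sC _] sab] _] := adm.
have lin c u v : Hh_loc l E u -> Hh_loc l E v ->
    proj0 E l (c *: u + v) = c *: proj0 E l u + proj0 E l v.
  by move=> hu hv; exact: (proj0_lin dE l c (Hh_loc_sqi pE hu) (Hh_loc_sqi pE hv)).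
have PP v : Hh_loc l E v -> proj0 E l (proj0 E l v) = proj0 E l v.
  by move=> hv; apply: proj0_poly => //; case: (proj0P dE l (Hh_loc_sqi pE hv)).
have orth v : Hh_loc l E v -> inner C (v - proj0 E l v) (proj0 E l v) = 0.
  by move=> hv; have [pp o] := proj0P dE l (Hh_loc_sqi pE hv); exact: o.
have sab' v : Hh_loc l E v -> proj0 E l v = 0 ->
    a * inner C v v <= s0 st v v <= b * inner C v v.
  by move=> hv h; apply: sab => // x; rewrite h.
split; [exact: stab_form_psd pI proj0_Hh lin PP slin sC a0 sab'| |].
  by move=> f hf; exact: (stab_form_le pI proj0_Hh lin PP orth sab').
by move=> f hf; exact: (stab_form_ge pI proj0_Hh lin PP orth sab').
Qed.

Lemma mF_loc_psd : [/\ psd (Vh_loc k E) (mF_loc k E st),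
  (forall f, Vh_loc k E f -> mF_loc k E st f f <= Num.max 1 b * innerM C f f) &
  (forall f, Vh_loc k E f -> Num.min 1 a * innerM C f f <= mF_loc k E st f f)].
Proof.
rewrite mF_loc_form; have [[[slin sC _] sab] _ _ _] := adm.
have lin c u v : Vh_loc k E u -> Vh_loc k E v ->
    proj0M E k (c *: u + v) = c *: proj0M E k u + proj0M E k v.
  by move=> hu hv; exact: (proj0M_lin dE k c (Vh_loc_sqi pE hu) (Vh_loc_sqi pE hv)).
have entv (w : pt -> 'cV[R]_2) : polyv k w -> forall i j, poly2 k (ent w i j).
  by move=> pw i j; rewrite (ord1 j); exact: pw.
have PP v : Vh_loc k E v -> proj0M E k (proj0M E k v) = proj0M E k v.
  move=> hv; apply: (proj0M_poly dE); apply: entv.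
  by apply: proj0M_polyv; exact: Vh_loc_sqi hv.
have orth v : Vh_loc k E v -> innerM C (v - proj0M E k v) (proj0M E k v) = 0.
  move=> hv; have sv := Vh_loc_sqi pE hv; have sP := proj0M_sqi dE k sv.
  rewrite (psdBl (psd_innerM mC))//; apply/eqP; rewrite subr_eq0; apply/eqP.
  apply: esym; apply: (proj0M_inner dE) => //; apply: entv.
  exact: proj0M_polyv.
have sab' v : Vh_loc k E v -> proj0M E k v = 0 ->
    a * innerM C v v <= s0F st v v <= b * innerM C v v.
  by move=> hv h; apply: sab => // x; rewrite h.
split; [exact: stab_form_psd pIF proj0M_Vh lin PP slin sC a0 sab'| |].
  by move=> f hf; exact: (stab_form_le pIF proj0M_Vh lin PP orth sab').
by move=> f hf; exact: (stab_form_ge pIF proj0M_Vh lin PP orth sab').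
Qed.

Lemma aG_loc_ge v : Vh_loc k E v -> Num.min 1 a * BG E v v <= aG_loc k E st v v.
Proof.
move=> hv; have Sv := Vh_loc_SG hv; have [_ [_ sab] _ _] := adm.
have hp : Vh_loc k E (projG E k v) by apply: (polyv_Vh_loc pE k0); exact: projG_polyv.
have hd : Vh_loc k E (v - projG E k v) by apply: (subspB (Vh_loc_subsp pE k0)).
have P0 : projG E k (v - projG E k v) = 0.
  rewrite addrC -scaleN1r (projG_lin pE k _ (Vh_loc_SG hp) Sv).
  by rewrite (projG_self pE (projG_polyv pE k Sv)) scaleN1r addNr.
have [s1 _] := andP (sab _ hd (fun x => congr1 (fun f => f x) P0)).
have := gradient_coercive pE k Sv; rewrite /aG_loc; rewrite -/(BG E _ _) in s1 *.
set A := innerM _ _ _; have A0 : 0 <= A.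
  apply: (psd_ge0 (psd_innerM mC)); apply: (proj0M_sqi dE); apply: gradv_sqi => // i.
  by case: (Sv i).
set B := BG E (_ - _) _ => h; have B0 : 0 <= B by apply: (psd_ge0 (psd_BG pE)); exact: Vh_loc_SG hd.
have m0 : 0 <= Num.min 1 a by rewrite le_min ler01 ltW.
apply: (le_trans (ler_wpM2l m0 h)); rewrite mulrDr; apply: lerD.
  by rewrite ler_piMl// ge_min lexx.
by apply: (le_trans _ s1); apply: ler_wpM2r => //; rewrite ge_min lexx orbT.
Qed.

Lemma aD_loc_ge f : Hh_loc l E f -> Num.min 1 a * BD E f f <= aD_loc l E st f f.
Proof.
move=> hv; have Sv := Hh_loc_SD hv; have [_ _ _ [_ sab]] := adm.
have hp : Hh_loc l E (projD E l f) by apply: (poly2_Hh_loc pE l1); exact: projD_poly2.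
have hd : Hh_loc l E (f - projD E l f) by apply: (subspB (Hh_loc_subsp pE l1)).
have P0 : projD E l (f - projD E l f) = 0.
  rewrite addrC -scaleN1r (projD_lin pE l0 _ (Hh_loc_SD hp) Sv).
  by rewrite (projD_self pE l0 (projD_poly2 pE l0 Sv)) scaleN1r addNr.
have [s1 _] := andP (sab _ hd (fun x => congr1 (fun f => f x) P0)).
have := hessian_coercive pE l0 Sv; rewrite /aD_loc; rewrite -/(BD E _ _) in s1 *.
set A := innerM _ _ _; have A0 : 0 <= A.
  by apply: (psd_ge0 (psd_innerM mC)); apply: (proj0M_sqi dE); apply: (hess_sqi pE); case: Sv.
set B := BD E (_ - _) _ => h; have B0 : 0 <= B by apply: (psd_ge0 (psd_BD pE)); exact: Hh_loc_SD hd.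
have m0 : 0 <= Num.min 1 a by rewrite le_min ler01 ltW.
apply: (le_trans (ler_wpM2l m0 h)); rewrite mulrDr; apply: lerD.
  by rewrite ler_piMl// ge_min lexx.
by apply: (le_trans _ s1); apply: ler_wpM2r => //; rewrite ge_min lexx orbT.
Qed.

End ElementForms.

(** * Integration over one-dimensional slices *)

Section Interval.
Context {R : realType}.
Local Notation leb := (@lebesgue_measure R).
Implicit Types (F G w : R -> R) (a b : R) (A : set R).

Lemma near_rightP a (P : set R) : (\forall x \near a^'+, P x) <->
  exists2 d, 0 < d & forall x, a < x < a + d -> P x.
Proof.
split.
  move=> /nbhs_ballP[d /= d0 h]; exists d => // x /andP[ax xd]; apply: h => //.
  by rewrite /ball /= distrC ger0_norm; lra.
move=> [d d0 h]; apply/nbhs_ballP; exists d => //= x; rewrite /ball /= => xd ax.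
by apply: h; rewrite ax; move: xd; rewrite ltr_norml => /andP[h1 h2]; lra.
Qed.

Lemma near_leftP a (P : set R) : (\forall x \near a^'-, P x) <->
  exists2 d, 0 < d & forall x, a - d < x < a -> P x.
Proof.
split.
  move=> /nbhs_ballP[d /= d0 h]; exists d => // x /andP[ax xd]; apply: h => //.
  by rewrite /ball /= ger0_norm; lra.
move=> [d d0 h]; apply/nbhs_ballP; exists d => //= x; rewrite /ball /= => xd ax.
by apply: h; rewrite ax; move: xd; rewrite ltr_norml => /andP[h1 h2]; lra.
Qed.

Lemma le_Rint_subset d (T : measurableType d) (mu : {measure set T -> \bar R})
    (A B : set T) (f : T -> R) : measurable A -> measurable B -> A `<=` B -> intg mu B f ->
  (forall x, B x -> 0 <= f x) -> \int[mu]_(x in A) f x <= \int[mu]_(x in B) f x.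
Proof.
move=> mA mB AB iB f0; have iA := intgS mB mA AB iB.
rewrite -lee_fin !Rint_EFin//; apply: ge0_subset_integral => //.
  by apply/measurable_EFinP; exact: intg_meas iB.
Qed.

Lemma intg_small F A a b (e : R) : a < b -> `]a, b[ `<=` A -> measurable A ->
  intg leb A F -> \int[leb]_(x in A) `|F x| < e * (b - a) ->
  exists2 x, a < x < b & `|F x| < e.
Proof.
move=> ab IA mA iF h; apply: contrapT => /forall2NP no.
have iaF := intg_norm iF.
have ci : intg leb `]a, b[ (fun=> e).
  apply: (intg_bound _ _ (measurable_cst _) (fun x _ => lexx `|e|)) => //.
  by rewrite /= lebesgue_measure_itv/= lte_fin ab ltry.
suff : e * (b - a) <= \int[leb]_(x in A) `|F x| by rewrite leNgt h.
apply: (@le_trans _ _ (\int[leb]_(x in `]a, b[) `|F x|)); last first.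
  by apply: le_Rint_subset => // x _.
rewrite (_ : e * (b - a) = \int[leb]_(x in `]a, b[) e).
  apply: le_Rint => //; first exact: intgS iaF.
  move=> x /=; rewrite in_itv /= => xab; have [//|/negP] := no x.
  by rewrite -leNgt.
rewrite Rintegral_cst//= lebesgue_measure_itv/= lte_fin ab //.
Qed.

Lemma norm_sum5 (k t1 t2 t3 t4 t5 : R) : `|t1| < k -> `|t2| < k -> `|t3| < k ->
  `|t4| < k -> `|t5| < k -> `|- t1 + t2 - t3 + t4 + t5| <= 5 * k.
Proof.
rewrite !ltr_norml => /andP[? ?] /andP[? ?] /andP[? ?] /andP[? ?] /andP[? ?].
by rewrite ler_norml; apply/andP; split; lra.
Qed.

(** A continuous function that is an L1-limit of continuously differentiable
  ones, along with the derivatives, is a primitive of the limit. *)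
Lemma itv_green F G a b : a < b -> {within `[a, b], continuous F} ->
  intg leb setT G ->
  (forall e, 0 < e -> exists w w',
    [/\ forall x, a < x < b -> is_derive x 1 w (w' x) /\ {for x, continuous w'},
        intg leb `]a, b[ (fun x => w x - F x),
        intg leb `]a, b[ (fun x => w' x - G x),
        \int[leb]_(x in `]a, b[) `|w x - F x| < e &
        \int[leb]_(x in `]a, b[) `|w' x - G x| < e]) ->
  F b - F a = \int[leb]_(x in `]a, b[) G x.
Proof.
move=> ab cF iG happ; have mI : measurable (`]a, b[%classic : set R) by [].
pose I x := \int[leb]_(t in `[a, x]) G t.
have iGc : intg leb `[a, b] G.
  exact: intgS iG.
have cI : {within `[a, b], continuous I} := parameterized_integral_continuous (ltW ab) iGc.
pose P x := F x - I x.
have cP : {within `[a, b], continuous P} by move=> x; apply: cvgB; [exact: cF|exact: cI].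
suff : P b = P a.
  rewrite /P /I set_itv1 Rintegral_set1 subr0 => /eqP; rewrite subr_eq addrC -subr_eq => /eqP ->.
  have iGoc : intg leb `]a, b[ G by exact: intgS iG.
  rewrite -(Rintegral_itv_bndo_bndc (a := BLeft a)) ?(Rintegral_itv_obnd_cbnd iGoc)//.
  exact: intgS iG.
have [_ Pa Pb] := (continuous_within_itvP P ab).1 cP.
apply/eqP; rewrite -subr_eq0 -normr_le0; apply/ler_addgt0Pl => e e0; rewrite addr0.
pose k := e / 5.
have k0 : 0 < k by rewrite divr_gt0.
have [d /andP[d0 dab] [da db]] : exists2 d, 0 < d < (b - a) / 2 &
   (forall x, a < x < a + d -> `|P x - P a| < k) /\ (forall x, b - d < x < b -> `|P x - P b| < k).
  have /near_rightP[d1 d10 h1] := Pa _ (nbhsx_ballx (P a) k k0).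
  have /near_leftP[d2 d20 h2] := Pb _ (nbhsx_ballx (P b) k k0).
  exists (Num.min (Num.min d1 d2) ((b - a) / 3)).
    by rewrite lt_min lt_min d10 d20 gt_min; apply/andP; split; [lra|apply/orP; right; lra].
  split=> x /andP[xa xb].
    rewrite distrC; apply: h1; rewrite xa (lt_le_trans xb)// lerD2l.
    by rewrite ge_min ge_min lexx.
  rewrite distrC; apply: h2; rewrite xb (le_lt_trans _ xa)// lerD2l lerN2.
  by rewrite ge_min ge_min lexx orbT.
have kd0 : 0 < k * Num.min d 1 by rewrite mulr_gt0// lt_min d0 ltr01.
have [w [w' [dw iF iG' sF sG]]] := happ _ kd0.
have m1 : k * Num.min d 1 <= k * d by rewrite ler_pM2l// ge_min lexx.
have m2 : k * Num.min d 1 <= k by rewrite ler_piMr ?ge_min ?lexx ?orbT// ltW.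
have [x ax hx] : exists2 x, a < x < a + d & `|w x - F x| < k.
  apply: (intg_small (A := `]a, b[)) => //.
  - by rewrite ltrDl.
  - by move=> t /=; rewrite !in_itv /= => /andP[-> h]; apply: lt_trans h _; lra.
  - by rewrite addrAC subrr add0r; exact: lt_le_trans sF m1.
have [y yb hy] : exists2 y, b - d < y < b & `|w y - F y| < k.
  apply: (intg_small (A := `]a, b[)) => //.
  - by rewrite gtrBl.
  - by move=> t /=; rewrite !in_itv /= => /andP[h ->]; rewrite andbT; apply: lt_trans h; lra.
  - by rewrite opprB addrCA subrr addr0; exact: lt_le_trans sF m1.
have [/andP[ax' xd] /andP[yd yb']] := (ax, yb).
have xyI : `[x, y] `<=` `]a, b[.
  by move=> t /=; rewrite !in_itv /= => /andP[h1 h2]; apply/andP; split; lra.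
have xy : x < y by lra.
have wxy : w y - w x = \int[leb]_(t in `[x, y]) w' t.
  apply: esym; apply: Rint_deriv; first exact: ltW.
    by move=> t /xyI /=; rewrite in_itv => /dw[].
  by apply: continuous_in_subspaceT => t; rewrite inE => /xyI /=; rewrite in_itv => /dw[].
have Ixy : I y - I x = \int[leb]_(t in `[x, y]) G t.
  rewrite /I (Rintegral_itvB (a := BLeft a) (b := BRight y)) ?bnd_simp; [|exact: intgS iG|exact: ltW..].
  by rewrite Rintegral_itv_obnd_cbnd//; exact: intgS iG.
have hd : `|(w y - w x) - (I y - I x)| < k.
  have iwG : intg leb `[x, y] (fun t => w' t - G t) by exact: intgS iG'.
  have ic : intg leb `[x, y] w'.
    by apply: eq_intg (intgD _ iwG (intgS _ _ _ iG)) => // t _; rewrite subrK.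
  rewrite wxy Ixy -RintegralB//; last exact: intgS iG.
  apply: le_lt_trans (le_normr_Rintegral _ _) _ => //.
  apply: le_lt_trans (lt_le_trans sG m2); apply: le_Rint_subset => //.
  exact: intg_norm iG'.
have h1 := da x ax; have h2 := db y yb.
rewrite {1}(_ : P b - P a = - (P y - P b) + (P x - P a) - (w y - F y) + (w x - F x) +
  ((w y - w x) - (I y - I x))); last by rewrite /P; ring.
by rewrite (_ : e = 5 * k); [exact: norm_sum5|rewrite /k; field].
Qed.

(** An interval free of boundary points of A is connected to its left end: it lies
  in A or in the complement as a whole. *)
Lemma no_boundary_itv A a b (c : bool) : a < b -> open A ->
  (forall z, a < z < b -> closure A z -> A z) -> (\forall z \near a^'+, A z <-> c) ->
  forall z, a < z < b -> A z <-> c.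
Proof.
move=> ab oA cA /near_rightP[d d0 hd]; pose J := `]a, b[%classic : set R.
have JP z : J z <-> a < z < b by rewrite /J /= in_itv.
have cJ : connected J by apply/connected_intervalP; exact: interval_is_interval.
pose t := a + Num.min d (b - a) / 2.
have mt : Num.min d (b - a) / 2 < Num.min d (b - a).
  have : 0 < Num.min d (b - a) by rewrite lt_min d0 subr_gt0.
  by move=> m0; lra.
have m0 : 0 < Num.min d (b - a) by rewrite lt_min d0 subr_gt0.
have md : Num.min d (b - a) <= d by rewrite ge_min lexx.
have mb : Num.min d (b - a) <= b - a by rewrite ge_min lexx orbT.
have tc : A t <-> c by apply: hd; rewrite /t; apply/andP; split; lra.
have tJ : J t by apply/JP; rewrite /t; apply/andP; split; lra.
have [[x [Jx Ax]]|no] := pselect (exists x, J x /\ A x).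
  have e : J `&` A = J.
    apply: cJ; first by exists x.
      by exists A.
    exists (closure A); first exact: closed_closure.
    apply/seteqP; split=> z [Jz Az]; split => //; first exact: subset_closure.
    by apply: cA => //; exact/JP.
  have AJ z : J z -> A z by rewrite -{1}e => -[].
  have {tc}c1 : c by apply/tc; exact: AJ.
  by move=> z /JP /AJ Az.
have {tc}c0 : ~ c by move=> /tc At; apply: no; exists t.
by move=> z /JP Jz; split=> // Az; case: no; exists z.
Qed.

(** Telescoping along a line: between two consecutive boundary points the line stays
  inside or outside A, and each boundary point is an exit (up) or an entry. *)
Lemma slice_sum (I : eqType) A (X : I -> R) (up : I -> bool) F G :
  open A -> (exists b, forall z, A z -> z < b) -> intg leb A G ->
  (forall p q, p < q -> `]p, q[ `<=` A -> F q - F p = \int[leb]_(x in `]p, q[) G x) ->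
  forall (s : seq I) a (c : bool), path <%R a (map X s) ->
  (forall z, a < z -> closure A z -> ~ A z -> z \in map X s) ->
  (forall e, e \in s -> (\forall z \near (X e)^'-, A z <-> up e) /\
                        (\forall z \near (X e)^'+, A z <-> ~~ up e)) ->
  (\forall z \near a^'+, A z <-> c) ->
  \int[leb]_(x in A `&` `]a, +oo[) G x =
    \sum_(e <- s) (if up e then F (X e) else - F (X e)) - (if c then F a else 0).
Proof.
move=> oA [b hb] iG hFG; have mA : measurable A by exact: open_measurable.
elim=> [|e s IH] a c /=.
  move=> _ bd _ hc; rewrite big_nil.
  have aM0 : a <= Num.max a b by rewrite le_max lexx.
  have aB : a < Num.max a b + 1 by lra.
  have hJ := no_boundary_itv aB oA _ hc.
  have h z : a < z < Num.max a b + 1 -> A z <-> c.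
    apply: hJ => y /andP[ay _] cy; apply: contrapT => nA; have := bd _ ay cy nA.
    by rewrite in_nil.
  have c0 : c = false.
    apply/negbTE/negP; have aM : a <= Num.max a b by rewrite le_max lexx.
    have bM : b <= Num.max a b by rewrite le_max lexx orbT.
    have /h[_ k] : a < Num.max a b + 1 / 2 < Num.max a b + 1 by apply/andP; split; lra.
    by move=> /k /hb; lra.
  rewrite c0 subr0 (_ : A `&` _ = set0) ?Rintegral_set0//.
  apply/seteqP; split=> // z [Az /=]; rewrite in_itv /= andbT => az.
  have bM : b <= Num.max a b by rewrite le_max lexx orbT.
  have /h[] : a < z < Num.max a b + 1 by rewrite az/=; have := hb _ Az; lra.
  by rewrite c0 => /(_ Az).
move=> /andP[aq ps] bd sd hc; set q := X e in aq ps *.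
have [l r] := sd e (mem_head _ _).
have qb z : q < z -> closure A z -> ~ A z -> z \in map X s.
  move=> qz cz nz; have := bd z (lt_trans aq qz) cz nz; rewrite inE => /orP[/eqP zq|//].
  by move: qz; rewrite zq ltxx.
have allq z : z \in map X s -> q < z.
  by move: ps; rewrite (path_sortedE lt_trans) => /andP[/allP + _]; exact.
have hJ z : a < z < q -> A z <-> c.
  apply: (no_boundary_itv aq oA _ hc) => y /andP[ay yq] cy; apply: contrapT => nA.
  have := bd y ay cy nA; rewrite inE => /orP[/eqP yq'|/allq qy].
    by move: yq; rewrite yq' ltxx.
  by move: (lt_trans yq qy); rewrite ltxx.
have cu : c = up e.
  move: l => /near_leftP[d d0 hd].
  pose t := q - Num.min d (q - a) / 2.
  have m0 : 0 < Num.min d (q - a) by rewrite lt_min d0 subr_gt0.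
  have md : Num.min d (q - a) <= d by rewrite ge_min lexx.
  have mb : Num.min d (q - a) <= q - a by rewrite ge_min lexx orbT.
  have t1 : A t <-> up e by apply: hd; rewrite /t; apply/andP; split; rewrite -/q; lra.
  have t2 : A t <-> c by apply: hJ; rewrite /t; apply/andP; split; lra.
  by apply/idP/idP => [/t2/t1|/t1/t2].
have nq : ~ A q.
  move=> Aq; have nb : nbhs q A by exact: open_nbhs_nbhs.
  have nl : \forall z \near q^'-, A z by exact: cvg_within nb.
  have nr : \forall z \near q^'+, A z by exact: cvg_within nb.
  move: l r nl nr => /near_leftP[d1 d10 h1] /near_rightP[d2 d20 h2] /near_leftP[d3 d30 h3] /near_rightP[d4 d40 h4].
  have u1 : up e.
    have m0 : 0 < Num.min d1 d3 by rewrite lt_min d10.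
    have m1 : Num.min d1 d3 <= d1 by rewrite ge_min lexx.
    have m3 : Num.min d1 d3 <= d3 by rewrite ge_min lexx orbT.
    apply/(h1 (q - Num.min d1 d3 / 2)); first by rewrite -/q; apply/andP; split; lra.
    by apply: h3; apply/andP; split; lra.
  have u2 : ~~ up e.
    have m0 : 0 < Num.min d2 d4 by rewrite lt_min d20.
    have m1 : Num.min d2 d4 <= d2 by rewrite ge_min lexx.
    have m3 : Num.min d2 d4 <= d4 by rewrite ge_min lexx orbT.
    apply/(h2 (q + Num.min d2 d4 / 2)); first by rewrite -/q; apply/andP; split; lra.
    by apply: h4; apply/andP; split; lra.
  by move: u2; rewrite u1.
have -> : A `&` `]a, +oo[ = (A `&` `]a, q[) `|` (A `&` `]q, +oo[).
  apply/seteqP; split=> z.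
    move=> [Az /=]; rewrite in_itv /= andbT => az; case: (ltgtP z q) => [zq|qz|zq].
    - by left; split => //=; rewrite in_itv /= az.
    - by right; split => //=; rewrite in_itv /= andbT.
    - by move: Az; rewrite zq.
  move=> [[Az /=]|[Az /=]]; rewrite in_itv /= => /andP[h1 _]; split => //=; rewrite in_itv /= andbT//.
  exact: lt_trans aq h1.
have mAq : measurable (A `&` `]a, q[) by exact: measurableI.
have mqi : measurable (A `&` `]q, +oo[) by exact: measurableI.
have iU : intg leb (A `&` `]a, q[ `|` A `&` `]q, +oo[) G.
  apply: intgS iG; [exact: mA|exact: measurableU|by move=> z [[]|[]]].
rewrite Rintegral_setU//; last first.
  apply/disj_setPS => z [[_ /=]]; rewrite !in_itv /= andbT => /andP[_ zq] [_ qz].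
  by move: (lt_trans zq qz); rewrite ltxx.
rewrite (IH q (~~ up e) ps qb _ r); last by move=> e' es; apply: sd; rewrite inE es orbT.
rewrite big_cons -/q -cu; case: c cu hJ hc => cu hJ hc /=.
  rewrite (_ : A `&` _ = (`]a, q[%classic : set R)); last first.
    apply/seteqP; split=> [z [] //|z /= zI]; split => //; move: zI; rewrite in_itv /=.
    by move=> /hJ[_]; exact.
  rewrite -hFG//; last by move=> z /=; rewrite in_itv /= => /hJ[_]; exact.
  by rewrite subr0; ring.
rewrite (_ : A `&` _ = set0) ?Rintegral_set0; first by ring.
by apply/seteqP; split=> // z [Az /=]; rewrite in_itv /= => /hJ[/(_ Az)].
Qed.

End Interval.

(** * Polygons near their edges *)

Section Sides.
Context {R : realType}.
Local Notation pt := (R * R)%type.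
Implicit Types (e : pt * pt) (w x z : pt) (E : set pt) (L : seq (pt * pt)).

(** Positive on the left of the edge, where an oriented polygon lies. *)
Definition cross e w : R := (e.2 - e.1).1 * w.2 - (e.2 - e.1).2 * w.1.

(** The part of the definition of a polygon that survives exchanging the
  coordinates, which turns the sign t of the orientation. *)
Definition sided (t : R) E L := [/\
  [/\ open E, bounded_set E & closure E `\` E = \bigcup_(e in [set` L]) segment e],
  (forall e, e \in L -> e.1 != e.2), uniq L,
  (forall e e', e \in L -> e' \in L -> e != e' -> open_segment e `&` segment e' = set0) &
  forall e x, e \in L -> open_segment e x -> exists2 r, 0 < r &
    forall z, `|z - x| < r ->
      (0 < t * cross e (z - x) -> E z) /\ (t * cross e (z - x) < 0 -> ~ E z)].

Lemma edge_compact e : compact (segment e).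
Proof.
apply: continuous_compact; last exact: segment_compact.
by apply: continuous_subspaceT; exact: edge_pt_cont.
Qed.

(** A connected set that avoids the boundary cannot leave an open set. *)
Lemma avoid_boundary (K E : set pt) x z : connected K -> open E ->
  K `&` (closure E `\` E) = set0 -> K x -> K z -> E x -> E z.
Proof.
move=> cK oE h Kx Kz Ex; have e : K `&` E = K.
  apply: cK; first by exists x.
    by exists E.
  exists (closure E); first exact: closed_closure.
  apply/seteqP; split=> y [Ky Ey]; split => //; first exact: subset_closure.
  by apply: contrapT => nE; have : (K `&` (closure E `\` E)) y; [|rewrite h].
by have : K z by []; rewrite -{1}e => -[].
Qed.

Lemma ball_avoids L x : (forall e, e \in L -> ~ segment e x) ->
  exists2 r, 0 < r & forall z, `|z - x| < r -> forall e, e \in L -> ~ segment e z.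
Proof.
elim: L => [|e L IH] h; first by exists 1.
have [r r0 hr] := IH (fun e' eL => h e' (introT orP (or_intror eL))).
have cS : closed (segment e) by apply: compact_closed; [exact: norm_hausdorff|exact: edge_compact].
have oS : open (~` segment e) by exact: closed_openC.
have /nbhs_ballP[d /= d0 hd] : nbhs x (~` segment e).
  by apply: open_nbhs_nbhs; split => //; apply: h; exact: mem_head.
exists (Num.min r d); first by rewrite lt_min r0.
move=> z; rewrite lt_min => /andP[zr zd] e'; rewrite inE => /predU1P[->|]; last exact: hr.
by apply: hd; rewrite -ball_normE /= distrC.
Qed.

Lemma edge_ptE e s : edge_pt e s = (e.1.1 + s * (e.2.1 - e.1.1), e.1.2 + s * (e.2.2 - e.1.2)).
Proof. by []. Qed.

Lemma cross_edge e s t : cross e (edge_pt e s - edge_pt e t) = 0.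
Proof. by rewrite /cross !edge_ptE /=; ring. Qed.

Lemma ball_segment (a b x : pt) r s : `|a - x| < r -> `|b - x| < r -> 0 <= s <= 1 ->
  `|edge_pt (a, b) s - x| < r.
Proof.
move=> ha hb /andP[s0 s1].
have -> : edge_pt (a, b) s - x = (1 - s) *: (a - x) + s *: (b - x).
  by apply: injective_projections; rewrite edge_ptE /= /GRing.scale /=; ring.
apply: (le_lt_trans (ler_normD _ _)); rewrite !normrZ !ger0_norm ?subr_ge0//.
have [->|s0'] := eqVneq s 0; first by rewrite subr0 mul1r mul0r addr0.
have s0'' : 0 < s by rewrite lt_neqAle eq_sym s0'.
rewrite (_ : r = (1 - s) * r + s * r); last by ring.
by apply: ler_ltD; [apply: ler_wpM2l; [rewrite subr_ge0|exact: ltW]|rewrite ltr_pM2l].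
Qed.

Lemma cross_segment e (a b x : pt) s (t : R) : 0 < t * cross e (a - x) -> 0 < t * cross e (b - x) ->
  0 <= s <= 1 -> 0 < t * cross e (edge_pt (a, b) s - x).
Proof.
move=> ha hb /andP[s0 s1].
have -> : t * cross e (edge_pt (a, b) s - x) =
    (1 - s) * (t * cross e (a - x)) + s * (t * cross e (b - x)).
  by rewrite /cross edge_ptE /=; ring.
have [->|s0'] := eqVneq s 0; first by rewrite subr0 mul1r mul0r addr0.
have s0'' : 0 < s by rewrite lt_neqAle eq_sym s0'.
by apply: ltr_wpDl; [rewrite mulr_ge0 ?subr_ge0// ltW|rewrite mulr_gt0].
Qed.

Lemma enor0 e : enor e 0 0 = (elen e)^-1 * (e.2.2 - e.1.2).
Proof. by rewrite /enor mxE /= /etan mxE /coords mxE. Qed.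

Lemma enor1 e : enor e 1 0 = - ((elen e)^-1 * (e.2.1 - e.1.1)).
Proof. by rewrite /enor mxE /= /etan mxE /coords mxE. Qed.

Lemma cross_shift e x s : e.1 != e.2 -> cross e (shift_pt x s (enor e) - x) = - (s * elen e).
Proof.
move=> e12; have l0 : elen e != 0 by rewrite gt_eqF// elen_gt0.
have l2 : elen e ^+ 2 = (e.2.1 - e.1.1) ^+ 2 + (e.2.2 - e.1.2) ^+ 2.
  by rewrite /elen euclid_distE sqr_sqrtr// addr_ge0// sqr_ge0.
have -> : cross e (shift_pt x s (enor e) - x) =
    (e.2.1 - e.1.1) * (s * enor e 1 0) - (e.2.2 - e.1.2) * (s * enor e 0 0).
  by rewrite /cross /shift_pt /= ![_.1 + _]addrC ![_.2 + _]addrC !addrK.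
rewrite enor0 enor1; apply: (mulIf l0); rewrite mulNr -mulrA -expr2 l2.
by set l := elen e in l0 *; field.
Qed.

Lemma norm_shift x s (v : 'cV[R]_2) : `|shift_pt x s v - x| <= `|s| * (`|v 0 0| + `|v 1 0|).
Proof.
rewrite /shift_pt prod_normE /= ![_.1 + _]addrC ![_.2 + _]addrC !addrK !normrM mulrDr.
by rewrite ge_max lerDl lerDr !mulr_ge0.
Qed.

(** Near an interior point of an edge no other edge is met, so the two half-balls
  cut by the edge avoid the boundary and lie on the side that the polygon
  prescribes along the normal. *)
Lemma polygonal_sided P : polygonal_domain P -> sided 1 (cell P) (edges P).
Proof.
move=> pP; have [[oE E0 cE bE] bdE [ed uf pf] dis side] := pP.
split => //; first by have := map_uniq uf.
move=> e x eL ex; set n := enor e.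
have xS e' : e' \in [seq e'' <- edges P | e'' != e] -> ~ segment e' x.
  rewrite mem_filter /= => /andP[ne eL'] xe'.
  have : (open_segment e `&` segment e') x by [].
  by rewrite dis// eq_sym.
have [r r0 hr] := ball_avoids xS.
exists r => // z zr; rewrite !mul1r.
have avoid y : `|y - x| < r -> cross e (y - x) != 0 -> ~ (closure (cell P) `\` cell P) y.
  move=> yr cy; rewrite bdE => -[e' /= e'L ye'].
  have [ee|ne] := eqVneq e' e; last by case: (hr y yr e' _ ye'); rewrite mem_filter /= ne.
  move: ye' ex; rewrite ee => -[s _ sy] [t _ tx]; move: cy.
  by rewrite -sy -tx cross_edge eqxx.
have nn : 0 <= `|n 0 0| + `|n 1 0| by rewrite addr_ge0.
have /near_rightP[d d0 hd] := side e x eL ex.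
pose q := r / (`|n 0 0| + `|n 1 0| + 1).
have n1 : 0 < `|n 0 0| + `|n 1 0| + 1 by rewrite ltr_wpDl.
have q0 : 0 < q by rewrite divr_gt0.
pose s := Num.min d q / 2.
have m0 : 0 < Num.min d q by rewrite lt_min d0.
have md : Num.min d q <= d by rewrite ge_min lexx.
have mq : Num.min d q <= q by rewrite ge_min lexx orbT.
have s0 : 0 < s by rewrite divr_gt0.
have sd : s < d by rewrite /s; lra.
have sq : s < q by rewrite /s; lra.
have [Pm Pp] : cell P (shift_pt x (- s) n) /\ ~ closure (cell P) (shift_pt x s n).
  by apply: hd; rewrite add0r s0.
have bs c : `|c| = s -> `|shift_pt x c n - x| < r.
  move=> cs; apply: le_lt_trans (norm_shift _ _ _) _; rewrite cs.
  have : q * (`|n 0 0| + `|n 1 0| + 1) = r by rewrite /q divfK// gt_eqF.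
  move=> <-; apply: (@lt_le_trans _ _ (q * (`|n 0 0| + `|n 1 0| + 1))) => //.
  apply: (@le_lt_trans _ _ (s * (`|n 0 0| + `|n 1 0| + 1))).
    by rewrite ler_pM2l// lerDl.
  by rewrite ltr_pM2r.
have el : 0 < elen e by apply: elen_gt0; exact: ed.
have key a b : `|a - x| < r -> `|b - x| < r -> (exists t, 0 < t * cross e (a - x) /\ 0 < t * cross e (b - x)) ->
    cell P a -> cell P b.
  move=> ar br [t [ta tb]]; apply: (avoid_boundary (K := segment (a, b))) => //.
  - apply: connected_continuous_connected.
      by apply/connected_intervalP; exact: interval_is_interval.
    by apply: continuous_subspaceT; exact: edge_pt_cont.
  - apply/seteqP; split=> // y [[u /=]]; rewrite in_itv /= => hu <-; apply: avoid.
      exact: ball_segment.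
    have := cross_segment ta tb hu; rewrite neq_lt => h.
    by case: (ltgtP (cross e (edge_pt (a, b) u - x)) 0) h => // ->; rewrite mulr0 ltxx.
  - by exists 0; rewrite /= ?in_itv /= ?lexx ?ler01// edge_ptE /= !mul0r !addr0; case: (a).
  - by exists 1; rewrite /= ?in_itv /= ?lexx ?ler01// edge_ptE /= !mul1r !subrKC; case: (b).
split=> h.
  apply: key (bs (- s) _) zr _ Pm; first by rewrite normrN gtr0_norm.
  by exists 1; rewrite cross_shift ?ed// mulNr opprK !mul1r; split => //; rewrite mulr_gt0.
move=> Ez; apply: Pp; apply: subset_closure.
apply: key zr (bs s _) _ Ez; first by rewrite gtr0_norm.
by exists (-1); rewrite cross_shift ?ed// !mulN1r opprK oppr_gt0; split => //; rewrite mulr_gt0.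
Qed.

Definition swap (x : pt) : pt := (x.2, x.1).

Lemma swap_cont : continuous swap.
Proof. by move=> x; exact: swap_continuous. Qed.

Lemma swap_closure E : closure (swap @^-1` E) = swap @^-1` closure E.
Proof.
have h (A : set pt) : closure (swap @^-1` A) `<=` swap @^-1` closure A.
  move=> x cx B /swap_cont /cx[y [/= Ey By]]; by exists (swap y).
apply/seteqP; split; first exact: h.
move=> x cx; have e : E = swap @^-1` (swap @^-1` E) by apply/seteqP; split=> -[].
by move: cx => /=; rewrite {1}e => /h /=; case: x.
Qed.

Definition swape e : pt * pt := (swap e.1, swap e.2).

Lemma swap_sided t E L : sided t E L -> sided (- t) (swap @^-1` E) (map swape L).
Proof.
move=> [[oE bE cE] ed uL dis side].
have sP e s : edge_pt (swape e) s = swap (edge_pt e s) by [].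
have swapK : involutive swap by case.
have mP e' : e' \in map swape L -> exists2 e, e \in L & e' = swape e by move/mapP.
have inj : injective swape by move=> [[a b] [c d]] [[a' b'] [c' d']] [-> -> -> ->].
have segs e x : segment (swape e) x <-> segment e (swap x).
  split=> [[s hs <-]|[s hs h]]; first by exists s => //; rewrite sP swapK.
  by exists s => //; rewrite sP h swapK.
have osegs e x : open_segment (swape e) x <-> open_segment e (swap x).
  split=> [[s hs <-]|[s hs h]]; first by exists s => //; rewrite sP swapK.
  by exists s => //; rewrite sP h swapK.
have nS (x : pt) : `|swap x| = `|x| by rewrite !prod_normE /= maxC.
split.
- split.
  + by apply: open_comp => // x _; exact: swap_cont.
  + have [M [rM hM]] := bE; exists M; split => // x /hM h y /= Ey.
    by rewrite -nS; exact: h.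
  + rewrite swap_closure; apply/seteqP; split=> x.
      move=> [h1 h2]; have : (closure E `\` E) (swap x) by [].
      rewrite cE => -[e /= eL ex]; exists (swape e); last exact/segs.
      by rewrite /= map_f.
    move=> [e' /= /mP[e eL ->] /segs ex]; have : (closure E `\` E) (swap x).
      by rewrite cE; exists e.
    by [].
- move=> e' /mP[e eL ->]; apply: contraNneq (ed e eL) => /= h; apply/eqP.
  by rewrite -[e.1]swapK -[e.2]swapK h.
- by rewrite map_inj_uniq.
- move=> e1 e2 /mP[e eL ->] /mP[e' eL' ->] ne; apply/seteqP; split=> // x [/osegs h1 /segs h2].
  have ne' : e != e' by apply: contraNneq ne => ->.
  by have : (open_segment e `&` segment e') (swap x) by []; rewrite dis.
- move=> e' x /mP[e eL ->] /osegs ex; have [r r0 h] := side e _ eL ex.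
  exists r => // z zr; have zr' : `|swap z - swap x| < r by rewrite -nS in zr.
  have [h1 h2] := h _ zr'.
  have cr : - t * cross (swape e) (z - x) = t * cross e (swap z - swap x).
    by rewrite /cross /=; ring.
  by rewrite cr; split.
Qed.

End Sides.

(** * Green's formula on polygons *)

Section SlicePolygon.
Context {R : realType}.
Local Notation pt := (R * R)%type.
Local Notation leb := (@lebesgue_measure R).
Implicit Types (e : pt * pt) (E : set pt) (L : seq (pt * pt)).

(** The contribution of the edge e to the slice at height y, signed by whether the
  slice enters or leaves the polygon; the asymmetric test counts a vertex once. *)
Definition crossing (t : R) (F : pt -> R) e (y : R) : R :=
  if (e.1.2 < y) != (e.2.2 < y) then
    (if 0 < t * (e.2.2 - e.1.2) then 1 else -1) *
    F (edge_pt e ((y - e.1.2) / (e.2.2 - e.1.2)))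
  else 0.

Lemma slice_closure E (x y : R) : closure [set x | E (x, y)] x -> closure E (x, y).
Proof.
move=> cx B nB; have c : (fun x' : R => (x', y)) @ x --> (x, y) by exact: pair_cont0.
by have [x' [/= Ex Bx]] := cx _ (c _ nB); exists (x', y).
Qed.

Lemma sub_closure_itv (p q : R) : p < q -> `[p, q] `<=` closure `]p, q[.
Proof.
move=> pq x; rewrite /= in_itv /= => /andP[px xq] B /nbhs_ballP[d /= d0 hB].
have m0 : 0 < Num.min d (q - p) by rewrite lt_min d0 subr_gt0.
have md : Num.min d (q - p) <= d by rewrite ge_min lexx.
have mq : Num.min d (q - p) <= q - p by rewrite ge_min lexx orbT.
have [xp|xp] := ltP x ((p + q) / 2).
  exists (x + Num.min d (q - p) / 3); split; first by rewrite /= in_itv /=; apply/andP; split; lra.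
  by apply: hB; rewrite -ball_normE /= opprD addNKr normrN gtr0_norm ?divr_gt0//; lra.
exists (x - Num.min d (q - p) / 3); split; first by rewrite /= in_itv /=; apply/andP; split; lra.
by apply: hB; rewrite -ball_normE /= opprB addrCA subrr addr0 gtr0_norm ?divr_gt0//; lra.
Qed.

Lemma near_left_norm (x r z : R) : x - r < z < x -> `|z - x| < r.
Proof. by move=> /andP[h1 h2]; rewrite ltr_norml; apply/andP; split; lra. Qed.

Lemma near_right_norm (x r z : R) : x < z < x + r -> `|z - x| < r.
Proof. by move=> /andP[h1 h2]; rewrite ltr_norml; apply/andP; split; lra. Qed.

Lemma outside_bound (m z : R) : z < - (m + 2) + 1 -> - (m + 1) <= z -> False.
Proof. by move=> ? ?; lra. Qed.

Lemma crossing_frac (a b y : R) : y != a -> y != b -> (a < y) != (b < y) ->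
  0 < (y - a) / (b - a) < 1.
Proof.
move=> ya yb; have [ay|ya'] := ltP a y; have [by'|yb'] := ltP b y => //= _.
  have h : y < b by rewrite lt_neqAle yb.
  have h0 : 0 < b - a by lra.
  by apply/andP; split; [rewrite divr_gt0// subr_gt0|rewrite ltr_pdivrMr// mul1r; lra].
have h : y < a by rewrite lt_neqAle ya.
rewrite (_ : (y - a) / (b - a) = (a - y) / (a - b)); last by field; apply/andP; split; lra.
have h0 : 0 < a - b by lra.
by apply/andP; split; [rewrite divr_gt0// subr_gt0|rewrite ltr_pdivrMr// mul1r; lra].
Qed.

Lemma frac_crossing (a b u : R) : a != b -> 0 < u < 1 ->
  (a < a + u * (b - a)) != (b < a + u * (b - a)).
Proof.
move=> ab /andP[u0 u1].
have [lt|ge] := ltP a b.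
  have h1 : 0 < u * (b - a) by rewrite mulr_gt0 ?subr_gt0.
  have h2 : 0 < (1 - u) * (b - a) by rewrite mulr_gt0 ?subr_gt0.
  have -> : (a < a + u * (b - a)) = true by lra.
  by have -> : (b < a + u * (b - a)) = false by apply/negbTE; rewrite -leNgt; lra.
have gt : b < a by rewrite lt_neqAle eq_sym ab.
have h1 : 0 < u * (a - b) by rewrite mulr_gt0 ?subr_gt0.
have h2 : 0 < (1 - u) * (a - b) by rewrite mulr_gt0 ?subr_gt0.
have -> : (a < a + u * (b - a)) = false by apply/negbTE; rewrite -leNgt; lra.
by have -> : (b < a + u * (b - a)) = true by lra.
Qed.

(** Green's formula on one line.  The hypothesis on y excludes the lines through
  vertices, so the line crosses every edge that it meets transversally. *)
Lemma slice_polygon (t : R) E L (F : pt -> R) (G : R -> R) (y : R) :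
  let A := [set x | E (x, y)] in
  t != 0 -> sided t E L -> (forall e, e \in L -> y != e.1.2 /\ y != e.2.2) ->
  C0bar E F -> intg leb A G ->
  (forall d, 0 < d -> exists w w',
    [/\ forall x, A x -> is_derive x 1 w (w' x) /\ {for x, continuous w'},
        intg leb A (fun x => w x - F (x, y)), intg leb A (fun x => w' x - G x),
        \int[leb]_(x in A) `|w x - F (x, y)| < d &
        \int[leb]_(x in A) `|w' x - G x| < d]) ->
  \int[leb]_(x in A) G x = \sum_(e <- L) crossing t F e y.
Proof.
move=> A t0 [[oE bE bdE] ed uL dis side] gen cF iG happ.
have oA : open A by apply: open_comp => // x _; exact: pair_cont0.
have mA : measurable A by exact: open_measurable.
have [M [rM hM]] := closure_bounded bE.
pose c := `|M| + 2.
have cb z : closure E (z, y) -> `|z| <= `|M| + 1.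
  move=> Az; have : `|(z, y)| <= `|M| + 1.
    by apply: hM Az; rewrite (le_lt_trans (ler_norm _))// ltrDl.
  by rewrite prod_normE /= ge_max => /andP[].
have bA z : A z -> `|z| <= `|M| + 1 by move=> Az; apply: cb; exact: subset_closure.
pose X e := (edge_pt e ((y - e.1.2) / (e.2.2 - e.1.2))).1.
pose up e := 0 < t * (e.2.2 - e.1.2).
pose s := [seq e <- L | (e.1.2 < y) != (e.2.2 < y)].
have sP e : e \in s -> e \in L /\ (e.1.2 < y) != (e.2.2 < y).
  by rewrite mem_filter => /andP[].
have dn0 e : e \in s -> e.2.2 - e.1.2 != 0.
  by move=> /sP[_]; apply: contraNneq => /eqP; rewrite subr_eq0 => /eqP ->.
have Xpt e : e \in s -> edge_pt e ((y - e.1.2) / (e.2.2 - e.1.2)) = (X e, y).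
  move=> es; rewrite /X edge_ptE /=; congr (_, _).
  by rewrite divfK ?dn0//; ring.
have Xseg e : e \in s -> open_segment e (X e, y).
  move=> es; have [eL ce] := sP _ es; have [y1 y2] := gen _ eL.
  exists ((y - e.1.2) / (e.2.2 - e.1.2)); last exact: Xpt.
  by rewrite /= in_itv /=; exact: crossing_frac.
have Xinj : {in s &, injective X}.
  move=> e e' es es' XX; apply/eqP/negPn/negP => ne.
  have [[eL _] [eL' _]] := (sP _ es, sP _ es').
  have : (open_segment e `&` segment e') (X e, y).
    split; first exact: Xseg.
    have [u hu eu] := Xseg _ es'; exists u; last by rewrite XX.
    by move: hu; rewrite /= !in_itv /= => /andP[/ltW -> /ltW ->].
  by rewrite dis.
have hFG p q : p < q -> `]p, q[ `<=` A ->
    F (q, y) - F (p, y) = \int[leb]_(x in `]p, q[) G x.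
  move=> pq IA; pose G' := G \_ A.
  have eG : \int[leb]_(x in `]p, q[) G x = \int[leb]_(x in `]p, q[) G' x.
    by apply: eq_Rint => x Ix; rewrite /G' patchT// inE; exact: IA.
  rewrite eG; apply: (@itv_green _ (fun x => F (x, y))) => //.
  - apply/subspace_continuousP => x xI B nB.
    have cx : closure E (x, y).
      apply: slice_closure; apply: (closure_subset IA).
      exact: sub_closure_itv.
    have := (C0barP E F).1 cF _ cx _ nB; rewrite /nbhs /= /within /= => h.
    have hn : nbhs x [set x' | closure E (x', y) -> B (F (x', y))] by exact: (pair_cont0 h).
    suff : nbhs x [set x' | `[p, q]%classic x' -> B (F (x', y))] by [].
    apply: filterS hn => x' hx' x'I; apply: hx'.
    apply: slice_closure; apply: (closure_subset IA).
    exact: sub_closure_itv.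
  - by apply/intg_restrict.
  move=> d d0; have [w [w' [h1 h2 h3 h4 h5]]] := happ d d0.
  have mI : measurable (`]p, q[%classic : set R) by [].
  exists w, w'; split.
  - by move=> x xI; apply: h1; apply: IA; rewrite /= in_itv.
  - exact: intgS h2.
  - have i3 : intg leb `]p, q[ (fun x => w' x - G x) by exact: intgS h3.
    by apply: (eq_intg _ _ i3) => // x Ix; rewrite /G' patchT// inE; exact: IA.
  - by apply: le_lt_trans h4; apply: le_Rint_subset => //; exact: intg_norm.
  - rewrite (_ : \int[leb]_(x in _) _ = \int[leb]_(x in `]p, q[) `|w' x - G x|).
      by apply: le_lt_trans h5; apply: le_Rint_subset => //; exact: intg_norm.
    by apply: eq_Rint => x Ix; rewrite /G' patchT// inE; exact: IA.
pose s' := sort (fun e e' => X e <= X e') s.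
have ps' : path <%R (- c) (map X s').
  rewrite (path_sortedE lt_trans); apply/andP; split.
    apply/allP => _ /mapP[e + ->]; rewrite mem_sort => es.
    have [eL _] := sP _ es.
    have /cb : closure E (X e, y).
      have [u hu eu] := Xseg _ es.
      have : (closure E `\` E) (X e, y) by rewrite bdE; exists e => //; exists u;
        [move: hu; rewrite /= !in_itv /= => /andP[/ltW -> /ltW ->]|].
      by case.
    by rewrite ler_norml /c => /andP[h _]; lra.
  rewrite lt_sorted_uniq_le; apply/andP; split.
    rewrite map_inj_in_uniq ?sort_uniq ?filter_uniq//.
    by move=> e e'; rewrite !mem_sort; exact: Xinj.
  by rewrite sorted_map; apply: sort_sorted => e e'; exact: le_total.
have key := slice_sum (X := X) (up := up) (F := fun x => F (x, y)) oA _ iG hFG ps' (c := false).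
rewrite subr0 in key.
have eA : A `&` `]- c, +oo[ = A.
  apply/seteqP; split=> [x []//|x Ax]; split => //; rewrite /= in_itv /= andbT.
  by have := bA x Ax; rewrite ler_norml /c => /andP[h _]; lra.
rewrite -{1}eA key; last 4 first.
- by exists c => z /bA; rewrite ler_norml /c => /andP[_ h]; lra.
- move=> z _ cz nz; have : (closure E `\` E) (z, y) by split => //; exact: slice_closure.
  rewrite bdE => -[e /= eL [u]]; rewrite /= in_itv /= => /andP[u0 u1].
  rewrite edge_ptE => -[ez ey]; have [y1 y2] := gen _ eL.
  have u0' : 0 < u.
    by rewrite lt_neqAle u0 andbT; apply: contraNneq y1 => h; rewrite -ey -h mul0r addr0.
  have u1' : u < 1.
    by rewrite lt_neqAle u1 andbT; apply: contraNneq y2 => h; rewrite -ey h mul1r addrC subrK.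
  have d0 : e.1.2 != e.2.2.
    by apply: contraNneq y1 => h; rewrite -ey h subrr mulr0 addr0.
  have es : e \in s.
    by rewrite mem_filter eL andbT -ey; apply: frac_crossing => //; rewrite u0'.
  apply/mapP; exists e; first by rewrite mem_sort.
  rewrite /X edge_ptE /= -ez -ey (_ : _ / _ = u)//; field.
  exact: dn0.
- move=> e; rewrite mem_sort => es; have [eL ce] := sP _ es.
  have [r r0 hr] := side e _ eL (Xseg _ es).
  have cr z : cross e ((z, y) - (X e, y)) = - (e.2.2 - e.1.2) * (z - X e).
    by rewrite /cross /=; ring.
  have nr z : `|(z, y) - (X e, y)| = `|z - X e|.
    by rewrite prod_normE /= subrr normr0; apply/max_idPl.
  have td : t * (e.2.2 - e.1.2) != 0 by rewrite mulf_neq0 ?dn0.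
  have side' z : `|z - X e| < r ->
      (0 < - (t * (e.2.2 - e.1.2)) * (z - X e) -> A z) /\
      (- (t * (e.2.2 - e.1.2)) * (z - X e) < 0 -> ~ A z).
    move=> zr; have := hr (z, y); rewrite nr cr => /(_ zr).
    by rewrite !mulrA !mulrN !mulNr.
  have ln z : X e - r < z < X e -> `|z - X e| < r by exact: near_left_norm.
  have rn z : X e < z < X e + r -> `|z - X e| < r by exact: near_right_norm.
  rewrite /up; case: (ltP 0 (t * (e.2.2 - e.1.2))) => [tp|tn].
    split; [apply/near_leftP|apply/near_rightP]; exists r => // z hz.
      split=> // _; have [k _] := side' z (ln _ hz); apply: k.
      by rewrite mulNr -mulrN mulr_gt0// oppr_gt0 subr_lt0; case/andP: hz.
    split=> // Az; have [_ k] := side' z (rn _ hz); case: k => //.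
    by rewrite mulNr oppr_lt0 mulr_gt0// subr_gt0; case/andP: hz.
  have {}tn : 0 < - (t * (e.2.2 - e.1.2)) by rewrite oppr_gt0 lt_neqAle td.
  split; [apply/near_leftP|apply/near_rightP]; exists r => // z hz.
    split=> // Az; have [_ k] := side' z (ln _ hz); case: k => //.
    by rewrite -oppr_gt0 -mulrN mulr_gt0// oppr_gt0 subr_lt0; case/andP: hz.
  split=> // _; have [k _] := side' z (rn _ hz); apply: k.
  by rewrite mulr_gt0// subr_gt0; case/andP: hz.
- apply/near_rightP; exists 1 => // z /andP[_ hz]; split => // /bA.
  rewrite ler_norml => /andP[h _]; case: (outside_bound hz h).
rewrite /s' (perm_big s) /=; last by rewrite perm_sort.
rewrite big_filter big_mkcond; apply: eq_big_seq => e eL; rewrite /crossing; case: ifP => // ce.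
have es : e \in s by rewrite mem_filter ce.
by rewrite Xpt// /up; case: ifP; rewrite ?mul1r ?mulN1r.
Qed.

Lemma affine_subst (H : R -> R) (p q : R) : p < q -> {within `[0, 1], continuous H} ->
  forall a d, (a, d) = (p, q - p) \/ (a, d) = (q, p - q) ->
  intg leb `[p, q] (fun y => H ((y - a) / d)) /\
  \int[leb]_(y in `[p, q]) H ((y - a) / d) = (q - p) * \int[leb]_(s in `[0, 1]) H s.
Proof.
move=> pq cH; have qp0 : q - p != 0 by rewrite subr_eq0 gt_eqF.
have pq0 : p - q != 0 by rewrite subr_eq0 lt_eqF.
have iH : intg leb `[0, 1] H.
  by apply: continuous_compact_integrable => //; exact: segment_compact.
have drv (c d : R) x : is_derive x (1 : R) (fun y : R => (y - c) / d) d^-1.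
  have -> : (fun y : R => (y - c) / d) = d^-1 *: (id - cst c).
    by apply/funext => y; rewrite !fctE /= mulrC.
  by apply: is_derive_eq; rewrite subr0 scaler1.
have d1 (c d : R) : (fun y : R => (y - c) / d)^`()%classic = cst d^-1.
  by apply/funext => y; rewrite derive1E; have [] := drv c d y.
have cont (c d : R) : continuous (fun y : R => (y - c) / d).
  by move=> y; apply: differentiable_continuous; apply/derivable1_diffP; have [] := drv c d y.
have lr (c d : R) a b : derivable_oo_LRcontinuous (fun y : R => (y - c) / d) a b.
  split; first by move=> x _; have [] := drv c d x.
    by apply: cvg_at_right_filter; exact: cont.
  by apply: cvg_at_left_filter; exact: cont.
have Z1 : 0 = (p - p) / (q - p) by rewrite subrr mul0r.
have Z2 : 1 = (q - p) / (q - p) by rewrite divff.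
have Z3 : 0 = (q - q) / (p - q) by rewrite subrr mul0r.
have Z4 : 1 = (p - q) / (p - q) by rewrite divff.
have iC (c d : R) : (forall y, p <= y <= q -> 0 <= (y - c) / d <= 1) ->
    intg leb `[p, q] (fun y => H ((y - c) / d)).
  move=> hcd; apply: continuous_compact_integrable; first exact: segment_compact.
  apply/subspace_continuousP => x xI B nB.
  have x01 : `[0, 1]%classic ((x - c) / d) by move: xI; rewrite /= !in_itv; exact: hcd.
  have /(_ _ x01 _ nB) h := (subspace_continuousP _ _).1 cH.
  have hn : nbhs x [set y | `[0, 1]%classic ((y - c) / d) -> B (H ((y - c) / d))] by exact: (cont c d x _ h).
  suff : nbhs x [set y | `[p, q]%classic y -> B (H ((y - c) / d))] by [].
  apply: filterS hn => y hy yI; apply: hy; move: yI; rewrite /= !in_itv; exact: hcd.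
have i1 : intg leb `[p, q] (fun y => H ((y - p) / (q - p))).
  apply: iC => y /andP[py yq]; have h : 0 < q - p by lra.
  by apply/andP; split; [rewrite divr_ge0 ?subr_ge0// ltW|rewrite ler_pdivrMr// mul1r; lra].
have i2 : intg leb `[p, q] (fun y => H ((y - q) / (p - q))).
  apply: iC => y /andP[py yq]; have h : 0 < q - p by lra.
  rewrite (_ : (y - q) / (p - q) = (q - y) / (q - p)); last by field; apply/andP.
  by apply/andP; split; [rewrite divr_ge0 ?subr_ge0// ltW|rewrite ler_pdivrMr// mul1r; lra].
move=> a d [[-> ->]|[-> ->]]; split => //.
  have e : \int[leb]_(s in `[0, 1]) H s =
      \int[leb]_(y in `[p, q]) (H ((y - p) / (q - p)) * (q - p)^-1).
    rewrite /Rintegral; congr fine; rewrite {1}Z1 {1}Z2.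
    rewrite (integration_by_substitution_increasing (F := fun y : R => (y - p) / (q - p)) (ltW pq)).
    - by apply: eq_integral => y _; rewrite d1.
    - by move=> x y _ _ xy; rewrite ltr_pM2r ?invr_gt0 ?subr_gt0//; lra.
    - by rewrite d1 => x _; exact: cvg_cst.
    - by rewrite d1; exact: is_cvg_cst.
    - by rewrite d1; exact: is_cvg_cst.
    - exact: lr.
    - by rewrite -Z1 -Z2.
  by rewrite e RintegralZr// mulrCA divff// mulr1.
have e : \int[leb]_(s in `[0, 1]) H s =
    \int[leb]_(y in `[p, q]) (H ((y - q) / (p - q)) * - (p - q)^-1).
  rewrite /Rintegral; congr fine; rewrite {1}Z3 {1}Z4.
  rewrite (integration_by_substitution_decreasing (F := fun y : R => (y - q) / (p - q)) (ltW pq)).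
  - by apply: eq_integral => y _; rewrite d1.
  - by move=> x y _ _ xy; rewrite ltr_nM2r ?invr_lt0 ?subr_lt0//; lra.
  - by rewrite d1 => x _; exact: cvg_cst.
  - by rewrite d1; exact: is_cvg_cst.
  - by rewrite d1; exact: is_cvg_cst.
  - exact: lr.
  - by rewrite -Z3 -Z4.
by rewrite e RintegralZr// -invrN opprB mulrCA divff// mulr1.
Qed.

(** The change of variables between the height y and the parameter of the edge; the
  sign of the crossing and the Jacobian combine to the normal component. *)
Lemma crossing_int (t : R) (F : pt -> R) e : `|t| = 1 ->
  {within `[0, 1], continuous (fun s => F (edge_pt e s))} ->
  intg leb setT (crossing t F e) /\ \int[leb]_y crossing t F e y =
    t * (e.2.2 - e.1.2) * \int[leb]_(s in `[0, 1]) F (edge_pt e s).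
Proof.
move=> t1 cF; set d := e.2.2 - e.1.2; pose H s := F (edge_pt e s).
have [d0|dn] := eqVneq e.1.2 e.2.2.
  have -> : crossing t F e = fun=> 0 by apply/funext => y; rewrite /crossing d0 eqxx.
  split; first exact: intg0.
  by rewrite /d d0 subrr mulr0 mul0r /Rintegral integral0.
pose sg : R := if 0 < t * d then 1 else -1.
pose p := Num.min e.1.2 e.2.2; pose q := Num.max e.1.2 e.2.2.
have pq : p < q by rewrite /p /q; case: (ltgtP e.1.2 e.2.2) dn.
have mI : measurable (`]p, q]%classic : set R) by [].
have crossE : crossing t F e = (fun y => sg * H ((y - e.1.2) / d)) \_ `]p, q].
  apply/funext => y; rewrite /crossing patchE; congr (if _ then _ else _).
  apply/idP/idP; rewrite inE /= in_itv /= /p /q.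
    by have [h1|h1] := ltP e.1.2 y; have [h2|h2] := ltP e.2.2 y => // _;
      rewrite gt_min le_max ?h1 ?h2 ?orbT.
  by rewrite gt_min le_max => /andP[/orP[h1|h1] /orP[h2|h2]]; rewrite ?h1 1?ltNge ?h2 ?andbF//=;
    rewrite ?ltNge ?h2//; move: h1; rewrite ltNge ?h2.
have [iC eC] : intg leb `[p, q] (fun y => H ((y - e.1.2) / d)) /\
    \int[leb]_(y in `[p, q]) H ((y - e.1.2) / d) = (q - p) * \int[leb]_(s in `[0, 1]) H s.
  apply: (affine_subst pq cF); rewrite /d /p /q.
  by case: (ltgtP e.1.2 e.2.2) dn => // h _; [left|right].
have sgd : sg * (q - p) = t * d.
  have : `|t * d| = q - p.
    rewrite normrM t1 mul1r /d /p /q; case: (ltgtP e.1.2 e.2.2) dn => // h _.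
      by rewrite ger0_norm// subr_ge0 ltW.
    by rewrite distrC ger0_norm// subr_ge0 ltW.
  move=> <-; rewrite /sg; case: ltP => h; first by rewrite gtr0_norm// mul1r.
  by rewrite ler0_norm// mulN1r opprK.
have iH : intg leb `]p, q] (fun y => H ((y - e.1.2) / d)).
  apply: intgS iC => // y; rewrite /= !in_itv /= => /andP[/ltW -> ->] //.
have e1 : \int[leb]_(y in `]p, q]) H ((y - e.1.2) / d) = (q - p) * \int[leb]_(s in `[0, 1]) H s.
  by rewrite -eC Rintegral_itv_obnd_cbnd.
split.
  rewrite crossE; apply/intg_restrict => //; exact: intgZ.
rewrite crossE -sgd -mulrA -e1 -RintegralZl//.
by rewrite [RHS]Rintegral_mkcond.
Qed.

End SlicePolygon.

(** Convergence in L1 to zero without passing to an explicit subsequence. *)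
Lemma small_ae {d} {T : measurableType d} {R : realType} (mu : {measure set T -> \bar R})
    (a : nat -> T -> R) : (forall n, intg mu setT (a n)) -> (forall n x, 0 <= a n x) ->
  (fun n => \int[mu]_x a n x) @ \oo --> 0 ->
  {ae mu, forall x, forall c, 0 < c -> exists n, a n x < c}.
Proof.
move=> ia a0 lim0.
have key (k : nat) : {ae mu, forall x, exists n, a n x < k.+1%:R^-1}.
  set c : R := k.+1%:R^-1; have c0 : 0 < c by rewrite invr_gt0.
  pose B := \bigcap_n [set x | c <= a n x].
  have mB : measurable B.
    apply: bigcapT_measurable => n.
    have := intg_meas (ia n) measurableT (measurable_itv `[c, +oo[).
    by rewrite setTI (_ : _ @^-1` _ = [set x | c <= a n x])//; apply/seteqP; split=> x;
      rewrite /= in_itv /= andbT.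
  have B0 : mu B = 0%E.
    apply/eqP; rewrite eq_le measure_ge0 andbT; apply/lee_addgt0Pr => e e0; rewrite add0e.
    have ce : 0 < c * e by rewrite mulr_gt0.
    have /cvgrPdist_lt/(_ _ ce)[n _ /(_ n (leqnn n))] := lim0.
    rewrite /= sub0r normrN => /(le_lt_trans (ler_norm _)) h.
    have : (c%:E * mu B <= (\int[mu]_x a n x)%:E)%E.
      rewrite -integral_cst// Rint_EFin//.
      apply: (@le_trans _ _ (\int[mu]_(x in B) (a n x)%:E)%E).
        apply: ge0_le_integral => //.
        - by move=> x _; rewrite lee_fin ltW.
        - by apply/measurable_EFinP; apply: measurable_funS (intg_meas (ia n)).
        - by move=> x Bx; rewrite lee_fin; exact: Bx.
      apply: ge0_subset_integral => //; first by apply/measurable_EFinP; exact: intg_meas.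
      by move=> x _; rewrite lee_fin.
    move=> h'; have {h'} : (c%:E * mu B <= c%:E * e%:E)%E.
      by apply: le_trans h' _; rewrite -EFinM lee_fin ltW.
    by rewrite lee_pmul2l.
  exists B; split => // x /= no n _ /=; rewrite leNgt; apply/negP => h; apply: no; by exists n.
apply: filterS (ae_foralln key) => x h c c0.
have [k hk] : exists k : nat, k.+1%:R^-1 < c.
  exists (Num.truncn c^-1); rewrite -[ltRHS]invrK ltf_pV2 ?posrE ?invr_gt0//.
  by rewrite truncnS_gt.
by have [n hn] := h k; exists n; exact: lt_trans hk.
Qed.

Lemma ae_seq {d} {T : measurableType d} {R : realType} (mu : {measure set T -> \bar R})
    (I : eqType) (s : seq I) (P : I -> T -> Prop) :
  (forall i, i \in s -> {ae mu, forall x, P i x}) -> {ae mu, forall x i, i \in s -> P i x}.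
Proof.
elim: s => [|i s IH] h; first exact: ae_all.
have h2 := IH (fun j js => h j (introT orP (or_intror js))).
by apply: ae_imp2 (h i (mem_head _ _)) h2 => x p1 p2 j; rewrite inE => /predU1P[->|/p2].
Qed.

Section Green.
Context {R : realType}.
Local Notation pt := (R * R)%type.
Local Notation leb := (@lebesgue_measure R).
Implicit Types (e : pt * pt) (E : set pt) (L : seq (pt * pt)) (f F G : pt -> R).

Definition slice_pt (i : 'I_2) (y x : R) : pt := if i == 0 then (x, y) else (y, x).

Lemma slice_fubini i f : intg leb2 setT f ->
  [/\ {ae leb, forall y, intg leb setT (fun x => f (slice_pt i y x))},
      intg leb setT (fun y => \int[leb]_x f (slice_pt i y x)) &
      \int[leb2]_z f z = \int[leb]_y \int[leb]_x f (slice_pt i y x)].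
Proof.
move=> If; elim/ord2_ind: i; rewrite /slice_pt /=.
  split; [exact: fubini_section2 If|exact: fubini_intg2 If|exact: fubini_Rint2].
split; [exact: fubini_section1 If|exact: fubini_intg1 If|exact: fubini_Rint1].
Qed.

Lemma slice_derive i f y x : derivable f (slice_pt i y x) (ebase i) ->
  is_derive x (1 : R) (fun r => f (slice_pt i y r)) (pd i f (slice_pt i y x)).
Proof.
elim/ord2_ind: i; rewrite /slice_pt /=.
  by rewrite derivable_slice0 pd_slice0 => h; split.
by rewrite derivable_slice1 pd_slice1 => h; split.
Qed.

Lemma slice_pt_cont i y : continuous (slice_pt i y).
Proof. by elim/ord2_ind: i => x; [exact: pair_cont0|exact: pair_cont1]. Qed.

Definition tsign (i : 'I_2) : R := if i == 0 then 1 else -1.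
Definition tset (i : 'I_2) E := if i == 0 then E else swap @^-1` E.
Definition tfun (i : 'I_2) f := if i == 0 then f else f \o swap.
Definition tedge (i : 'I_2) e : pt * pt := if i == 0 then e else swape e.

(** Green's formula for limits in L1 of smooth functions: the formula on almost every
  line, integrated over the lines. *)
Lemma green_L1 (P : polygon R) i F G (w : nat -> pt -> R) :
  polygonal_domain P -> let E := cell P in
  C0bar E F -> intg leb2 E F -> intg leb2 E G ->
  (forall n x, E x -> derivable (w n) x (ebase i) /\ {for x, continuous (pd i (w n))}) ->
  (forall n, intg leb2 E (w n)) -> (forall n, intg leb2 E (pd i (w n))) ->
  (fun n => \int[leb2]_(x in E) `|w n x - F x|) @ \oo --> 0 ->
  (fun n => \int[leb2]_(x in E) `|pd i (w n) x - G x|) @ \oo --> 0 ->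
  \int[leb2]_(x in E) G x = bdint P (fun e x => enor e i 0 * F x).
Proof.
move=> pP E cF iF iG dw iw ipw lF lG.
have dE : domain E := polygonal_domain_domain pP.
have mE : measurable2 E by exact: domain_meas.
have sE : sided (tsign i) (tset i E) (map (tedge i) (edges P)).
  elim/ord2_ind: i {dw ipw lG} => /=; first by rewrite map_id; exact: polygonal_sided.
  by rewrite -[tsign 1]/(- 1); exact: swap_sided (polygonal_sided pP).
have t1 : `|tsign i| = 1 by rewrite /tsign; case: ifP; rewrite ?normrN normr1.
have t0 : tsign i != 0 by rewrite -normr_eq0 t1 oner_eq0.
have tE y : [set x | tset i E (x, y)] = [set x | E (slice_pt i y x)].
  by elim/ord2_ind: i {dw ipw lG sE t1 t0}.
have tF x y : tfun i F (x, y) = F (slice_pt i y x).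
  by elim/ord2_ind: i {dw ipw lG sE t1 t0 tE}.
have cF' : C0bar (tset i E) (tfun i F).
  elim/ord2_ind: i {dw ipw lG sE t1 t0 tE tF} => //=.
  apply/C0barP => x; rewrite /tset /= swap_closure => cx B nB.
  have h := (C0barP E F).1 cF _ cx _ nB.
  have hn : nbhs x [set z | closure E (swap z) -> B (F (swap z))] by exact: (swap_cont h).
  exact: hn.
have [_ I2 I3] := slice_fubini i ((intg_restrict _ _ mE).2 iG).
have dF n : intg leb2 E (fun x => w n x - F x) by exact: intgB.
have dG n : intg leb2 E (fun x => pd i (w n) x - G x) by exact: intgB.
pose a n y := \int[leb]_x ((fun x => `|w n x - F x|) \_ E) (slice_pt i y x) +
  \int[leb]_x ((fun x => `|pd i (w n) x - G x|) \_ E) (slice_pt i y x).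
have nF n := slice_fubini i ((intg_restrict _ _ mE).2 (intg_norm (dF n))).
have nG n := slice_fubini i ((intg_restrict _ _ mE).2 (intg_norm (dG n))).
have ia n : intg leb setT (a n) by have [_ ? _] := nF n; have [_ ? _] := nG n; exact: intgD.
have a0 n y : 0 <= a n y.
  by apply: addr_ge0; apply: Rintegral_ge0 => x _; rewrite patchE; case: ifP.
have la : (fun n => \int[leb]_y a n y) @ \oo --> 0.
  have -> : (fun n => \int[leb]_y a n y) = (fun n => \int[leb2]_(x in E) `|w n x - F x| +
      \int[leb2]_(x in E) `|pd i (w n) x - G x|).
    apply/funext => n; have [_ i1 e1] := nF n; have [_ i2 e2] := nG n.
    by rewrite RintegralD// -e1 -e2 -!Rintegral_mkcond.
  by rewrite -[0]addr0; exact: cvgD.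
have sm := small_ae ia a0 la.
have mA y : measurable [set x | E (slice_pt i y x)].
  apply: open_measurable; apply: open_comp; last by case: dE.
  by move=> x _; exact: slice_pt_cont.
have sec f : intg leb2 E f -> {ae leb, forall y, intg leb [set x | E (slice_pt i y x)] (fun x => f (slice_pt i y x))}.
  move=> If; have [h _ _] := slice_fubini i ((intg_restrict _ _ mE).2 If).
  apply: ae_imp h => y h; apply/intg_restrict; first exact: mA.
  by rewrite (_ : _ \_ _ = fun x => (f \_ E) (slice_pt i y x)).
have key : {ae leb, forall y, \int[leb]_x (G \_ E) (slice_pt i y x) =
    \sum_(e <- map (tedge i) (edges P)) crossing (tsign i) (tfun i F) e y}.
  have s1 := ae_foralln (fun n => sec _ (dF n)).
  have s2 := ae_foralln (fun n => sec _ (dG n)).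
  have s3 := sec _ iG.
  have s4 : {ae leb, forall y, forall e, e \in map (tedge i) (edges P) -> y != e.1.2 /\ y != e.2.2}.
    apply: ae_seq => e _; have n1 (c : R) : {ae leb, forall y, y != c}.
      exists [set c]; split => //; first exact: lebesgue_measure_set1.
      by move=> y /= /negP; rewrite negbK => /eqP.
    by apply: ae_imp2 (n1 e.1.2) (n1 e.2.2).
  have part f y : \int[leb]_x ((fun x => `|f x|) \_ E) (slice_pt i y x) =
      \int[leb]_(x in [set x | E (slice_pt i y x)]) `|f (slice_pt i y x)|.
    by rewrite [RHS]Rintegral_mkcond.
  have s12 := ae_imp2 (Q := fun y => (forall n, _) /\ (forall n, _)) (fun y h1 h2 => conj h1 h2) s1 s2.
  have s34 := ae_imp2 (fun y h1 h2 => conj h1 h2) s3 s4.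
  have s125 := ae_imp2 (fun y h1 h2 => conj h1 h2) s12 sm.
  apply: ae_imp2 s34 s125 => y [g1 g2] [[g3 g4] g5].
  rewrite (_ : \int[leb]_x _ = \int[leb]_(x in [set x | tset i E (x, y)]) G (slice_pt i y x)); last first.
    by rewrite tE [RHS]Rintegral_mkcond.
  apply: slice_polygon => //; first by rewrite tE.
  move=> d d0; have [n hn] := g5 d d0; rewrite tE.
  exists (fun x => w n (slice_pt i y x)), (fun x => pd i (w n) (slice_pt i y x)); split.
  - move=> x Ex; have [h1 h2] := dw n _ Ex; split; first exact: slice_derive.
    by apply: continuous_comp; [exact: slice_pt_cont|exact: h2].
  - by apply: eq_intg (g3 n); [exact: mA|move=> x _; rewrite tF].
  - exact: g4.
  - rewrite (_ : \int[leb]_(x in _) _ =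
      \int[leb]_(x in [set x | E (slice_pt i y x)]) `|w n (slice_pt i y x) - F (slice_pt i y x)|).
      by apply: le_lt_trans hn; rewrite /a !part lerDl; apply: Rintegral_ge0 => z _.
    by apply: eq_Rint => x _; rewrite tF.
  - by apply: le_lt_trans hn; rewrite /a !part lerDr; apply: Rintegral_ge0 => z _.
rewrite Rintegral_mkcond I3.
have ic e : e \in map (tedge i) (edges P) -> intg leb setT (crossing (tsign i) (tfun i F) e) /\
    \int[leb]_y crossing (tsign i) (tfun i F) e y =
    tsign i * (e.2.2 - e.1.2) * \int[leb]_(s in `[0, 1]) tfun i F (edge_pt e s).
  move=> /mapP[e' eL ->]; apply: crossing_int => //.
  have tFe : (fun s => tfun i F (edge_pt (tedge i e') s)) = (fun s => F (edge_pt e' s)).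
    by apply/funext => s; elim/ord2_ind: i {dw ipw lG sE t1 t0 tE tF cF' I2 I3 dG a nF nG ia a0 la sm sec mA key}.
  by rewrite tFe; exact: (C0bar_edge pP eL cF).
pose c e := if e \in map (tedge i) (edges P) then crossing (tsign i) (tfun i F) e else fun=> 0.
have icc e : intg leb setT (c e) by rewrite /c; case: ifP => [/ic[]//|_]; exact: intg0.
have cE y : \sum_(e <- map (tedge i) (edges P)) crossing (tsign i) (tfun i F) e y =
    \sum_(e <- map (tedge i) (edges P)) c e y.
  by apply: eq_big_seq => e eL; rewrite /c eL.
transitivity (\int[leb]_y \sum_(e <- map (tedge i) (edges P)) c e y).
  have isum : intg leb setT (fun y => \sum_(e <- map (tedge i) (edges P)) c e y) by exact: intg_sum.
  apply/le_anti/andP; split; apply: le_Rint_ae => //; apply: ae_imp key => y h _; by rewrite h cE.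
rewrite Rint_sum// big_map; apply: eq_big_seq => e eL.
have eL' : tedge i e \in map (tedge i) (edges P) by exact: map_f.
rewrite /c eL' (ic _ eL').2.
rewrite RintegralZl//; last exact: (C0bar_edge_intg pP eL cF).
have l0 : elen e != 0.
  by rewrite gt_eqF// elen_gt0//; case: pP => [_ _ [ed _ _] _ _]; exact: ed.
rewrite mulrA; elim/ord2_ind: i {dw ipw lG sE t1 t0 tE tF cF' I2 I3 dG a nF nG ia a0 la sm sec mA key ic c icc cE eL'}.
  by rewrite /= enor0 mulrA divff// !mul1r.
by rewrite /= enor1 mulrN mulrA divff// mul1r mulN1r.
Qed.

End Green.

(** * Conservation of mass *)

Section Cover.
Context {R : realType}.
Local Notation pt := (R * R)%type.
Local Notation leb := (@lebesgue_measure R).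

Lemma below_both (a b : R) : 0 < a -> 0 < b -> exists t, [/\ 0 < t, t < a & t < b].
Proof.
move=> a0 b0; exists (Num.min a b / 2).
have m0 : 0 < Num.min a b by rewrite lt_min a0.
have ma : Num.min a b <= a by rewrite ge_min lexx.
have mb : Num.min a b <= b by rewrite ge_min lexx orbT.
by split; [rewrite divr_gt0|lra|lra].
Qed.

Lemma segment_null (e : pt * pt) : e.1 != e.2 -> leb2 (segment e) = 0%E.
Proof.
move=> ne; have mS : measurable2 (segment e).
  by apply: compact2_measurable; exact: edge_compact.
rewrite /leb2 /product_measure1 /=.
transitivity (\int[leb]_x (cst 0%E x))%E; last exact: integral0.
apply: ae_eq_integral => //.
- exact: (@measurable_fun_xsection _ _ _ _ _ leb (segment e)).
- exists [set e.1.1]; split => //; first exact: lebesgue_measure_set1.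
  move=> x /=; apply: contra_notP => /eqP xe _.
  apply/eqP; rewrite eq_le measure_ge0 andbT.
  pose s := (x - e.1.1) / (e.2.1 - e.1.1).
  have sub : xsection (segment e) x `<=` [set e.1.2 + s * (e.2.2 - e.1.2)].
    move=> y; rewrite /xsection /= inE => -[u _]; rewrite edge_ptE => -[ux uy] /=.
    have d0 : e.2.1 - e.1.1 != 0.
      by apply: contraNneq xe => d0; rewrite -ux d0 mulr0 addr0.
    by rewrite -uy; congr (_ + _ * _); rewrite /s -ux; field; exact: d0.
  rewrite -(lebesgue_measure_set1 (e.1.2 + s * (e.2.2 - e.1.2))).
  by apply: le_measure; rewrite ?inE; [exact: measurable_xsection|exact: measurable_set1|].
Qed.

Lemma boundary_null (P : polygon R) : polygonal_domain P ->
  {ae leb2, forall x, closure (cell P) x -> cell P x}.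
Proof.
move=> pP; have [_ bd [ed _ _] _ _] := pP.
have h : {ae leb2, forall x e, e \in edges P -> ~ segment e x}.
  apply: ae_seq => e eP; exists (segment e); split.
  - by apply: compact2_measurable; exact: edge_compact.
  - exact: segment_null (ed _ eP).
  - by move=> x /= /contrapT.
apply: ae_imp h => x h cx; apply: contrapT => nx.
have : (closure (cell P) `\` cell P) x by [].
by rewrite bd => -[e /= eP /h]; apply.
Qed.

Context (Om : polygon R) (pO : polygonal_domain Om) (N : nat) (M : 'I_N -> polygon R).
Context (dec : decomposition Om M).

Let pM i : polygonal_domain (M i). Proof. by case: dec. Qed.

(** An element meeting the boundary of the domain would contain points beyond an
  edge, outside the closure of the domain. *)
Lemma cell_sub i : cell (M i) `<=` cell Om.
Proof.
move=> x Mx; apply: contrapT => nO.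
have [[oM _ _ _] _ _ _ _] := pM i; have [_ _ cov] := dec.
have sub : cell (M i) `<=` closure (cell Om).
  by rewrite cov => y My; exists i => //; exact: subset_closure.
have [_ bd [ed _ _] _ side] := pO.
have : (closure (cell Om) `\` cell Om) x by split => //; exact: sub.
rewrite bd => -[e /= eO [s]]; rewrite /= in_itv /= => /andP[s0 s1] ex.
have nx : nbhs (edge_pt e s) (cell (M i)) by rewrite ex; exact: open_nbhs_nbhs.
have /nbhs_ballP[d /= d0 hd] := edge_pt_cont nx.
have [r [r0 r1] Mr] : exists2 r, 0 < r /\ r < 1 & cell (M i) (edge_pt e r).
  have m0 : 0 < Num.min d 1 by rewrite lt_min d0 ltr01.
  have md : Num.min d 1 <= d by rewrite ge_min lexx.
  have m1 : Num.min d 1 <= 1 by rewrite ge_min lexx orbT.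
  have [sh|sh] := ltP s (1 / 2).
    exists (s + Num.min d 1 / 3); first by split; lra.
    by apply: hd; rewrite -ball_normE /= opprD addNKr normrN gtr0_norm ?divr_gt0//; lra.
  exists (s - Num.min d 1 / 3); first by split; lra.
  by apply: hd; rewrite -ball_normE /= opprB addrCA subrr addr0 gtr0_norm ?divr_gt0//; lra.
have er : open_segment e (edge_pt e r) by exists r => //=; rewrite in_itv /= r0.
have /near_rightP[q q0 hq] := side e _ eO er.
have nr : nbhs (edge_pt e r) (cell (M i)) by exact: open_nbhs_nbhs.
have /nbhs_ballP[p /= p0 hp] := nr; set n := enor e in hq.
have n1 : 0 < `|n 0 0| + `|n 1 0| + 1 by rewrite ltr_wpDl// addr_ge0.
have [t [t0 tq tp]] := below_both q0 (divr_gt0 p0 n1).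
have [|_] := hq t; first by rewrite t0 add0r.
apply; apply: sub; apply: hp; rewrite -ball_normE /= distrC.
apply: le_lt_trans (norm_shift _ _ _) _; rewrite gtr0_norm//.
rewrite ltr_pdivlMr// in tp; apply: le_lt_trans tp.
by rewrite ler_pM2l// lerDl.
Qed.

Lemma cell_cover : {ae leb2, forall x, cell Om x -> exists i, cell (M i) x}.
Proof.
have h : {ae leb2, forall x i, closure (cell (M i)) x -> cell (M i) x}.
  by apply: ae_forall_fin => i; exact: boundary_null.
apply: ae_imp h => x h Ox; have [_ _ cov] := dec.
have : closure (cell Om) x by exact: subset_closure.
by rewrite cov => -[i _ /h]; exists i.
Qed.

(** The elements are disjoint and their boundaries are null sets. *)
Lemma Rint_cells (f : pt -> R) : intg leb2 (cell Om) f ->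
  \int[leb2]_(x in cell Om) f x = \sum_i \int[leb2]_(x in cell (M i)) f x.
Proof.
move=> If; have mO : measurable2 (cell Om) by apply: domain_meas; exact: polygonal_domain_domain.
have mM i : measurable2 (cell (M i)) by apply: domain_meas; exact: polygonal_domain_domain.
have IM i : intg leb2 setT (f \_ (cell (M i))).
  by apply/intg_restrict => //; apply: intgS If => //; exact: cell_sub.
rewrite Rintegral_mkcond; under [RHS]eq_bigr do rewrite Rintegral_mkcond.
rewrite -Rint_sum//; have I1 := (intg_restrict _ _ mO).2 If.
have I2 : intg leb2 setT (fun x => \sum_i (f \_ (cell (M i))) x) by exact: intg_sum.
have e : {ae leb2, forall x, (f \_ (cell Om)) x = \sum_i (f \_ (cell (M i))) x}.
  apply: ae_imp cell_cover => x h; rewrite patchE; case: ifPn => [/set_mem Ox|/negP nO].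
    have [i Mi] := h Ox; rewrite (bigD1 i)//= patchT ?inE// big1 ?addr0// => j ji.
    rewrite patchE; case: ifPn => // /set_mem Mj; have [_ dis _] := dec.
    have : (cell (M j) `&` cell (M i)) x by []; by rewrite dis.
  rewrite big1// => i _; rewrite patchE; case: ifPn => // /set_mem /cell_sub Ox.
  by case: nO; rewrite inE.
by apply/le_anti/andP; split; apply: le_Rint_ae => //; apply: ae_imp e => x -> _.
Qed.

End Cover.

Section Limits.
Context {R : realType}.
Local Notation pt := (R * R)%type.

(** Cauchy-Schwarz against the bounded factor, the domain having finite measure. *)
Lemma L2_cvg_L1 (D E : set pt) (h : nat -> pt -> R) (b : pt -> R) (K : R) :
  domain D -> measurable2 E -> E `<=` D -> measurable_fun E b ->
  (forall x, E x -> `|b x| <= K) -> (forall n, sqi leb2 D (h n)) ->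
  (fun n => L2norm D (h n)) @ \oo --> 0%E ->
  (fun n => \int[leb2]_(x in E) `|h n x * b x|) @ \oo --> 0.
Proof.
move=> dD mE ED mb bK sh lim0; have mD := domain_meas dD.
have fD := domain_fin dD.
have s1 : sqi leb2 D (fun=> 1) by exact: sqi_cst.
pose c := Num.sqrt (ipg leb2 D (fun=> 1) (fun=> 1)).
have shD n : sqi leb2 D (fun x => `|h n x|).
  have [mh ih] := sh n; split; first by apply: measurableT_comp => //; exact: normr_measurable.
  by apply: eq_intg ih => // x _; rewrite real_normK ?num_real.
have key n : \int[leb2]_(x in E) `|h n x * b x| <=
    `|K| * c * fine (L2norm D (h n)).
  have ih : intg leb2 E (fun x => `|h n x|).
    by apply: intgS (sqi_intg mD fD (shD n)).
  have ihb : intg leb2 E (fun x => h n x * b x).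
    have ih' : intg leb2 E (fun x => h n x * K).
      by apply: eq_intg (intgZ mE K (intgS mD mE ED (sqi_intg mD fD (sh n)))) => // x _; rewrite mulrC.
    apply: intg_le ih' => //.
      apply: measurable_funM => //; apply: measurable_funS (sqi_meas (sh n)) => //.
    move=> x Ex; rewrite !normrM ler_wpM2l//.
    by apply: le_trans (bK x Ex) _; exact: ler_norm.
  apply: (@le_trans _ _ (\int[leb2]_(x in E) (`|K| * `|h n x|))).
    apply: le_Rint => //; [exact: intg_norm|exact: intgZ|].
    move=> x Ex; rewrite normrM mulrC ler_wpM2r//.
    by apply: le_trans (bK x Ex) _; exact: ler_norm.
  rewrite RintegralZl// -mulrA ler_wpM2l//.
  apply: (@le_trans _ _ (\int[leb2]_(x in D) `|h n x|)).
    by apply: le_Rint_subset => //; exact: sqi_intg.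
  have -> : \int[leb2]_(x in D) `|h n x| = ipg leb2 D (fun=> 1) (fun x => `|h n x|).
    by apply: eq_Rint => x _; rewrite mul1r.
  apply: (le_trans (ler_norm _)).
  apply: (le_trans (psd_cs (psd_ipg leb2 mD) s1 (shD n))).
  rewrite ler_wpM2l ?sqrtr_ge0// /L2norm Lnorm2_ipg// le_eqVlt; apply/orP; left.
  apply/eqP; congr Num.sqrt; apply: eq_Rint => x _.
  by rewrite -normrM ger0_norm// -expr2 sqr_ge0.
have lim1 : (fun n => `|K| * c * fine (L2norm D (h n))) @ \oo --> 0.
  rewrite -[X in _ --> X](mulr0 (`|K| * c)); exact: (cvgM (cvg_cst _) (fine_cvg lim0)).
apply: (squeeze_cvgr _ (cvg_cst 0) lim1).
by apply: nearW => n; rewrite key andbT; apply: Rintegral_ge0.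
Qed.

End Limits.

Section Convection.
Context {R : realType}.
Local Notation pt := (R * R)%type.
Context (Om : polygon R) (pO : polygonal_domain Om) (N : nat) (M : 'I_N -> polygon R).
Context (dec : decomposition Om M).
Implicit Types (u : pt -> 'cV[R]_2) (f phi : pt -> R).

Let pM i : polygonal_domain (M i). Proof. by case: dec. Qed.
Let dO : domain (cell Om). Proof. exact: polygonal_domain_domain. Qed.
Let mO : measurable2 (cell Om). Proof. exact: domain_meas. Qed.
Let oO : open (cell Om). Proof. by case: dO. Qed.
Let dM i : domain (cell (M i)). Proof. exact: polygonal_domain_domain. Qed.
Let mM i : measurable2 (cell (M i)). Proof. exact: domain_meas. Qed.
Let oM i : open (cell (M i)). Proof. by case: (dM i). Qed.

Lemma cont_eq_open (D : set pt) f g x : open D -> D x -> (forall y, D y -> f y = g y) ->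
  {for x, continuous g} -> {for x, continuous f}.
Proof.
move=> oD Dx fg cg; have nD : nbhs x D by exact: open_nbhs_nbhs.
rewrite /prop_for /continuous_at fg//; apply: cvg_trans cg.
by apply: near_eq_cvg; apply: filterS nD => y /fg.
Qed.

Lemma pd_mul (j : 'I_2) f g x : derivable f x (ebase j) -> derivable g x (ebase j) ->
  derivable (f * g) x (ebase j) /\ pd j (f * g) x = pd j f x * g x + f x * pd j g x.
Proof.
move=> df dg; have hf : is_derive x (ebase j) f (pd j f x) by split.
have hg : is_derive x (ebase j) g (pd j g x) by split.
have [h1 h2] := is_deriveM hf hg; split => //.
by apply: (etrans h2); rewrite addrC /GRing.scale /= mulrC.
Qed.

Lemma green_product i (j : 'I_2) f g : H10 (cell Om) g -> C0bar (cell (M i)) g ->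
  C1bar (cell (M i)) f ->
  \int[leb2]_(x in cell (M i)) (wd (cell Om) j g x * f x + g x * pd j f x) =
  bdint (M i) (fun e x => enor e j 0 * (g x * f x)).
Proof.
move=> [hg [W tW [W0 W1]]] cg /[dup] cf /C1barP[cf0 /(_ j)[f' [cf' hf']]].
have sub := cell_sub pO dec (i := i); set E := cell (M i) in cg cf cf0 cf' hf' sub *.
have [sg hwg] := (H1P _ dO).1 hg; have [_ swg] := hwg j.
have sgE : sqi leb2 E g := sqiS mO (mM i) sub sg.
have swgE := sqiS mO (mM i) sub swg.
have sf : sqi leb2 E f by exact: C0bar_sqi (dM i) cf0.
have sf' : sqi leb2 E f' by exact: C0bar_sqi (dM i) cf'.
have sW n : sqi leb2 (cell Om) (W n).
  by apply: C0bar_sqi => //; apply: C0bar_cont; exact: smooth_cont (tW n).1.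
have spW n : sqi leb2 (cell Om) (pd j (W n)).
  by apply: C0bar_sqi => //; apply: C0bar_cont; exact: smooth_cont (smooth_pd j (tW n).1).
have sWE n := sqiS mO (mM i) sub (sW n).
have spWE n := sqiS mO (mM i) sub (spW n).
have [_ _ bM] := dM i.
have [K1 hK1] := C0bar_bound bM cf0.
have [K2 hK2] := C0bar_bound bM cf'.
pose G x := wd (cell Om) j g x * f x + g x * f' x.
have eG : \int[leb2]_(x in E) (wd (cell Om) j g x * f x + g x * pd j f x) =
    \int[leb2]_(x in E) G x.
  by apply: eq_Rint => x Ex; rewrite /G (hf' x Ex).2.
have pdW n x : E x -> derivable (W n * f) x (ebase j) /\
    pd j (W n * f) x = pd j (W n) x * f x + W n x * f' x.
  move=> Ex; have [df ef] := hf' x Ex.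
  by rewrite -ef; apply: pd_mul => //; exact: smooth_derivable (tW n).1.
rewrite eG; apply: (green_L1 (F := g * f) (w := fun n => W n * f)) => //.
- exact: C0bar_mul.
- exact: sqi_mul.
- by apply: intgD => //; exact: sqi_mul.
- move=> n x Ex; have [h1 h2] := pdW n x Ex; split => //.
  have cW : {for x, continuous (W n)} by exact: smooth_cont (tW n).1 x.
  have cpW : {for x, continuous (pd j (W n))} by exact: smooth_cont (smooth_pd j (tW n).1) x.
  have hc : {for x, continuous (fun y => pd j (W n) y * f y + W n y * f' y)}.
    by apply: cvgD; apply: cvgM;
      [exact: cpW|exact: (C0bar_in (@oM i) cf0 Ex)|exact: cW|exact: (C0bar_in (@oM i) cf' Ex)].
  exact: (cont_eq_open (@oM i) Ex (fun y Ey => (pdW n y Ey).2) hc).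
- by move=> n; exact: sqi_mul.
- move=> n; apply: (eq_intg (mM i) (f := fun x => pd j (W n) x * f x + W n x * f' x)).
    by move=> x Ex; rewrite (pdW n x Ex).2.
  by apply: intgD => //; exact: sqi_mul.
- have h := L2_cvg_L1 dO (mM i) sub (sqi_meas sf) (fun x Ex => hK1 x (subset_closure Ex)) _ W0.
  have {}h := h (fun n => subspB (sqi_subsp leb2 mO) (sW n) sg).
  rewrite (_ : (fun n => _) = (fun n => \int[leb2]_(x in E) `|(W n \- g) x * f x|)) //.
  by apply/funext => n; apply: eq_Rint => x _; rewrite /= mulrBl.
- have h1 := L2_cvg_L1 dO (mM i) sub (sqi_meas sf) (fun x Ex => hK1 x (subset_closure Ex))
    (fun n => subspB (sqi_subsp leb2 mO) (spW n) swg) (W1 j).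
  have h2 := L2_cvg_L1 dO (mM i) sub (sqi_meas sf') (fun x Ex => hK2 x (subset_closure Ex))
    (fun n => subspB (sqi_subsp leb2 mO) (sW n) sg) W0.
  have h12 : (fun n => \int[leb2]_(x in E) `|(pd j (W n) \- wd (cell Om) j g) x * f x| +
      \int[leb2]_(x in E) `|(W n \- g) x * f' x|) @ \oo --> 0.
    by rewrite -[X in _ --> X]addr0; exact: (cvgD h1 h2).
  apply: (squeeze_cvgr _ (cvg_cst 0) h12); apply: nearW => n.
  have i1 : intg leb2 E (fun x => (pd j (W n) \- wd (cell Om) j g) x * f x).
    exact: (sqi_mul (mM i) (subspB (sqi_subsp leb2 (mM i)) (spWE n) swgE) sf).
  have i2 : intg leb2 E (fun x => (W n \- g) x * f' x).
    exact: (sqi_mul (mM i) (subspB (sqi_subsp leb2 (mM i)) (sWE n) sgE) sf').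
  apply/andP; split; first by apply: Rintegral_ge0.
  rewrite -(RintegralD (mM i) (intg_norm i1) (intg_norm i2)).
  rewrite (_ : \int[leb2]_(x in E) _ = \int[leb2]_(x in E)
      `|(pd j (W n) \- wd (cell Om) j g) x * f x + (W n \- g) x * f' x|); last first.
    apply: eq_Rint => x Ex; rewrite (pdW n x Ex).2 /G /=; congr `|_|; ring.
  apply: (le_Rint (mM i) (intg_norm (intgD (mM i) i1 i2)) (intgD (mM i) (intg_norm i1) (intg_norm i2))).
  by move=> x _; exact: ler_normD.
Qed.

Lemma bdint_normal i u f : (forall j, C0bar (cell (M i)) (vcomp u j)) -> C0bar (cell (M i)) f ->
  bdint (M i) (fun e x => frob (u x) (enor e) * f x) =
  \sum_j bdint (M i) (fun e x => enor e j 0 * (vcomp u j x * f x)).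
Proof.
move=> cu cf; rewrite sum_ord2 /bdint -big_split; apply: eq_big_seq => e eM /=.
have h j : intg lebesgue_measure `[0, 1] (fun s => vcomp u j (edge_pt e s) * f (edge_pt e s)).
  exact: (C0bar_edge_intg (pM i) eM (C0bar_mul (cu j) cf)).
rewrite -mulrDr -RintegralD//; [|exact: intgZ|exact: intgZ].
congr (_ * _); apply: eq_Rint => s _; rewrite frob_col2 /vcomp; ring.
Qed.

Lemma element_green i u f : Vspace Om u -> (forall j, C0bar (cell (M i)) (vcomp u j)) ->
  C1bar (cell (M i)) f ->
  bdint (M i) (fun e x => frob (u x) (enor e) * f x) =
  \sum_j \int[leb2]_(x in cell (M i))
    (wd (cell Om) j (vcomp u j) x * f x + vcomp u j x * pd j f x).
Proof.
move=> vu cu cf; rewrite bdint_normal//; last by case/C1barP: cf.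
by apply: eq_bigr => j _; rewrite green_product.
Qed.

(** Test functions on an element are test functions on the domain. *)
Lemma wd_cell i j f : H1 (cell Om) f ->
  {ae leb2, forall x, cell (M i) x -> wd (cell (M i)) j f x = wd (cell Om) j f x}.
Proof.
move=> /(H1P _ dO)[_ /(_ j)[h _]]; have sub := cell_sub pO dec (i := i).
by have hE := is_wdS sub h; have := wdE (@oM i) hE.
Qed.

Lemma ipg_cvg (h : nat -> pt -> R) f z : (forall n, sqi leb2 (cell Om) (h n)) ->
  sqi leb2 (cell Om) f -> sqi leb2 (cell Om) z ->
  (fun n => L2norm (cell Om) (h n \- f)) @ \oo --> 0%E ->
  (fun n => inner (cell Om) (h n) z) @ \oo --> inner (cell Om) f z.
Proof.
move=> sh sf sz lim0; have pI := psd_ipg leb2 mO.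
have shf n : sqi leb2 (cell Om) (h n \- f) := subspB (sqi_subsp leb2 mO) (sh n) sf.
have lim1 : (fun n => fine (L2norm (cell Om) (h n \- f)) *
    Num.sqrt (ipg leb2 (cell Om) z z)) @ \oo --> 0.
  by rewrite -[X in _ --> X](mul0r (Num.sqrt (ipg leb2 (cell Om) z z)));
    exact: (cvgM (fine_cvg lim0) (cvg_cst _)).
have lim2 : (fun n => inner (cell Om) (h n) z - inner (cell Om) f z) @ \oo --> 0.
  apply: norm_cvg0; apply: (squeeze_cvgr _ (cvg_cst 0) lim1); apply: nearW => n.
  rewrite normr_ge0 /=; have := psd_cs pI (shf n) sz.
  by rewrite /L2norm Lnorm2_ipg// -[h n \- f]/(h n - f) (psdBl pI).
rewrite (_ : (fun n => _) =
    (fun n => inner (cell Om) (h n) z - inner (cell Om) f z) \+ cst (inner (cell Om) f z)).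
  by rewrite -[X in _ --> X]add0r; exact: (cvgD lim2 (cvg_cst _)).
by apply/funext => n; rewrite /= subrK.
Qed.

Lemma H10_wd_parts j f phi : H10 (cell Om) f -> H1 (cell Om) phi ->
  inner (cell Om) f (wd (cell Om) j phi) = - inner (cell Om) (wd (cell Om) j f) phi.
Proof.
move=> [hf [W tW [W0 W1]]] hphi; have [sf wf] := (H1P _ dO).1 hf.
have [sphi wphi] := (H1P _ dO).1 hphi; have [_ swf] := wf j; have [[_ _ parts] swphi] := wphi j.
have sW n : sqi leb2 (cell Om) (W n).
  by apply: C0bar_sqi => //; apply: C0bar_cont; exact: smooth_cont (tW n).1.
have spW n : sqi leb2 (cell Om) (pd j (W n)).
  by apply: C0bar_sqi => //; apply: C0bar_cont; exact: smooth_cont (smooth_pd j (tW n).1).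
have l1 := ipg_cvg sW sf swphi W0.
have l2 := ipg_cvg spW swf sphi (W1 j).
have e : (fun n => inner (cell Om) (W n) (wd (cell Om) j phi)) =
    (fun n => - inner (cell Om) (pd j (W n)) phi).
  apply/funext => n; have := parts (W n) (tW n); rewrite /inner => p.
  have c (a b : pt -> R) : \int[leb2]_(x in cell Om) (a x * b x) =
    \int[leb2]_(x in cell Om) (b x * a x) by apply: eq_Rint => x _; rewrite mulrC.
  by rewrite [in RHS]c p opprK c.
by rewrite e in l1; exact: (cvg_unique (@Rhausdorff R) l1 (cvgN l2)).
Qed.

Lemma wd_cst (D : set pt) (c : R) j : open D ->
  {ae leb2, forall x, D x -> wd D j (cst c) x = 0}.
Proof.
move=> oD; apply: ae_imp (poly2_wd j oD (poly2_cst 0 c)) => x h Dx.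
by rewrite h// pd_cst.
Qed.

Lemma H10_wd_int j f : H10 (cell Om) f -> inner (cell Om) (wd (cell Om) j f) (cst 1) = 0.
Proof.
move=> Hf; have h1 : H1 (cell Om) (cst 1) by exact: poly2_H1 dO (poly2_cst 0 1).
have [sf wf] := (H1P _ dO).1 Hf.1; have [_ w1] := (H1P _ dO).1 h1.
have [_ sw1] := w1 j.
have := H10_wd_parts j Hf h1 => /eqP; rewrite -eqr_oppLR => /eqP <-.
apply/eqP; rewrite oppr_eq0; apply/eqP.
have s0 : sqi leb2 (cell Om) (fun=> 0) by exact: sqi_cst mO _ (domain_fin dO).
have e := ae_ipg mO (sqi_meas sf) (sqi_meas sw1) (sqi_meas sf) (sqi_meas s0)
  (ae_all leb2 (fun x _ => erefl (f x))) (wd_cst 1 j oO).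
apply: (etrans e).
by rewrite /ipg (_ : (fun x => _) = cst 0) ?Rintegral_cst ?mul0r//; apply/funext => x; rewrite mulr0.
Qed.

Lemma divv_sqi u : (forall j, H1 (cell Om) (vcomp u j)) -> sqi leb2 (cell Om) (divv (cell Om) u).
Proof.
move=> hu; rewrite (_ : divv _ _ = wd (cell Om) 0 (vcomp u 0) + wd (cell Om) 1 (vcomp u 1)).
  by apply: (subspD (sqi_subsp leb2 mO)); have [_ h] := (H1P _ dO).1 (hu 0);
    have [_ h'] := (H1P _ dO).1 (hu 1); [exact: (h 0).2|exact: (h' 1).2].
by apply/funext => x; rewrite divvE.
Qed.

(** The discrete divergence constraint is tested with the divergence itself,
  which is an elementwise polynomial. *)
Lemma divergence_free k u : Zh k Om M u ->
  {ae leb2, forall x, cell Om x -> divv (cell Om) u x = 0}.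
Proof.
move=> [[vu vl] hq]; have hu j : H1 (cell Om) (vcomp u j) by case: (vu j).
have /choice[p hp] : forall i, exists p, poly2 k.-1 p /\
    {ae leb2, forall x, cell (M i) x -> divv (cell (M i)) u x = p x}.
  by move=> i; have [_ _ [p pp h] _ _] := vl i; exists p.
pose q x := \sum_i (p i \_ (cell (M i))) x.
have qE i x : cell (M i) x -> q x = p i x.
  move=> Mi; rewrite /q (bigD1 i)//= patchT ?inE// big1 ?addr0// => j ji.
  rewrite patchE; case: ifPn => // /set_mem Mj; have [_ dis _] := dec.
  by have : (cell (M j) `&` cell (M i)) x by []; rewrite dis.
have sd := divv_sqi hu.
have dq : {ae leb2, forall x, cell Om x -> divv (cell Om) u x = q x}.
  have h : {ae leb2, forall x i, cell (M i) x -> [/\ divv (cell (M i)) u x = p i x,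
      wd (cell (M i)) 0 (vcomp u 0) x = wd (cell Om) 0 (vcomp u 0) x &
      wd (cell (M i)) 1 (vcomp u 1) x = wd (cell Om) 1 (vcomp u 1) x]}.
    apply: ae_forall_fin => i.
    have h2 : {ae leb2, forall x, cell (M i) x ->
        wd (cell (M i)) 0 (vcomp u 0) x = wd (cell Om) 0 (vcomp u 0) x /\
        wd (cell (M i)) 1 (vcomp u 1) x = wd (cell Om) 1 (vcomp u 1) x}.
      apply: ae_imp2 (wd_cell i 0 (hu 0)) (wd_cell i 1 (hu 1)) => x a b Mx.
      by split; [exact: a|exact: b].
    apply: ae_imp2 (hp i).2 h2 => x a b Mx; have [b0 b1] := b Mx.
    by split => //; exact: a.
  apply: ae_imp2 h (cell_cover dec) => x a c Ox.
  have [i Mi] := c Ox; have [a0 b0 b1] := a i Mi.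
  rewrite (qE i x Mi) -a0; apply: (etrans (divvE _ _ _)).
  by apply: (etrans _ (esym (divvE _ _ _))); exact: (f_equal2 +%R (esym b0) (esym b1)).
have mq : measurable_fun (cell Om) q.
  apply: measurable_sum => i; apply: (measurable_funS (E := setT)) => //.
  apply/(measurable_restrictT _ (mM i)).
  exact: sqi_meas (poly2_sqi (@oM i) (let: And3 _ _ b := dM i in b) (hp i).1).
have sq : sqi leb2 (cell Om) q by exact: (ae_sqi mO mq dq sd).
have s1 : sqi leb2 (cell Om) (cst 1) by exact: sqi_cst mO _ (domain_fin dO).
have qQ : Qh k Om M q.
  split; first exact/(L2P _ mO).
    apply: (etrans (ae_ipg mO (sqi_meas sq) (sqi_meas s1) (sqi_meas sd) (sqi_meas s1)
      (ae_imp (fun x h Dx => esym (h Dx)) dq) (ae_all leb2 (fun x _ => erefl _)))).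
    have w j := (((H1P _ dO).1 (hu j)).2 j).2.
    rewrite (_ : divv _ _ = wd (cell Om) 0 (vcomp u 0) + wd (cell Om) 1 (vcomp u 1)); last first.
      by apply/funext => x; rewrite divvE.
    rewrite (psdDl (psd_ipg leb2 mO) (w 0) (w 1) s1).
    apply: (etrans (f_equal2 +%R (H10_wd_int 0 (vu 0)) (H10_wd_int 1 (vu 1)))).
    by rewrite addr0.
  by move=> i; exists (p i) => [|x /qE//]; case: (hp i).
have qq : ipg leb2 (cell Om) q q = 0.
  rewrite -[RHS](hq q qQ); apply: (ae_ipg mO (sqi_meas sq) (sqi_meas sq) (sqi_meas sq) (sqi_meas sd)
    (ae_all leb2 (fun x _ => erefl _))).
  exact: ae_imp (fun x h Dx => esym (h Dx)) dq.
by apply: ae_imp2 dq (ipg0_ae mO sq qq) => x h1 h2 Ox; rewrite h1// h2.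
Qed.

(** Transport does not change the mass: on each element the boundary terms of
  the form combine, by Green's formula, to the integral of u.grad phi. *)
Lemma element_convection k l i u phi : (l.-1 <= k)%N -> (1 < l)%N ->
  Vspace Om u -> Vh_loc k (M i) u -> H1 (cell Om) phi -> Hh_loc l (M i) phi ->
  {ae leb2, forall x, cell Om x -> divv (cell Om) u x = 0} ->
  c_loc k l (M i) u phi (cst 1) = 2^-1 *
    \sum_j inner (cell (M i)) (vcomp u j) (wd (cell Om) j phi).
Proof.
move=> hkl l1 vu vl hphi hl d0; set E := cell (M i).
have l0 : (0 < l)%N by exact: ltnW.
have hu j : H1 (cell Om) (vcomp u j) by case: (vu j).
have sub : E `<=` cell Om := cell_sub pO dec (i := i).
have su j : sqi leb2 E (vcomp u j) := sqiS mO (mM i) sub ((H1P _ dO).1 (hu j)).1.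
have sw j : sqi leb2 E (wd (cell Om) j (vcomp u j)) :=
  sqiS mO (mM i) sub (((H1P _ dO).1 (hu j)).2 j).2.
have swp j : sqi leb2 E (wd (cell Om) j phi) := sqiS mO (mM i) sub (((H1P _ dO).1 hphi).2 j).2.
have sphi := Hh_loc_sqi (pM i) hl.
have cphi : C1bar E phi by case: (Hh_loc_SD hl).
set p := proj0 (M i) l phi; have pp : poly2 l p by case: (proj0P (dM i) l sphi).
have p1 : poly2 l (cst 1 : pt -> R) by exact: poly2_cst.
have e1 : proj0 (M i) l (cst 1) = cst 1 by exact: (proj0_poly (dM i) p1).
have cf : C1bar E (phi - p).
  exact: (subspB (C1bar_subsp E) cphi (smooth_C1bar E (poly2_smooth pp))).
have sf : sqi leb2 E (phi - p).
  by apply: C0bar_sqi (dM i) _; case/C1barP: cf.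
have spd j : sqi leb2 E (pd j p) by apply: poly2_sqi (poly2_pd j pp); [exact: oM|case: (dM i)].
have sg : sqiM E (grad E p).
  move=> a b; rewrite (_ : ent _ a b = wd E a p); last by apply/funext => x; rewrite /ent mxE.
  by have [_ h] := (H1P _ (dM i)).1 (poly2_H1 (dM i) pp); exact: (h a).2.
have smu : sqiM E u by move=> a b; rewrite (ord1 b); exact: su.
pose gp : pt -> 'cV[R]_2 := fun x => \col_j pd j p x.
have entg a b : ent gp a b = pd a p by apply/funext => x; rewrite /ent mxE.
have sgp : sqiM E gp by move=> a b; rewrite entg.
have spu := proj0M_sqi (dM i) k smu.
have volume : innerM E (proj0M (M i) k u) (grad E p) = \sum_j inner E (vcomp u j) (pd j p).
  apply: (@etrans _ _ (innerM E (proj0M (M i) k u) gp)).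
    apply: (ae_innerM (mM i) spu spu sg sgp); first by move=> a b; exact: ae_all.
    by move=> a b; apply: ae_imp (poly2_wd a (@oM i) pp) => x h Ex; rewrite !mxE h.
  apply: (etrans (proj0M_inner (dM i) smu _)).
    by move=> a b; rewrite entg; apply: poly2_le (poly2_pd a pp); rewrite -subn1 subn1.
  rewrite (innerM_sum (mM i) smu sgp); apply: eq_bigr => j _.
  by rewrite big_ord1 entg.
have ct1 : c_tilde k l (M i) u phi (cst 1) = \sum_j inner E (vcomp u j) (wd (cell Om) j phi).
  rewrite /c_tilde e1 -/p -/E.
  have -> : inner E (fun x => frob (proj0M (M i) k u x) (grad E p x)) (cst 1) =
      innerM E (proj0M (M i) k u) (grad E p).
    by apply: eq_Rint => x _; rewrite mulr1.
  have -> : bdint (M i) (fun e x => frob (u x) (enor e) * (phi x - p x) * cst 1 x) =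
      bdint (M i) (fun e x => frob (u x) (enor e) * (phi - p) x).
    by apply: eq_bdint => e x _ _; rewrite mulr1.
  rewrite volume (element_green vu (fun j => (Vh_loc_SG vl j).1) cf).
  have spz j : sqi leb2 E (wd (cell Om) j phi - pd j p).
    exact: (subspB (sqi_subsp leb2 (mM i)) (swp j) (spd j)).
  have pI := psd_ipg leb2 (mM i).
  have part j : \int[leb2]_(x in E) (wd (cell Om) j (vcomp u j) x * (phi - p) x +
      vcomp u j x * pd j (phi - p) x) = inner E (wd (cell Om) j (vcomp u j)) (phi - p) +
      (inner E (vcomp u j) (wd (cell Om) j phi) - inner E (vcomp u j) (pd j p)).
    have [_ /(_ j)[f' [cf' hf']]] := (C1barP _ _).1 cf.
    have [_ /(_ j)[q [cq hq]]] := (C1barP _ _).1 cphi.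
    have sf' : sqi leb2 E f' := C0bar_sqi (dM i) cf'.
    have fz : {ae leb2, forall x, E x -> f' x = (wd (cell Om) j phi - pd j p) x}.
      have wE := wdE (@oM i) (C1bar_is_wd j (@oM i) cphi).
      apply: ae_imp2 wE (wd_cell i j hphi) => x h1 h2 Ex.
      have [df ef] := hf' x Ex; have [dphi _] := hq x Ex.
      rewrite -ef -[RHS]/(wd (cell Om) j phi x - pd j p x) -(h2 Ex) (h1 Ex).
      rewrite (_ : phi - p = -1 *: p + phi); last by rewrite scaleN1r addrC.
      rewrite pd_lin//; first by rewrite mulN1r addrC.
      exact: smooth_derivable (poly2_smooth pp).
    transitivity (\int[leb2]_(x in E) (wd (cell Om) j (vcomp u j) x * (phi - p) x +
      vcomp u j x * f' x)).
      by apply: eq_Rint => x Ex; rewrite (hf' x Ex).2.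
    rewrite (RintegralD (mM i) (sqi_mul (mM i) (sw j) sf) (sqi_mul (mM i) (su j) sf')).
    congr (_ + _).
    apply: (etrans (ae_ipg (mM i) (sqi_meas (su j)) (sqi_meas sf') (sqi_meas (su j))
      (sqi_meas (spz j)) (ae_all leb2 (fun x _ => erefl _)) fz)).
    exact: (psdBr pI (swp j) (spd j) (su j)).
  have divf : \sum_j inner E (wd (cell Om) j (vcomp u j)) (phi - p) = 0.
    rewrite sum_ord2; apply: (etrans (esym (psdDl pI (sw 0) (sw 1) sf))).
    apply: (etrans _ (psd0l pI sf)).
    have s0 : sqi leb2 E (fun=> 0) by case: (sqi_subsp leb2 (mM i)).
    have s2 := subspD (sqi_subsp leb2 (mM i)) (sw 0) (sw 1).
    apply: (ae_ipg (mM i) (sqi_meas s2) (sqi_meas sf) (sqi_meas s0) (sqi_meas sf) _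
      (ae_all leb2 (fun x _ => erefl _))).
    by apply: ae_imp d0 => x h Ex; have := h (sub x Ex); rewrite divvE.
  rewrite (eq_bigr _ (fun j _ => part j)) big_split /= divf add0r -big_split /=.
  by apply: eq_bigr => j _; rewrite addrC subrK.
have ct2 : c_tilde k l (M i) u (cst 1) phi = 0.
  rewrite /c_tilde e1.
  have -> : bdint (M i) (fun e x => frob (u x) (enor e) * (cst 1 x - cst 1 x) *
      proj0 (M i) l phi x) = 0.
    rewrite (eq_bdint (G := fun _ _ => 0)); last by move=> e x _ _; rewrite subrr mulr0 mul0r.
    by rewrite bdint_cst mul0r.
  rewrite addr0; have w1 j : sqi leb2 E (wd E j (cst 1)).
    by have [_ h] := (H1P _ (dM i)).1 (poly2_H1 (dM i) p1); exact: (h j).2.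
  have ge j x : grad E (cst 1) x j 0 = wd E j (cst 1) x by rewrite mxE.
  transitivity (\int[leb2]_(x in E) (fun=> 0) x); last by rewrite /Rintegral integral0.
  apply: ae_eq_meas => //.
  - have [_ _ bM] := dM i; have sp : sqi leb2 E p := poly2_sqi (@oM i) bM pp.
    apply: measurable_funM; last exact: (sqi_meas sp).
    rewrite (_ : (fun x => _) = (fun x => ent (proj0M (M i) k u) 0 0 x * wd E 0 (cst 1) x +
      ent (proj0M (M i) k u) 1 0 x * wd E 1 (cst 1) x)).
      by apply: measurable_funD; apply: measurable_funM;
        [exact: (sqi_meas (spu 0 0))|exact: (sqi_meas (w1 0))|exact: (sqi_meas (spu 1 0))|exact: (sqi_meas (w1 1))].
    by apply/funext => x; rewrite frob_col2 !ge.
  - apply: ae_imp2 (wd_cst 1 0 (@oM i)) (wd_cst 1 1 (@oM i)) => x h1 h2 Ex.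
    by rewrite frob_col2 !ge (h1 Ex) (h2 Ex) !mulr0 addr0 mul0r.
by rewrite /c_loc ct1 ct2 subr0.
Qed.

(** Summed over the elements, the half integrals of u.grad phi give the integral of
  div (phi u), which vanishes since u has zero trace and zero divergence. *)
Lemma convection_mass k l u phi : (l.-1 <= k)%N -> (1 < l)%N ->
  Zh k Om M u -> Hh l Om M phi -> \sum_i c_loc k l (M i) u phi (cst 1) = 0.
Proof.
move=> hkl l1 zu [[[hphi _] _] hl]; have d0 := divergence_free zu.
have [[vu vl] _] := zu.
under eq_bigr => i _ do rewrite (element_convection hkl l1 vu (vl i) hphi (hl i) d0).
have hu j : H1 (cell Om) (vcomp u j) by case: (vu j).
have su j := ((H1P _ dO).1 (hu j)).1.
have sw j := (((H1P _ dO).1 hphi).2 j).2.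
rewrite -mulr_sumr exchange_big /=.
have e j : \sum_i inner (cell (M i)) (vcomp u j) (wd (cell Om) j phi) =
    inner (cell Om) (vcomp u j) (wd (cell Om) j phi).
  by rewrite /inner (Rint_cells pO dec)//; exact: sqi_mul.
rewrite sum_ord2; have E j := etrans (e j) (H10_wd_parts j (vu j) hphi).
apply: (etrans (f_equal (fun s => 2^-1 * s) (f_equal2 +%R (E 0) (E 1)))).
have sphi := ((H1P _ dO).1 hphi).1.
have w j := (((H1P _ dO).1 (hu j)).2 j).2.
rewrite -opprD -[X in - X]/(ipg leb2 _ _ _ + ipg leb2 _ _ _).
rewrite -(psdDl (psd_ipg leb2 mO) (w 0) (w 1) sphi).
have sd := divv_sqi hu.
have s0 : sqi leb2 (cell Om) (cst 0) by exact: sqi_cst mO _ (domain_fin dO).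
have -> : ipg leb2 (cell Om) (wd (cell Om) 0 (vcomp u 0) + wd (cell Om) 1 (vcomp u 1)) phi = 0.
  rewrite -[RHS](psd0l (psd_ipg leb2 mO) sphi).
  have de : divv (cell Om) u = wd (cell Om) 0 (vcomp u 0) + wd (cell Om) 1 (vcomp u 1).
    by apply/funext => x; rewrite divvE.
  rewrite -de; apply: (ae_ipg mO (sqi_meas sd) (sqi_meas sphi) (sqi_meas s0) (sqi_meas sphi) d0).
  exact: ae_all.
by rewrite oppr0 mulr0.
Qed.

End Convection.

(** * Inverse estimates on star-shaped elements *)

(** On the span of finitely many functions all norms are comparable; the proof
  adds the functions one at a time, after orthogonalisation. *)
Lemma span_sup_bound {R : realType} {T : Type} (S : set (T -> R)) (B : (T -> R) -> (T -> R) -> R)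
    (X : set T) (s : seq (T -> R)) : psd S B -> (forall e, e \in s -> S e) ->
  (forall e, e \in s -> exists K, forall x, X x -> `|e x| <= K) ->
  (forall p, S p -> B p p = 0 -> p = 0) ->
  exists2 C, 0 <= C & forall p, span s p -> forall x, X x -> `|p x| <= C * Num.sqrt (B p p).
Proof.
move=> pB; elim: s => [|e s IH] sS bd df.
  exists 0 => // p -> x _; rewrite normr0 mul0r //.
have sS' f : f \in s -> S f by move=> fs; apply: sS; rewrite inE fs orbT.
have [C C0 hC] := IH sS' (fun f fs => bd f (introT orP (or_intror fs))) df.
have Se : S e by apply: sS; rewrite mem_head.
have subS := (let: And4 a _ _ _ := pB in a) : subsp S.
have spS p : span s p -> S p by exact: span_sub.
have [pe spe orth] := psd_projection pB sS' Se.
pose d := e - pe; have Sd : S d by exact: (subspB subS Se (spS _ spe)).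
have [K0 hK0] := bd e (mem_head _ _).
have [K K1 hK] : exists2 K, 0 <= K & forall x, X x -> `|d x| <= K.
  exists (`|K0| + C * Num.sqrt (B pe pe)); first by rewrite addr_ge0 ?mulr_ge0 ?sqrtr_ge0.
  move=> x Xx; rewrite -[d x]/(e x - pe x); apply: (le_trans (ler_normB _ _)); apply: lerD.
    by apply: le_trans (hK0 x Xx) _; exact: ler_norm.
  exact: hC.
pose b := Num.sqrt (B d d).
exists (K / b + C); first by rewrite addr_ge0// divr_ge0// sqrtr_ge0.
move=> _ [a [q [sq ->]]] x Xx.
pose q' := a *: pe + q; have sq' : span s q' by case: (span_subsp s) => _; exact.
have -> : a *: e + q = a *: d + q' by rewrite /d /q' scalerBr addrA subrK.
set p := a *: d + q'; have Sq' := spS _ sq'.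
have Sp : S p by case: subS => _; exact.
have Bp : B p p = a ^+ 2 * B d d + B q' q'.
  rewrite /p [a *: d + q']addrC (psd_sqrD pB a Sq' Sd) (psdC pB Sq' Sd) orth//.
  by rewrite mulr0 addr0 addrC.
have Bd0 := psd_ge0 pB Sd; have Bq0 := psd_ge0 pB Sq'.
have hq : `|q' x| <= C * Num.sqrt (B p p).
  apply: le_trans (hC _ sq' x Xx) _; rewrite ler_wpM2l// ler_wsqrtr// Bp lerDr.
  by rewrite mulr_ge0 ?sqr_ge0.
rewrite mulrDl -[p x]/(a * d x + q' x); apply: (le_trans (ler_normD _ _)); apply: lerD => //.
have [d0|dn0] := eqVneq (B d d) 0.
  by rewrite (df d Sd d0) mulr0 normr0 mulr_ge0 ?sqrtr_ge0// divr_ge0 ?sqrtr_ge0.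
have b0 : 0 < b by rewrite sqrtr_gt0 lt_neqAle eq_sym dn0.
have ab : `|a| * b <= Num.sqrt (B p p).
  rewrite -sqrtr_sqr -sqrtrM ?sqr_ge0// ler_wsqrtr// Bp lerDl//.
rewrite normrM mulrAC ler_pdivlMr// mulrAC mulrC.
by apply: ler_pM; [exact: normr_ge0|rewrite mulr_ge0// ltW|exact: hK|exact: ab].
Qed.

Section Boxes.
Context {R : realType}.
Local Notation pt := (R * R)%type.
Local Notation leb := (@lebesgue_measure R).

Lemma box_sep (a b : pt) (g h : R -> R) : continuous g -> continuous h ->
  \int[leb2]_(x in cbox a b) (g x.1 * h x.2) =
  (\int[leb]_(x in `[a.1, b.1]) g x) * \int[leb]_(y in `[a.2, b.2]) h y.
Proof.
move=> cg ch; pose f (x : pt) := g x.1 * h x.2.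
have mb : measurable2 (cbox a b) by exact: cbox_measurable.
have cf : continuous f.
  by move=> x; apply: cvgM; apply: continuous_comp; [exact: cvg_fst|exact: cg|exact: cvg_snd|exact: ch].
have If : intg leb2 (cbox a b) f.
  have [M hM] := compact_bound (cbox_compact (a := a) (b := b)) (continuous_subspaceT cf).
  exact: (intg_bound mb (leb2_cbox a b) (cont_meas mb cf) hM).
have [_ _ e] := slice_fubini 0 ((intg_restrict _ _ mb).2 If).
have ig : intg leb `[a.1, b.1] g.
  by apply: continuous_compact_integrable; [exact: segment_compact|exact: continuous_subspaceT].
have ih : intg leb `[a.2, b.2] h.
  by apply: continuous_compact_integrable; [exact: segment_compact|exact: continuous_subspaceT].
rewrite Rintegral_mkcond e -RintegralZl// [RHS]Rintegral_mkcond.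
apply: eq_Rint => y _; rewrite patchE; case: ifPn => [yI|yI].
  rewrite mulrC -RintegralZl// [RHS]Rintegral_mkcond; apply: eq_Rint => x _.
  rewrite !patchE /slice_pt /=; have -> : ((x, y) \in cbox a b) = (x \in `[a.1, b.1]%classic).
    apply/idP/idP; rewrite !inE /cbox /=; first by case.
    by move=> xI; split => //; move: yI; rewrite inE.
  by case: ifP => //; rewrite /f mulrC.
rewrite (_ : (fun x => _) = cst 0) ?Rintegral_cst ?mul0r//.
apply/funext => x; rewrite patchE /slice_pt /=; case: ifPn => //.
by rewrite inE /cbox /= => -[_ h2]; move: yI; rewrite notin_setE; case.
Qed.

Lemma itv_scale (g : R -> R) (c w : R) : 0 < w -> continuous g ->
  \int[leb]_(x in `[c, c + w]) g x = w * \int[leb]_(s in `[0, 1]) g (c + w * s).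
Proof.
move=> w0 cg; have cw : c < c + w by rewrite ltrDl.
have cH : {within `[0, 1], continuous (fun s => g (c + w * s))}.
  apply: continuous_subspaceT => s; apply: continuous_comp; last exact: cg.
  by apply: cvgD; [exact: cvg_cst|apply: cvgM; [exact: cvg_cst|exact: cvg_id]].
have wE : c + w - c = w by rewrite addrC addKr.
have [_] := affine_subst cw cH (or_introl (erefl (c, c + w - c))); rewrite wE => <-.
apply: eq_Rint => x _; congr g; rewrite mulrC divfK ?gt_eqF//; ring.
Qed.

Definition scale_pt (c : pt) (w : R) (x : pt) : pt := (c.1 + w * x.1, c.2 + w * x.2).

Lemma poly2_mul m n (p q : pt -> R) : poly2 m p -> poly2 n q -> poly2 (m + n) (p * q).
Proof.
move=> pp pq; pose S1 : set (pt -> R) := [set p | poly2 (m + n) (p * q)].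
apply: (poly2_ind (S := S1)) pp.
  split; first by rewrite /S1 /= mul0r; case: (@poly2_subsp R (m + n)).
  move=> a f g hf hg; rewrite /S1 /= (_ : _ * q = a *: (f * q) + g * q).
    exact: (proj2 (@poly2_subsp R _)).
  apply/funext => x; rewrite -[LHS]/((a * f x + g x) * q x).
  by rewrite -[RHS]/(a * (f x * q x) + g x * q x) mulrDl mulrA.
move=> i j ijm; pose S2 : set (pt -> R) := [set q | poly2 (m + n) (mono i j * q)].
apply: (poly2_ind (S := S2)) pq.
  split; first by rewrite /S2 /= mulr0; case: (@poly2_subsp R (m + n)).
  move=> a f g hf hg; rewrite /S2 /= (_ : _ * _ = a *: (mono i j * f) + mono i j * g).
    exact: (proj2 (@poly2_subsp R _)).
  apply/funext => x; rewrite -[LHS]/(mono i j x * (a * f x + g x)).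
  by rewrite -[RHS]/(a * (mono i j x * f x) + mono i j x * g x) mulrDr mulrCA.
move=> i' j' ijn; rewrite /S2 /= (_ : _ * _ = mono (i + i') (j + j')).
  by apply: poly2_mono; rewrite addnACA leq_add.
by apply/funext => x; rewrite /mono !fctE !exprD; ring.
Qed.

Lemma poly2_scale n (c : pt) (w : R) (p : pt -> R) : poly2 n p -> poly2 n (fun x => p (scale_pt c w x)).
Proof.
apply: (poly2_ind (S := [set p | poly2 n (fun x => p (scale_pt c w x))])).
  split; first by case: (@poly2_subsp R n).
  move=> a f g hf hg; exact: (proj2 (@poly2_subsp R n) a _ _ hf hg).
have lin (d : R) (i : 'I_2) : poly2 1 (fun x : pt => d + w * (if i == 0 then x.1 else x.2)).
  elim/ord2_ind: i => /=.
    rewrite (_ : (fun x => _) = (fun=> d) + w *: mono 1 0).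
      by apply: subspD; [exact: poly2_subsp|exact: poly2_cst|apply: (subspZ _ (@poly2_subsp R 1)); exact: poly2_mono].
    by apply/funext => x; rewrite !fctE monoE expr0 mulr1.
  rewrite (_ : (fun x => _) = (fun=> d) + w *: mono 0 1).
    by apply: subspD; [exact: poly2_subsp|exact: poly2_cst|apply: (subspZ _ (@poly2_subsp R 1)); exact: poly2_mono].
  by apply/funext => x; rewrite !fctE monoE expr0 mul1r.
have ex (f : pt -> R) k : poly2 1 f -> poly2 k (fun x => f x ^+ k).
  move=> pf; elim: k => [|k IH].
    by rewrite (_ : (fun x => _) = fun=> 1); [exact: poly2_cst|apply/funext => x; rewrite expr0].
  rewrite (_ : (fun x => _) = f * (fun x => f x ^+ k)); last by apply/funext => x; rewrite exprS.
  exact: (poly2_mul pf IH).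
move=> i j ijn /=; apply: (poly2_le ijn).
exact: (poly2_mul (ex _ i (lin c.1 0)) (ex _ j (lin c.2 1))).
Qed.

Lemma box_scale n (c : pt) (w : R) (p : pt -> R) : 0 < w -> poly2 n p ->
  \int[leb2]_(x in cbox c (c.1 + w, c.2 + w)) p x =
  w ^+ 2 * \int[leb2]_(x in cbox (0, 0) (1, 1)) p (scale_pt c w x).
Proof.
move=> w0 pp.
have pc m (q : pt -> R) : poly2 m q -> continuous q by move=> pq; exact: smooth_cont (poly2_smooth pq).
have ib (a b : pt) (f : pt -> R) : continuous f -> intg leb2 (cbox a b) f.
  move=> cf; have mb : measurable2 (cbox a b) by exact: cbox_measurable.
  have [M hM] := compact_bound (cbox_compact (a := a) (b := b)) (continuous_subspaceT cf).
  exact: (intg_bound mb (leb2_cbox a b) (cont_meas mb cf) hM).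
pose S := [set q : pt -> R | [/\ continuous q, continuous (fun x => q (scale_pt c w x)) &
  \int[leb2]_(x in cbox c (c.1 + w, c.2 + w)) q x =
  w ^+ 2 * \int[leb2]_(x in cbox (0, 0) (1, 1)) q (scale_pt c w x)]].
suff : S p by case.
apply: (poly2_ind (S := S)) pp.
  split.
    split; [by move=> x; exact: cvg_cst|by move=> x; exact: cvg_cst|].
    by rewrite /Rintegral !integral0 mulr0.
  move=> a f g [cf cfs hf] [cg cgs hg].
  have mQ (a' b' : pt) : measurable2 (cbox a' b') by exact: cbox_measurable.
  split; [by move=> x; apply: cvgD; [apply: cvgM; [exact: cvg_cst|exact: cf]|exact: cg]|
    by move=> x; apply: cvgD; [apply: cvgM; [exact: cvg_cst|exact: cfs]|exact: cgs]|].
  rewrite -[LHS]/(\int[leb2]_(x in cbox c (c.1 + w, c.2 + w)) (a * f x + g x)).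
  rewrite -[X in _ * X]/(\int[leb2]_(x in cbox (0, 0) (1, 1))
    (a * f (scale_pt c w x) + g (scale_pt c w x))).
  rewrite !RintegralD//; try exact: ib; try by apply: intgZ => //; exact: ib.
  by rewrite !RintegralZl//; [rewrite hf hg; ring|exact: ib..].
move=> i j _; have pm := @poly2_mono R _ i j (leqnn _).
split; [exact: pc pm|exact: pc (poly2_scale c w pm)|].
have cX k : continuous (fun x : R => x ^+ k) by exact: exprn_continuous.
have cXs (c' : R) k : continuous (fun x : R => (c' + w * x) ^+ k).
  move=> x; have h : {for x, continuous (fun x : R => c' + w * x)}.
    by apply: cvgD; [exact: cvg_cst|apply: cvgM; [exact: cvg_cst|exact: cvg_id]].
  exact: (continuous_comp h (cX k _)).
rewrite -[LHS]/(\int[leb2]_(x in cbox c (c.1 + w, c.2 + w)) (x.1 ^+ i * x.2 ^+ j)).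
rewrite -[X in _ * X]/(\int[leb2]_(x in cbox (0, 0) (1, 1))
  ((c.1 + w * x.1) ^+ i * (c.2 + w * x.2) ^+ j)).
rewrite (box_sep c (c.1 + w, c.2 + w) (cX i) (cX j)) /= !itv_scale//.
rewrite (box_sep (0, 0) (1, 1) (cXs c.1 i) (cXs c.2 j)) /=; ring.
Qed.

End Boxes.

Section InverseEstimate.
Context {R : realType}.
Local Notation pt := (R * R)%type.

(** Equivalence of norms on the polynomials over the unit square, then scaling. *)
Lemma poly_sup_box n (r : R) : exists2 C, 0 <= C & forall (c : pt) (w : R) (p : pt -> R),
  0 < w -> poly2 n p -> forall x, `|x.1 - c.1| <= r * w -> `|x.2 - c.2| <= r * w ->
  p x ^+ 2 <= C * w ^- 2 * inner (cbox c (c.1 + w, c.2 + w)) p p.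
Proof.
pose Q : set pt := cbox (0, 0) (1, 1).
have mQ (a b : pt) : measurable2 (cbox a b) by exact: cbox_measurable.
have bQ : bounded_set (obox ((0, 0) : pt) (1, 1)).
  exists 1; split => // M M1 x [] /=; rewrite !in_itv /= => /andP[a b] /andP[c d].
  rewrite prod_normE /= ge_max !ger0_norm; lra.
have sQ (a b : pt) (p : pt -> R) : poly2 n p -> sqi leb2 (cbox a b) p.
  move=> pp; have [M hM] := compact_bound (cbox_compact (a := a) (b := b))
    (continuous_subspaceT (smooth_cont (poly2_smooth pp))).
  exact: (sqi_bound (mQ a b) (leb2_cbox a b) (cont_meas (mQ a b) (smooth_cont (poly2_smooth pp))) hM).
have pB : psd (@poly2 R n) (inner Q).
  by apply: (psd_sub (psd_ipg leb2 (mQ _ _))) (poly2_subsp n) _ => p; exact: sQ.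
pose X : set pt := [set x | `|x.1| <= r /\ `|x.2| <= r].
have [s hs] := @poly2_span R n.
have sP e : e \in s -> poly2 n e by move=> /mem_span /hs.
have [C C0 hC] : exists2 C, 0 <= C & forall p, span s p -> forall x, X x ->
    `|p x| <= C * Num.sqrt (inner Q p p).
  apply: (span_sup_bound pB sP).
    move=> e /sP pe; have [M hM] := compact_bound (cbox_compact (a := (- r, - r)) (b := (r, r)))
      (continuous_subspaceT (smooth_cont (poly2_smooth pe))).
    exists M => x [x1 x2]; apply: hM; apply/cboxE.
    by move: x1 x2; rewrite !ler_norml => /andP[? ?] /andP[? ?].
  move=> p pp B0; have := ipg0_ae (mQ _ _) (sQ _ _ _ pp) B0 => h.
  apply: (poly2_ae0 (D := obox (0, 0) (1, 1)) _ _ pp).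
  - exact: obox_open.
  - by exists (1 / 2, 1 / 2); split => /=; rewrite in_itv /=; lra.
  - by apply: ae_imp h => x h /obox_cbox; exact: h.
exists (C ^+ 2) => [|c w p w0 pp x x1 x2]; first exact: sqr_ge0.
pose q x := p (scale_pt c w x); have pq : poly2 n q by exact: poly2_scale.
pose z : pt := ((x.1 - c.1) / w, (x.2 - c.2) / w).
have qz : q z = p x.
  by rewrite /q /scale_pt /z /= ![w * _]mulrC !divfK ?gt_eqF// !subrKC; case: (x).
have Xz : X z by split; rewrite /= normrM normfV (gtr0_norm w0) ler_pdivrMr.
have h := hC q ((hs q).1 pq) z Xz; rewrite qz in h.
have h2 : p x ^+ 2 <= C ^+ 2 * inner Q q q.
  rewrite -[p x ^+ 2]real_normK ?num_real// -[inner Q q q]sqr_sqrtr ?(psd_ge0 pB)// -exprMn.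
  by rewrite lerXn2r ?nnegrE ?mulr_ge0 ?sqrtr_ge0.
apply: (le_trans h2); rewrite -mulrA ler_wpM2l ?sqr_ge0// le_eqVlt; apply/orP; left; apply/eqP.
have := box_scale c w0 (poly2_mul pp pp); rewrite /inner => e.
apply: esym; apply: (etrans (f_equal (fun t => w ^- 2 * t) e)).
by rewrite mulKf// expf_neq0// gt_eqF.
Qed.

Lemma euclid_coord (x y : pt) : `|x.1 - y.1| <= euclid_dist x y /\ `|x.2 - y.2| <= euclid_dist x y.
Proof.
rewrite euclid_distE -!sqrtr_sqr; split; apply: ler_wsqrtr.
  by rewrite lerDl sqr_ge0.
by rewrite lerDr sqr_ge0.
Qed.

Lemma euclid_le (x y : pt) (d : R) : `|x.1 - y.1| <= d -> `|x.2 - y.2| <= d ->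
  euclid_dist x y <= 2 * d.
Proof.
move=> h1 h2; have d0 : 0 <= d by exact: le_trans h1.
rewrite euclid_distE -[leRHS]ger0_norm ?mulr_ge0// -sqrtr_sqr; apply: ler_wsqrtr.
have s1 : (x.1 - y.1) ^+ 2 <= d ^+ 2 by rewrite -(real_normK (num_real _)) lerXn2r ?nnegrE.
have s2 : (x.2 - y.2) ^+ 2 <= d ^+ 2 by rewrite -(real_normK (num_real _)) lerXn2r ?nnegrE.
have s3 : 0 <= d ^+ 2 by exact: sqr_ge0.
rewrite exprMn (_ : 2 ^+ 2 = 4); last by ring.
lra.
Qed.

Lemma le_diam (D : set pt) x y : bounded_set D -> D x -> D y -> euclid_dist x y <= diam D.
Proof.
move=> bD Dx Dy; have [M M0 hM] := bounded_cbox bD.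
apply: ub_le_sup; last by exists x, y.
exists (2 * (2 * M)) => _ [a [b [Da Db ->]]]; apply: euclid_le.
  have /cboxE[/= ? ? ? ?] := hM _ Da; have /cboxE[/= ? ? ? ?] := hM _ Db.
  by rewrite ler_norml; apply/andP; split; lra.
have /cboxE[/= ? ? ? ?] := hM _ Da; have /cboxE[/= ? ? ? ?] := hM _ Db.
by rewrite ler_norml; apply/andP; split; lra.
Qed.

Lemma diam_gt0 (D : set pt) : open D -> D !=set0 -> bounded_set D -> 0 < diam D.
Proof.
move=> oD D0 bD; have [a [b [ab1 ab2 sub]]] := open_has_box oD D0.
pose x : pt := (a.1 + (b.1 - a.1) / 3, (a.2 + b.2) / 2).
pose y : pt := (a.1 + 2 * (b.1 - a.1) / 3, (a.2 + b.2) / 2).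
have Dx : D x by apply: sub; split => /=; rewrite in_itv /=; apply/andP; split; lra.
have Dy : D y by apply: sub; split => /=; rewrite in_itv /=; apply/andP; split; lra.
apply: lt_le_trans (le_diam bD Dy Dx); apply: lt_le_trans (euclid_coord y x).1.
by rewrite /= gtr0_norm; lra.
Qed.

(** A regular element contains a square of comparable size, around the centre c of
  the ball of star points; on the whole element a polynomial is bounded by its mean
  square over that square, and the projection does not increase mean squares. *)
Lemma proj0_bounded n (rho : R) : 0 < rho -> exists2 C, 0 <= C & forall (E : polygon R),
  polygonal_domain E ->
  (exists c r, rho * diam (cell E) <= r /\
     forall y, euclid_dist y c < r -> forall x, cell E x ->
       forall s, 0 <= s <= 1 -> cell E (edge_pt (y, x) s)) ->
  forall (f : pt -> R) (K : R), sqi leb2 (cell E) f ->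
  {ae leb2, forall x, cell E x -> `|f x| <= K} ->
  forall x, cell E x -> proj0 E n f x ^+ 2 <= C * K ^+ 2.
Proof.
move=> rho0; pose k := 3 / rho; have k0 : 0 < k by rewrite divr_gt0.
have [C C0 hC] := poly_sup_box n k.
pose A := inner (cbox ((0, 0) : pt) (1, 1)) (fun=> 1) (fun=> 1).
have A0 : 0 <= A by apply: Rintegral_ge0 => x _; rewrite mulr1.
exists (C * ((2 * k) ^+ 2 * A)).
  by rewrite mulr_ge0// mulr_ge0// sqr_ge0.
move=> E pE [c [r [hr star]]] f K sf fK x Ex.
have dE := polygonal_domain_domain pE; have mE := domain_meas dE.
have [oE E0 bE] := dE.
have h0 := diam_gt0 oE E0 bE; have r0 : 0 < r by apply: lt_le_trans hr; rewrite mulr_gt0.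
have bE' y : euclid_dist y c < r -> cell E y.
  move=> yr; have := star y yr x Ex 0; rewrite lexx ler01 => /(_ isT).
  by rewrite edge_ptE /= !mul0r !addr0; case: (y).
have Ec : cell E c by apply: bE'; rewrite euclid_distE !subrr expr0n addr0 sqrtr0.
pose w := r / 3; have w0 : 0 < w by rewrite divr_gt0.
have kw : k * w = r / rho by rewrite /k /w; field; rewrite gt_eqF.
have hw : diam (cell E) <= k * w by rewrite kw ler_pdivlMr// mulrC.
have near_c y : cell E y -> `|y.1 - c.1| <= k * w /\ `|y.2 - c.2| <= k * w.
  move=> Ey; have [e1 e2] := euclid_coord y c; have ed := le_diam bE Ey Ec.
  by split; apply: le_trans hw; apply: le_trans ed.
pose B := cbox c (c.1 + w, c.2 + w); have mB : measurable2 B by exact: cbox_measurable.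
have BE : B `<=` cell E.
  move=> y /cboxE[/= b1 b2 b3 b4]; apply: bE'.
  apply: (@le_lt_trans _ _ (2 * w)); last by rewrite /w; lra.
  by apply: euclid_le; rewrite ger0_norm; lra.
have [pp _] := proj0P dE n sf; set p := proj0 E n f in pp *.
have sp : sqi leb2 (cell E) p by exact: (poly2_sqi oE bE pp).
have [x1 x2] := near_c x Ex.
apply: le_trans (hC c w p w0 pp x x1 x2) _.
have iE (q : pt -> R) : sqi leb2 (cell E) q -> intg leb2 (cell E) (fun x => q x * q x).
  by move=> sq; exact: (sqi_mul mE sq sq).
have BB : inner B p p <= inner (cell E) p p.
  by apply: le_Rint_subset => // [|y _]; [exact: iE|by rewrite -expr2 sqr_ge0].
have s1 : sqi leb2 (cell E) (fun=> 1) by exact: (sqi_cst mE 1 (domain_fin dE)).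
have fE : inner (cell E) f f <= K ^+ 2 * inner (cell E) (fun=> 1) (fun=> 1).
  have -> : K ^+ 2 * inner (cell E) (fun=> 1) (fun=> 1) =
      \int[leb2]_(x in cell E) (K ^+ 2 * (1 * 1)).
    by symmetry; apply: RintegralZl => //; exact: (iE _ s1).
  apply: le_Rint_ae => //; [exact: iE|by apply: intgZ => //; exact: (iE _ s1)|].
  apply: ae_imp fK => y fy Ey; have fy' := fy Ey.
  rewrite !mulr1 -expr2 -(real_normK (num_real (f y))).
  by rewrite ler_sqr ?nnegrE//; apply: le_trans fy'.
have oneE : inner (cell E) (fun=> 1) (fun=> 1) <= (2 * (k * w)) ^+ 2 * A.
  pose W := 2 * (k * w); pose c' : pt := (c.1 - k * w, c.2 - k * w).
  have W0 : 0 < W by rewrite mulr_gt0// mulr_gt0.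
  have p1 : poly2 0 (fun _ : pt => 1 * 1 : R) by exact: poly2_cst.
  have := box_scale c' W0 p1; rewrite -/(inner _ _ _) => {1}<-.
  have mB' : measurable2 (cbox c' (c'.1 + W, c'.2 + W)) by exact: cbox_measurable.
  have i1 : intg leb2 (cbox c' (c'.1 + W, c'.2 + W)) (fun=> 1 * 1).
    by have s2 := sqi_cst mB' 1 (leb2_cbox _ _); exact: (sqi_mul mB' s2 s2).
  apply: le_Rint_subset i1 _ => //.
  move=> y /near_c [y1 y2]; apply/cboxE; move: y1 y2; rewrite !ler_norml /c' /W /=.
  by move=> /andP[? ?] /andP[? ?]; split; lra.
have pf := proj0_contract dE n sf.
have w2 : 0 <= w ^- 2 by rewrite invr_ge0 sqr_ge0.
have -> : C * ((2 * k) ^+ 2 * A) * K ^+ 2 = C * w ^- 2 * (K ^+ 2 * ((2 * (k * w)) ^+ 2 * A)).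
  by field; rewrite gt_eqF.
apply: ler_wpM2l; first by rewrite mulr_ge0.
apply: le_trans BB _; apply: le_trans pf _; apply: le_trans fE _.
by apply: ler_wpM2l => //; exact: sqr_ge0.
Qed.

End InverseEstimate.

(** * Energy identity for curves in a semidefinite inner product space *)

Lemma intg_le_ae {d} {T : measurableType d} {R : realType} (mu : {measure set T -> \bar R})
    (A : set T) (f g : T -> R) : measurable A -> measurable_fun A f -> intg mu A g ->
  {ae mu, forall x, A x -> `|f x| <= g x} -> intg mu A f.
Proof.
move=> mA mf ig fg; have ng := intg_norm ig.
pose f' x := Num.max (- `|g x|) (Num.min (f x) `|g x|).
have mf' : measurable_fun A f'.
  apply: measurable_maxr; last by apply: measurable_minr => //; exact: intg_meas ng.
  by apply: measurableT_comp => //; exact: intg_meas ng.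
apply: (@ae_intg _ _ _ mu A mA f') => //.
  apply: ae_imp fg => x h Ax; have {}h := le_trans (h Ax) (ler_norm (g x)).
  move: h; rewrite ler_norml => /andP[h1 h2].
  by rewrite /f' (min_idPl h2) (max_idPr h1).
apply: (intg_le mA mf' _ ng) => x _; rewrite normr_id ler_norml /f'.
rewrite le_max lexx /= ge_max ge_min lexx orbT andbT.
by apply: le_trans (normr_ge0 _); rewrite oppr_le0.
Qed.

(** A function that is uniformly approximable, relatively to an integrable weight,
  by integrable functions is integrable up to a null set; the null set cannot be
  discarded because the measure need not be complete. *)
Lemma ae_approx {d} {T : measurableType d} {R : realType} (mu : {measure set T -> \bar R})
    (A : set T) (h N : T -> R) : measurable A -> intg mu A N ->
  (forall e : R, 0 < e -> exists2 f, intg mu A f &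
     {ae mu, forall x, A x -> `|h x - f x| <= e * N x}) ->
  exists2 H, intg mu A H & {ae mu, forall x, A x -> H x = h x}.
Proof.
move=> mA iN app.
have ex n : exists f, intg mu A f /\
    {ae mu, forall x, A x -> `|h x - f x| <= n.+1%:R^-1 * N x}.
  by have [f ? ?] := app n.+1%:R^-1 (ltac:(by rewrite invr_gt0 ltr0n)); exists f.
have {ex} [f /all_and2 [iF fh]] := choice ex.
pose H x := fine (limn_esup (fun n => (f n x)%:E)).
have mH : measurable_fun A H.
  apply: (measurableT_comp (f := fine)) => //.
  apply: (@measurable_fun_limn_esup _ _ _ A (fun n => EFin \o f n)) => n.
  exact/measurable_EFinP/intg_meas/iF.
have Hh : {ae mu, forall x, A x -> H x = h x}.
  have /ae_foralln := fh; apply: ae_imp => x hx Ax; rewrite /H.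
  have cv : (f n x)%:E @[n --> \oo] --> (h x)%:E.
    apply: cvg_EFin; first exact: nearW.
    apply/cvgrPdist_le => e e0.
    have [n0 hn0] : exists n0, N x / e <= n0%:R.
      exists (Num.bound `|N x / e|); apply: le_trans (ler_norm _) _.
      exact: ltW (archi_boundP (normr_ge0 _)).
    near=> n; apply: le_trans (hx n Ax) _.
    rewrite mulrC ler_pdivrMr ?ltr0n// mulrC -ler_pdivrMr//.
    apply: le_trans hn0 _; rewrite ler_nat leqW//.
    by near: n; exact: nbhs_infty_ge.
  by rewrite (cvg_limn_einf_sup cv).2.
exists H => //.
apply: (@intg_le_ae _ _ _ mu A H (fun x => `|f 0%N x| + N x)) => //.
  by apply: intgD => //; apply: intg_norm; exact: iF.
apply: ae_imp2 Hh (fh 0%N) => x hx fx Ax; rewrite hx//; have := fx Ax.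
rewrite invr1 mul1r => {}fx; rewrite -[h x](subrK (f 0%N x)).
by apply: le_trans (ler_normD _ _) _; rewrite addrC lerD2l.
Unshelve. all: by end_near.
Qed.

Section Energy.
Context {R : realType} {V : lmodType R} (S : set V) (B m : V -> V -> R) (beta T : R).
Context (w w' : R -> V) (N : R -> R).
Local Notation leb := (@lebesgue_measure R).
Local Notation D := (`]0, T[%classic : set R).
Local Notation itv s t := (`]s, t]%classic : set R).

Hypotheses (pB : psd S B) (pm : psd S m) (beta0 : 0 <= beta).
Hypothesis mB : forall u, S u -> m u u <= beta * B u u.
Hypotheses (T0 : 0 < T) (iN : intg leb D N) (N0 : forall r, 0 <= N r).
Hypotheses (Sw0 : S (w 0)) (Sw : {ae leb, forall r, 0 < r < T -> S (w r)}).
Hypothesis Sw' : {ae leb, forall r, 0 < r < T -> S (w' r) /\ B (w' r) (w' r) <= N r ^+ 2}.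
Hypothesis iw : forall z, S z -> intg leb D (fun r => B (w' r) z).
Hypothesis weak : forall t z, 0 <= t < T -> S (w t) -> S z ->
  B (w t - w 0) z = \int[leb]_(r in itv 0 t) B (w' r) z.

Let good t := 0 <= t < T /\ S (w t).
Let I s t := \int[leb]_(r in itv s t) N r.
Let sS : subsp S. Proof. by case: pB. Qed.
Let mD : measurable D. Proof. exact: measurable_itv. Qed.
Let mI s t : measurable (itv s t). Proof. exact: measurable_itv. Qed.

Let DP r : D r <-> 0 < r < T. Proof. by rewrite /= in_itv. Qed.
Let IP s t r : itv s t r <-> s < r <= t. Proof. by rewrite /= in_itv. Qed.

Let sub (s : R) (t : R) : 0 <= s -> t < T -> itv s t `<=` D.
Proof. by move=> s0 tT r /IP/andP[sr rt]; apply/DP/andP; split; lra. Qed.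

Let intI F (s : R) (t : R) : 0 <= s -> t < T -> intg leb D F -> intg leb (itv s t) F.
Proof. by move=> s0 tT iF; apply: intgS iF => //; exact: sub. Qed.

Let split_int F (s : R) (c : R) (t : R) : 0 <= s -> t < T -> s <= c <= t -> intg leb D F ->
  \int[leb]_(r in itv s t) F r =
  \int[leb]_(r in itv s c) F r + \int[leb]_(r in itv c t) F r.
Proof.
move=> s0 tT /andP[sc ct] iF.
have := @Rintegral_itvB _ F (BRight s) (BRight t) c (intI s0 tT iF).
rewrite !bnd_simp => /(_ sc ct) <-.
by rewrite addrC subrK.
Qed.

Let I_ge0 (s : R) (t : R) : 0 <= I s t.
Proof. by apply: Rintegral_ge0 => r _; exact: N0. Qed.

Let ae_sub P (s : R) (t : R) : 0 <= s -> t < T -> {ae leb, forall r, 0 < r < T -> P r} ->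
  {ae leb, forall r, itv s t r -> P r}.
Proof. by move=> s0 tT; apply: ae_imp => r h /(sub s0 tT)/DP; exact: h. Qed.

Let ae_D P : {ae leb, forall r, 0 < r < T -> P r} -> {ae leb, forall r, D r -> P r}.
Proof. by apply: ae_imp => r h /DP; exact: h. Qed.

Let good_in (s : R) (t : R) : 0 <= s -> s < t -> t <= T -> exists2 c : R, s < c < t & good c.
Proof.
move=> s0 st tT; apply: contrapT => /forall2NP no.
have [A [mA A0 AP]] := Sw.
have sA : `]s, t[%classic `<=` A.
  move=> r /=; rewrite in_itv /= => /andP[sr rt]; apply: AP => /= h.
  have [/negP[]|[]] := no r; first by rewrite sr rt.
  have r0 : 0 < r < T by apply/andP; split; lra.
  by split; [apply/andP; split; lra|exact: h].
have : (leb `]s, t[%classic <= leb A)%E by apply: le_measure; rewrite ?inE//; exact: measurable_itv.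
rewrite A0 lebesgue_measure_itv/= lte_fin st -EFinB lee_fin; lra.
Qed.

Let small (e : R) : 0 < e -> exists2 d, 0 < d & forall s t : R, 0 <= s -> t < T -> t - s < d -> I s t <= e.
Proof.
move=> e0; have iN' : intg leb setT (N \_ D) by apply/intg_restrict.
have [d [d0 h]] := integral_normr_continuous iN' e0.
exists d => // s t s0 tT std.
have : \int[leb]_(r in itv s t) `|(N \_ D) r| < e.
  apply: h; first exact: mI.
  rewrite [ltLHS](_ : _ = (if (s%:E < t%:E)%E then (t%:E - s%:E)%E else 0%E)); last first.
    exact: (lebesgue_measure_itv (Interval (BRight s) (BRight t))).
  by case: ifP => _; rewrite ?lte_fin// -EFinB lte_fin.
move=> /ltW; congr (_ <= _); apply: eq_Rint => r /(sub s0 tT) Dr.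
by rewrite patchE mem_set// ger0_norm.
Qed.

Let incr (s : R) (t : R) z : good s -> good t -> s <= t -> S z ->
  B (w t - w s) z = \int[leb]_(r in itv s t) B (w' r) z.
Proof.
move=> [/andP[s0 sT] Ss] [/andP[t0 tT] St] st Sz.
have -> : w t - w s = (w t - w 0) - (w s - w 0) by rewrite opprB addrA subrK.
rewrite (psdBl pB)//; [|exact: subspB|exact: subspB].
rewrite !weak ?s0 ?t0//.
rewrite (split_int (lexx 0) tT (c := s)) ?s0//; last exact: iw.
by rewrite addrC addKr.
Qed.

Let Bw' z : S z -> {ae leb, forall r, 0 < r < T -> `|B (w' r) z| <= Num.sqrt (B z z) * N r}.
Proof.
move=> Sz; apply: ae_imp Sw' => r h r0; have [Sr hr] := h r0.
apply: le_trans (psd_cs pB Sr Sz) _; rewrite mulrC ler_wpM2l//.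
by rewrite -[leRHS]ger0_norm// -sqrtr_sqr ler_sqrt// sqr_ge0.
Qed.

Let incr_norm (s : R) (t : R) : good s -> good t -> s <= t ->
  Num.sqrt (B (w t - w s) (w t - w s)) <= I s t.
Proof.
move=> gs gt st; have [/andP[s0 sT] Ss] := gs; have [/andP[t0 tT] St] := gt.
set d := w t - w s; have Sd : S d by exact: subspB.
set x := Num.sqrt _; have x0 : 0 <= x by exact: sqrtr_ge0.
have h : x * x <= x * I s t.
  rewrite -expr2 sqr_sqrtr ?(psd_ge0 pB)// {1}/d incr//.
  rewrite /I -RintegralZl//; last exact: intI.
  apply: le_Rint_ae => //; [exact/intI/iw|by apply: intgZ => //; exact: intI|].
  by apply: ae_imp (ae_sub s0 tT (Bw' Sd)) => r hr Ir; apply: le_trans (hr Ir); exact: ler_norm.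
have [x00|x1] := eqVneq x 0; first by rewrite x00.
by move: h; rewrite ler_pM2l// lt_def x1.
Qed.

Let sqrt_beta u : S u -> Num.sqrt (m u u) <= Num.sqrt beta * Num.sqrt (B u u).
Proof.
move=> Su; rewrite -sqrtrM// ler_sqrt; first exact: mB.
by rewrite mulr_ge0// (psd_ge0 pB).
Qed.

Let mBnd u v : S u -> S v -> `|m u v| <= beta * (Num.sqrt (B u u) * Num.sqrt (B v v)).
Proof.
move=> Su Sv; apply: le_trans (psd_cs pm Su Sv) _.
have -> : beta * (Num.sqrt (B u u) * Num.sqrt (B v v)) =
    (Num.sqrt beta * Num.sqrt (B u u)) * (Num.sqrt beta * Num.sqrt (B v v)).
  by rewrite mulrACA -expr2 sqr_sqrtr.
by apply: ler_pM => //; exact: sqrt_beta.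
Qed.

Let mw' z : S z -> {ae leb, forall r, 0 < r < T -> `|m (w' r) z| <= beta * (N r * Num.sqrt (B z z))}.
Proof.
move=> Sz; apply: ae_imp Sw' => r h r0; have [Sr hr] := h r0.
apply: le_trans (mBnd Sr Sz) _; rewrite ler_wpM2l// ler_wpM2r//.
by rewrite -[leRHS]ger0_norm// -sqrtr_sqr ler_sqrt// sqr_ge0.
Qed.

(** The form m is not an integral, so its action on the curve is reached by
  approximating the functional m(., z) by inner products with elements of S. *)
Let weak_m z : S z -> exists F : R -> R, [/\ intg leb D F,
  {ae leb, forall r, 0 < r < T -> F r = m (w' r) z} &
  forall s t : R, good s -> good t -> s <= t -> m (w t - w s) z = \int[leb]_(r in itv s t) F r].
Proof.
move=> Sz.
have riesz (e : R) : 0 < e -> exists2 y, S y & forall u, S u -> `|m u z - B u y| <= e * Num.sqrt (B u u).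
  have L a u v : S u -> S v -> m (a *: u + v) z = a * m u z + m v z.
    by case: pm => _ + _ _ Su Sv; apply.
  have M u : S u -> `|m u z| <= beta * Num.sqrt (B z z) * Num.sqrt (B u u).
    by move=> Su; apply: le_trans (mBnd Su Sz) _; rewrite [_ * Num.sqrt (B z z)]mulrC mulrA.
  move=> e0; have [y Sy hy] := riesz_approx pB L M e0.
  by exists y => // u Su; rewrite (psdC pB Su Sy); exact: hy.
have app (e : R) y : S y -> (forall u, S u -> `|m u z - B u y| <= e * Num.sqrt (B u u)) -> 0 < e ->
    {ae leb, forall r, D r -> `|m (w' r) z - B (w' r) y| <= e * N r}.
  move=> Sy hy e0; apply: ae_D; apply: ae_imp Sw' => r h r0; have [Sr hr] := h r0.
  apply: le_trans (hy _ Sr) _; rewrite ler_pM2l//.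
  by rewrite -[leRHS]ger0_norm// -sqrtr_sqr ler_sqrt// sqr_ge0.
have [F iF Fm] : exists2 F : R -> R, intg leb D F & {ae leb, forall r : R, D r -> F r = m (w' r) z}.
  apply: (@ae_approx _ _ _ leb D (fun r : R => m (w' r) z) N mD iN) => e e0; have [y Sy hy] := riesz e e0.
  by exists (fun r => B (w' r) y); [exact: iw|exact: app].
exists F; split => //.
move=> s t gs gt st; have [/andP[s0 sT] Ss] := gs; have [/andP[t0 tT] St] := gt.
have Sd : S (w t - w s) by exact: subspB.
apply/eqP; rewrite -subr_eq0 -normr_le0; apply/ler_addgt0Pr => e e0; rewrite add0r.
pose k := e / (2 * (1 + I s t)); have k0 : 0 < k.
  by rewrite divr_gt0// mulr_gt0// ltr_pwDl.
have [y Sy hy] := riesz k k0.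
have h1 : `|m (w t - w s) z - \int[leb]_(r in itv s t) B (w' r) y| <= k * I s t.
  rewrite -incr//; apply: le_trans (hy _ Sd) _; rewrite ler_pM2l//.
  exact: incr_norm.
have h2 : `|\int[leb]_(r in itv s t) B (w' r) y - \int[leb]_(r in itv s t) F r| <= k * I s t.
  rewrite -RintegralB//; [|exact/intI/iw|exact: intI].
  have iBF : intg leb (itv s t) (fun r => B (w' r) y - F r).
    by apply: intgB; [exact: mI|exact/intI/iw|exact: intI].
  apply: le_trans (le_normr_Rintegral _ iBF) _ => //.
  rewrite /I -RintegralZl//; last exact: intI.
  apply: le_Rint_ae => //; [exact: intg_norm iBF|by apply: intgZ => //; exact: intI|].
  apply: ae_imp2 (app k y Sy hy k0) Fm => r a1 a2 Ir; have Dr := sub s0 tT Ir.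
  by rewrite a2// distrC; exact: a1.
apply: le_trans (_ : k * I s t + k * I s t <= _).
  by apply: le_trans (ler_distD (\int[leb]_(r in itv s t) B (w' r) y) _ _) _; exact: lerD.
have -> : k * I s t + k * I s t = e * (I s t / (1 + I s t)).
  by rewrite /k; field; rewrite gt_eqF// ltr_pwDl.
rewrite ler_piMr//; first exact: ltW.
by rewrite ler_pdivrMr ?mul1r ?lerDr// ltr_pwDl.
Qed.

(** The increments of the curve over a short interval are small in S, so that
  freezing the second argument at the left end point perturbs m(w' r, w r) by a
  small multiple of N r; the pieces are glued by induction on the number of short
  intervals. *)
Let measurable_energy : exists2 H : R -> R, intg leb D H &
  {ae leb, forall r, D r -> H r = m (w' r) (w r)}.
Proof.
pose h (r : R) := m (w' r) (w r).
apply: (@ae_approx _ _ _ leb D h N mD iN) => e e0.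
pose k := e / (1 + beta); have k0 : 0 < k by rewrite divr_gt0// ltr_pwDl.
have ke : beta * k <= e.
  by rewrite /k mulrCA ler_piMr ?(ltW e0)// ler_pdivrMr ?mul1r ?lerDr// ltr_pwDl.
have [d d0 hd] := small k0.
pose ok s t := exists2 f : R -> R, intg leb D f &
  {ae leb, forall r : R, s < r < t -> `|h r - f r| <= e * N r}.
have base s t : good s -> s < t -> t <= T -> t - s < d -> ok s t.
  move=> gs st tT std; have [/andP[s0 sT] Ss] := gs.
  have [F [iF Fm _]] := weak_m Ss; exists F => //.
  have Fm' := ae_imp2 (fun r a b => conj a b) Fm Sw'.
  apply: ae_imp2 Fm' Sw => r [a1 a2] a3 /andP[sr rt].
  have r0 : 0 < r < T by apply/andP; split; lra.
  have [Sr' Nr] := a2 r0; have Sr := a3 r0; rewrite a1// /h.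
  have gr : good r by split => //; apply/andP; split; lra.
  rewrite -(psdBr pm)//; apply: le_trans (mBnd Sr' _) _; first exact: subspB.
  have h1 : Num.sqrt (B (w' r) (w' r)) <= N r.
    by rewrite -[leRHS]ger0_norm// -sqrtr_sqr ler_sqrt// sqr_ge0.
  have h2 : Num.sqrt (B (w r - w s) (w r - w s)) <= k.
    by apply: le_trans (incr_norm gs gr (ltW sr)) _; apply: hd => //; lra.
  apply: le_trans (_ : beta * (N r * k) <= _).
    by rewrite ler_wpM2l// ler_pM// sqrtr_ge0.
  by rewrite mulrCA mulrC ler_wpM2r.
have glue s c t : 0 <= s -> s < c -> c < t -> t <= T -> ok s c -> ok c t -> ok s t.
  move=> s0 sc ct tT [f1 if1 hf1] [f2 if2 hf2].
  pose f r := if r < c then f1 r else f2 r.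
  have mfD : measurable_fun D f.
    apply: measurable_fun_if => //.
    - by apply: measurable_fun_ltr.
    - by apply: measurable_funS (intg_meas if1) => //; exact: subIsetl.
    - by apply: measurable_funS (intg_meas if2) => //; exact: subIsetl.
  exists f.
    apply: (@intg_le _ _ _ leb D mD f (fun r => `|f1 r| + `|f2 r|)) => //.
      by move=> r _; rewrite [leRHS]ger0_norm ?addr_ge0// /f; case: ifP => _; rewrite ?lerDl ?lerDr.
    by apply: intgD => //; apply: intg_norm.
  have nc : {ae leb, forall r, r != c}.
    exists [set c]; split => //; first exact: lebesgue_measure_set1.
    by move=> r /= /negP; rewrite negbK => /eqP.
  have h12 := ae_imp2 (fun r a b => conj a b) hf1 hf2.
  apply: ae_imp2 h12 nc => r [a1 a2] rc /andP[sr rt]; rewrite /f.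
  case: ltP => rc'; first by apply: a1; rewrite sr.
  by apply: a2; rewrite rt andbT lt_def rc.
have step n : forall s t, good s -> s < t -> t <= T -> t - s < n.+1%:R * (d / 2) -> ok s t.
  elim: n => [|n IH] s t gs st tT std; first by apply: base => //; lra.
  have [tsd|dts] := ltP (t - s) (n.+1%:R * (d / 2)); first exact: IH.
  have [/andP[s0 sT] Ss] := gs.
  have n0 : 0 < n.+1%:R * (d / 2) by rewrite mulr_gt0 ?ltr0n// divr_gt0.
  have e2 : n.+2%:R * (d / 2) = n.+1%:R * (d / 2) + d / 2 by rewrite -[n.+2%:R]natr1 mulrDl mul1r.
  pose y : R := n.+1%:R * (d / 2).
  have [c /andP[c1 c2] gc] : exists2 c : R, Num.max s (t - d) < c < Num.min t (s + y) & good c.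
    have [M1 M2] : s <= Num.max s (t - d) /\ Num.min t (s + y) <= t.
      by rewrite le_max lexx ge_min lexx.
    apply: good_in; [exact: le_trans M1| |exact: le_trans tT].
    rewrite gt_max !lt_min st/=; rewrite e2 in std; rewrite -/y in std n0.
    by apply/and3P; split; lra.
  move: c1 c2; rewrite gt_max lt_min => /andP[sc tdc] /andP[ct csy].
  have [t1 t2] : c <= T /\ c - s < n.+1%:R * (d / 2) by rewrite -/y; split; lra.
  by apply: (glue s c t) => //; [exact: IH|apply: base => //; lra].
have g0 : good 0 by split; [rewrite lexx T0|].
have [n hn] : exists n : nat, T < n.+1%:R * (d / 2).
  have d2 : 0 < d / 2 by rewrite divr_gt0.
  exists (Num.bound (T / (d / 2))); rewrite -ltr_pdivrMr//.
  apply: lt_le_trans (archi_boundP _) _; first by rewrite divr_ge0// ltW.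
  by rewrite ler_nat.
have [f iF hf] := step n 0 T g0 T0 (lexx T) (ltac:(by rewrite subr0)).
by exists f => //; apply: ae_imp hf => r hr /DP; exact: hr.
Qed.

Let energy_step H (s t : R) : intg leb D H -> {ae leb, forall r, D r -> H r = m (w' r) (w r)} ->
  good s -> good t -> s <= t ->
  `|m (w t) (w t) - m (w s) (w s) - 2 * \int[leb]_(r in itv s t) H r| <= beta * I s t ^+ 2.
Proof.
move=> iH Hm gs gt st; have [/andP[s0 sT] Ss] := gs; have [/andP[t0 tT] St] := gt.
have Sz : S (w t + w s) by exact: subspD.
have [F [iF Fm Fint]] := weak_m Sz.
have -> : m (w t) (w t) - m (w s) (w s) = \int[leb]_(r in itv s t) F r.
  rewrite -Fint// (psdBl pm)// !(psdDr pm)// (psdC pm Ss St); ring.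
rewrite -RintegralZl//; last exact: intI.
rewrite -RintegralB//; [|exact: intI|by apply: intgZ => //; exact: intI].
have iFH : intg leb (itv s t) (fun r => F r - 2 * H r).
  by apply: intgB => //; [exact: intI|apply: intgZ => //; exact: intI].
apply: le_trans (le_normr_Rintegral _ iFH) _ => //.
have -> : beta * I s t ^+ 2 = \int[leb]_(r in itv s t) (beta * I s t * N r).
  by rewrite RintegralZl//; [rewrite -mulrA|exact: intI].
apply: le_Rint_ae => //; [exact: intg_norm iFH|by apply: intgZ => //; exact: intI|].
have a12 := ae_imp2 (fun r a b => conj a b) Fm Hm.
have a34 := ae_imp2 (fun r a b => conj a b) Sw Sw'.
apply: ae_imp2 a12 a34 => r [a1 a2] [a3 a4] Ir.
have Dr := sub s0 tT Ir; have /DP r0 := Dr.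
have [Sr' Nr] := a4 r0; have Sr := a3 r0; rewrite a1// a2//.
have /IP/andP[sr rt] := Ir.
have gr : good r by split => //; apply/andP; split; lra.
have Dt : S (w t - w r) by exact: subspB.
have Ds : S (w r - w s) by exact: subspB.
have -> : m (w' r) (w t + w s) - 2 * m (w' r) (w r) = m (w' r) (w t - w r) - m (w' r) (w r - w s).
  by rewrite (psdDr pm)// !(psdBr pm)//; ring.
have h1 : Num.sqrt (B (w' r) (w' r)) <= N r.
  by rewrite -[leRHS]ger0_norm// -sqrtr_sqr ler_sqrt// sqr_ge0.
have srt : s <= r <= t by rewrite rt ltW.
rewrite {1}/I (split_int s0 tT srt iN) -/(I s r) -/(I r t).
have b1 : `|m (w' r) (w t - w r)| <= beta * (N r * I r t).
  by apply: le_trans (mBnd Sr' Dt) _; rewrite ler_wpM2l// ler_pM ?sqrtr_ge0// incr_norm.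
have b2 : `|m (w' r) (w r - w s)| <= beta * (N r * I s r).
  by apply: le_trans (mBnd Sr' Ds) _; rewrite ler_wpM2l// ler_pM ?sqrtr_ge0// incr_norm// ltW.
apply: le_trans (ler_normB _ _) _.
have -> : beta * (I s r + I r t) * N r = beta * (N r * I r t) + beta * (N r * I s r) by ring.
exact: lerD.
Qed.

Let identity : exists H : R -> R, [/\ intg leb D H,
  {ae leb, forall r, D r -> H r = m (w' r) (w r)} &
  forall t, 0 <= t < T -> S (w t) ->
    m (w t) (w t) = m (w 0) (w 0) + 2 * \int[leb]_(r in itv 0 t) H r].
Proof.
have [H iH Hm] := measurable_energy; exists H; split => // t t0T St.
have gt : good t by []. have g0 : good 0 by split; [rewrite lexx T0|].
have {t0T}[/andP[t0 tT] _] := gt.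
pose G s := m (w s) (w s).
pose err s t := `|G t - G s - 2 * \int[leb]_(r in itv s t) H r|.
suff e0 (e : R) : 0 < e -> err 0 t <= e * (beta * I 0 t).
  have : err 0 t <= 0.
    apply/ler_addgt0Pr => e e0'; rewrite add0r.
    have k0 : 0 < 1 + beta * I 0 t by rewrite ltr_pwDl// mulr_ge0.
    apply: le_trans (e0 (e / (1 + beta * I 0 t)) _) _; first by rewrite divr_gt0.
    rewrite -mulrA ler_piMr ?(ltW e0')// mulrC ler_pdivrMr// mul1r; lra.
  by rewrite /err normr_le0 subr_eq0 subr_eq => /eqP; rewrite addrC.
move=> e0; have [d d0 hd] := small e0.
have base (s u : R) : good s -> good u -> s <= u -> u - s < d -> err s u <= e * (beta * I s u).
  move=> gs gu su usd; apply: le_trans (energy_step iH Hm gs gu su) _.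
  have [/andP[s0 sT] _] := gs; have [/andP[u0 uT] _] := gu.
  have b0 : 0 <= beta * I s u by rewrite mulr_ge0.
  have hI := ler_wpM2l b0 (hd s u s0 uT usd).
  by rewrite [leRHS]mulrC expr2 [leLHS]mulrA.
have step n : forall s u : R, good s -> good u -> s < u -> u - s < n.+1%:R * (d / 2) ->
    err s u <= e * (beta * I s u).
  elim: n => [|n IH] s u gs gu su usd; first by apply: base => //; [exact: ltW|lra].
  have [sud|dus] := ltP (u - s) (n.+1%:R * (d / 2)); first exact: IH.
  have [/andP[s0 sT] Ss] := gs; have [/andP[u0 uT] _] := gu.
  have n0 : 0 < n.+1%:R * (d / 2) by rewrite mulr_gt0 ?ltr0n// divr_gt0.
  have e2 : n.+2%:R * (d / 2) = n.+1%:R * (d / 2) + d / 2 by rewrite -[n.+2%:R]natr1 mulrDl mul1r.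
  pose y : R := n.+1%:R * (d / 2).
  have [c /andP[c1 c2] gc] : exists2 c : R, Num.max s (u - d) < c < Num.min u (s + y) & good c.
    have [M1 M2] : s <= Num.max s (u - d) /\ Num.min u (s + y) <= u.
      by rewrite le_max lexx ge_min lexx.
    apply: good_in; [exact: le_trans M1| |exact: le_trans (ltW uT)].
    rewrite gt_max !lt_min su/=; rewrite e2 in usd; rewrite -/y in usd n0.
    by apply/and3P; split; lra.
  move: c1 c2; rewrite gt_max lt_min => /andP[sc udc] /andP[cu csy].
  have h1 : err s c <= e * (beta * I s c) by apply: IH => //; rewrite -/y; lra.
  have h2 : err c u <= e * (beta * I c u) by apply: base => //; [exact: ltW|lra].
  have scu : s <= c <= u by rewrite !ltW.
  rewrite /I (split_int s0 uT scu iN) -/(I s c) -/(I c u) mulrDr mulrDr.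
  apply: le_trans (lerD h1 h2); rewrite /err (split_int s0 uT scu iH).
  rewrite (_ : G u - G s - _ = (G c - G s - 2 * \int[leb]_(r in itv s c) H r) +
    (G u - G c - 2 * \int[leb]_(r in itv c u) H r)); last by ring.
  exact: ler_normD.
have [t00|tn0] := eqVneq t 0.
  by apply: base; rewrite ?t00// subrr.
have [n hn] : exists n : nat, t < n.+1%:R * (d / 2).
  have d2 : 0 < d / 2 by rewrite divr_gt0.
  exists (Num.bound (t / (d / 2))); rewrite -ltr_pdivrMr//.
  apply: lt_le_trans (archi_boundP _) _; first by rewrite divr_ge0// ltW.
  by rewrite ler_nat.
by apply: (step n) => //; [rewrite lt_def tn0|rewrite subr0].
Qed.

Let total H : intg leb D H ->
  (forall t, 0 <= t < T -> S (w t) ->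
    m (w t) (w t) = m (w 0) (w 0) + 2 * \int[leb]_(r in itv 0 t) H r) ->
  0 <= m (w 0) (w 0) + 2 * \int[leb]_(r in D) H r.
Proof.
move=> iH id; apply/ler_addgt0Pr => e e0.
have e2 : 0 < e / 2 by rewrite divr_gt0.
have iH' : intg leb setT (H \_ D) by apply/intg_restrict.
have [d [d0 hd]] := integral_normr_continuous iH' e2.
have [M1 M2] : 0 <= Num.max 0 (T - d) /\ T - d <= Num.max 0 (T - d).
  by rewrite !le_max !lexx orbT.
have M3 : Num.max 0 (T - d) < T by rewrite gt_max T0 /=; lra.
have [t /andP[t1 t2] gt] := good_in M1 M3 (lexx T).
have [/andP[t0 tT] St] := gt; have Gt := id t (introT andP (conj t0 tT)) St.
have G0 : 0 <= m (w t) (w t) by exact: (psd_ge0 pm).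
have sT : `]t, T[%classic `<=` D.
  by move=> r /=; rewrite !in_itv /= => /andP[tr ->]; rewrite (le_lt_trans t0 tr).
have mT : measurable (`]t, T[%classic : set R) by exact: measurable_itv.
have h1 : `|\int[leb]_(r in `]t, T[) H r| <= e / 2.
  have iHt : intg leb `]t, T[%classic H by apply: intgS iH.
  apply: le_trans (le_normr_Rintegral _ iHt) _ => //; apply: ltW.
  have : \int[leb]_(r in `]t, T[) `|(H \_ D) r| < e / 2.
    apply: hd; first exact: measurable_itv.
    rewrite [ltLHS](_ : _ = (if (t%:E < T%:E)%E then (T%:E - t%:E)%E else 0%E)); last first.
      exact: (lebesgue_measure_itv (Interval (BRight t) (BLeft T))).
    rewrite lte_fin t2 -EFinB lte_fin; lra.
  congr (_ < _); apply: eq_Rint => r /sT Dr; by rewrite patchE mem_set.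
have split : \int[leb]_(r in D) H r = \int[leb]_(r in itv 0 t) H r + \int[leb]_(r in `]t, T[) H r.
  have := @Rintegral_itvB _ H (BRight 0) (BLeft T) t iH.
  rewrite !bnd_simp => /(_ t0 tT) <-.
  by rewrite addrC subrK.
rewrite split; move: h1; rewrite ler_norml => /andP[h1 _].
have -> : m (w 0) (w 0) + 2 * (\int[leb]_(r in itv 0 t) H r + \int[leb]_(r in `]t, T[) H r) + e =
  m (w t) (w t) + 2 * (e / 2 + \int[leb]_(r in `]t, T[) H r) by rewrite Gt; field.
by rewrite addr_ge0// mulr_ge0// -lerBlDl add0r.
Qed.

(** The error of the identity over [s, t] is at most beta (I s t)^2, where I s t is
  the integral of N: it is additive in the interval and of second order, hence zero.
  Only the times at which the curve lies in S enter; they are dense. *)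
Lemma energy_identity : exists H : R -> R, [/\ intg leb D H,
  {ae leb, forall r : R, 0 < r < T -> H r = m (w' r) (w r)},
  (forall t : R, 0 <= t < T -> S (w t) ->
    m (w t) (w t) = m (w 0) (w 0) + 2 * \int[leb]_(r in itv 0 t) H r) &
  0 <= m (w 0) (w 0) + 2 * \int[leb]_(r in D) H r].
Proof.
have [H [iH Hm id]] := identity; exists H; split => //; exact: total.
Qed.

End Energy.

(** * Curves of square-integrable functions *)

Lemma Rint_eq0 {d} {T : measurableType d} {R : realType} (mu : {measure set T -> \bar R})
    (D : set T) (f : T -> R) : (forall x, D x -> f x = 0) -> \int[mu]_(x in D) f x = 0.
Proof. by move=> f0; rewrite /Rintegral integral0_eq// => x Dx; rewrite f0. Qed.

Section PlaneSigmaFinite.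
Context {R : realType}.

Lemma leb2_sigma_finite : sigma_finite setT (@leb2 R).
Proof.
exists (fun n => cbox (- n%:R, - n%:R) (n%:R, n%:R)); last first.
  by move=> n; split; [exact: cbox_measurable|exact: leb2_cbox].
apply/seteqP; split => // x _; pose n := Num.bound (`|x.1| + `|x.2|).
have hn : `|x.1| + `|x.2| < n%:R by apply: archi_boundP; rewrite addr_ge0.
exists n => //; apply/cboxE => /=.
have := ler_norm x.1; have := ler_norm (- x.1); have := ler_norm x.2; have := ler_norm (- x.2).
by rewrite !normrN => h1 h2 h3 h4; have p1 := normr_ge0 x.1; have p2 := normr_ge0 x.2; split; lra.
Qed.

Definition lebp := (@lebesgue_measure R \x @lebesgue_measure R)%E.
HB.instance Definition _ := Measure.on lebp.
HB.instance Definition _ := Measure_isSigmaFinite.Build _ _ _ lebp leb2_sigma_finite.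
End PlaneSigmaFinite.

Section TimeCurves.
Context {R : realType}.
Local Notation pt := (R * R)%type.
Local Notation leb := (@lebesgue_measure R).
Context (D : set pt) (mD : measurable2 D) (T : R).
Local Notation J := (`]0, T[%classic : set R).
Implicit Types (w : R -> pt -> R) (z : pt -> R).

Let mJ : measurable J. Proof. exact: measurable_itv. Qed.
Let mJD : measurable (J `*` D). Proof. exact: measurableX. Qed.

Definition cyl w := (fun p : R * pt => w p.1 p.2) \_ (J `*` D).

Lemma cyl_meas w : time_measurable T D w -> measurable_fun setT (cyl w).
Proof. by move=> mw; apply/(measurable_restrictT _ mJD). Qed.

Lemma cylE w t : 0 < t < T -> (fun x => cyl w (t, x)) = (w t \_ D).
Proof.
move=> t0; apply/funext => x; rewrite /cyl !patchE; congr (if _ then _ else _).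
by apply/idP/idP => /set_mem; [move=> [] _ Dx; apply/mem_set|move=> Dx; apply/mem_set; split => //=; rewrite in_itv].
Qed.

Lemma cyl0 w t x : ~ 0 < t < T -> cyl w (t, x) = 0.
Proof.
by move=> t0; rewrite /cyl patchE memNset// => -[/=]; rewrite in_itv /=.
Qed.

Lemma time_section w t : time_measurable T D w -> 0 < t < T -> measurable_fun D (w t).
Proof.
move=> mw t0; apply/(measurable_restrictT _ mD); rewrite -cylE//.
apply: measurableT_comp; first exact: cyl_meas.
exact: pair1_measurable.
Qed.

Lemma time_sq_meas w : time_measurable T D w ->
  measurable_fun J (fun t => \int[leb2]_(x in D) (w t x ^+ 2)%:E)%E.
Proof.
move=> mw; pose f (p : R * pt) : \bar R := (cyl w p ^+ 2)%:E.
have mf : measurable_fun setT f.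
  by apply/measurable_EFinP; apply: measurable_funX; exact: cyl_meas.
have f0 p : (0 <= f p)%E by rewrite lee_fin sqr_ge0.
have := @measurable_fun_fubini_tonelli_F _ _ _ _ R (@lebp R) f mf f0.
move=> mF; have {}mF := @measurable_funS _ _ _ _ setT J _ measurableT (@subsetT _ _) mF.
apply: eq_measurable_fun mF => t /set_mem /=; rewrite in_itv /= => t0.
rewrite /fubini_F [RHS]integral_mkcond; apply: eq_integral => x _.
have := congr1 (fun h => h x) (cylE w t0); rewrite /= /f /patch => ->.
case: ifP => _ //; exact: (congr1 EFin (expr0n _ 2)).
Qed.

Lemma time_norm_meas w : time_measurable T D w ->
  measurable_fun J (fun t => Num.sqrt (ipg leb2 D (w t) (w t))).
Proof.
move=> mw; apply: (measurableT_comp (f := @Num.sqrt R)).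
  by apply: continuous_measurable_fun; exact: sqrt_continuous.
have : measurable_fun J (fine \o (fun t => \int[leb2]_(x in D) (w t x ^+ 2)%:E)%E).
  by apply: measurableT_comp => //; exact: time_sq_meas.
apply: eq_measurable_fun => t _; rewrite /ipg /Rintegral /=; congr fine.
Qed.

Lemma time_pair_intg w z : time_measurable T D w -> sqi leb2 D z ->
  {ae leb, forall t, 0 < t < T -> sqi leb2 D (w t)} ->
  intg leb J (fun t => Num.sqrt (ipg leb2 D (w t) (w t))) ->
  intg (leb \x lebp)%E setT (fun p : R * pt => cyl w p * (z \_ D) p.2).
Proof.
move=> mw sz sw iN; set f := (fun p => _).
have mz : measurable_fun setT (z \_ D) by apply/(measurable_restrictT _ mD); case: sz.
have mf : measurable_fun setT f.
  apply: measurable_funM; first exact: cyl_meas.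
  exact: (measurableT_comp mz).
apply/(integrable12ltyP leb lebp); first exact/measurable_EFinP.
pose Z := Num.sqrt (ipg leb2 D z z).
pose N t := Num.sqrt (ipg leb2 D (w t) (w t)).
have iNZ : intg leb setT ((fun t => Z * N t) \_ J) by apply/intg_restrict => //; exact: intgZ.
have iNZ' := integrableP _ _ _ iNZ; case: iNZ' => mNZ fNZ.
apply: le_lt_trans fNZ; apply: ae_ge0_le_integral => //.
- by move=> t _; apply: integral_ge0.
- have f0 p : (0 <= `|(f p)%:E|)%E by exact: abse_ge0.
  apply: (@measurable_fun_fubini_tonelli_F _ _ _ _ R (@lebp R) (fun p => `|(f p)%:E|)%E _ f0).
  exact/measurableT_comp/measurable_EFinP.
- exact: measurableT_comp.
apply: ae_imp sw => t swt _.
have [t0|t0] := pselect (0 < t < T); last first.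
  rewrite integral0_eq; first exact: abse_ge0.
  by move=> x _; rewrite /f /= cyl0// mul0r normr0.
have st := swt t0.
have iwz : intg leb2 D (fun x => `|w t x * z x|) by apply: intg_norm; exact: sqi_mul.
have -> : (\int[lebp]_x `|(f (t, x))%:E| = (\int[leb2]_(x in D) `|w t x * z x|)%:E)%E.
  rewrite Rint_EFin// [RHS]integral_mkcond; apply: eq_integral => x _ /=.
  have := congr1 (fun h => h x) (cylE w t0); rewrite /f /= /patch => ->.
  by case: ifP => _ //; rewrite mul0r normr0.
rewrite /= /patch mem_set /=; last by rewrite in_itv.
rewrite lee_fin [leRHS]ger0_norm; last by apply: mulr_ge0; exact: sqrtr_ge0.
rewrite mulrC.
have nsq h : sqi leb2 D h -> sqi leb2 D (fun x => `|h x|).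
  move=> [mh ih]; split; first exact: measurableT_comp.
  by apply: eq_intg ih => // x _; rewrite real_normK ?num_real.
have nip h : ipg leb2 D (fun x => `|h x|) (fun x => `|h x|) = ipg leb2 D h h.
  by apply: eq_Rint => x _; rewrite -!expr2 real_normK ?num_real.
have := psd_cs (psd_ipg leb2 mD) (nsq _ st) (nsq _ sz); rewrite !nip -/(N t) -/Z.
apply: le_trans; apply: le_trans (ler_norm _); rewrite le_eqVlt; apply/orP; left; apply/eqP.
by apply: eq_Rint => x _; rewrite normrM.
Qed.

(** Fubini's theorem turns the pointwise representation of a curve by the integral
  of its derivative into a scalar one against every fixed square-integrable function. *)
Lemma time_weak w' z : time_measurable T D w' -> sqi leb2 D z -> (leb2 D < +oo)%E ->
  {ae leb, forall t, 0 < t < T -> sqi leb2 D (w' t)} ->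
  intg leb J (fun t => Num.sqrt (ipg leb2 D (w' t) (w' t))) ->
  intg leb J (fun t => ipg leb2 D (w' t) z) /\
  forall t f, 0 <= t < T -> measurable_fun D f ->
    {ae leb2, forall x, D x -> f x = \int[leb]_(s in `[0, t]) w' s x} ->
    ipg leb2 D f z = \int[leb]_(s in `]0, t]) ipg leb2 D (w' s) z.
Proof.
move=> mw sz fin sw iN; have s1 := sqi_cst mD 1 fin.
have If := time_pair_intg mw sz sw iN; have I1 := time_pair_intg mw s1 sw iN.
pose f (p : R * pt) := cyl w' p * (z \_ D) p.2.
have fE t : 0 < t < T -> (fun x => f (t, x)) = (fun x => w' t x * z x) \_ D.
  move=> t0; apply/funext => x; have := congr1 (fun h => h x) (cylE w' t0).
  by rewrite /f /= !patchE => ->; case: ifP => _ //; rewrite mul0r.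
have ipE t : 0 < t < T -> \int[lebp]_x f (t, x) = ipg leb2 D (w' t) z.
  by move=> t0; rewrite fE// /ipg [RHS]Rintegral_mkcond.
have iJ : intg leb J (fun t => ipg leb2 D (w' t) z).
  have i1 : intg leb J (fun t => \int[lebp]_x f (t, x)).
    by apply: intgS (fubini_intg1 If).
  by apply: eq_intg i1 => // t; rewrite /= in_itv /=; exact: ipE.
split => // t g t0T mg gE; have /andP[t0 tT] := t0T.
pose K := `]0, t]%classic : set R.
have KJ : K `<=` J by move=> s; rewrite /K /= !in_itv /= => /andP[s0 st]; apply/andP; split; lra.
have mK : measurable K by exact: measurable_itv.
pose F (p : R * pt) := f p * \1_K p.1.
have mF1 : measurable_fun setT (fun p : R * pt => \1_K p.1 : R) by apply: measurableT_comp; [exact: measurable_indic|exact: measurable_fst].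
have IF : intg (leb \x lebp)%E setT F.
  apply: (@intg_le _ _ _ (leb \x lebp)%E setT measurableT F f) => //.
    by apply: measurable_funM => //; exact: intg_meas If.
  move=> p _; rewrite /F normrM ler_piMr//; rewrite indicE; case: (_ \in _); rewrite ?normr1 ?normr0 ?ler01//.
have -> : \int[leb]_(s in K) ipg leb2 D (w' s) z = \int[leb]_s \int[lebp]_x F (s, x).
  rewrite Rintegral_mkcond; apply: eq_Rint => s _; rewrite patchE /F /=.
  case: ifPn => [/set_mem Ks|/negP nK].
    have s0 : 0 < s < T by have := KJ _ Ks; rewrite /J /= in_itv.
    by rewrite -ipE//; apply: eq_Rint => x _; rewrite indicE mem_set// mulr1.
  rewrite [RHS]Rint_eq0// => x _.
  by rewrite indicE (_ : (s \in K) = false) ?mulr0//; apply/negP.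
rewrite -(fubini_Rint1 IF) (fubini_Rint2 IF) /ipg Rintegral_mkcond.
have i2 := fubini_section2 I1.
have mL : measurable_fun setT ((fun x => g x * z x) \_ D).
  by apply/(measurable_restrictT _ mD); apply: measurable_funM => //; case: sz.
have mR := intg_meas (fubini_intg2 IF).
apply: ae_eq_meas => //; apply: ae_imp2 gE i2 => x gx ix _.
rewrite patchE /F /f /cyl /=; case: ifPn => [/set_mem Dx|nD]; last first.
  rewrite [RHS]Rint_eq0// => s _.
  by rewrite [(z \_ D) x]patchE (negbTE nD) mulr0 mul0r.
rewrite gx// {gx}.
have iK : intg leb K (w'^~ x).
  have : intg leb K (fun s => cyl w' (s, x) * ((fun=> 1 : R) \_ D) x) by apply: intgS ix.
  apply: eq_intg => // s Ks; rewrite /cyl !patchE /= mem_set ?mem_set// ?mulr1//.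
  by split => //; exact: KJ.
have e1 : \int[leb]_(s in `[0, t]) w' s x = \int[leb]_(s in K) w' s x.
  by rewrite -Rintegral_itv_obnd_cbnd.
rewrite e1 [RHS](_ : _ = \int[leb]_(s in K) (z x * w' s x)); last first.
  rewrite [RHS]Rintegral_mkcond; apply: eq_Rint => s _; rewrite !patchE /= indicE.
  case: (boolP (s \in K)) => [/set_mem Ks|_]; last by rewrite mulr0.
  by rewrite mulr1 !mem_set//; [exact: mulrC|split => //; exact: KJ].
by rewrite RintegralZl// mulrC.
Qed.

End TimeCurves.

(** * Norms of curves *)

(** The integral of a nonnegative function, measurable or not, is a supremum over
  the simple functions below it.  This matters for the norms of the gradient and the
  Hessian of a curve, whose measurability in time is not known. *)
Lemma le_integral_nn {d} {T : measurableType d} {R : realType}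
    (mu : {measure set T -> \bar R}) (f g : T -> \bar R) :
  (forall x, (0 <= f x)%E) -> (forall x, (f x <= g x)%E) -> (\int[mu]_x f x <= \int[mu]_x g x)%E.
Proof.
move=> f0 fg; rewrite !ge0_integralTE//; last by move=> x; exact: le_trans (fg x).
by apply: ereal_sup_le => _ [h hf <-]; exists h => // x; exact: le_trans (fg x).
Qed.

Lemma le_integral_ae {d} {T : measurableType d} {R : realType}
    (mu : {measure set T -> \bar R}) (f g : T -> \bar R) :
  (forall x, (0 <= f x)%E) -> (forall x, (0 <= g x)%E) ->
  measurable_fun setT f \/ measurable_fun setT g ->
  {ae mu, forall x, (f x <= g x)%E} -> (\int[mu]_x f x <= \int[mu]_x g x)%E.
Proof.
move=> f0 g0 mfg [A [mA A0 AP]].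
have mif (c h : T -> \bar R) : measurable_fun setT h -> measurable_fun setT c ->
    measurable_fun setT (fun x => if x \in A then c x else h x).
  move=> mh mc; apply: measurable_fun_if => //; [|exact: measurable_funS mc|exact: measurable_funS mh].
  by apply: (measurable_fun_bool true); rewrite setTI (_ : _ @^-1` _ = A)//; apply/seteqP; split => x /=; [move/set_mem|move/mem_set].
have ae_if (c h : T -> \bar R) : measurable_fun setT h -> measurable_fun setT c ->
    (\int[mu]_x h x = \int[mu]_x (if x \in A then c x else h x))%E.
  move=> mh mc; apply: ae_eq_integral => //; first exact: mif.
  exists A; split => // x /= hx; apply: contrapT => nA.
  by apply: hx => _; rewrite memNset.
have nP x : (x \in A) = false -> (f x <= g x)%E.
  by move=> nA; apply: contrapT => no; move/negP: nA; apply; apply/mem_set/AP.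
case: mfg => [mf|mg].
  rewrite (ae_if (fun=> 0%E) f)//; apply: le_integral_nn => x; case: ifPn => //.
  by move/negbTE; exact: nP.
rewrite (ae_if (fun=> +oo%E) g)//; apply: le_integral_nn => // x; case: ifPn => [_|/negbTE]; first exact: leey.
exact: nP.
Qed.

Section TimeNorms.
Context {R : realType}.
Local Notation pt := (R * R)%type.
Local Notation leb := (@lebesgue_measure R).
Context (T : R) (T0 : 0 < T).
Local Notation J := (`]0, T[%classic : set R).

Let mJ : measurable J. Proof. exact: measurable_itv. Qed.
Let JP t : J t <-> 0 < t < T. Proof. by rewrite /= in_itv. Qed.

Let leb_pos : (0 < leb setT)%E.
Proof.
apply: lt_le_trans (_ : leb J <= _)%E; first by rewrite lebesgue_measure_itv/= lte_fin T0 oppr0 adde0 lte_fin.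
by apply: le_measure; rewrite ?inE.
Qed.

Lemma time_normyP (f : R -> \bar R) (c : \bar R) : (forall t, (0 <= f t)%E) -> (0 <= c)%E ->
  (time_norm T +oo f <= c)%E <-> {ae leb, forall t, 0 < t < T -> (f t <= c)%E}.
Proof.
move=> f0 c0; rewrite /time_norm unlock leb_pos.
split=> [/ess_sup_inf.ess_supP|] h; last apply/ess_sup_inf.ess_supP.
  apply: ae_imp h => t /= + t0; rewrite patchE mem_set; last exact/JP.
  by rewrite gee0_abs.
apply: ae_imp h => t /= ht; rewrite patchE; case: ifPn => [/set_mem/JP t0|_].
  by rewrite gee0_abs//; exact: ht.
by rewrite abse0.
Qed.

Lemma time_norm2_le (f : R -> \bar R) (q P : R -> R) (c : R) : 0 <= c ->
  (forall t, (0 <= f t)%E) -> intg leb J P ->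
  {ae leb, forall t, 0 < t < T -> f t = (Num.sqrt (q t))%:E /\ 0 <= q t <= P t} ->
  \int[leb]_(t in J) P t <= c ^+ 2 -> (time_norm T 2%:E f <= c%:E)%E.
Proof.
move=> c0 f0 iP fq Pc; rewrite /time_norm unlock.
have n0 : (0 <= \int[leb]_t `|(f \_ J) t| `^ 2)%E by apply: integral_ge0 => t _; exact: poweR_ge0.
rewrite poweR12_sqrt//.
pose g t := `|((EFin \o P) \_ J) t|%E.
have le1 : (\int[leb]_t `|(f \_ J) t| `^ 2 <= \int[leb]_t g t)%E.
  apply: le_integral_ae => //.
  - by move=> t; exact: poweR_ge0.
  - by move=> t; exact: abse_ge0.
  - right; apply: measurableT_comp => //; apply/(measurable_restrictT _ mJ).
    by apply/measurable_EFinP; exact: intg_meas iP.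
  apply: ae_imp fq => t ft; rewrite /g /patch; case: ifPn => [/set_mem/JP t0|_].
    have [-> /andP[q0 qP]] := ft t0; rewrite abse_EFin poweR_EFin ger0_norm ?sqrtr_ge0//.
    rewrite powR_mulrn ?sqrtr_ge0// sqr_sqrtr// lee_fin.
    by apply: le_trans qP (ler_norm _).
  by rewrite abse0 (poweR0r (r := 2)) ?pnatr_eq0.
have P0 : {ae leb, forall t, J t -> 0 <= P t}.
  by apply: ae_imp fq => t h /JP/h[_ /andP[a b]]; exact: le_trans b.
have le2 : (\int[leb]_t g t = (\int[leb]_(t in J) P t)%:E)%E.
  have -> : \int[leb]_(t in J) P t = \int[leb]_(t in J) `|P t|.
    apply: ae_eq_meas => //; [exact: intg_meas iP|exact/intg_meas/intg_norm/iP|].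
    by apply: ae_imp P0 => t h /h P0; rewrite ger0_norm.
  rewrite Rint_EFin//; last exact: intg_norm.
  rewrite [RHS]integral_mkcond; apply: eq_integral => t _; rewrite /g /patch.
  by case: ifP => _ //=; rewrite normr0.
apply: le_trans (_ : sqrte (c ^+ 2)%:E <= _)%E.
  rewrite lee_sqrt ?lee_fin ?sqr_ge0//.
  by apply: le_trans le1 _; rewrite le2 lee_fin.
by rewrite /= sqrtr_sqr ger0_norm.
Qed.

Section Curve.
Context (D : set pt) (mD : measurable2 D) (w : R -> pt -> R) (mw : time_measurable T D w).
Local Notation N t := (Num.sqrt (ipg leb2 D (w t) (w t))).

Lemma time_norm1_intg : {ae leb, forall t, 0 < t < T -> sqi leb2 D (w t)} ->
  (time_norm T 1%:E (fun t => L2norm D (w t)) < +oo)%E -> intg leb J (fun t => N t).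
Proof.
move=> sw; rewrite /time_norm Lnorm1 => fin.
apply/integrableP; split; first by apply/measurable_EFinP; exact: time_norm_meas.
rewrite integral_mkcond; apply: le_lt_trans fin.
pose f t := `|(fun t => L2norm D (w t)) \_ J t|%E.
have e : {ae leb, forall t, (((fun t => `|(N t)%:E|) \_ J) t = f t)%E}.
  apply: ae_imp sw => t st; rewrite /f /patch; case: ifPn => [/set_mem/JP t0|_]; last by rewrite abse0.
  by rewrite /L2norm Lnorm2_ipg//; exact: st.
apply: le_integral_ae.
- by move=> t; rewrite /patch; case: ifP => _ //; exact: abse_ge0.
- by move=> t; exact: abse_ge0.
- left; apply/(measurable_restrictT _ mJ); apply: measurableT_comp => //.
  by apply/measurable_EFinP; exact: time_norm_meas.
by apply: ae_imp e => t ->.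
Qed.

Lemma time_norm2_intg : (time_norm T 2%:E (fun t => L2norm D (w t)) < +oo)%E ->
  {ae leb, forall t, 0 < t < T -> sqi leb2 D (w t)} /\ intg leb J (fun t => ipg leb2 D (w t) (w t)).
Proof.
rewrite /time_norm unlock => fin.
pose Q t := (\int[leb2]_(x in D) (w t x ^+ 2)%:E)%E.
have Q0 t : (0 <= Q t)%E by apply: integral_ge0 => x _; rewrite lee_fin sqr_ge0.
have mQ : measurable_fun J Q by exact: time_sq_meas.
have n0 : (0 <= \int[leb]_t `|((fun t => L2norm D (w t)) \_ J) t| `^ 2)%E.
  by apply: integral_ge0 => t _; exact: poweR_ge0.
have iQ : leb.-integrable J Q.
  apply/integrableP; split => //; rewrite integral_mkcond.
  move: fin; rewrite poweR12_sqrt// => fin.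
  apply: (@le_lt_trans _ _ (\int[leb]_t `|((fun t => L2norm D (w t)) \_ J) t| `^ 2)%E); last first.
    by move: fin n0; case: (\int[leb]_t _)%E => // r _ _; exact: ltry.
  apply: le_integral_nn => t; first by rewrite /patch; case: ifP => _ //; exact: abse_ge0.
  rewrite /patch; case: ifPn => [/set_mem/JP t0|_]; last by rewrite abse0 (poweR0r (r := 2)) ?pnatr_eq0.
  rewrite /L2norm Lnorm2E; last exact: (time_section mD mw).
  rewrite !gee0_abs ?sqrte_ge0// -/(Q t); case: (Q t) (Q0 t) => [r| |] r0.
  - by rewrite /sqrte poweR_EFin powR_mulrn ?sqrtr_ge0// sqr_sqrtr// -lee_fin.
  - by rewrite /sqrte poweRyr ?pnatr_eq0.
  - by [].
have aQ : {ae leb, forall t : R, J t -> Q t \is a fin_num} by apply: integrable_ae iQ.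
have sw : {ae leb, forall t, 0 < t < T -> sqi leb2 D (w t)}.
  apply: ae_imp aQ => t Qt t0; have mt := time_section mD mw t0.
  split => //; apply/integrableP; split; first by apply/measurable_EFinP; exact: measurable_funX.
  have := Qt ((JP t).2 t0); rewrite ge0_fin_numE//; apply: le_lt_trans.
  rewrite le_eqVlt; apply/orP; left; apply/eqP; apply: eq_integral => x _ /=.
  by rewrite ger0_norm// sqr_ge0.
split => //.
suff : intg leb J (fine \o Q) by exact: id.
move: iQ => /integrableP[_ fQ].
apply/integrableP; split.
  by apply/measurable_EFinP; apply: measurableT_comp.
rewrite integral_mkcond; apply: le_lt_trans fQ; rewrite [leRHS]integral_mkcond.
apply: le_integral_nn => t; rewrite /patch; case: ifP => _ //.
rewrite /comp; case: (Q t) => [r| |]; [exact: lexx|exact: leey|exact: leey].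
Qed.
End Curve.
End TimeNorms.

(** * The discrete forms on the whole mesh *)

Lemma psd_sum {R : realType} {V : lmodType R} (S : set V) (I : finType) (B : I -> V -> V -> R) :
  subsp S -> (forall i, psd S (B i)) -> psd S (fun u v => \sum_i B i u v).
Proof.
move=> sS pB; split => // [a u v w Su Sv Sw|u v Su Sv|u Su].
- rewrite mulr_sumr -big_split; apply: eq_bigr => i _.
  by case: (pB i) => _ + _ _; apply.
- by apply: eq_bigr => i _; rewrite (psdC (pB i)).
- by apply: sumr_ge0 => i _; exact: (psd_ge0 (pB i)).
Qed.

Lemma young {R : realFieldType} (t x y : R) : 0 < t ->
  `|x * y| <= t / 2 * x ^+ 2 + (2 * t)^-1 * y ^+ 2.
Proof.
move=> t0; rewrite normrM -[in leRHS](real_normK (num_real x)) -[in leRHS](real_normK (num_real y)).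
move: (`|x|) (`|y|) => u v; have t2 : 0 <= (2 * t)^-1 by rewrite invr_ge0 mulr_ge0// ltW.
have h := mulr_ge0 t2 (sqr_ge0 (t * u - v)); rewrite -subr_ge0.
rewrite (_ : _ - _ = (2 * t)^-1 * (t * u - v) ^+ 2)//.
by field; rewrite gt_eqF.
Qed.

Lemma psd_young {R : realType} {V : lmodType R} (S : set V) (B : V -> V -> R) (t : R) u v :
  psd S B -> 0 < t -> S u -> S v -> `|B u v| <= t / 2 * B u u + (2 * t)^-1 * B v v.
Proof.
move=> pB t0 Su Sv; apply: le_trans (psd_cs pB Su Sv) _.
have := young (Num.sqrt (B u u)) (Num.sqrt (B v v)) t0.
rewrite !sqr_sqrtr ?(psd_ge0 pB)//; apply: le_trans; exact: ler_norm.
Qed.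

Section MeshForms.
Context {R : realType}.
Local Notation pt := (R * R)%type.
Context (Om : polygon R) (pO : polygonal_domain Om) (N : nat) (M : 'I_N -> polygon R).
Context (dec : decomposition Om M) (st : 'I_N -> stab R).
Context (k l : nat) (k0 : (0 < k)%N) (l1 : (1 < l)%N) (a b : R) (a0 : 0 < a).
Context (adm : forall i, stab_admissible k l a b (M i) (st i)).
Implicit Types (u v : pt -> 'cV[R]_2) (f phi : pt -> R).
Local Notation Om' := (cell Om).

Let pM i : polygonal_domain (M i). Proof. by case: dec. Qed.
Let dO : domain Om'. Proof. exact: polygonal_domain_domain. Qed.
Let mO : measurable2 Om'. Proof. exact: domain_meas. Qed.
Let oO : open Om'. Proof. by case: dO. Qed.
Let dM i : domain (cell (M i)). Proof. exact: polygonal_domain_domain. Qed.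
Let mM i : measurable2 (cell (M i)). Proof. exact: domain_meas. Qed.
Let oM i : open (cell (M i)). Proof. by case: (dM i). Qed.
Let sub i : cell (M i) `<=` Om'. Proof. by have := cell_sub pO dec (i := i). Qed.

Definition phase_space f := sqi leb2 Om' f /\ forall i, Hh_loc l (M i) f.
Definition velocity_space v := sqiM Om' v /\ forall i, Vh_loc k (M i) v.

Lemma phase_subsp : subsp phase_space.
Proof.
have [s0 sD] := sqi_subsp leb2 mO; have hl i := Hh_loc_subsp (pM i) l1.
split=> [|c f g [sf hf] [sg hg]]; first by split => // i; case: (hl i).
by split=> [|i]; [exact: sD|case: (hl i) => _; exact].
Qed.

Lemma velocity_subsp : subsp velocity_space.
Proof.
have [s0 sD] := @sqiM_subsp R 2 1 _ mO; have hl i := Vh_loc_subsp (pM i) k0.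
split=> [|c f g [sf hf] [sg hg]]; first by split => // i; case: (hl i).
by split=> [|i]; [exact: sD|case: (hl i) => _; exact].
Qed.

Lemma Hh_phase f : Hh l Om M f -> phase_space f.
Proof. by move=> [[[h _] _] hl]; split => //; case: ((H1P f dO).1 h). Qed.

Lemma Vh_velocity v : Vh k Om M v -> velocity_space v.
Proof.
move=> [h hl]; split => // i j; have [h1 _] := h i; have [s _] := (H1P _ dO).1 h1.
by rewrite (ord1 j).
Qed.

Lemma inner_cells f g : sqi leb2 Om' f -> sqi leb2 Om' g ->
  inner Om' f g = \sum_i inner (cell (M i)) f g.
Proof. by move=> sf sg; exact: (Rint_cells pO dec (sqi_mul mO sf sg)). Qed.

Lemma innerM_cells m n (F G : pt -> 'M[R]_(m, n)) : sqiM Om' F -> sqiM Om' G ->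
  innerM Om' F G = \sum_i innerM (cell (M i)) F G.
Proof.
move=> sF sG; have sF' i : sqiM (cell (M i)) F by move=> p q; exact: (sqiS mO (mM i) (@sub i) (sF p q)).
have sG' i : sqiM (cell (M i)) G by move=> p q; exact: (sqiS mO (mM i) (@sub i) (sG p q)).
rewrite innerM_sum//; under [RHS]eq_bigr => i _ do rewrite innerM_sum//.
rewrite [RHS]exchange_big; apply: eq_bigr => p _; rewrite [RHS]exchange_big; apply: eq_bigr => q _.
exact: inner_cells.
Qed.

Definition mass_phase f g := \sum_i m_loc l (M i) (st i) f g.
Definition mass_velocity u v := \sum_i mF_loc k (M i) (st i) u v.

Lemma mass_phase_psd : [/\ psd phase_space mass_phase,
  (forall f, phase_space f -> mass_phase f f <= Num.max 1 b * inner Om' f f) &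
  (forall f, phase_space f -> Num.min 1 a * inner Om' f f <= mass_phase f f)].
Proof.
have h i := m_loc_psd (pM i) l1 a0 (adm i).
split=> [|f [sf hf]|f [sf hf]].
- apply: psd_sum; first exact: phase_subsp.
  by move=> i; have [p _ _] := h i; apply: psd_sub p phase_subsp _ => f [].
- rewrite inner_cells// mulr_sumr; apply: ler_sum => i _.
  by have [_ p _] := h i; exact: p.
- rewrite inner_cells// mulr_sumr; apply: ler_sum => i _.
  by have [_ _ p] := h i; exact: p.
Qed.

Lemma mass_velocity_psd : [/\ psd velocity_space mass_velocity,
  (forall v, velocity_space v -> mass_velocity v v <= Num.max 1 b * innerM Om' v v) &
  (forall v, velocity_space v -> Num.min 1 a * innerM Om' v v <= mass_velocity v v)].
Proof.
have h i := mF_loc_psd (pM i) k0 a0 (adm i).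
split=> [|f [sf hf]|f [sf hf]].
- apply: psd_sum; first exact: velocity_subsp.
  by move=> i; have [p _ _] := h i; apply: psd_sub p velocity_subsp _ => f [].
- rewrite innerM_cells// mulr_sumr; apply: ler_sum => i _.
  by have [_ p _] := h i; exact: p.
- rewrite innerM_cells// mulr_sumr; apply: ler_sum => i _.
  by have [_ _ p] := h i; exact: p.
Qed.

(** The inner derivative is only known almost everywhere on the element, which does
  not affect the outer weak derivative. *)
Lemma hess_cell i f : H2 Om' f -> H2 (cell (M i)) f -> forall p q,
  {ae leb2, forall x, cell (M i) x -> hess (cell (M i)) f x p q = hess Om' f x p q}.
Proof.
move=> [h1 h2] [g1 g2] p q.
have a1 := wd_cell pO dec i p h1.
have a2 := wd_cell pO dec i q (h2 p).
have [_ w1] := (H1P _ dO).1 (h2 p); have [w2 _] := w1 q.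
have [_ w3] := (H1P _ (dM i)).1 (g2 p); have [w4 _] := w3 q.
have w5 := is_wdS (@sub i) w2.
have [l1' l2 _] := w4; have [l3 l4 _] := w5.
have w6 : is_wd (cell (M i)) q (wd (cell (M i)) p f) (wd Om' q (wd Om' p f)).
  have a1' : {ae leb2, forall x, cell (M i) x -> wd Om' p f x = wd (cell (M i)) p f x}.
    by apply: ae_imp a1 => x h Dx; rewrite h.
  have a3 : {ae leb2, forall x, cell (M i) x -> wd Om' q (wd Om' p f) x = wd Om' q (wd Om' p f) x}.
    exact: ae_all.
  exact: (is_wd_ae (@oM i) l1' l4 a1' a3 w5).
by apply: ae_imp (wdE (@oM i) w6) => x h Dx; rewrite !mxE; exact: h.
Qed.

Lemma hess_cells f : Hh l Om M f ->
  \sum_i BD (M i) f f = innerM Om' (hess Om' f) (hess Om' f).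
Proof.
move=> [[h2 _] hl]; have sh := hess_sqi pO h2.
rewrite innerM_cells//; apply: eq_bigr => i _.
have h2i : H2 (cell (M i)) f by case: (hl i) => -[].
have s1 := hess_sqi (pM i) h2i.
have s2 : sqiM (cell (M i)) (hess Om' f) by move=> p q; exact: (sqiS mO (mM i) (@sub i) (sh p q)).
by apply: (ae_innerM (mM i)) => // p q; exact: hess_cell.
Qed.

Lemma grad_cells v : Vh k Om M v ->
  \sum_i BG (M i) v v = innerM Om' (gradv Om' v) (gradv Om' v).
Proof.
move=> [h1 hl]; have h1' i : H1 Om' (vcomp v i) by case: (h1 i).
have sh := gradv_sqi pO h1'; rewrite innerM_cells//; apply: eq_bigr => i _.
have s1 : sqiM (cell (M i)) (gradv (cell (M i)) v).
  by apply: (gradv_sqi (pM i)) => p; case: (hl i) => /(_ p)[].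
have s2 : sqiM (cell (M i)) (gradv Om' v) by move=> p q; exact: (sqiS mO (mM i) (@sub i) (sh p q)).
have ae p q : {ae leb2, forall x, cell (M i) x -> gradv (cell (M i)) v x p q = gradv Om' v x p q}.
  by apply: ae_imp (wd_cell pO dec i q (h1' p)) => x h Dx; rewrite !mxE; exact: h.
by apply: (ae_innerM (mM i)).
Qed.

Lemma aD_ge f : Hh l Om M f ->
  Num.min 1 a * innerM Om' (hess Om' f) (hess Om' f) <= \sum_i aD_loc l (M i) (st i) f f.
Proof.
move=> hf; rewrite -hess_cells// mulr_sumr; apply: ler_sum => i _.
by apply: (aD_loc_ge (pM i) l1 a0 (adm i)); case: hf.
Qed.

Lemma aG_ge v : Vh k Om M v ->
  Num.min 1 a * innerM Om' (gradv Om' v) (gradv Om' v) <= \sum_i aG_loc k (M i) (st i) v v.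
Proof.
move=> hf; rewrite -grad_cells// mulr_sumr; apply: ler_sum => i _.
by apply: (aG_loc_ge (pM i) k0 a0 (adm i)); case: hf.
Qed.

(** The projection fixes constants and preserves integrals against them. *)
Lemma mass_one f : phase_space f -> mass_phase f (cst 1) = inner Om' f (cst 1).
Proof.
move=> [sf hf]; have s1 : sqi leb2 Om' (cst 1) by exact: (sqi_cst mO 1 (domain_fin dO)).
rewrite inner_cells//; apply: eq_bigr => i _; rewrite /m_loc.
have p1 : poly2 l (cst 1 : pt -> R) by exact: poly2_cst.
rewrite (proj0_poly (dM i) p1).
have sfi : sqi leb2 (cell (M i)) f by exact: (sqiS mO (mM i) (@sub i) sf).
have s1i : sqi leb2 (cell (M i)) (cst 1) by exact: (sqiS mO (mM i) (@sub i) s1).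
have [pp /(_ _ p1) orth] := proj0P (dM i) l sfi.
have [_ _ bM] := dM i; have spp := poly2_sqi (@oM i) bM pp.
have [_ _ [[lin C _] _] _] := adm i.
have hs := Hh_loc_subsp (pM i) l1.
have z0 w : Hh_loc l (M i) w -> s0 (st i) w 0 = 0.
  move=> hw; have h0 : Hh_loc l (M i) 0 by case: hs.
  have z : (fun x : pt => -1 *: (0 : pt -> R) x + (0 : pt -> R) x) = 0.
    by apply/funext => x; rewrite scaler0 addr0.
  have e := lin (-1) 0 0 w h0 h0 hw; rewrite z mulN1r addNr in e.
  exact: etrans (C w 0 hw h0) e.
have -> : (cst 1 : pt -> R) \- cst 1 = 0 by apply/funext => x /=; rewrite subrr.
rewrite z0; last by apply: (subspB hs) => //; exact: poly2_Hh_loc.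
rewrite addr0; apply/eqP; rewrite eq_sym -subr_eq0.
by rewrite -(psdBl (psd_ipg leb2 (mM i)) sfi spp s1i); apply/eqP.
Qed.

Lemma proj0_null i n f : sqi leb2 (cell (M i)) f ->
  {ae leb2, forall x, cell (M i) x -> f x = 0} -> proj0 (M i) n f = 0.
Proof.
move=> sf f0; have [oE E0 bE] := dM i; have [pp _] := proj0P (dM i) n sf.
have spp := poly2_sqi oE bE pp; have sff := sqi_mul (mM i) sf sf.
have ff : inner (cell (M i)) f f = 0.
  rewrite -[RHS](Rint_eq0 leb2 (D := cell (M i)) (f := fun=> 0))//.
  apply: (ae_eq_meas (mM i)) => //; first exact: intg_meas sff.
  by apply: ae_imp f0 => x h Dx; rewrite h// mul0r.
have h : inner (cell (M i)) (proj0 (M i) n f) (proj0 (M i) n f) = 0.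
  apply/eqP; rewrite eq_le (psd_ge0 (psd_ipg leb2 (mM i)))// andbT.
  by rewrite -[leRHS]ff; exact: proj0_contract.
by apply: (poly2_ae0 oE E0 pp); exact: (ipg0_ae (mM i) spp h).
Qed.

Lemma proj0M_null i n m1 m2 (F : pt -> 'M[R]_(m1, m2)) : sqiM (cell (M i)) F ->
  (forall p q, {ae leb2, forall x, cell (M i) x -> F x p q = 0}) -> proj0M (M i) n F = 0.
Proof.
move=> sF F0; apply/funext => x; apply/matrixP => p q; rewrite !mxE.
by rewrite (proj0_null n (sF p q) (F0 p q)).
Qed.

Lemma one_poly n : poly2 n (cst 1 : pt -> R). Proof. exact: poly2_cst. Qed.

Lemma aD_one i f : Hh_loc l (M i) f -> aD_loc l (M i) (st i) f (cst 1) = 0.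
Proof.
move=> hf; have l0 : (0 < l)%N by exact: ltnW.
have S1 := poly2_SD (pM i) (one_poly l); have Sf := Hh_loc_SD hf.
have h1 p q : {ae leb2, forall x, cell (M i) x -> hess (cell (M i)) (cst 1) x p q = 0}.
  by apply: ae_imp (hess_poly (pM i) p q (one_poly 0)) => x h Dx; rewrite h// !pd_cst.
have P1 := proj0M_null (l - 2) (hess_sqi (pM i) S1.2) h1.
rewrite /aD_loc -[RHS]addr0; congr (_ + _).
  have s0 : sqiM (cell (M i)) (0 : pt -> 'M[R]_2) by case: (@sqiM_subsp R 2 2 _ (mM i)).
  have s1 := proj0M_sqi (dM i) (l - 2) (hess_sqi (pM i) Sf.2).
  apply: etrans (psd0r (@psd_innerM R 2 2 _ (mM i)) s1).
  exact: (congr1 (innerM (cell (M i)) _) P1).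
have e0 : (cst 1 : pt -> R) \- projD (M i) l (cst 1) = 0.
  by rewrite (projD_self (pM i) l0 (one_poly l)); apply/funext => x /=; rewrite subrr.
rewrite e0; have [_ _ _ [[lin C _] _]] := adm i.
have hs := Hh_loc_subsp (pM i) l1.
set w := f \- _; have hw : Hh_loc l (M i) w.
  have pp : poly2 l (projD (M i) l f) by exact: (projD_poly2 (pM i) l0 Sf).
  exact: (subspB hs hf (poly2_Hh_loc (pM i) l1 pp)).
have h0 : Hh_loc l (M i) 0 by case: hs.
have z : (fun x : pt => -1 *: (0 : pt -> R) x + (0 : pt -> R) x) = 0.
  by apply/funext => x; rewrite scaler0 addr0.
have e := lin (-1) 0 0 w h0 h0 hw; rewrite z mulN1r addNr in e.
exact: etrans (C w 0 hw h0) e.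
Qed.

Lemma grad_sqi i f : H1 (cell (M i)) f -> sqiM (cell (M i)) (grad (cell (M i)) f).
Proof.
move=> /(H1P _ (dM i))[_ h] p q; have [_ s] := h p.
by rewrite (_ : ent _ _ _ = wd (cell (M i)) p f)//; apply/funext => x; rewrite /ent mxE.
Qed.

Lemma r_one i f : r_loc l (M i) f f (cst 1) = 0.
Proof.
have g0 p q : {ae leb2, forall x, cell (M i) x -> grad (cell (M i)) (cst 1) x p q = 0}.
  apply: ae_imp (poly2_wd p (@oM i) (one_poly 0)) => x h Dx.
  by rewrite mxE h// pd_cst.
have P1 := proj0M_null l.-1 (grad_sqi (poly2_H1 (dM i) (one_poly 0))) g0.
rewrite /r_loc; apply: etrans (congr1 (innerM (cell (M i)) _) P1) _.
rewrite /innerM; apply: Rint_eq0 => x _; rewrite /frob big1// => p _.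
by rewrite big1// => q _; rewrite [(0 : pt -> 'cV[R]_2) x p q]mxE mulr0.
Qed.

Lemma Hh_one : Hh l Om M (cst 1).
Proof.
split=> [|i]; last exact: (poly2_Hh_loc (pM i) l1 (one_poly l)).
have [_ h2] := poly2_SD pO (one_poly l); split => //.
exists 0 => [i|e _]; last first.
  by apply: ae_all => s _; rewrite /frob big1// => p _; rewrite big1// => q _; rewrite mxE mul0r.
have v0 : vcomp (0 : pt -> 'cV[R]_2) i = fun=> 0 by apply/funext => x; rewrite /vcomp mxE.
rewrite v0; split=> [e _|]; first exact: measurable_cst.
have ni D g : measurable2 D -> sqi leb2 D g -> {ae leb2, forall x, D x -> g x = 0} ->
    (fun _ : nat => L2norm D ((fun=> 0) \- g)) @ \oo --> 0%E.
  move=> mD sg g0; rewrite (_ : L2norm _ _ = 0%E); first exact: cvg_cst.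
  have s0 : sqi leb2 D ((fun=> 0) \- g).
    by have := subspB (sqi_subsp leb2 mD) (proj1 (sqi_subsp leb2 mD)) sg.
  rewrite /L2norm Lnorm2_ipg// (_ : ipg _ _ _ _ = 0) ?sqrtr0//.
  rewrite -[RHS](Rint_eq0 leb2 (D := D) (f := fun=> 0))//.
  apply: (ae_eq_meas mD) => //; first exact: (intg_meas (sqi_mul mD s0 s0)).
  by apply: ae_imp g0 => x h Dx; rewrite /= h// subrr mul0r.
exists (fun _ => fun=> 0); split.
- by move=> n; exact: smooth_cst.
- have [h10 h11] := h2; split=> [|q].
    apply: ni => //; last exact: wd_cst.
    by have [_ /(_ i)[_ s]] := (H1P _ dO).1 h10.
  rewrite (_ : (fun _ => _) = (fun _ => L2norm Om' ((fun=> 0) \- wd Om' q (wd Om' i (cst 1))))).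
    apply: ni => //; first by have [_ /(_ q)[_ s]] := (H1P _ dO).1 (h11 i).
    apply: ae_imp (hess_poly pO i q (one_poly 0)) => x h Dx.
    by have := h Dx; rewrite mxE !pd_cst.
  by apply/funext => n; rewrite pd_cst.
- move=> e _; rewrite (_ : (fun _ => _) = fun _ => 0%E); first exact: cvg_cst.
  apply/funext => n; rewrite (_ : EFin \o _ = fun=> 0%E) ?Lnorm0//.
  by apply/funext => s /=; rewrite /patch; case: ifP; rewrite ?subrr.
Qed.

Section Potential.
Context (C : R) (phi : pt -> R) (hphi : Hh l Om M phi).
Hypothesis gradC : forall j, {ae leb2, forall x, Om' x -> `|wd Om' j phi x| <= C}.

Let hH1 : H1 Om' phi. Proof. by case: hphi => [[[]]]. Qed.
Let hSD i : SD (M i) phi. Proof. by case: hphi => _ /(_ i); exact: Hh_loc_SD. Qed.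
Let hH2 i : H2 (cell (M i)) phi. Proof. by case: (hSD i). Qed.
Let hg i : sqiM (cell (M i)) (grad (cell (M i)) phi).
Proof. by apply: grad_sqi; case: (hH2 i). Qed.

Let gradCi i (j : 'I_2) : {ae leb2, forall x, cell (M i) x -> `|ent (grad (cell (M i)) phi) j 0 x| <= C}.
Proof.
apply: ae_imp2 (gradC j) (wd_cell pO dec i j hH1) => x h1 h2 Dx.
by rewrite /ent mxE h2//; apply: h1; exact: sub Dx.
Qed.

Let intOne i : intg leb2 (cell (M i)) (fun=> 1).
Proof. exact: (sqi_intg (mM i) (domain_fin (dM i)) (sqi_cst (mM i) 1 (domain_fin (dM i)))). Qed.

Let intOneO : intg leb2 Om' (fun=> 1).
Proof. exact: (sqi_intg mO (domain_fin dO) (sqi_cst mO 1 (domain_fin dO))). Qed.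

Let inner_bound i f : sqi leb2 (cell (M i)) f -> {ae leb2, forall x, cell (M i) x -> `|f x| <= C} ->
  inner (cell (M i)) f f <= C ^+ 2 * \int[leb2]_(x in cell (M i)) 1.
Proof.
move=> sf fC; have sff := sqi_mul (mM i) sf sf.
rewrite -RintegralZl//; last exact: intOne.
apply: le_Rint_ae => //; first by apply: intgZ => //; exact: intOne.
apply: ae_imp fC => x h Dx; rewrite mulr1 -expr2 -(real_normK (num_real (f x))).
have h' := h Dx; have C0 := le_trans (normr_ge0 _) h'.
by rewrite ler_sqr ?nnegrE.
Qed.

Lemma derive_fpot (s : R) : derive1 (@fpot R) s = 3 * s ^+ 2 - 1.
Proof.
have -> : @fpot R = horner ('X^3 - 'X) by apply/funext => y; rewrite !hornerE.
by rewrite -derivE derivB derivXn derivX hornerD hornerN hornerMn hornerXn hornerC mulr_natl.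
Qed.

Lemma poly_sqiM i m n (F : pt -> 'M[R]_(m, n)) (d : nat) :
  (forall p q, poly2 d (ent F p q)) -> sqiM (cell (M i)) F.
Proof. by have [oE _ bE] := dM i => hF p q; exact: (poly2_sqi oE bE (hF p q)). Qed.

(** The derivative 3 s^2 - 1 of the potential is bounded below by -1, and the
  projection of the gradient is bounded in mean square by the gradient. *)
Lemma r_ge : - (2 * C ^+ 2 * \int[leb2]_(x in Om') 1) <= \sum_i r_loc l (M i) phi phi phi.
Proof.
rewrite (Rint_cells pO dec intOneO) mulr_sumr -sumrN; apply: ler_sum => i _.
have [oE E0 bE] := dM i; set E := cell (M i) in oE E0 bE *.
have mE : measurable2 E by exact: mM.
have sP := proj0M_sqi (dM i) l.-1 (hg i).
have c1 : innerM E (proj0M (M i) l.-1 (grad E phi)) (proj0M (M i) l.-1 (grad E phi)) <=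
    2 * C ^+ 2 * \int[leb2]_(x in E) 1.
  apply: le_trans (proj0M_contract (dM i) l.-1 (hg i)) _.
  rewrite innerM_sum//.
  rewrite -mulrA mulr_natl mulr2n big_ord_recl big_ord1 !big_ord1.
  by apply: lerD; apply: (inner_bound (hg i _ _)); exact: gradCi.
set P := proj0M _ _ _ in sP c1 *.
have pP j q : poly2 l.-1 (ent P j q).
  rewrite (_ : ent P j q = proj0 (M i) l.-1 (fun y => grad E phi y j q)).
    exact: (proj0P (dM i) l.-1 (hg i j q)).1.
  by apply/funext => x; rewrite /ent mxE.
have sphi : sqi leb2 E phi by have [h _] := (H1P _ (dM i)).1 (hH2 i).1.
pose s := proj0 (M i) l phi; have ps : poly2 l s by case: (proj0P (dM i) l sphi).
pose c : pt -> R := 3 *: (s * s) + (-1) *: cst 1.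
have pc : poly2 (l + l) c.
  have sp2 := @poly2_subsp R (l + l).
  by apply: sp2.2; [exact: poly2_mul|exact: (subspZ (-1) sp2 (one_poly _))].
have cE x : derive1 (@fpot R) (s x) = c x.
  by rewrite derive_fpot /c expr2 -[RHS]/(3 * (s x * s x) + -1 * 1) mulr1.
pose G x : 'cV[R]_2 := c x *: P x.
have pG j q : poly2 (l + l + l.-1) (ent G j q).
  rewrite (_ : ent G j q = c * ent P j q); first exact: poly2_mul.
  by apply/funext => x; rewrite /ent /G mxE.
have sG : sqiM E G by exact: (@poly_sqiM i _ _ _ _ pG).
have -> : r_loc l (M i) phi phi phi = innerM E G P.
  by rewrite /r_loc; apply: (congr1 (fun H => innerM E H P)); apply/funext => x; rewrite /G -cE.
apply: le_trans (_ : - innerM E P P <= _); first by rewrite lerN2.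
rewrite !innerM_sum// -sumrN; apply: ler_sum => j _; rewrite -sumrN; apply: ler_sum => q _.
have iPP := sqi_mul (mM i) (sP j q) (sP j q).
rewrite -mulN1r /inner -RintegralZl//.
apply: le_Rint => //; [exact: intgZ|exact: (sqi_mul (mM i) (sG j q) (sP j q))|].
move=> x _; have -> : ent G j q x = c x * ent P j q x by rewrite /ent /G mxE.
rewrite -mulrA; apply: ler_wpM2r; first by rewrite -expr2 sqr_ge0.
by rewrite -cE derive_fpot lerDr mulr_ge0// sqr_ge0.
Qed.

(** Young's inequality with weight theta; the gradient of the phase enters through
  the maximum norm of its projection, bounded on a regular mesh. *)
Lemma d_bound (K theta : R) v : 0 < theta -> velocity_space v ->
  (forall i j q x, cell (M i) x -> proj0M (M i) l.-1 (grad (cell (M i)) phi) x j q ^+ 2 <= K) ->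
  `|\sum_i d_loc k l (M i) phi phi v| <=
    2 * theta * K * innerM Om' (hess Om' phi) (hess Om' phi) + theta^-1 * innerM Om' v v.
Proof.
move=> t0 [sv hv] PK; rewrite -hess_cells// innerM_cells// !mulr_sumr -big_split /=.
apply: le_trans (ler_norm_sum _ _ _) _; apply: ler_sum => i _.
have [oE E0 bE] := dM i; have := PK i; set E := cell (M i) in oE E0 bE * => {}PK.
have mE : measurable2 E by exact: mM.
have sP := proj0M_sqi (dM i) l.-1 (hg i); set P := proj0M _ _ _ in PK sP *.
have pP j q : poly2 l.-1 (ent P j q).
  rewrite (_ : ent P j q = proj0 (M i) l.-1 (fun y => grad E phi y j q)).
    exact: (proj0P (dM i) l.-1 (hg i j q)).1.
  by apply/funext => x; rewrite /ent mxE.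
have svi : sqiM E v by move=> j q; exact: (sqiS mO (mM i) (@sub i) (sv j q)).
have sV := proj0M_sqi (dM i) k svi; set V := proj0M _ _ _ in sV *.
have sh := hess_sqi (pM i) (hH2 i).
have lE : lap E phi = ent (hess E phi) 0 0 + ent (hess E phi) 1 1.
  by apply/funext => x; rewrite /lap sum_ord2 /ent -[RHS]/(_ + _) !mxE.
have sl : sqi leb2 E (lap E phi) by rewrite lE; apply: (subspD (sqi_subsp leb2 (mM i))).
pose q := proj0 (M i) (l - 2) (lap E phi).
have pq : poly2 (l - 2) q by case: (proj0P (dM i) (l - 2) sl).
have sq := poly2_sqi oE bE pq.
pose G x : 'cV[R]_2 := q x *: P x.
have pG j c : poly2 (l - 2 + l.-1) (ent G j c).
  rewrite (_ : ent G j c = q * ent P j c); first exact: poly2_mul.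
  by apply/funext => x; rewrite /ent /G mxE.
have sG : sqiM E G by exact: (@poly_sqiM i _ _ _ _ pG).
rewrite -[d_loc _ _ _ _ _ _]/(innerM E G V).
have iq := sqi_mul (mM i) sq sq.
have term j c : `|inner E (ent G j c) (ent V j c)| <=
    theta / 2 * (K * inner E q q) + (2 * theta)^-1 * inner E (ent V j c) (ent V j c).
  have iGV := sqi_mul (mM i) (sG j c) (sV j c); have iVV := sqi_mul (mM i) (sV j c) (sV j c).
  apply: le_trans (le_normr_Rintegral _ iGV) _ => //.
  have iR : intg leb2 E (fun x => theta / 2 * (K * (q x * q x)) +
      (2 * theta)^-1 * (ent V j c x * ent V j c x)).
    by apply: intgD => //; [do 2![apply: intgZ => //]|apply: intgZ].
  have -> : theta / 2 * (K * inner E q q) + (2 * theta)^-1 * inner E (ent V j c) (ent V j c) =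
      \int[leb2]_(x in E) (theta / 2 * (K * (q x * q x)) + (2 * theta)^-1 * (ent V j c x * ent V j c x)).
    rewrite RintegralD//; [|do 2![apply: intgZ => //]|apply: intgZ => //].
    by rewrite RintegralZl//; [rewrite !RintegralZl|apply: intgZ].
  apply: le_Rint => // [|x Ex]; first exact: intg_norm.
  apply: le_trans (young _ _ t0) _; rewrite -!expr2 lerD2r ler_wpM2l ?divr_ge0 ?(ltW t0)//.
  have -> : ent G j c x = q x * P x j c by rewrite /ent /G mxE.
  by rewrite exprMn mulrC ler_wpM2r ?sqr_ge0//; exact: PK.
rewrite innerM_sum//.
have K0 : 0 <= K by have [x0 Ex0] := E0; apply: le_trans (PK 0 0 x0 Ex0); exact: sqr_ge0.
have qB : inner E q q <= 2 * BD (M i) phi phi.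
  apply: le_trans (proj0_contract (dM i) (l - 2) sl) _.
  have s0 := sqi_mul (mM i) (sh 0 0) (sh 0 0); have s1 := sqi_mul (mM i) (sh 1 1) (sh 1 1).
  apply: le_trans (_ : 2 * (inner E (ent (hess E phi) 0 0) (ent (hess E phi) 0 0) +
      inner E (ent (hess E phi) 1 1) (ent (hess E phi) 1 1)) <= _).
    rewrite /inner -RintegralD// -RintegralZl//; last exact: intgD.
    apply: le_Rint => //; [exact: (sqi_mul (mM i) sl sl)|by apply: intgZ => //; exact: intgD|].
    move=> x _; rewrite lE; set y := ent _ 0 0; set z := ent _ 1 1; rewrite -[(y + z) x]/(y x + z x).
    by rewrite -subr_ge0 (_ : _ - _ = (y x - z x) ^+ 2) ?sqr_ge0//; ring.
  have nn p c : 0 <= inner E (ent (hess E phi) p c) (ent (hess E phi) p c).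
    exact: (psd_ge0 (psd_ipg leb2 mE) (sh p c)).
  rewrite ler_pM2l// /BD innerM_sum// !sum_ord2.
  by apply: lerD; [rewrite lerDl|rewrite lerDr]; exact: nn.
have VB := proj0M_contract (dM i) k svi.
rewrite [in leLHS]innerM_sum// sum_ord2 !big_ord1 in VB.
rewrite sum_ord2 !big_ord1; apply: le_trans (ler_normD _ _) _.
apply: le_trans (lerD (term 0 0) (term 1 0)) _.
have t2 : 0 <= (2 * theta)^-1 by rewrite invr_ge0 mulr_ge0// ltW.
have tK : 0 <= theta * K by rewrite mulr_ge0// ltW.
have h1 := ler_wpM2l tK qB; have h2 := ler_wpM2l t2 VB.
have vv : 0 <= innerM E v v by exact: (psd_ge0 (@psd_innerM R 2 1 _ mE) svi).
have h3 : (2 * theta)^-1 * innerM E v v <= theta^-1 * innerM E v v.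
  by apply: ler_wpM2r => //; rewrite lef_pV2 ?posrE ?mulr_gt0// ler_peMl ?(ltW t0)// ler1n.
have h4 := lerD h1 (le_trans h2 h3).
apply: le_trans (le_trans _ h4) _; last by rewrite lerD2r mulrCA !mulrA.
by rewrite mulrDr addrACA lerD2r -mulrDl -splitr mulrA.
Qed.

End Potential.

Lemma source_bound (theta : R) g v : 0 < theta -> sqiM Om' g -> velocity_space v ->
  `|\sum_i innerM (cell (M i)) (proj0M (M i) k g) v| <=
    theta * innerM Om' g g + theta^-1 * innerM Om' v v.
Proof.
move=> t0 sg [sv _]; rewrite !innerM_cells// !mulr_sumr -big_split /=.
apply: le_trans (ler_norm_sum _ _ _) _; apply: ler_sum => i _.
have svi : sqiM (cell (M i)) v by move=> p q; exact: (sqiS mO (mM i) (@sub i) (sv p q)).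
have sgi : sqiM (cell (M i)) g by move=> p q; exact: (sqiS mO (mM i) (@sub i) (sg p q)).
have sP := proj0M_sqi (dM i) k sgi; have pI := @psd_innerM R 2 1 _ (mM i).
apply: le_trans (psd_young pI t0 sP svi) _; apply: lerD.
  apply: le_trans (_ : theta * innerM (cell (M i)) (proj0M (M i) k g) (proj0M (M i) k g) <= _).
    apply: ler_wpM2r; first exact: (psd_ge0 pI).
    by rewrite ler_pdivrMr// ler_peMr ?(ltW t0)// ler1n.
  by rewrite ler_pM2l//; exact: proj0M_contract.
apply: ler_wpM2r; first exact: (psd_ge0 pI).
by rewrite lef_pV2 ?posrE ?mulr_gt0// ler_peMl ?(ltW t0)// ler1n.
Qed.

End MeshForms.

(** * Energy identities for weakly differentiable curves *)

Section CurveEnergy.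
Context {R : realType}.
Local Notation pt := (R * R)%type.
Local Notation leb := (@lebesgue_measure R).
Context (D : set pt) (mD : measurable2 D) (fin : (leb2 D < +oo)%E) (T : R) (T0 : 0 < T).
Local Notation J := (`]0, T[%classic : set R).
Context (beta : R) (beta0 : 0 <= beta).

Let mJ : measurable J. Proof. exact: measurable_itv. Qed.
Let JP (t : R) : J t -> 0 < t < T. Proof. by rewrite /= in_itv. Qed.

(** The value at time 0 is replaced by the prescribed initial value, which belongs
  to the space and agrees with it almost everywhere. *)
Let start (V : Type) (w : R -> V) w0 (t : R) := if t == 0 then w0 else w t.

Let start_pos (V : Type) (w : R -> V) w0 (t : R) : 0 < t -> start w w0 t = w t.
Proof. by move=> t0; rewrite /start gt_eqF. Qed.

Let start_diff (w w' : R -> pt -> R) w0 (t : R) : is_time_deriv T D w w' ->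
  {ae leb2, forall x, D x -> w 0 x = w0 x} -> 0 <= t < T ->
  {ae leb2, forall x, D x -> start w w0 t x - w0 x = \int[leb]_(s in `[0, t]) w' s x}.
Proof.
move=> [_ _ rep] ae0 /andP[t0 tT]; have h := rep t (introT andP (conj t0 (ltW tT))).
apply: ae_imp2 h ae0 => x a1 a2 Dx; have {}a1 := a1 Dx; have {}a2 := a2 Dx.
rewrite /start; case: eqVneq => [t00|_]; last by rewrite a1 a2 addrC addKr.
rewrite t00 in a1 *; rewrite subrr; apply/esym/(addrI (w 0 x)).
by rewrite -a1 addr0.
Qed.

Lemma phase_energy (S : set (pt -> R)) (m : (pt -> R) -> (pt -> R) -> R)
    (w w' : R -> pt -> R) (w0 : pt -> R) : S `<=` sqi leb2 D -> psd S m ->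
  (forall f, S f -> m f f <= beta * inner D f f) -> is_time_deriv T D w w' -> S w0 ->
  {ae leb2, forall x, D x -> w 0 x = w0 x} ->
  {ae leb, forall t, 0 < t < T -> S (w t)} -> {ae leb, forall t, 0 < t < T -> S (w' t)} ->
  exists H : R -> R, [/\ intg leb J H,
    {ae leb, forall t : R, 0 < t < T -> H t = m (w' t) (w t)},
    {ae leb, forall t : R, 0 < t < T ->
      m (w t) (w t) = m w0 w0 + 2 * \int[leb]_(r in `]0, t]) H r} &
    0 <= m w0 w0 + 2 * \int[leb]_(r in J) H r].
Proof.
move=> SD pm mb dw Sw0 ae0 Sw Sw'; have [mw' n1 _] := dw.
have sS : subsp S by case: pm.
have pB : psd S (inner D) by apply: psd_sub (psd_ipg leb2 mD) sS SD.
have sw' : {ae leb, forall t, 0 < t < T -> sqi leb2 D (w' t)}.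
  by apply: ae_imp Sw' => t h t0; apply: SD; exact: h.
have iN := time_norm1_intg mD mw' sw' n1.
have tw z (Sz : S z) := time_weak mD mw' (SD _ Sz) fin sw' iN.
have Sst0 : S (start w w0 0) by rewrite /start eqxx.
have Sst : {ae leb, forall t, 0 < t < T -> S (start w w0 t)}.
  by apply: ae_imp Sw => t h t0; rewrite start_pos; [exact: h|case/andP: t0].
have Sst' : {ae leb, forall t, 0 < t < T -> S (w' t) /\
    inner D (w' t) (w' t) <= Num.sqrt (inner D (w' t) (w' t)) ^+ 2}.
  by apply: ae_imp Sw' => t h t0; have s := h t0; split => //; rewrite sqr_sqrtr// (psd_ge0 pB).
have weak (t : R) z : 0 <= t < T -> S (start w w0 t) -> S z ->
    inner D (start w w0 t - start w w0 0) z = \int[leb]_(r in `]0, t]) inner D (w' r) z.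
  move=> t0 St Sz; have [_ h] := tw z Sz; apply: (h t _ t0).
    exact: (sqi_meas (SD _ (subspB sS St Sst0))).
  apply: ae_imp (start_diff dw ae0 t0) => x hx Dx.
  by rewrite -hx// -[LHS]/(start w w0 t x - start w w0 0 x) [start w w0 0]/start eqxx.
have [H [iH Hm id tot]] := energy_identity pB pm beta0 mb T0 iN (fun t => sqrtr_ge0 _)
  Sst0 Sst Sst' (fun z Sz => (tw z Sz).1) weak.
have s0 : start w w0 0 = w0 by rewrite /start eqxx.
rewrite s0 in id tot; exists H; split => //.
  by apply: ae_imp Hm => t h t0; rewrite h// start_pos//; case/andP: t0.
apply: ae_imp Sw => t h t0; have /andP[t1 t2] := t0.
by have := id t; rewrite start_pos// (ltW t1) t2; apply => //; exact: h.
Qed.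

Lemma velocity_energy (S : set (pt -> 'cV[R]_2)) (m : (pt -> 'cV[R]_2) -> (pt -> 'cV[R]_2) -> R)
    (w w' : R -> pt -> 'cV[R]_2) (w0 : pt -> 'cV[R]_2) : S `<=` sqiM D -> psd S m ->
  (forall f, S f -> m f f <= beta * innerM D f f) ->
  (forall i, is_time_deriv T D (fun t => vcomp (w t) i) (fun t => vcomp (w' t) i)) -> S w0 ->
  {ae leb2, forall x, D x -> w 0 x = w0 x} ->
  {ae leb, forall t, 0 < t < T -> S (w t)} -> {ae leb, forall t, 0 < t < T -> S (w' t)} ->
  exists H : R -> R, [/\ intg leb J H,
    {ae leb, forall t : R, 0 < t < T -> H t = m (w' t) (w t)},
    {ae leb, forall t : R, 0 < t < T ->
      m (w t) (w t) = m w0 w0 + 2 * \int[leb]_(r in `]0, t]) H r} &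
    0 <= m w0 w0 + 2 * \int[leb]_(r in J) H r].
Proof.
move=> SD pm mb dw Sw0 ae0 Sw Sw'.
have mw' i : time_measurable T D (fun t => vcomp (w' t) i) by case: (dw i).
have sS : subsp S by case: pm.
pose B (u v : pt -> 'cV[R]_2) := \sum_i ipg leb2 D (vcomp u i) (vcomp v i).
have pB : psd S B.
  apply: psd_sum => // i.
  apply: (psd_pull (T := fun u : pt -> 'cV[R]_2 => vcomp u i) (psd_ipg leb2 mD) sS).
    by move=> u Su; exact: (SD _ Su i 0).
  by move=> c u v z _ _ _; rewrite vcomp_lin.
have BE u : S u -> innerM D u u = B u u.
  by move=> Su; rewrite innerM_sum//; [apply: eq_bigr => i _; rewrite big_ord1|exact: SD..].
have {}mb u : S u -> m u u <= beta * B u u by move=> Su; rewrite -BE//; exact: mb.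
have sw' i : {ae leb, forall t, 0 < t < T -> sqi leb2 D (vcomp (w' t) i)}.
  by apply: ae_imp Sw' => t h t0; exact: (SD _ (h t0) i 0).
have iN i : intg leb J (fun t => Num.sqrt (ipg leb2 D (vcomp (w' t) i) (vcomp (w' t) i))).
  by have [_ n1 _] := dw i; exact: (time_norm1_intg mD (mw' i) (sw' i) n1).
pose Ni i t := Num.sqrt (ipg leb2 D (vcomp (w' t) i) (vcomp (w' t) i)).
have iN2 : intg leb J (fun t => \sum_i Ni i t) by apply: intg_sum => // i; exact: iN.
have N0 t : 0 <= \sum_i Ni i t by apply: sumr_ge0 => i _; exact: sqrtr_ge0.
have tw i z (Sz : S z) := time_weak mD (mw' i) (SD _ Sz i 0) fin (sw' i) (iN i).
have Sst0 : S (start w w0 0) by rewrite /start eqxx.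
have Sst : {ae leb, forall t, 0 < t < T -> S (start w w0 t)}.
  by apply: ae_imp Sw => t h t0; rewrite start_pos; [exact: h|case/andP: t0].
have Sst' : {ae leb, forall t, 0 < t < T -> S (w' t) /\ B (w' t) (w' t) <= (\sum_i Ni i t) ^+ 2}.
  apply: ae_imp Sw' => t h t0; have s := h t0; split => //.
  have q i : ipg leb2 D (vcomp (w' t) i) (vcomp (w' t) i) = Ni i t ^+ 2.
    by rewrite sqr_sqrtr//; exact: (psd_ge0 (psd_ipg leb2 mD) (SD _ s i 0)).
  rewrite /B !sum_ord2 !q sqrrD addrAC lerDl mulrn_wge0// mulr_ge0//; exact: sqrtr_ge0.
have weak (t : R) z : 0 <= t < T -> S (start w w0 t) -> S z ->
    B (start w w0 t - start w w0 0) z = \int[leb]_(r in `]0, t]) B (w' r) z.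
  move=> t0 St Sz; have sub : `]0, t]%classic `<=` J.
    by have /andP[_ tT] := t0; move=> r /=; rewrite !in_itv /= => /andP[-> rt]; exact: le_lt_trans tT.
  rewrite Rint_sum//; last by move=> i; apply: intgS (tw i z Sz).1.
  apply: eq_bigr => i _; have [_ h] := tw i z Sz; apply: (h t _ t0).
    have Sd : S (start w w0 t - start w w0 0) by exact: subspB.
    exact: sqi_meas (SD _ Sd i 0).
  have a0 : {ae leb2, forall x, D x -> vcomp (w 0) i x = vcomp w0 i x}.
    by apply: ae_imp ae0 => x hx Dx; rewrite /vcomp hx.
  apply: ae_imp (start_diff (dw i) a0 t0) => x hx Dx; rewrite -hx// /vcomp /start eqxx.
  by rewrite !fctE !mxE; case: eqP.
have iw z : S z -> intg leb J (fun r => B (w' r) z).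
  by move=> Sz; apply: intg_sum => // i; exact: (tw i z Sz).1.
have [H [iH Hm id tot]] := energy_identity pB pm beta0 mb T0 iN2 N0
  Sst0 Sst Sst' iw weak.
have s0 : start w w0 0 = w0 by rewrite /start eqxx.
rewrite s0 in id tot; exists H; split => //.
  by apply: ae_imp Hm => t h t0; rewrite h// start_pos//; case/andP: t0.
apply: ae_imp Sw => t h t0; have /andP[t1 t2] := t0.
by have := id t; rewrite start_pos// (ltW t1) t2; apply => //; exact: h.
Qed.

End CurveEnergy.

(** * Norms of fields *)

Section FieldNorms.
Context {R : realType}.
Local Notation pt := (R * R)%type.
Local Notation leb := (@lebesgue_measure R).
Implicit Types (D : set pt).

Lemma frob_ge0 m n (A : 'M[R]_(m, n)) : 0 <= frob A A.
Proof. by apply: sumr_ge0 => i _; apply: sumr_ge0 => j _; rewrite -expr2 sqr_ge0. Qed.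

Lemma enorm_sqr m n (A : 'M[R]_(m, n)) : enorm A * enorm A = frob A A.
Proof. by rewrite -expr2 sqr_sqrtr// frob_ge0. Qed.

Lemma le_enorm m n (A : 'M[R]_(m, n)) i j : `|A i j| <= enorm A.
Proof.
rewrite -sqrtr_sqr ler_sqrt ?frob_ge0// /frob (bigD1 i)//= (bigD1 j)//= -expr2 -addrA lerDl.
apply: addr_ge0; first by apply: sumr_ge0 => q _; rewrite -expr2 sqr_ge0.
by apply: sumr_ge0 => p _; apply: sumr_ge0 => q _; rewrite -expr2 sqr_ge0.
Qed.

Lemma enorm_meas d (X : measurableType d) (A : set X) m n (F : X -> 'M[R]_(m, n)) :
  (forall i j, measurable_fun A (fun x => F x i j)) -> measurable_fun A (fun x => enorm (F x)).
Proof.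
move=> mF; apply: (measurableT_comp (f := @Num.sqrt R)).
  by apply: continuous_measurable_fun; exact: sqrt_continuous.
by apply: measurable_sum => i; apply: measurable_sum => j; exact: measurable_funM.
Qed.

Lemma enorm_sqi D m n (F : pt -> 'M[R]_(m, n)) : measurable2 D -> sqiM D F ->
  sqi leb2 D (fun x => enorm (F x)).
Proof.
move=> mD sF; split.
  by apply: enorm_meas => i j; exact: sqi_meas (sF i j).
have iF : intg leb2 D (fun x => \sum_i \sum_j ent F i j x * ent F i j x).
  by apply: intg_sum => // i; apply: intg_sum => // j; exact: (sqi_mul mD (sF i j) (sF i j)).
by apply: eq_intg iF => // x _; rewrite expr2 enorm_sqr.
Qed.

Lemma ipg_enorm D m n (F : pt -> 'M[R]_(m, n)) :
  ipg leb2 D (fun x => enorm (F x)) (fun x => enorm (F x)) = innerM D F F.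
Proof. by apply: eq_Rint => x _; exact: enorm_sqr. Qed.

Lemma L2normM_innerM D m n (F : pt -> 'M[R]_(m, n)) : measurable2 D -> sqiM D F ->
  L2normM D F = (Num.sqrt (innerM D F F))%:E.
Proof.
move=> mD sF; rewrite /L2normM /L2norm Lnorm2_ipg//; last exact: enorm_sqi.
by rewrite ipg_enorm.
Qed.

Lemma L2norm_ge0 D f : (0 <= L2norm D f)%E.
Proof. by rewrite /L2norm unlock; exact: poweR_ge0. Qed.

Lemma Linf_ae D f (c : R) : (Linfnorm D f <= c%:E)%E ->
  {ae leb2, forall x, D x -> `|f x| <= c}.
Proof.
rewrite /Linfnorm unlock; case: ifPn => [_|].
  move=> /ess_sup_inf.ess_supP; apply: ae_imp => x /= + Dx.
  by rewrite patchE mem_set// lee_fin.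
rewrite -leNgt => h _; exists setT; split => //.
by apply/eqP; rewrite eq_le h measure_ge0.
Qed.

Lemma W1inf_ae D f (c : R) : (W1inf_norm D f <= c%:E)%E ->
  {ae leb2, forall x, D x -> `|f x| <= c} /\
  forall j, {ae leb2, forall x, D x -> `|wd D j f x| <= c}.
Proof.
rewrite /W1inf_norm ge_max => /andP[h1 h2]; split; first exact: Linf_ae.
move=> j; apply: ae_imp (Linf_ae h2) => x h Dx; have {}h := h Dx.
rewrite ger0_norm ?sqrtr_ge0// in h; apply: le_trans h.
by have := le_enorm (grad D f x) j 0; rewrite mxE.
Qed.

Lemma time_field_intg (T : R) D (g : R -> pt -> 'cV[R]_2) : measurable2 D ->
  (forall i, time_measurable T D (fun t => vcomp (g t) i)) ->
  (time_norm T 2%:E (fun t => L2normM D (g t)) < +oo)%E ->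
  {ae leb, forall t, 0 < t < T -> sqiM D (g t)} /\
  intg leb (`]0, T[%classic : set R) (fun t => innerM D (g t) (g t)).
Proof.
move=> mD mg fg; pose e t x := enorm (g t x).
have me : time_measurable T D e.
  by apply: enorm_meas => i j; rewrite (ord1 j); exact: mg.
have [h1 h2] := time_norm2_intg mD me fg; split.
  apply: ae_imp h1 => t h t0 i j; have [me' ie] := h t0.
  have mi : measurable_fun D (ent (g t) i j).
    by rewrite (ord1 j); exact: (time_section mD (mg i) t0).
  split => //; apply: (intg_le mD _ _ ie); first exact: measurable_funX.
  move=> x _; rewrite !normrX ler_sqr ?nnegrE//.
  by apply: le_trans (le_enorm (g t x) i j) _; exact: ler_norm.
by apply: eq_intg h2 => // t _; rewrite ipg_enorm.
Qed.

End FieldNorms.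

(** * Stability of the semi-discrete solution *)

Lemma phase_balance {R : realFieldType} (m g ad c ge r al q B : R) :
  m + g * ad + c + ge * r = 0 -> c = 0 -> 0 <= g -> 0 <= ge -> al * q <= ad -> - B <= r ->
  q * (g * al) <= ge * B - m.
Proof.
move=> e c0 g0 ge0 h1 h2; have := ler_wpM2l g0 h1; have := ler_wpM2l ge0 h2.
rewrite mulrN mulrA => h3 h4; rewrite [q * _]mulrC; lra.
Qed.

Lemma velocity_balance {R : realFieldType}
    (m nu ag c lam d g al q qh P gg y Y theta K : R) :
  m + nu * ag + c + lam * d = g -> c = 0 -> 0 <= nu -> 0 <= lam -> 0 < theta -> 0 <= K ->
  al * q <= ag -> `|d| <= 2 * theta * K * qh + theta^-1 * y -> `|g| <= theta * gg + theta^-1 * y ->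
  qh <= P -> y <= Y ->
  q * (nu * al) <= theta * (2 * lam * K * P + gg) + theta^-1 * (lam + 1) * Y - m.
Proof.
move=> e c0 nu0 lam0 t0 K0 h1 h2 h3 h4 h5.
have tV : 0 <= theta^-1 by rewrite invr_ge0 ltW.
have a1 := ler_wpM2l nu0 h1.
have tK : 0 <= 2 * theta * K by rewrite mulr_ge0// mulr_ge0// ltW.
have a2 := ler_wpM2l tK h4; have a3 := ler_wpM2l tV h5.
have {}h2 := le_trans (ler_norm (- d)) (eq_ind_r (fun z => z <= _) h2 (normrN d)).
have a4 := ler_wpM2l lam0 (le_trans h2 (lerD a2 a3)).
have a5 := le_trans (ler_norm g) (le_trans h3 (lerD (lexx _) a3)).
have -> : q * (nu * al) = nu * (al * q) by ring.
have -> : theta * (2 * lam * K * P + gg) + theta^-1 * (lam + 1) * Y - m =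
  lam * (2 * theta * K * P + theta^-1 * Y) + (theta * gg + theta^-1 * Y) - m by ring.
rewrite mulrN in a4; lra.
Qed.

Section Stability.
Context {R : realType}.
Local Notation pt := (R * R)%type.
Local Notation leb := (@lebesgue_measure R).
Context (Om : polygon R) (pO : polygonal_domain Om) (N : nat) (M : 'I_N -> polygon R).
Context (dec : decomposition Om M) (st : 'I_N -> stab R).
Context (k l : nat) (k0 : (0 < k)%N) (l1 : (1 < l)%N) (kl : (l.-1 <= k)%N).
Context (a b : R) (a0 : 0 < a) (adm : forall i, stab_admissible k l a b (M i) (st i)).
Context (T : R) (T0 : 0 < T).
Context (u ut : R -> pt -> 'cV[R]_2) (phi phit : R -> pt -> R).
Local Notation Om' := (cell Om).
Local Notation J := (`]0, T[%classic : set R).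
Local Notation al := (Num.min 1 a).
Local Notation be := (Num.max 1 b).
Local Notation area1 := (\int[leb2]_(x in Om') 1).

Let dO : domain Om'. Proof. exact: polygonal_domain_domain. Qed.
Let mO : measurable2 Om'. Proof. exact: domain_meas. Qed.
Let fO : (leb2 Om' < +oo)%E. Proof. exact: domain_fin. Qed.
Let mJ : measurable J. Proof. exact: measurable_itv. Qed.
Let JP (t : R) : J t -> 0 < t < T. Proof. by rewrite /= in_itv. Qed.

Let al0 : 0 < al. Proof. by rewrite lt_min ltr01. Qed.
Let be0 : 0 <= be. Proof. by rewrite le_max ler01. Qed.

Let lebJ : leb J = T%:E.
Proof.
apply: etrans (lebesgue_measure_itv (Interval (BRight 0) (BLeft T))) _.
by rewrite /= lte_fin T0 -EFinB subr0.
Qed.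

Let fJ : (leb J < +oo)%E.
Proof. by apply: (le_lt_trans _ (ltry T)); rewrite le_eqVlt; apply/orP; left; apply/eqP; exact: lebJ. Qed.

Let intJ_cst (c : R) : intg leb J (fun=> c).
Proof. by apply: sqi_intg => //; apply: sqi_cst. Qed.

Let RintJ_cst (c : R) : \int[leb]_(t in J) c = c * T.
Proof. by rewrite Rintegral_cst//; congr (_ * _); exact: (congr1 fine lebJ). Qed.

Let RintJ_B (c : R) H : intg leb J H ->
  \int[leb]_(t in J) (c - H t) = c * T - \int[leb]_(t in J) H t.
Proof.
move=> iH; have ic := intJ_cst c.
have e2 : \int[leb]_(t in J) (c - H t) = \int[leb]_(t in J) c - \int[leb]_(t in J) H t.
  by apply: RintegralB.
by rewrite e2 -(RintJ_cst c).
Qed.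

Let RintJ_D (c : R) H : intg leb J H ->
  \int[leb]_(t in J) (H t + c) = \int[leb]_(t in J) H t + c * T.
Proof.
move=> iH; have ic := intJ_cst c.
have e2 : \int[leb]_(t in J) (H t + c) = \int[leb]_(t in J) H t + \int[leb]_(t in J) c.
  by apply: RintegralD.
by rewrite e2 -(RintJ_cst c).
Qed.

Hypothesis Hphi : {ae leb, forall t, 0 < t < T -> Hh l Om M (phi t)}.
Hypothesis Hphit : {ae leb, forall t, 0 < t < T -> Hh l Om M (phit t)}.
Hypothesis Zu : {ae leb, forall t, 0 < t < T -> Zh k Om M (u t)}.
Hypothesis Zut : {ae leb, forall t, 0 < t < T -> Zh k Om M (ut t)}.

Section Phase.
Context (gam eps C_T C_0 : R) (gam0 : 0 < gam) (eps0 : 0 < eps) (phi0 : pt -> R).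
Hypothesis dphi : is_time_deriv T Om' phi phit.
Hypothesis Hphi0 : Hh l Om M phi0.
Hypothesis init : {ae leb2, forall x, Om' x -> phi 0 x = phi0 x}.
Hypothesis phi0C : inner Om' phi0 phi0 <= C_0 ^+ 2.
Hypothesis gradC : {ae leb, forall t, 0 < t < T ->
  forall j, {ae leb2, forall x, Om' x -> `|wd Om' j (phi t) x| <= C_T}}.
Hypothesis eqn : {ae leb, forall t, 0 < t < T -> forall psi, Hh l Om M psi ->
  \sum_i m_loc l (M i) (st i) (phit t) psi + gam * \sum_i aD_loc l (M i) (st i) (phi t) psi
  + \sum_i c_loc k l (M i) (u t) (phi t) psi
  + gam * eps ^- 2 * \sum_i r_loc l (M i) (phi t) (phi t) psi = 0}.

(** Testing with the constant 1 kills the fourth-order form and the potential, and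
  the convective form by the divergence theorem on each element. *)
Lemma mass_conserved :
  {ae leb, forall t, 0 < t < T -> inner Om' (phi t) (cst 1) = inner Om' phi0 (cst 1)}.
Proof.
have H1 := Hh_one pO dec l1; have s1 := sqi_cst mO 1 fO.
have m0 : {ae leb, forall t, 0 < t < T -> inner Om' (phit t) (cst 1) = 0}.
  have h1 := ae_imp2 (fun t x y => conj x y) Hphi Hphit.
  have h2 := ae_imp2 (fun t x y => conj x y) Zu eqn.
  apply: ae_imp2 h1 h2 => t [a1 a2] [a3 a4] t0.
  have e := a4 t0 _ H1; have p := Hh_phase pO (a2 t0).
  have me := mass_one pO dec l1 adm p; have ce := convection_mass pO dec kl l1 (a3 t0) (a1 t0).
  have aD0 : \sum_i aD_loc l (M i) (st i) (phi t) (cst 1) = 0.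
    by apply: big1 => i _; have [_ hl] := a1 t0; exact: (aD_one dec l1 adm (hl i)).
  have r0 : \sum_i r_loc l (M i) (phi t) (phi t) (cst 1) = 0.
    by apply: big1 => i _; exact: (r_one dec).
  rewrite -[inner _ _ _]me -[RHS]e.
  by rewrite [\sum_i aD_loc _ _ _ _ _]aD0 [\sum_i c_loc _ _ _ _ _ _]ce [\sum_i r_loc _ _ _ _ _]r0 !mulr0 !addr0.
have [mw' n1 _] := dphi.
have sphit : {ae leb, forall t, 0 < t < T -> sqi leb2 Om' (phit t)}.
  by apply: ae_imp Hphit => t h t0; case: (Hh_phase pO (h t0)).
have [iw weak] := time_weak mO mw' s1 fO sphit (time_norm1_intg mO mw' sphit n1).
apply: ae_imp Hphi => t h t0; have /andP[t1 t2] := t0.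
have [sp _] := Hh_phase pO (h t0); have [sp0 _] := Hh_phase pO Hphi0.
have pI := psd_ipg leb2 mO; have sd := subspB (sqi_subsp leb2 mO) sp sp0.
apply/eqP; rewrite -subr_eq0 -(psdBl pI)//; apply/eqP.
have t01 : 0 <= t < T by rewrite (ltW t1).
apply: etrans (weak t (phi t - phi0) t01 (sqi_meas sd) _) _.
  have [_ _ rep] := dphi; have := rep t (introT andP (conj (ltW t1) (ltW t2))).
  apply: ae_imp2 init => x hx h0 Dx; have {}h0 := h0 Dx; have {}hx := hx Dx.
  by rewrite -[LHS]/(phi t x - phi0 x) h0 hx addrC addKr.
have sub : `]0, t]%classic `<=` J.
  by move=> r /=; rewrite !in_itv /= => /andP[-> rt]; exact: le_lt_trans t2.
rewrite -[RHS](Rint_eq0 leb (D := `]0, t]%classic) (f := fun=> 0))//.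
apply: ae_eq_meas => //; first by apply: intg_meas; apply: intgS iw.
by apply: ae_imp m0 => r hr /sub/JP; exact: hr.
Qed.

(** Testing with the phase itself: the convective form is antisymmetric. *)
Lemma phase_estimate : exists P : R -> R, [/\ intg leb J P,
  {ae leb, forall t, 0 < t < T ->
     innerM Om' (hess Om' (phi t)) (hess Om' (phi t)) <= P t} &
  \int[leb]_(t in J) P t <=
     (gam * al)^-1 * (gam * eps ^- 2 * (2 * C_T ^+ 2 * area1) * T + be * C_0 ^+ 2 / 2)].
Proof.
have [pm mb _] := mass_phase_psd pO dec l1 a0 adm.
have SD : phase_space Om M l `<=` sqi leb2 Om' by move=> f [].
have S0 := Hh_phase pO Hphi0.
have Sw : {ae leb, forall t, 0 < t < T -> phase_space Om M l (phi t)}.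
  by apply: ae_imp Hphi => t h t0; exact: Hh_phase (h t0).
have Sw' : {ae leb, forall t, 0 < t < T -> phase_space Om M l (phit t)}.
  by apply: ae_imp Hphit => t h t0; exact: Hh_phase (h t0).
have [H [iH Hm _ tot]] := phase_energy mO fO T0 be0 SD pm mb dphi S0 init Sw Sw'.
pose c1 := gam * eps ^- 2 * (2 * C_T ^+ 2 * area1).
have ga0 : 0 < gam * al by rewrite mulr_gt0.
exists (fun t => (gam * al)^-1 * (c1 - H t)).
have iP : intg leb J (fun t => c1 - H t) by apply: intgB.
split; first exact: intgZ.
  have h1 := ae_imp2 (fun t x y => conj x y) Hphi gradC.
  have h2 := ae_imp2 (fun t x y => conj x y) Hm eqn.
  apply: ae_imp2 h1 h2 => t [hp gC] [Ht e] t0.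
  have {}hp := hp t0; have {}e := e t0 _ hp; have {}Ht := Ht t0.
  have aD := aD_ge pO dec l1 a0 adm hp.
  have rg := r_ge pO dec hp (gC t0).
  have cv : \sum_i c_loc k l (M i) (u t) (phi t) (phi t) = 0.
    by apply: big1 => i _; rewrite /c_loc subrr mulr0.
  rewrite mulrC ler_pdivlMr// Ht; apply: phase_balance e cv _ _ aD rg; first exact: ltW.
  by rewrite mulr_ge0 ?(ltW gam0)// invr_ge0 sqr_ge0.
have iE : \int[leb]_(t in J) (c1 - H t) = c1 * T - \int[leb]_(t in J) H t.
  exact: RintJ_B.
rewrite RintegralZl// iE; apply: ler_wpM2l; first by rewrite invr_ge0 ltW.
rewrite lerD2l; have m0 := mb _ S0; have b0 := ler_wpM2l be0 phi0C.
move: tot m0 b0; set x := mass_phase _ _ _ _ _; move=> tot m0 b0; lra.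
Qed.
End Phase.

Section Velocity.
Context (nu lam C_0 K theta Y : R) (nu0 : 0 < nu) (lam0 : 0 < lam) (theta0 : 0 < theta).
Context (g : R -> pt -> 'cV[R]_2) (u0 : pt -> 'cV[R]_2) (P : R -> R) (P1 : R) (K0 : 0 <= K).
Hypothesis du : forall i, is_time_deriv T Om' (fun t => vcomp (u t) i) (fun t => vcomp (ut t) i).
Hypothesis Vu0 : Vh k Om M u0.
Hypothesis init : {ae leb2, forall x, Om' x -> u 0 x = u0 x}.
Hypothesis u0C : innerM Om' u0 u0 <= C_0 ^+ 2.
Hypothesis iP : intg leb J P.
Hypothesis hessP : {ae leb, forall t, 0 < t < T ->
  innerM Om' (hess Om' (phi t)) (hess Om' (phi t)) <= P t}.
Hypothesis PP1 : \int[leb]_(t in J) P t <= P1.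
Hypothesis gradK : {ae leb, forall t, 0 < t < T -> forall i j q x, cell (M i) x ->
  proj0M (M i) l.-1 (grad (cell (M i)) (phi t)) x j q ^+ 2 <= K}.
Hypothesis sg : {ae leb, forall t, 0 < t < T -> sqiM Om' (g t)}.
Hypothesis ig : intg leb J (fun t => innerM Om' (g t) (g t)).
Hypothesis uY : {ae leb, forall t, 0 < t < T -> innerM Om' (u t) (u t) <= Y}.
Hypothesis eqn : {ae leb, forall t, 0 < t < T -> forall v, Zh k Om M v ->
  \sum_i mF_loc k (M i) (st i) (ut t) v + nu * \sum_i aG_loc k (M i) (st i) (u t) v
  + \sum_i cF_loc k (M i) (u t) (u t) v + lam * \sum_i d_loc k l (M i) (phi t) (phi t) v
  = \sum_i innerM (cell (M i)) (proj0M (M i) k (g t)) v}.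

Let F t := 2 * lam * K * P t + innerM Om' (g t) (g t).
Let F1 := 2 * lam * K * P1 + \int[leb]_(t in J) innerM Om' (g t) (g t).
Let c := theta^-1 * (lam + 1) * Y.

(** The bound Y of the kinetic energy enters on the right through Young's inequality
  with weight theta; a large theta makes its factor small enough for absorption. *)
Lemma velocity_estimate :
  {ae leb, forall t, 0 < t < T ->
     al * innerM Om' (u t) (u t) <= be * C_0 ^+ 2 + 2 * (theta * F1 + c * T)} /\
  exists Q : R -> R, [/\ intg leb J Q,
  {ae leb, forall t, 0 < t < T ->
     innerM Om' (gradv Om' (u t)) (gradv Om' (u t)) <= Q t} &
  \int[leb]_(t in J) Q t <= (nu * al)^-1 * (theta * F1 + c * T + be * C_0 ^+ 2 / 2)].
Proof.
have [pm mb ma] := mass_velocity_psd pO dec k0 a0 adm.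
have SD : velocity_space Om M k `<=` sqiM Om' by move=> f [].
have S0 := Vh_velocity pO Vu0.
have Sw : {ae leb, forall t, 0 < t < T -> velocity_space Om M k (u t)}.
  by apply: ae_imp Zu => t h t0; have [hv _] := h t0; exact: Vh_velocity hv.
have Sw' : {ae leb, forall t, 0 < t < T -> velocity_space Om M k (ut t)}.
  by apply: ae_imp Zut => t h t0; have [hv _] := h t0; exact: Vh_velocity hv.
have [H [iH Hm id tot]] := velocity_energy mO fO T0 be0 SD pm mb du S0 init Sw Sw'.
have iF : intg leb J F by apply: intgD => //; exact: intgZ.
have FF1 : \int[leb]_(t in J) F t <= F1.
  rewrite RintegralD//; last exact: intgZ.
  rewrite lerD2r RintegralZl//; apply: ler_wpM2l => //.
  by rewrite mulr_ge0// mulr_ge0// ltW.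
have key : {ae leb, forall t, 0 < t < T ->
    innerM Om' (gradv Om' (u t)) (gradv Om' (u t)) * (nu * al) <= theta * F t + c - H t}.
  have h1 := ae_imp2 (fun t x y => conj x y) Zu Hphi.
  have h2 := ae_imp2 (fun t x y => conj x y) Hm eqn.
  have h3 := ae_imp2 (fun t x y => conj x y) hessP gradK.
  have h4 := ae_imp2 (fun t x y => conj x y) sg uY.
  have h12 := ae_imp2 (fun t x y => conj x y) h1 h2.
  have h34 := ae_imp2 (fun t x y => conj x y) h3 h4.
  apply: ae_imp2 h12 h34 => t [[hz hp] [Ht e]] [[qP gK] [gt yY]] t0.
  have {}hz := hz t0; have {}hp := hp t0; have {}e := e t0 _ hz; have {}Ht := Ht t0.
  have {}qP := qP t0; have {}gK := gK t0; have {}gt := gt t0; have {}yY := yY t0.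
  have [hv _] := hz; have Vv := Vh_velocity pO hv.
  have aG := aG_ge pO dec k0 a0 adm hv.
  have dB := d_bound pO dec hp theta0 Vv gK.
  have gB := source_bound pO dec (k := k) theta0 gt Vv.
  have cv : \sum_i cF_loc k (M i) (u t) (u t) (u t) = 0.
    by apply: big1 => i _; rewrite /cF_loc subrr mulr0.
  rewrite Ht /F /c; exact: (velocity_balance e cv (ltW nu0) (ltW lam0) theta0 K0 aG dB gB qP yY).
have iR : intg leb J (fun t => theta * F t + c) by apply: intgD => //; exact: intgZ.
have itF : intg leb J (fun t => theta * F t) by exact: intgZ.
have iRE : \int[leb]_(t in J) (theta * F t + c) = theta * \int[leb]_(t in J) F t + c * T.
  by rewrite (RintJ_D c itF); congr (_ + _); apply: RintegralZl.
have iRle : \int[leb]_(t in J) (theta * F t + c) <= theta * F1 + c * T.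
  by rewrite iRE lerD2r ler_pM2l.
have m0 := mb _ S0; have b0 := ler_wpM2l be0 u0C.
have na0 : 0 < nu * al by rewrite mulr_gt0.
split.
  have h1 := ae_imp2 (fun t x y => conj x y) id Sw.
  apply: ae_imp h1 => t [it St] t0; have /andP[t1 t2] := t0.
  have sub : `]0, t]%classic `<=` J.
    by move=> r /=; rewrite !in_itv /= => /andP[-> rt]; exact: le_lt_trans t2.
  have hH : \int[leb]_(r in `]0, t]) H r <= theta * F1 + c * T.
    apply: le_trans iRle.
    pose G r := `|theta * F r + c|.
    have iG : intg leb J G by exact: intg_norm.
    have G0 : {ae leb, forall r : R, 0 < r < T -> 0 <= theta * F r + c}.
      apply: ae_imp2 hessP uY => r h1' h2 r0.
      have P0 : 0 <= P r by apply: le_trans (h1' r0); apply: Rintegral_ge0 => x _; exact: frob_ge0.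
      have Y0 : 0 <= Y by apply: le_trans (h2 r0); apply: Rintegral_ge0 => x _; exact: frob_ge0.
      have g0 : 0 <= innerM Om' (g r) (g r) by apply: Rintegral_ge0 => x _; exact: frob_ge0.
      rewrite addr_ge0// mulr_ge0 ?(ltW theta0)//.
        by rewrite addr_ge0// mulr_ge0// mulr_ge0// mulr_ge0// ltW.
      by rewrite mulr_ge0 ?invr_ge0 ?(ltW theta0)// addr_ge0// ltW.
    apply: le_trans (_ : \int[leb]_(r in `]0, t]) G r <= _).
      apply: le_Rint_ae => //; [by apply: intgS iH|by apply: intgS iG|].
      apply: ae_imp key => r kr /sub/JP r0; apply: le_trans (ler_norm _).
      have q0 : 0 <= innerM Om' (gradv Om' (u r)) (gradv Om' (u r)) * (nu * al).
        by rewrite mulr_ge0 ?(ltW na0)//; apply: Rintegral_ge0 => x _; exact: frob_ge0.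
      by have := le_trans q0 (kr r0); rewrite subr_ge0.
    apply: le_trans (_ : \int[leb]_(r in J) G r <= _).
      by apply: le_Rint_subset => // r _; exact: normr_ge0.
    apply: le_Rint_ae => //; apply: ae_imp G0 => r Gr /JP r0.
    by rewrite /G ger0_norm//; exact: Gr.
  have mt := ma _ (St t0); have it' := it t0.
  apply: le_trans mt _; rewrite it'; apply: lerD; first exact: le_trans m0 b0.
  by rewrite ler_pM2l.
exists (fun t => (nu * al)^-1 * (theta * F t + c - H t)).
have iQ : intg leb J (fun t => theta * F t + c - H t) by apply: intgB.
split; first exact: intgZ.
  by apply: ae_imp key => t h t0; rewrite mulrC ler_pdivlMr//; exact: h.
rewrite RintegralZl//; apply: ler_wpM2l; first by rewrite invr_ge0 ltW.
rewrite RintegralB//.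
move: tot m0 b0 iRle; set x := mass_velocity _ _ _ _ _; set y := \int[leb]_(t in J) H t.
set z := \int[leb]_(t in J) _; move=> tot m0 b0 iRle; lra.
Qed.
End Velocity.

End Stability.

Lemma half_le {R : realFieldType} (x z : R) : x <= z + x / 2 -> x <= 2 * z.
Proof. by move=> h; lra. Qed.

Lemma absorb {R : realFieldType} (al th lam T Y y B : R) : 0 < al -> 0 < lam -> 0 < T ->
  th = 4 * (lam + 1) * T / al -> al * y <= B + 2 * (th^-1 * (lam + 1) * Y * T) ->
  y <= B / al + Y / 2.
Proof.
move=> al0 lam0 T0 -> h; have l10 : 0 < lam + 1 by rewrite addr_gt0.
rewrite (_ : B / al + Y / 2 = (B + al * (Y / 2)) / al); last by field; rewrite gt_eqF.
rewrite ler_pdivlMr// mulrC; apply: le_trans h _; rewrite lerD2l le_eqVlt; apply/orP; left.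
by apply/eqP; field; rewrite !gt_eqF.
Qed.

Theorem theorem4p1 (R : realType)
  (Om : polygon R) (hOm : polygonal_domain Om)
  (T nu lam gam eps : R) (hT : 0 < T)
  (hnu : 0 < nu) (hlam : 0 < lam) (hgam : 0 < gam) (heps : 0 < eps)
  (g : R -> R * R -> 'cV[R]_2)
  (hgm : forall i, time_measurable T (cell Om) (fun t => vcomp (g t) i))
  (hg : (time_norm T 2%:E (fun t => L2normM (cell Om) (g t)) < +oo)%E)
  (k l : nat) (hk : (1 <= k)%N) (hl : (2 <= l)%N) (hkl : (l.-1 <= k)%N)
  (rho a b C_T C_0 : R) (hrho : 0 < rho) (ha : 0 < a) :
  exists C_stab : R, 0 < C_stab /\
  forall (N : nat) (M : 'I_N -> polygon R) (st : 'I_N -> stab R)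
    (u0 : R * R -> 'cV[R]_2) (phi0 : R * R -> R)
    (u : R -> R * R -> 'cV[R]_2) (phi : R -> R * R -> R),
  decomposition Om M ->
  mesh_regular rho M ->
  (forall i, stab_admissible k l a b (M i) (st i)) ->
  Vh k Om M u0 -> Hh l Om M phi0 ->
  (L2normM (cell Om) u0 <= C_0%:E)%E ->
  (L2norm (cell Om) phi0 <= C_0%:E)%E ->
  kernel_solution Om T nu lam gam eps k l g M st u0 phi0 u phi ->
  (forall u' phi',
     kernel_solution Om T nu lam gam eps k l g M st u0 phi0 u' phi' ->
     {ae lebesgue_measure, forall t : R, 0 < t <= T ->
       {ae leb2, forall x, cell Om x -> u' t x = u t x /\ phi' t x = phi t x}}) ->
  {ae lebesgue_measure, forall t : R, 0 < t <= T ->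
     (W1inf_norm (cell Om) (phi t) <= C_T%:E)%E} ->
  {ae lebesgue_measure, forall t : R, 0 < t < T ->
     inner (cell Om) (phi t) (cst 1) = inner (cell Om) phi0 (cst 1)} /\
  (time_norm T +oo (fun t => L2normM (cell Om) (u t))
   + time_norm T +oo (fun t => L2norm (cell Om) (phi t))
   + time_norm T 2%:E (fun t => normV Om (u t))
   + time_norm T 2%:E (fun t => normH Om (phi t)) <= C_stab%:E)%E.
Proof.
have dO := polygonal_domain_domain hOm; have mO := domain_meas dO; have fO := domain_fin dO.
have [Cb Cb0 hCb] := proj0_bounded l.-1 hrho.
have [sg ig] := time_field_intg mO hgm hg.
pose al := Num.min 1 a; pose be := Num.max 1 b; pose A := \int[leb2]_(x in cell Om) 1.
have al0 : 0 < al by rewrite lt_min ltr01.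
pose K := Cb * C_T ^+ 2; have K0 : 0 <= K by rewrite mulr_ge0// sqr_ge0.
pose P1 := (gam * al)^-1 * (gam * eps ^- 2 * (2 * C_T ^+ 2 * A) * T + be * C_0 ^+ 2 / 2).
pose F1 := 2 * lam * K * P1 +
  \int[lebesgue_measure]_(t in `]0, T[%classic) innerM (cell Om) (g t) (g t).
pose theta := 4 * (lam + 1) * T / al.
have l10 : 0 < lam + 1 by rewrite addr_gt0.
have theta0 : 0 < theta by rewrite divr_gt0// mulr_gt0// mulr_gt0.
pose Y1 := 2 * ((be * C_0 ^+ 2 + 2 * (theta * F1)) / al).
pose Q1 := (nu * al)^-1 * (theta * F1 + theta^-1 * (lam + 1) * Y1 * T + be * C_0 ^+ 2 / 2).
pose root (x : R) := Num.sqrt `|x|.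
have rootP x : x <= root x ^+ 2 by rewrite sqr_sqrtr// ler_norm.
have root0 x : 0 <= root x by exact: sqrtr_ge0.
exists (root Y1 + root (C_T ^+ 2 * A) + root Q1 + root P1 + 1); split.
  by rewrite ltr_wpDl// !addr_ge0.
move=> N M st u0 phi0 u phi dec reg adm hu0 hphi0 u0C phi0C sol _ WC.
have [[mu fu fVu Zu] [mphi _ fHphi Hphi] init [ut [phit [du dphi hd eqn]]]] := sol.
have Zut : {ae lebesgue_measure, forall t, 0 < t < T -> Zh k Om M (ut t)}.
  by apply: ae_imp hd => t h t0; case: (h t0).
have Hphit : {ae lebesgue_measure, forall t, 0 < t < T -> Hh l Om M (phit t)}.
  by apply: ae_imp hd => t h t0; case: (h t0).
have iu0 : {ae leb2, forall x, cell Om x -> u 0 x = u0 x}.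
  by apply: ae_imp init => x h Dx; case: (h Dx).
have iphi0 : {ae leb2, forall x, cell Om x -> phi 0 x = phi0 x}.
  by apply: ae_imp init => x h Dx; case: (h Dx).
have openI (P : R -> Prop) : {ae lebesgue_measure, forall t : R, 0 < t <= T -> P t} ->
    {ae lebesgue_measure, forall t : R, 0 < t < T -> P t}.
  by apply: ae_imp => t h /andP[t0 tT]; apply: h; rewrite t0 ltW.
have {}eqn := openI _ eqn; have {}WC := openI _ WC.
have gradC : {ae lebesgue_measure, forall t, 0 < t < T ->
    forall j, {ae leb2, forall x, cell Om x -> `|wd (cell Om) j (phi t) x| <= C_T}}.
  by apply: ae_imp WC => t h t0; exact: (W1inf_ae (h t0)).2.
have [sphi0 _] := Hh_phase hOm hphi0; have [su0 _] := Vh_velocity hOm hu0.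
have sqle (x : R) : 0 <= x -> ((Num.sqrt x)%:E <= C_0%:E)%E -> x <= C_0 ^+ 2.
  move=> x0; rewrite lee_fin => h; rewrite -(sqr_sqrtr x0) ler_sqr ?nnegrE//.
  exact: le_trans h.
have phi0C' : inner (cell Om) phi0 phi0 <= C_0 ^+ 2.
  apply: sqle; first exact: (psd_ge0 (psd_ipg leb2 mO)).
  by rewrite -(Lnorm2_ipg mO sphi0).
have u0C' : innerM (cell Om) u0 u0 <= C_0 ^+ 2.
  apply: sqle; first exact: (psd_ge0 (@psd_innerM R 2 1 _ mO)).
  by rewrite -(L2normM_innerM mO su0).
have eqphi : {ae lebesgue_measure, forall t, 0 < t < T -> forall psi, Hh l Om M psi ->
  \sum_i m_loc l (M i) (st i) (phit t) psi + gam * \sum_i aD_loc l (M i) (st i) (phi t) psi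
  + \sum_i c_loc k l (M i) (u t) (phi t) psi
  + gam * eps ^- 2 * \sum_i r_loc l (M i) (phi t) (phi t) psi = 0}.
  by apply: ae_imp2 eqn Zu => t h1 h2 t0 psi hpsi; exact: (h1 t0 _ _ (h2 t0) hpsi).2.
have equ : {ae lebesgue_measure, forall t, 0 < t < T -> forall v, Zh k Om M v ->
  \sum_i mF_loc k (M i) (st i) (ut t) v + nu * \sum_i aG_loc k (M i) (st i) (u t) v
  + \sum_i cF_loc k (M i) (u t) (u t) v + lam * \sum_i d_loc k l (M i) (phi t) (phi t) v
  = \sum_i innerM (cell (M i)) (proj0M (M i) k (g t)) v}.
  by apply: ae_imp2 eqn Hphi => t h1 h2 t0 v hv; exact: (h1 t0 _ _ hv (h2 t0)).1.
split; first exact: (mass_conserved hOm dec hl hkl adm Hphi Hphit Zu dphi hphi0 iphi0 eqphi).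
have [P [iP hP PP1]] := phase_estimate hOm dec hl ha adm hT Hphi Hphit hgam dphi hphi0 iphi0
  phi0C' gradC eqphi.
have gradK : {ae lebesgue_measure, forall t, 0 < t < T -> forall i j q x, cell (M i) x ->
    proj0M (M i) l.-1 (grad (cell (M i)) (phi t)) x j q ^+ 2 <= K}.
  apply: ae_imp2 gradC Hphi => t gC hp t0 i j q x Ex.
  have pM : polygonal_domain (M i) by case: dec.
  have [[[h1 _] _] hloc] := hp t0.
  have h1i : H1 (cell (M i)) (phi t) by case: (hloc i) => -[_ []].
  rewrite mxE; apply: hCb => //; first exact: (reg i).1.
    exact: (grad_sqi dec h1i j q).
  apply: ae_imp2 (gC t0 j) (wd_cell hOm dec i j h1) => y a1 a2 Ey.
  by rewrite mxE a2//; apply: a1; exact: (cell_sub hOm dec (i := i)) Ey.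
have ru t : (0 <= L2normM (cell Om) (u t))%E by exact: L2norm_ge0.
pose E := time_norm T +oo (fun t => L2normM (cell Om) (u t)).
have E0 : (0 <= E)%E by exact: Lnorm_ge0.
have EY : E = (fine E)%:E by rewrite fineK// ge0_fin_numE.
set y := fine E in EY; have y0 : 0 <= y by exact: fine_ge0.
have sqiu : {ae lebesgue_measure, forall t, 0 < t < T -> sqiM (cell Om) (u t)}.
  by apply: ae_imp Zu => t h t0; have [hv _] := h t0; case: (Vh_velocity hOm hv).
have uy : {ae lebesgue_measure, forall t, 0 < t < T -> innerM (cell Om) (u t) (u t) <= y ^+ 2}.
  have h := (time_normyP hT ru (ltac:(by rewrite lee_fin) : (0 <= y%:E)%E)).1
    (ltac:(by rewrite -EY)).
  apply: ae_imp2 h sqiu => t h1 h2 t0; have {}h1 := h1 t0; have {}h2 := h2 t0.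
  rewrite L2normM_innerM// lee_fin in h1.
  have n0 := psd_ge0 (@psd_innerM R 2 1 _ mO) h2.
  by rewrite -(sqr_sqrtr n0) ler_sqr ?nnegrE.
have [ub [Q [iQ hQ QQ]]] := velocity_estimate hOm dec hk ha adm hT Hphi Zu Zut hnu hlam theta0
  K0 du hu0 iu0 u0C' iP hP PP1 gradK sg ig uy equ.
have y2 : y ^+ 2 <= Y1.
  pose B := be * C_0 ^+ 2 + 2 * (theta * F1).
  have h : {ae lebesgue_measure, forall t, 0 < t < T ->
      innerM (cell Om) (u t) (u t) <= B / al + y ^+ 2 / 2}.
    apply: ae_imp ub => t h t0; apply: (absorb al0 hlam hT (erefl theta)).
    by apply: le_trans (h t0) _; rewrite /B mulrDr addrA.
  have hE : (E <= (Num.sqrt (B / al + y ^+ 2 / 2))%:E)%E.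
    apply/(time_normyP hT ru); first by rewrite lee_fin sqrtr_ge0.
    apply: ae_imp2 h sqiu => t h1 h2 t0; rewrite L2normM_innerM//; last exact: h2.
    by rewrite lee_fin; apply: ler_wsqrtr; exact: h1.
  have A0 : 0 <= A by apply: Rintegral_ge0.
  have be0 : 0 <= be by rewrite le_max ler01.
  have bC0 : 0 <= be * C_0 ^+ 2 by rewrite mulr_ge0// sqr_ge0.
  have ga0 : 0 <= (gam * al)^-1 by rewrite invr_ge0 ltW// mulr_gt0.
  have ge0 : 0 <= gam * eps ^- 2 by apply: mulr_ge0; [exact: ltW|rewrite invr_ge0 sqr_ge0].
  have CA0 : 0 <= 2 * C_T ^+ 2 * A.
    by apply: mulr_ge0 => //; apply: mulr_ge0 => //; exact: sqr_ge0.
  have P10 : 0 <= P1.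
    apply: mulr_ge0 => //; apply: addr_ge0; last by rewrite divr_ge0.
    by apply: mulr_ge0 (ltW hT); exact: mulr_ge0.
  have F10 : 0 <= F1.
    apply: addr_ge0.
      by apply: mulr_ge0 => //; apply: mulr_ge0 => //; apply: mulr_ge0 => //; exact: ltW.
    by apply: Rintegral_ge0 => t _; apply: Rintegral_ge0 => x _; exact: frob_ge0.
  have BB : 0 <= B.
    by apply: addr_ge0 => //; apply: mulr_ge0 => //; apply: mulr_ge0 => //; exact: ltW.
  have B0 : 0 <= B / al + y ^+ 2 / 2.
    by apply: addr_ge0; apply: divr_ge0 => //; [exact: ltW|exact: sqr_ge0].
  rewrite EY lee_fin in hE.
  have hE2 : y ^+ 2 <= B / al + y ^+ 2 / 2.
    by rewrite -(sqr_sqrtr B0) ler_sqr ?nnegrE ?sqrtr_ge0.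
  rewrite /Y1 -/B; apply: half_le hE2.
have n1 : (E <= (root Y1)%:E)%E.
  rewrite EY lee_fin -(@ler_sqr R) ?nnegrE//; exact: le_trans y2 (rootP _).
have n2 : (time_norm T +oo (fun t => L2norm (cell Om) (phi t)) <= (root (C_T ^+ 2 * A))%:E)%E.
  apply/(time_normyP hT) => [t||]; [exact: L2norm_ge0|by rewrite lee_fin|].
  apply: ae_imp2 WC Hphi => t h1 h2 t0; have [sp _] := Hh_phase hOm (h2 t0).
  have [hC _] := W1inf_ae (h1 t0); rewrite /L2norm Lnorm2_ipg// lee_fin.
  apply: ler_wsqrtr; apply: le_trans (ler_norm _).
  have i1 : intg leb2 (cell Om) (fun=> 1) by exact: (sqi_intg mO fO (sqi_cst mO 1 fO)).
  rewrite /A -RintegralZl//; apply: le_Rint_ae => //; [exact: (sqi_mul mO sp sp)|exact: intgZ|].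
  apply: ae_imp hC => x hx Dx; rewrite mulr1 -expr2 -(real_normK (num_real (phi t x))).
  have hx' := hx Dx; have C0 := le_trans (normr_ge0 _) hx'.
  by rewrite ler_sqr ?nnegrE.
have n3 : (time_norm T 2%:E (fun t => normV Om (u t)) <= (root Q1)%:E)%E.
  apply: (@time_norm2_le _ T _ (fun t => innerM (cell Om) (gradv (cell Om) (u t)) (gradv (cell Om) (u t))) Q) => //.
  - by move=> t; exact: L2norm_ge0.
  - apply: ae_imp2 hQ Zu => t h1 h2 t0; have [[hv _] _] := h2 t0.
    have sgr : sqiM (cell Om) (gradv (cell Om) (u t)) by apply: (gradv_sqi hOm) => i; case: (hv i).
    split; first exact: L2normM_innerM.
    by rewrite (psd_ge0 (@psd_innerM R 2 2 _ mO) sgr)//=; exact: h1.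
  - apply: le_trans QQ _; apply: le_trans (rootP Q1).
    apply: ler_wpM2l; first by rewrite invr_ge0 mulr_ge0 ?(ltW hnu) ?(ltW al0).
    rewrite lerD2r lerD2l ler_wpM2r ?(ltW hT)// ler_wpM2l//.
    by rewrite mulr_ge0 ?invr_ge0 ?(ltW theta0) ?(ltW l10).
have n4 : (time_norm T 2%:E (fun t => normH Om (phi t)) <= (root P1)%:E)%E.
  apply: (@time_norm2_le _ T _ (fun t => innerM (cell Om) (hess (cell Om) (phi t)) (hess (cell Om) (phi t))) P) => //.
  - by move=> t; exact: L2norm_ge0.
  - apply: ae_imp2 hP Hphi => t h1 h2 t0; have [[hh _] _] := h2 t0.
    have sgr := hess_sqi hOm hh.
    split; first exact: L2normM_innerM.
    by rewrite (psd_ge0 (@psd_innerM R 2 2 _ mO) sgr)//=; exact: h1.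
  - exact: le_trans PP1 (rootP P1).
apply: (@le_trans _ _ (root Y1 + root (C_T ^+ 2 * A) + root Q1 + root P1)%:E).
  by rewrite !EFinD; do 3![apply: leeD => //].
by rewrite lee_fin lerDl.
Qed.
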